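(* Let $\Omega\subset\mathbb{R}^{2n}$ be a bounded uniformly convex open set with smooth boundary. Let $\tilde\phi\in\widetilde{\mathrm{Symp}}_0(\overline\Omega)$ be the homotopy class of a positive path $\phi=\{\phi^t\}_{t\in[0,1]}$ in $\mathrm{Symp}_0(\overline\Omega)$ with $\phi^0=\mathrm{id}$ and such that $\mathrm{d}\phi^t(z)$ does not have the eigenvalue $-1$ for every $z\in\overline\Omega$ and $t\in[0,1]$. Then every positive path $\psi$ in $\mathrm{Symp}_0(\overline\Omega)$ homotopic to $\phi$ with fixed ends satisfies the same condition, and $$\mathrm{length}_{\mathcal G}(\psi)\le\frac{2\pi}{n}\mathcal{M}(\tilde\phi).$$
   Context: $\mathbb{R}^{2n}$ carries $\omega_0=\sum_j\mathrm{d}x_j\wedge\mathrm{d}y_j$ and $J_0$ with $\omega_0(u,v)=J_0u\cdot v$. $\mathrm{Symp}_0(\overline\Omega)$ is the identity component of the group of symplectomorphisms of $\overline\Omega$, $\widetilde{\mathrm{Symp}}_0(\overline\Omega)$ its universal cover. A positive path is a path $\{\phi^t_H\}_{t\in[0,1]}$ with $\frac{\mathrm{d}}{\mathrm{d}t}\phi^t_H=J_0\nabla H_t(\phi^t_H)$, where $H\in C^\infty([0,1]\times\overline\Omega)$, each $H_t$ is constant on each leaf of the characteristic foliation of $\partial\Omega$ (tangent to $\ker\omega_0|_{T\partial\Omega}$), and $\nabla^2H_t(z)$ is positive definite for all $(t,z)$; its length is $\mathrm{length}_{\mathcal G}=\frac{1}{\mathrm{vol}(\Omega)}\int_0^1\int_\Omega(\det\nabla^2H_t(z))^{1/(2n)}\,\mathrm{d}z\,\mathrm{d}t$.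 Using $T\overline\Omega=\overline\Omega\times\mathbb{R}^{2n}$, $t\mapsto\mathrm{d}\phi^t(z)$ is a path in $\mathrm{Sp}(2n)$ from $\mathrm{id}$; $[\mathrm{d}\phi(z)]$ is its class in the universal cover $\widetilde{\mathrm{Sp}}(2n)$. $\mathcal{M}(\tilde\phi)=\frac{1}{\mathrm{vol}(\Omega)}\int_\Omega\mu([\mathrm{d}\phi(z)])\,\mathrm{d}z$, where $\mu:\widetilde{\mathrm{Sp}}(2n)\to\mathbb{R}$ is the homogeneous Maslov quasimorphism: with Krein form $\kappa(w,w')=\langle -iJ_0w,w'\rangle$ on $\mathbb{C}^{2n}$ ($\langle a,b\rangle=\sum a_k\overline{b_k}$), an eigenvalue $\lambda$ of $W\in\mathrm{Sp}(2n)$ on the unit circle $\mathbb{U}$ has Krein signature $(p(\lambda),q(\lambda))$ = signature of $\kappa$ on its generalized eigenspace; $\upsilon(W)=(-1)^m\prod_{\lambda\in\sigma(W)\cap\mathbb{U}\setminus\{\pm1\}}\lambda^{p(\lambda)}$ with $2m$ the total algebraic multiplicity of negative real eigenvalues; $\mu$ is the unique continuous function on $\widetilde{\mathrm{Sp}}(2n)$ with $e^{2\pi i\mu(w)}=\upsilon(w(1))$ and $\mu(\mathrm{id})=0$. *)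

(* Defs.v *)
(* MathComp + MathComp-Analysis (R : realType), plus mathcomp-real-closed
   for the complex numbers R[i] (used only as a field, with conjugation). *)
From HB Require Import structures.
From mathcomp Require Import all_boot all_order all_algebra.
From mathcomp Require Import all_classical all_reals all_analysis.
From mathcomp.real_closed Require Import complex.

Set Implicit Arguments.
Unset Strict Implicit.
Unset Printing Implicit Defensive.

Import Order.TTheory GRing.Theory Num.Theory.
Import numFieldNormedType.Exports.
Local Open Scope classical_set_scope.
Local Open Scope ring_scope.

(* ===================== smoothness ===================== *)

(* iterated directional derivatives  D_{v1} D_{v2} ... D_{vk} f *)
Fixpoint iterD {R : realType} {V W : normedModType R} (vs : seq V) (f : V -> W)
  : V -> W :=
  if vs is v :: vs' then (fun x => derive (iterD vs' f) x v) else f.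

(* f is C^infinity on the open set U: all iterated directional derivatives
   exist and are continuous at every point of U *)
Definition smooth_on {R : realType} {V W : normedModType R} (U : set V)
  (f : V -> W) : Prop :=
  forall (vs : seq V) (x : V), U x ->
    {for x, continuous (iterD vs f)} /\ forall v, derivable (iterD vs f) x v.

(* f is smooth on the (closed) set A: smooth on an open neighbourhood of A
   (i.e. f admits a smooth extension; up-to-the-boundary smoothness). *)
Definition smooth_near {R : realType} {V W : normedModType R} (A : set V)
  (f : V -> W) : Prop :=
  exists U : set V, [/\ open U, A `<=` U & smooth_on U f].

(* ===================== linear-algebra data on R^{2n} ===================== *)
(* Points of R^{2n} are row vectors z = (x_1..x_n, y_1..y_n) : 'rV_(n+n). *)

Definition evec {R : realType} {N : nat} (i : 'I_N) : 'rV[R]_N := delta_mx 0 i.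

(* J0 in row convention: (u *m Jmx) . v = omega0(u,v), i.e. u *m Jmx = J0 u *)
Definition Jmx {R : realType} (n : nat) : 'M[R]_(n + n) :=
  block_mx 0 1%:M (- 1%:M) 0.

(* omega0(u, v) = J0 u . v = sum_j (u_{x_j} v_{y_j} - u_{y_j} v_{x_j}) *)
Definition omega0 {R : realType} {n : nat} (u v : 'rV[R]_(n + n)) : R :=
  (u *m Jmx n *m v^T) 0 0.

(* Jacobian in row convention: u *m dmx f z = d f(z) u ;
   row i of dmx f z is the partial derivative of f in direction e_i *)
Definition dmx {R : realType} {N : nat} (f : 'rV[R]_N -> 'rV[R]_N)
  (z : 'rV[R]_N) : 'M[R]_N :=
  \matrix_(i, j) (derive f z (evec i)) 0 j.

Definition grad {R : realType} {N : nat} (h : 'rV[R]_N -> R) (z : 'rV[R]_N)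
  : 'rV[R]_N := \row_i derive h z (evec i).

Definition hess {R : realType} {N : nat} (h : 'rV[R]_N -> R) (z : 'rV[R]_N)
  : 'M[R]_N := \matrix_(i, j) derive (fun w => derive h w (evec j)) z (evec i).

Definition posdef {R : realType} {N : nat} (A : 'M[R]_N) : Prop :=
  forall v : 'rV[R]_N, v != 0 -> 0 < (v *m A *m v^T) 0 0.

(* ===================== the domain Omega ===================== *)

Definition bdry {R : realType} {N : nat} (O : set 'rV[R]_N) : set 'rV[R]_N :=
  closure O `\` O.

(* bounded uniformly convex open set with smooth boundary: nonempty, open,
   bounded, convex, with a smooth defining function rho (Omega = {rho < 0},
   grad rho <> 0 on {rho = 0}) whose Hessian is positive definite on the
   tangent hyperplanes of the boundary (all principal curvatures > 0) *)
Definition unif_convex_smooth {R : realType} {N : nat} (O : set 'rV[R]_N)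
  : Prop :=
  [/\ O !=set0, open O, bounded_set O,
      (forall x y (t : R), O x -> O y -> 0 <= t <= 1 -> O ((1 - t) *: x + t *: y))
    & exists rho : 'rV[R]_N -> R,
      [/\ smooth_on setT rho,
          O = [set z | rho z < 0],
          (forall z, rho z = 0 -> grad rho z != 0)
        & (forall z (v : 'rV[R]_N), rho z = 0 -> v != 0 -> (grad rho z *m v^T) 0 0 = 0 ->
             0 < (v *m hess rho z *m v^T) 0 0)]].

(* tangent vectors to the boundary: velocities at 0 of curves lying in the
   boundary near 0 *)
Definition bdry_tangent {R : realType} {N : nat} (O : set 'rV[R]_N)
  (z v : 'rV[R]_N) : Prop :=
  exists c : R -> 'rV[R]_N,
    [/\ c 0 = z, \forall s \near (0 : R), bdry O (c s),
        derivable c 0 1 & derive c 0 1 = v].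

(* v lies in ker (omega0 restricted to T_z dOmega): the characteristic line *)
Definition characteristic {R : realType} {n : nat} (O : set 'rV[R]_(n + n))
  (z v : 'rV[R]_(n + n)) : Prop :=
  bdry_tangent O z v /\ forall w, bdry_tangent O z w -> omega0 v w = 0.

(* curves tangent to the characteristic foliation (their images lie in leaves,
   and every leaf is the image of such a curve) *)
Definition char_curve {R : realType} {n : nat} (O : set 'rV[R]_(n + n))
  (g : R -> 'rV[R]_(n + n)) : Prop :=
  forall s, [/\ bdry O (g s), derivable g s 1 & characteristic O (g s) (derive g s 1)].

(* ===================== symplectomorphisms and paths ===================== *)

Definition symplecto {R : realType} {n : nat} (O : set 'rV[R]_(n + n))
  (f : 'rV[R]_(n + n) -> 'rV[R]_(n + n)) : Prop :=
  smooth_near (closure O) f /\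
  exists g : 'rV[R]_(n + n) -> 'rV[R]_(n + n),
    [/\ smooth_near (closure O) g,
        forall z, closure O z -> closure O (f z) /\ closure O (g z),
        forall z, closure O z -> g (f z) = z /\ f (g z) = z
      & forall z, closure O z -> dmx f z *m Jmx n *m (dmx f z)^T = Jmx n].

(* derivative of a curve at t in [0,1], taken within [0,1] (one-sided at ends) *)
Definition deriv01 {R : realType} {V : normedModType R} (c : R -> V) (t : R)
  (v : V) : Prop :=
  (fun h : R => h^-1 *: (c (t + h) - c t)) @
     within (fun h : R => h != 0 /\ 0 <= t + h <= 1) (nbhs (0 : R)) --> v.

Definition I01 {R : realType} : set R := [set t | 0 <= t <= 1].

(* phi = {phi^t}_{t in [0,1]} is the positive path generated by H *)
Definition positive_path {R : realType} {n : nat} (O : set 'rV[R]_(n + n))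
  (H : R -> 'rV[R]_(n + n) -> R)
  (phi : R -> 'rV[R]_(n + n) -> 'rV[R]_(n + n)) : Prop :=
  [/\ smooth_near (I01 `*` closure O) (fun p : R * 'rV[R]_(n + n) => H p.1 p.2),
      (forall t g s1 s2, I01 t -> char_curve O g -> H t (g s1) = H t (g s2)),
      (forall t z, I01 t -> closure O z -> posdef (hess (H t) z)),
      (forall z, closure O z -> phi 0 z = z /\
         forall t, I01 t -> deriv01 (fun s => phi s z) t (grad (H t) (phi t z) *m Jmx n))
    & (forall t, I01 t -> symplecto O (phi t))].

(* homotopy with fixed end points in Symp_0(closure O) (smooth homotopy) *)
Definition homotopic_rel_ends {R : realType} {n : nat} (O : set 'rV[R]_(n + n))
  (phi psi : R -> 'rV[R]_(n + n) -> 'rV[R]_(n + n)) : Prop :=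
  exists F : R -> R -> 'rV[R]_(n + n) -> 'rV[R]_(n + n),
    [/\ smooth_near (I01 `*` I01 `*` closure O)
          (fun p : R * R * 'rV[R]_(n + n) => F p.1.1 p.1.2 p.2),
        (forall s t, I01 s -> I01 t -> symplecto O (F s t)),
        (forall s z, I01 s -> closure O z -> F s 0 z = z /\ F s 1 z = phi 1 z)
      & (forall t z, I01 t -> closure O z -> F 0 t z = phi t z /\ F 1 t z = psi t z)].

(* ===================== integration over Omega ===================== *)

Definition setcoord {R : realType} {N : nat} (z : 'rV[R]_N) (j : 'I_N) (x : R)
  : 'rV[R]_N := z + (x - z 0 j) *: evec j.

(* iterated one-dimensional Lebesgue integrals over the listed coordinates *)
Fixpoint iint {R : realType} {N : nat} (js : seq 'I_N) (f : 'rV[R]_N -> R)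
  (z : 'rV[R]_N) : R :=
  if js is j :: js' then
    Rintegral (@lebesgue_measure R) setT (fun x => iint js' f (setcoord z j x))
  else f z.

(* Lebesgue integral over O in R^N (iterated over the coordinates) *)
Definition integral_over {R : realType} {N : nat} (O : set 'rV[R]_N)
  (f : 'rV[R]_N -> R) : R :=
  iint (enum 'I_N) (fun z => \1_O z * f z) 0.

Definition vol {R : realType} {N : nat} (O : set 'rV[R]_N) : R :=
  integral_over O (fun _ => 1).

(* length_G of the positive path generated by H *)
Definition lengthG {R : realType} {n : nat} (O : set 'rV[R]_(n + n))
  (H : R -> 'rV[R]_(n + n) -> R) : R :=
  (vol O)^-1 * Rintegral (@lebesgue_measure R) I01
    (fun t => integral_over O (fun z => powR (\det (hess (H t) z)) ((n + n)%:R^-1))).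

(* ===================== the Maslov quasimorphism ===================== *)
Local Open Scope complex_scope.

Definition cmx {R : realType} {N : nat} (W : 'M[R]_N) : 'M[R[i]]_N :=
  map_mx (fun x => x%:C) W.

(* Krein form kappa(w, w') = < -i J0 w, w' > *)
Definition krein {R : realType} {n : nat} (w w' : 'rV[R[i]]_(n + n)) : R[i] :=
  \sum_k (- 'i * (w *m cmx (Jmx n)) 0 k) * ((w' 0 k)^*).

(* generalized eigenspace of lambda (row space) *)
Definition geneig {R : realType} {N : nat} (W : 'M[R[i]]_N) (l : R[i]) : 'M[R[i]]_N :=
  kermx ((W - l%:M) ^+ N).

(* algebraic multiplicity *)
Definition algmult {R : realType} {N : nat} (W : 'M[R[i]]_N) (l : R[i]) : nat :=
  \rank (geneig W l).

(* p(lambda): positive index of kappa on the generalized eigenspace, i.e.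
   maximal dimension of a subspace on which kappa is positive definite *)
Definition krein_p {R : realType} {n : nat} (W : 'M[R[i]]_(n + n)) (l : R[i]) : nat :=
  \max_(r < (n + n).+1 |
     `[< exists S : 'M[R[i]]_(r, n + n),
           [/\ (S <= geneig W l)%MS, row_free S &
               forall c : 'rV[R[i]]_r, c != 0 ->
                 complex.Im (krein (c *m S) (c *m S)) = 0 /\ 0 < complex.Re (krein (c *m S) (c *m S))] >])
    (r : nat).

(* a duplicate-free list of all (complex) eigenvalues of W *)
Definition eigenlist {R : realType} {N : nat} (W : 'M[R[i]]_N) : seq R[i] :=
  xget [::] [set s : seq R[i] | uniq s /\ forall l, l \in s = eigenvalue W l].

Definition on_circle {R : realType} (l : R[i]) : bool := complex.Re l ^+ 2 + complex.Im l ^+ 2 == 1.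

Definition neg_real {R : realType} (l : R[i]) : bool :=
  (complex.Im l == 0) && (complex.Re l < 0).

(* upsilon(W) = (-1)^m prod_{lambda in sigma(W) cap U \ {+-1}} lambda^{p(lambda)} *)
Definition upsilon {R : realType} {n : nat} (W : 'M[R]_(n + n)) : R[i] :=
  let Wc := cmx W in
  let s := eigenlist Wc in
  let m : nat := (\sum_(l <- s | neg_real l) algmult Wc l)./2 in
  (-1) ^+ m *
  \prod_(l <- s | on_circle l && (l != 1) && (l != -1)) l ^+ krein_p Wc l.

(* e^{2 pi i x} *)
Definition expi {R : realType} (x : R) : R[i] :=
  cos (2 * pi * x) +i* sin (2 * pi * x).

(* mu of the class in the universal cover of Sp(2n) of the path
   t |-> gam t (t in [0,1], gam 0 = id): value at 1 of the continuous lift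
   theta of upsilon o gam with theta 0 = 0 *)
Definition mu_path {R : realType} {n : nat} (gam : R -> 'M[R]_(n + n)) : R :=
  xget 0 [set r : R | exists theta : R -> R,
    [/\ theta 0 = 0, {within I01, continuous theta},
        (forall t, I01 t -> expi (theta t) = upsilon (gam t)) & theta 1 = r]].

(* M(phi~) = 1/vol(O) int_O mu([d phi(z)]) dz *)
Definition maslov_mean {R : realType} {n : nat} (O : set 'rV[R]_(n + n))
  (phi : R -> 'rV[R]_(n + n) -> 'rV[R]_(n + n)) : R :=
  (vol O)^-1 * integral_over O (fun z => mu_path (fun t => dmx (phi t) z)).

(* Main.v *)
Require Import Defs.
From HB Require Import structures.
From mathcomp Require Import all_boot all_order all_algebra.
From mathcomp Require Import all_classical all_reals all_analysis.
From mathcomp.real_closed Require Import complex.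
From mathcomp Require Import measurable_realfun sesquilinear spectral perm ring lra.

(** Write W = dψ^t(z) for the differential along a positive path and A for the Hessian
    of the generating Hamiltonian, so that W' = W A J in row convention.  While -1 is not
    an eigenvalue of W, the Cayley transform B = -(W - 1)(W + 1)^-1 J is symmetric,
    B' = 2 C A C^T with C = (W + 1)^-1 W, and B starts at 0, so B > 0 at positive times.
    If x_k are the eigenvalues of -i B J, then 2π μ = Σ_k arctan |x_k|, and the arithmetic-
    geometric mean inequality bounds the derivative of this sum below by n (det A)^(1/2n).

    The path ψ never meets the eigenvalue -1: for c > 0 the determinant of
    c (W + 1) - i (W - 1) J has no zero on Sp(2n) and its argument increases along positive
    paths.  For c large the total increase along φ, hence along ψ by homotopy invariance,
    is less than π/2, which bounds B along ψ and keeps det (W + 1) away from 0.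

    It remains to integrate over Ω: ψ^t preserves the volume of Ω (the time derivative
    of f(ψ^t) is a divergence), so integrating the pointwise estimate in z and t gives the
    inequality. *)

Set Implicit Arguments.
Unset Strict Implicit.
Unset Printing Implicit Defensive.

Import Order.TTheory GRing.Theory Num.Theory.
Import numFieldNormedType.Exports.
Local Open Scope classical_set_scope.
Local Open Scope ring_scope.
(* [ssrnat] also has an [iterD]. *)
Local Notation iterD := Defs.iterD.

(** * Hermitian matrices and symplectic diagonalisation *)

Section HermitianMatrices.
Local Open Scope sesquilinear_scope.
Variable C : numClosedFieldType.

(** The [x_k] need not be differentiable where they collide, so [Theta] is expanded as a trace
    function. If U relates two eigenbases, the numbers U_ij (U^-1)_ji have row and column sums 1;
    averaging scalar Taylor remainders with them leaves a quadratic error, with no matching of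
    eigenvalues. The constant n appears because the velocity of B, written in the eigenbasis and
    weighted by |x_k| / (1 + x_k^2), has determinant det A / 2^(2n): every factor depending on W
    cancels.

    A positive path is a family of maps, each smooth in z, with time derivatives taken within
    [0, 1]. Joint smoothness comes from the homotopy [F]: its slices [F 0] and [F 1] agree with φ
    and ψ on the closure of Ω and stand in for them.

    Integrals are invariant under the flow for functions vanishing near the boundary; cutoffs of the
    length density then give an inequality in the direction that the length bound uses. The
    integrals over z and t are never exchanged: increments in time of the z-integral of the angle
    are compared with the integrand in t. *)

Lemma trmxC_mul m n p (A : 'M[C]_(m, n)) (B : 'M[C]_(n, p)) :
  (A *m B) ^t* = B ^t* *m A ^t*.
Proof. by rewrite trmx_mul map_mxM. Qed.

Lemma trmxC_diag n (d : 'rV[C]_n) : (forall k, d 0 k \is Num.real) ->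
  (diag_mx d) ^t* = diag_mx d.
Proof.
move=> dR; apply/matrixP=> i j; rewrite !mxE eq_sym.
by case: eqP => [->|_]; rewrite ?mulr1n ?mulr0n ?conjC0//; apply/CrealP.
Qed.

Definition posdefC n (A : 'M[C]_n) :=
  forall v : 'rV[C]_n, v != 0 -> 0 < (v *m A *m v ^t*) 0 0.

Lemma posdefC_conj n (A Q : 'M[C]_n) : Q \in unitmx -> posdefC A ->
  posdefC (Q *m A *m Q ^t*).
Proof.
move=> Qu Apos v v0.
have -> : v *m (Q *m A *m Q^t*) *m v^t* = (v *m Q) *m A *m (v *m Q)^t*.
  by rewrite trmxC_mul !mulmxA.
by apply: Apos; rewrite mulmx_free_eq0// row_free_unit.
Qed.

Lemma hermitian_diagonalize n (A : 'M[C]_n) : A ^t* = A ->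
  exists (V : 'M[C]_n) (x : 'rV[C]_n),
    [/\ V \in unitmx, V *m V^t* = 1%:M, V^t* *m V = 1%:M,
        V *m A = diag_mx x *m V & forall k, x 0 k \is Num.real].
Proof.
move=> Ah.
have Ahm : A \is hermsymmx by apply/is_hermitianmxP; rewrite expr0 scale1r Ah.
exists (spectralmx A), (spectral_diag A).
have Vu := spectral_unitarymx A.
have V1 : spectralmx A *m (spectralmx A)^t* = 1%:M by apply/unitarymxP.
split=> //.
- exact: spectral_unit.
- exact: mulmx1C.
- have /hermitian_normalmx/orthomx_spectralP e := Ahm; rewrite {2}e.
  by rewrite !mulmxA mulmxV ?spectral_unit// mul1mx.
- by move=> k; have /mxOverP/(_ 0 k) := hermitian_spectral_diag_real Ahm.
Qed.

Lemma row_mul_sqr n (V A : 'M[C]_n) k :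
  (row k V *m A *m (row k V)^t*) 0 0 = (V *m A *m V^t*) k k.
Proof. by rewrite -row_mul !mxE; apply: eq_bigr => j _; rewrite !mxE. Qed.

Lemma posdefC_diag n (A : 'M[C]_n) k : posdefC A -> 0 < A k k.
Proof.
move=> Ap; have := Ap (row k 1%:M).
rewrite row_mul_sqr mul1mx trmx1 map_mx1 mulmx1; apply.
apply/eqP => /rowP /(_ k); rewrite !mxE eqxx => /eqP.
by rewrite oner_eq0.
Qed.

(** Spectral decomposition A = V^H diag(x) V (^H is the adjoint) with the square roots of the
    positive x distributed over the two sides: L = V^H diag(sqrt x). *)
Lemma posdefC_factor n (A : 'M[C]_n) : A ^t* = A -> posdefC A ->
  exists2 L : 'M[C]_n, L \in unitmx & A = L *m L^t*.
Proof.
move=> Ah Ap; have [V [x [Vu V1 V2 VA xR]]] := hermitian_diagonalize Ah.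
have xp k : 0 < x 0 k.
  have := posdefC_diag k (posdefC_conj Vu Ap).
  rewrite VA -mulmxA V1 mulmx1 !mxE eqxx mulr1n; exact.
pose s := \row_k sqrtC (x 0 k).
have sR k : s 0 k \is Num.real by rewrite mxE realE sqrtC_ge0 ltW.
have ss : diag_mx s *m diag_mx s = diag_mx x.
  rewrite mulmx_diag; congr diag_mx; apply/rowP => k.
  by rewrite !mxE -expr2 sqrtCK.
have su : diag_mx s \in unitmx.
  rewrite unitmxE det_diag unitfE; apply/prodf_neq0 => k _.
  by rewrite mxE sqrtC_eq0 gt_eqF.
have Vsu : V^t* \in unitmx by have /mulmx1_unit[] := V2.
exists (V^t* *m diag_mx s); first by rewrite unitmx_mul su Vsu.
rewrite trmxC_mul trmxCK trmxC_diag// mulmxA -(mulmxA (V^t*) (diag_mx s)) ss.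
by rewrite -mulmxA -VA mulmxA V2 mul1mx.
Qed.

(** With A = L L^H, the product A K is conjugate by L to the Hermitian matrix L^H K L; if V
    diagonalises the latter, take Q = V L^-1. So A K has real eigenvalues, and the rows of Q are
    left eigenvectors of A K, orthonormal for A. *)
Lemma simultaneous_diagonalize n (A K : 'M[C]_n) :
  A ^t* = A -> posdefC A -> K ^t* = K ->
  exists (Q : 'M[C]_n) (x : 'rV[C]_n),
    [/\ Q \in unitmx, Q *m A *m Q^t* = 1%:M,
        Q *m A *m K = diag_mx x *m Q & forall k, x 0 k \is Num.real].
Proof.
move=> Ah Ap Kh; have [L Lu AL] := posdefC_factor Ah Ap.
have Hh : (L^t* *m K *m L)^t* = L^t* *m K *m L.
  by rewrite !trmxC_mul trmxCK Kh mulmxA.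
have [V [x [Vu V1 V2 VH xR]]] := hermitian_diagonalize Hh.
exists (V *m invmx L), x; split=> //.
- by rewrite unitmx_mul Vu unitmx_inv.
- rewrite AL trmxC_mul !mulmxA mulmxKV// -(mulmxA V) -trmxC_mul mulVmx//.
  by rewrite trmx1 map_mx1 mulmx1.
- rewrite AL [RHS]mulmxA -VH !mulmxA mulmxKV//.
  by rewrite mulmxK.
Qed.

(** Arithmetic-geometric mean inequality for the eigenvalues. *)
Lemma det_le_trace n (A : 'M[C]_n) : A ^t* = A -> posdefC A ->
  \det A <= (\tr A / n%:R) ^+ n.
Proof.
move=> Ah Ap; have [V [x [Vu V1 V2 VA xR]]] := hermitian_diagonalize Ah.
have xp k : 0 < x 0 k.
  have := posdefC_diag k (posdefC_conj Vu Ap).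
  rewrite VA -mulmxA V1 mulmx1 !mxE eqxx mulr1n; exact.
have AE : A = V^t* *m diag_mx x *m V by rewrite -mulmxA -VA mulmxA V2 mul1mx.
have -> : \tr A = \sum_k x 0 k by rewrite AE mxtrace_mulC mulmxA V1 mul1mx mxtrace_diag.
have -> : \det A = \prod_k x 0 k.
  by rewrite AE !det_mulmx mulrAC -det_mulmx V2 det1 mul1r det_diag.
have /= := @leif_AGM C 'I_n xpredT (fun k => x 0 k) (fun k _ => ltW (xp k)).
by rewrite card_ord => -[].
Qed.

End HermitianMatrices.

(** * A real-valued modulus on the complex numbers *)

Section ComplexModulus.
Variable R : realType.
Local Notation C := R[i].
Local Notation Re := complex.Re.
Local Notation Im := complex.Im.
Local Open Scope complex_scope.
Implicit Types (x y : C).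

(** The norm of [R[i]] takes values in [R[i]] itself; the estimates below need a modulus in [R]. *)
Definition cabs (x : C) : R := ComplexField.Normc.normc x.

Lemma cabsE x : cabs x = Num.sqrt (Re x ^+ 2 + Im x ^+ 2).
Proof. by case: x. Qed.

Lemma cabs_ge0 x : 0 <= cabs x.
Proof. by rewrite cabsE sqrtr_ge0. Qed.

Lemma sqr_cabs x : cabs x ^+ 2 = Re x ^+ 2 + Im x ^+ 2.
Proof. by rewrite cabsE sqr_sqrtr// addr_ge0// sqr_ge0. Qed.

Lemma cabsM x y : cabs (x * y) = cabs x * cabs y.
Proof. exact: ComplexField.Normc.normcM. Qed.

Lemma ler_cabsD x y : cabs (x + y) <= cabs x + cabs y.
Proof. exact: le_normcD. Qed.

Lemma cabs0 : cabs 0 = 0.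
Proof. exact: ComplexField.Normc.normc0. Qed.

Lemma cabsR (r : R) : cabs r%:C = `|r|.
Proof. by rewrite cabsE /= expr0n addr0 sqrtr_sqr. Qed.

Lemma ler_cabs_sum (I : Type) (s : seq I) (P : pred I) (F : I -> C) :
  cabs (\sum_(i <- s | P i) F i) <= \sum_(i <- s | P i) cabs (F i).
Proof.
elim/big_ind2: _ => [|a b c d ab cd|//]; first by rewrite cabs0.
by apply: le_trans (ler_cabsD _ _) _; apply: lerD.
Qed.

Lemma ler_Re_cabs x : `|Re x| <= cabs x.
Proof.
rewrite -(ler_pXn2r (_ : 0 < 2)%N) ?nnegrE ?cabs_ge0//.
by rewrite sqr_cabs real_normK ?num_real// lerDl sqr_ge0.
Qed.

Lemma conjCcE x : Num.conj x = conjc x.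
Proof. by []. Qed.

Lemma mulC_conj x : x * Num.conj x = (cabs x ^+ 2)%:C.
Proof.
rewrite sqr_cabs conjCcE; case: x => a b /=.
by rewrite /real_complex_def; apply/eqP; rewrite eq_complex /=; apply/andP; split; apply/eqP; ring.
Qed.

Lemma cReD x y : Re (x + y) = Re x + Re y. Proof. by case: x y => ? ? []. Qed.
Lemma cImD x y : Im (x + y) = Im x + Im y. Proof. by case: x y => ? ? []. Qed.
Lemma cReN x : Re (- x) = - Re x. Proof. by case: x. Qed.
Lemma cReM x y : Re (x * y) = Re x * Re y - Im x * Im y.
Proof. by case: x y => ? ? []. Qed.
Lemma cImM x y : Im (x * y) = Re x * Im y + Im x * Re y.
Proof. by case: x y => ? ? []. Qed.
Lemma cRe_sum (I : Type) (s : seq I) (P : pred I) (F : I -> C) :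
  Re (\sum_(i <- s | P i) F i) = \sum_(i <- s | P i) Re (F i).
Proof. by elim/big_ind2: _ => // a b c d <- <-; rewrite cReD. Qed.
Lemma cIm_sum (I : Type) (s : seq I) (P : pred I) (F : I -> C) :
  Im (\sum_(i <- s | P i) F i) = \sum_(i <- s | P i) Im (F i).
Proof. by elim/big_ind2: _ => // a b c d <- <-; rewrite cImD. Qed.
Lemma cReMr (r : R) x : Re (r%:C * x) = r * Re x.
Proof. by rewrite cReM /= mul0r subr0. Qed.
Lemma cRe_conj x : Re (Num.conj x) = Re x. Proof. by case: x. Qed.
Lemma cIm_conj x : Im (Num.conj x) = - Im x. Proof. by case: x. Qed.

End ComplexModulus.

(** * Complexified matrices, the Krein matrix and the angle function *)

Section ComplexifiedMatrices.
Variable R : realType.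
Local Notation C := R[i].
Local Notation Re := complex.Re.
Local Notation Im := complex.Im.
Local Open Scope complex_scope.
Local Open Scope sesquilinear_scope.

Lemma cmxE N (A : 'M[R]_N) : cmx A = map_mx (real_complex R) A.
Proof. by []. Qed.

Lemma cmxM N (A B : 'M[R]_N) : cmx (A *m B) = cmx A *m cmx B.
Proof. by rewrite !cmxE map_mxM. Qed.

Lemma cmxD N (A B : 'M[R]_N) : cmx (A + B) = cmx A + cmx B.
Proof. by rewrite !cmxE map_mxD. Qed.

Lemma cmxB N (A B : 'M[R]_N) : cmx (A - B) = cmx A - cmx B.
Proof. by rewrite !cmxE map_mxB. Qed.

Lemma cmx1 N : cmx (1%:M : 'M[R]_N) = 1%:M.
Proof. by rewrite cmxE map_mx1. Qed.

Lemma det_cmx N (A : 'M[R]_N) : \det (cmx A) = (\det A)%:C.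
Proof. by rewrite cmxE det_map_mx. Qed.

Lemma cmx_trC N (A : 'M[R]_N) : (cmx A)^t* = cmx A^T.
Proof.
apply/matrixP => i j; rewrite !mxE conjCcE.
by apply/eqP; rewrite eq_complex /= oppr0 !eqxx.
Qed.

(** The imaginary part is the antisymmetrised form in Re v and Im v, which the symmetry of A
    kills. *)
Lemma quad_cmx N (A : 'M[R]_N) (v : 'rV[C]_N) : A^T = A ->
  (v *m cmx A *m v^t*) 0 0 =
  ((map_mx (@Re R) v *m A *m (map_mx (@Re R) v)^T) 0 0 +
   (map_mx (@Im R) v *m A *m (map_mx (@Im R) v)^T) 0 0)%:C.
Proof.
move=> As; have eqf (K : pzRingType) (u w : 'rV[K]_N) (M : 'M[K]_N) :
    (u *m M *m w^T) 0 0 = \sum_i \sum_j u 0 j * M j i * w 0 i.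
  by rewrite mxE; apply: eq_bigr => i _; rewrite !mxE mulr_suml.
have -> : (v *m cmx A *m v^t*) 0 0
    = \sum_i \sum_j v 0 j * (A j i)%:C * Num.conj (v 0 i).
  rewrite mxE; apply: eq_bigr => i _; rewrite !mxE mulr_suml.
  by apply: eq_bigr => j _; rewrite mxE.
rewrite !eqf; apply/eqP; rewrite eq_complex; apply/andP; split; apply/eqP.
  rewrite cRe_sum /= -big_split; apply: eq_bigr => i _.
  rewrite cRe_sum /= -big_split; apply: eq_bigr => j _.
  rewrite !mxE !cReM !cImM cRe_conj cIm_conj /=; ring.
rewrite /= cIm_sum.
have -> : \sum_i Im (\sum_j v 0 j * (A j i)%:C * Num.conj (v 0 i)) =
   \sum_i \sum_j Im (v 0 j) * A j i * Re (v 0 i)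
   - \sum_i \sum_j Re (v 0 j) * A j i * Im (v 0 i).
  rewrite -sumrB; apply: eq_bigr => i _; rewrite cIm_sum -sumrB.
  by apply: eq_bigr => j _; rewrite !cImM !cReM cRe_conj cIm_conj /=; ring.
rewrite [X in X - _]exchange_big /= -sumrB big1// => i _.
rewrite -sumrB big1// => j _; have : A^T i j = A i j by rewrite As.
by rewrite mxE => ->; ring.
Qed.

Lemma posdef_cmx N (A : 'M[R]_N) : A^T = A -> posdef A -> posdefC (cmx A).
Proof.
move=> As Ap v v0; rewrite quad_cmx// ltcR.
have ge0 (u : 'rV[R]_N) : 0 <= (u *m A *m u^T) 0 0.
  have [->|u0] := eqVneq u 0; first by rewrite !mul0mx mxE.
  exact/ltW/Ap.
have [r0|r0] := eqVneq (map_mx (@Re R) v) 0; last by rewrite ltr_pwDl// Ap.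
have [i0|i0] := eqVneq (map_mx (@Im R) v) 0; last by rewrite ltr_wpDl// Ap.
case/eqP: v0; apply/rowP => k; rewrite mxE; apply/eqP; rewrite eq_complex.
by move/rowP/(_ k): r0; move/rowP/(_ k): i0; rewrite !mxE => -> ->; rewrite !eqxx.
Qed.

Lemma posdef_unit N (A : 'M[R]_N) : posdef A -> A \in unitmx.
Proof.
move=> Ap; rewrite -row_free_unit -kermx_eq0; apply/negPn/negP => /rowV0Pn[v].
move=> /sub_kermxP vA v0; have := Ap v v0; by rewrite vA mul0mx mxE ltxx.
Qed.

(** det A = |det L|^2 for the factorisation A = L L^H. *)
Lemma posdef_det_gt0 N (A : 'M[R]_N) : A^T = A -> posdef A -> 0 < \det A.
Proof.
move=> As Ap.
have [L Lu AL] := posdefC_factor (etrans (cmx_trC A) (congr1 _ As))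
  (posdef_cmx As Ap).
have : 0 < \det (cmx A).
  rewrite AL det_mulmx det_map_mx det_tr mulC_conj ltcR exprn_gt0//.
  rewrite lt_def cabs_ge0 andbT; apply: contraTN Lu => /eqP d0.
  rewrite unitmxE unitfE negbK; apply/eqP.
  exact: ComplexField.Normc.eq0_normc.
by rewrite det_cmx ltcR.
Qed.

(** The matrix of the Krein form. Passing from J to -iJ makes it Hermitian and an involution, so
    that [B K] has real eigenvalues for positive definite [B]. *)
Definition Kmx n : 'M[C]_(n + n) := - 'i%C *: cmx (Jmx n).

Lemma Jmx_tr n : (Jmx n)^T = - Jmx n :> 'M[R]_(n + n).
Proof.
by rewrite /Jmx tr_block_mx linearN /= !trmx0 !trmx1 opp_block_mx !oppr0 opprK.
Qed.

Lemma Jmx_sqr n : Jmx n *m Jmx n = - 1%:M :> 'M[R]_(n + n).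
Proof.
rewrite /Jmx mulmx_block !mul0mx !mulmx0 !mul1mx !mulmx1 !add0r !addr0.
by rewrite scalar_mx_block opp_block_mx !oppr0.
Qed.

Lemma Kmx_trC n : (Kmx n)^t* = Kmx n.
Proof.
rewrite /Kmx linearZ /= map_mxZ cmx_trC Jmx_tr !cmxE map_mxN scalerN -scaleNr.
congr (_ *: _); apply/eqP; rewrite eq_complex /=.
by apply/andP; split; apply/eqP; ring.
Qed.

Lemma Kmx_sqr n : Kmx n *m Kmx n = 1%:M.
Proof.
rewrite /Kmx -scalemxAl -scalemxAr scalerA -cmxM Jmx_sqr cmxE map_mxN map_mx1.
have -> : - 'i%C * - 'i%C = -1 :> C.
  by apply/eqP; rewrite eq_complex /=; apply/andP; split; apply/eqP; ring.
by rewrite scaleN1r opprK.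
Qed.

(** The rows of Q are left eigenvectors of -i B J, orthonormal for B, with real eigenvalues x.
    Equivalently, B^-1 = Q^H Q and -i J = Q^H diag(x) Q. *)
Definition sdiag n (B : 'M[R]_(n + n)) (Q : 'M[C]_(n + n)) (x : 'rV[R]_(n + n)) :=
  [/\ Q \in unitmx, Q *m cmx B *m Q^t* = 1%:M
    & Q *m cmx B *m Kmx n = diag_mx (map_mx (real_complex R) x) *m Q].

Lemma sdiag_exists n (B : 'M[R]_(n + n)) : B^T = B -> posdef B ->
  exists Q x, sdiag B Q x.
Proof.
move=> Bs Bp; have Bh : (cmx B)^t* = cmx B by rewrite cmx_trC Bs.
have [Q [x [Qu QB QK xR]]] :=
  simultaneous_diagonalize Bh (posdef_cmx Bs Bp) (Kmx_trC n).
exists Q, (map_mx (@Re R) x); split=> //; rewrite QK; congr (diag_mx _ *m _).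
apply/rowP => k; rewrite !mxE; have /complex_realP[r ->] := xR k; by [].
Qed.

Lemma sdiag_K n (B : 'M[R]_(n + n)) Q x : sdiag B Q x ->
  Kmx n = Q^t* *m diag_mx (map_mx (real_complex R) x) *m Q.
Proof.
case=> Qu QB QK; by rewrite -mulmxA -QK mulmxA (mulmx1C QB) mul1mx.
Qed.

(** J is invertible, so no eigenvalue vanishes; this makes y |-> |atan y| smooth at every [x_k]. *)
Lemma sdiag_neq0 n (B : 'M[R]_(n + n)) Q x : sdiag B Q x -> forall k, x 0 k != 0.
Proof.
move=> sd; have Ku : Kmx n \in unitmx by have /mulmx1_unit[] := Kmx_sqr n.
have := Ku; rewrite (sdiag_K sd) !unitmx_mul => /andP[/andP[_ +] _].
rewrite unitmxE det_diag unitfE => /prodf_neq0 h k; have := h k isT.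
by rewrite mxE; apply: contra_neq => ->.
Qed.

Lemma sdiag_det n (B : 'M[R]_(n + n)) Q x : sdiag B Q x ->
  cabs (\det Q) ^+ 2 * \det B = 1.
Proof.
case=> Qu /(congr1 determinant) QB _; move: QB.
rewrite !det_mulmx det1 det_cmx det_map_mx det_tr mulrAC mulC_conj -rmorphM.
exact: complexI.
Qed.

(* The linearisation of [sum_k |atan (x k)|] in the direction [M]. *)
Definition dTheta n (Q : 'M[C]_(n + n)) (x : 'rV[R]_(n + n)) (M : 'M[R]_(n + n)) : R :=
  \sum_k `|x 0 k| / (1 + x 0 k ^+ 2) * Re ((Q *m cmx M *m Q^t*) k k).

(* On the Cayley chart this is [2 pi] times the Maslov quasimorphism, see [upsilon_cay]. *)
Definition Theta n (B : 'M[R]_(n + n)) : R :=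
  \sum_k `|atan ((xget (0 : 'rV[R]_(n + n)) [set x | exists Q, sdiag B Q x]) 0 k)|.

End ComplexifiedMatrices.

(** * Second-order estimates for the arctangent *)

Section AtanExpansion.
Variable R : realType.
Implicit Types x y : R.

(** The mean value theorem gives the slope 1 / (1 + c^2) with c between x and y; replacing c by x
    costs at most |x - c|, because |x + c| <= (1 + c^2) (1 + x^2). *)
Lemma atan_taylor x y :
  `|atan y - atan x - (y - x) / (1 + x ^+ 2)| <= (y - x) ^+ 2.
Proof.
have p (z : R) : 0 < 1 + z ^+ 2 by rewrite ltr_pwDl ?sqr_ge0.
have key (a b : R) : a < b -> exists2 c, a <= c <= b &
    atan b - atan a = (b - a) / (1 + c ^+ 2).
  move=> ab; have [c cab ->] : exists2 c, c \in `]a, b[%R &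
      atan b - atan a = (1 + c ^+ 2)^-1 * (b - a).
    apply: (@MVT R atan (fun z => (1 + z ^+ 2)^-1) a b ab).
    by apply: continuous_subspaceT => z; exact: continuous_atan.
  exists c; last by rewrite mulrC.
  by move: cab; rewrite in_itv/= => /andP[/ltW-> /ltW->].
have [c cxy e] : exists2 c, `|x - c| <= `|y - x| &
    atan y - atan x = (y - x) / (1 + c ^+ 2).
  case: (ltgtP x y) => [xy|yx|->].
  - have [c /andP[c1 c2] e] := key _ _ xy; exists c => //.
    by rewrite ler0_norm ?subr_le0// ger0_norm ?subr_ge0 ?(ltW xy)// opprB lerB.
  - have [c /andP[c1 c2] e] := key _ _ yx; exists c.
      rewrite ger0_norm ?subr_ge0// ler0_norm ?subr_le0 ?(ltW yx)// opprB.
      by rewrite lerB.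
    by rewrite -opprB e -mulNr opprB.
  - by exists y; rewrite ?subrr ?mul0r.
rewrite e.
have -> : (y - x) / (1 + c ^+ 2) - (y - x) / (1 + x ^+ 2) =
    (y - x) * ((x - c) * ((x + c) / ((1 + c ^+ 2) * (1 + x ^+ 2)))).
  by field; rewrite !gt_eqF.
rewrite 2!normrM -[leRHS]real_normK ?num_real// [leRHS]expr2 ler_wpM2l//.
apply: le_trans cxy; rewrite ler_piMr// normrM normfV.
rewrite [X in _ / X]gtr0_norm ?mulr_gt0// ler_pdivrMr ?mulr_gt0// mul1r.
have h1 := sqr_ge0 (x - 2^-1); have h2 := sqr_ge0 (c - 2^-1).
have h3 := sqr_ge0 (x + 2^-1); have h4 := sqr_ge0 (c + 2^-1).
have h5 := sqr_ge0 (x * c).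
by rewrite ler_norml; apply/andP; split; nra.
Qed.

(** The slope |x| / (x (1 + x^2)) is sign(x) / (1 + x^2). While y stays on the side of x this is
    [atan_taylor]; across the origin |y - x| >= |x|, so the linear bound 2 |y - x| is absorbed by 2
    / |x| times the square. The bound holds for all y, with no smallness condition. *)
Lemma abs_atan_taylor x y : x != 0 ->
  `| `|atan y| - `|atan x| - `|x| / (x * (1 + x ^+ 2)) * (y - x)|
   <= (1 + 2 / `|x|) * (y - x) ^+ 2.
Proof.
have atN (z : R) : atan (- z) = - atan z by rewrite atanN.
have atge (z : R) : 0 <= z -> 0 <= atan z.
  rewrite le_eqVlt => /predU1P[<-|z0]; first by rewrite atan0.
  by rewrite -atan0; apply/ltW/lt_atan.
have nat (z : R) : `|atan z| = atan `|z|.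
  case: (leP 0 z) => z0; first by rewrite !ger0_norm// atge.
  rewrite (ltr0_norm z0) atN ler0_norm//.
  by rewrite -[z]opprK atN oppr_le0 atge// oppr_ge0 ltW.
have atle (z : R) : 0 <= z -> atan z <= z.
  rewrite le_eqVlt => /predU1P[<-|z0]; first by rewrite atan0.
  have [c _ ] : exists2 c, c \in `]0, z[%R & atan z - atan 0 = (1 + c ^+ 2)^-1 * (z - 0).
    apply: (@MVT R atan (fun z => (1 + z ^+ 2)^-1) 0 z z0).
    by apply: continuous_subspaceT => w; exact: continuous_atan.
  rewrite atan0 !subr0 => ->; rewrite ler_piMl ?(ltW z0)//.
  by rewrite invf_le1 ?lerDl ?sqr_ge0// ltr_pwDl ?sqr_ge0.
have main (a b : R) : 0 < a -> `| `|atan b| - atan a - (b - a) / (1 + a ^+ 2)|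
   <= (1 + 2 / a) * (b - a) ^+ 2.
  move=> a0; have p : 0 < 1 + a ^+ 2 by rewrite ltr_pwDl ?sqr_ge0.
  have ai : 0 < a^-1 by rewrite invr_gt0.
  case: (leP 0 b) => b0.
    rewrite (ger0_norm (atge _ b0)); apply: le_trans (atan_taylor a b) _.
    by rewrite ler_peMl ?sqr_ge0// lerDl mulr_ge0// ltW.
  rewrite nat (ltr0_norm b0).
  have h1 : `|atan (- b) - atan a| <= a - b.
    have h2 := atge (- b); have h3 := atge a; have := atle (- b); have := atle a.
    rewrite !oppr_ge0 in h2 *; have := h2 (ltW b0); have := h3 (ltW a0).
    rewrite ler_norml => u1 u2 u3 u4; have := u3 (ltW a0); have := u4 (ltW b0).
    by move=> *; apply/andP; split; lra.
  have h2 : `|(b - a) / (1 + a ^+ 2)| <= a - b.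
    rewrite normrM normfV (gtr0_norm p) ltr0_norm ?opprB; last by lra.
    by rewrite ler_pdivrMr// ler_peMr ?lerDl ?sqr_ge0//; lra.
  apply: le_trans (ler_normB _ _) _; apply: le_trans (lerD h1 h2) _.
  have -> : a - b + (a - b) = 2 / a * (a * (a - b)) by field; rewrite gt_eqF.
  have q : 0 <= 2 / a by rewrite mulr_ge0// ltW.
  have : 2 / a * (a * (a - b)) <= 2 / a * (b - a) ^+ 2 by apply: ler_wpM2l => //; nra.
  have := sqr_ge0 (b - a); lra.
move=> x0; case: (ltgtP x 0) x0 => // [xn|xp] _.
  have := main (- x) (- y); rewrite oppr_gt0 => /(_ xn).
  rewrite (atN y) normrN (nat x) !(ltr0_norm xn) sqrrN.
  have -> : (- y - - x) ^+ 2 = (y - x) ^+ 2 by ring.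
  have p : 1 + x ^+ 2 != 0 by rewrite gt_eqF// ltr_pwDl ?sqr_ge0.
  by have -> : (- y - - x) / (1 + x ^+ 2) = - x / (x * (1 + x ^+ 2)) * (y - x)
    by field; rewrite p lt_eqF.
have := main x y xp; rewrite (ger0_norm (atge _ (ltW xp))) (gtr0_norm xp).
have p : 1 + x ^+ 2 != 0 by rewrite gt_eqF// ltr_pwDl ?sqr_ge0.
by have -> : (y - x) / (1 + x ^+ 2) = x / (x * (1 + x ^+ 2)) * (y - x)
    by field; rewrite p gt_eqF.
Qed.

End AtanExpansion.

(** * First-order expansion of the angle sum *)

Section Klein.
Variable R : realType.
Local Notation C := R[i].
Local Notation Re := complex.Re.
Local Notation Im := complex.Im.
Local Open Scope complex_scope.
Local Open Scope sesquilinear_scope.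

Lemma diag_mulVE n (D : 'rV[C]_n) (A : 'M[C]_n) i j :
  (diag_mx D *m A) i j = D 0 i * A i j.
Proof. by rewrite mul_diag_mx mxE. Qed.

Lemma mul_diagE n (D : 'rV[C]_n) (A : 'M[C]_n) i j :
  (A *m diag_mx D) i j = A i j * D 0 j.
Proof. by rewrite mul_mx_diag mxE. Qed.

Lemma cabs_conj (z : C) : cabs (Num.conj z) = cabs z.
Proof. by case: z => a b; rewrite !cabsE /= sqrrN. Qed.

Lemma cabs_mulmx n (A B : 'M[C]_n) a b i j : 0 <= a ->
  (forall k, cabs (A i k) <= a) -> (forall k, cabs (B k j) <= b) ->
  cabs ((A *m B) i j) <= n%:R * (a * b).
Proof.
move=> a0 Aa Bb; rewrite mxE; apply: le_trans (ler_cabs_sum _ _ _) _.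
apply: (@le_trans _ _ (\sum_(k < n) a * b)).
  by apply: ler_sum => k _; rewrite cabsM ler_pM// cabs_ge0.
by rewrite sumr_const card_ord mulr_natl.
Qed.

Lemma row_norm_sum n (A : 'M[C]_n) i :
  Re ((A *m A^t*) i i) = \sum_k cabs (A i k) ^+ 2.
Proof. by rewrite mxE cRe_sum; apply: eq_bigr => k _; rewrite !mxE mulC_conj. Qed.

Lemma cabs_le_of_sum n (A : 'M[C]_n) i j :
  \sum_k cabs (A i k) ^+ 2 <= 2 -> cabs (A i j) <= 2.
Proof.
rewrite (bigD1 j)//= => h; have : cabs (A i j) ^+ 2 <= 2.
  by apply: le_trans h; rewrite lerDl sumr_ge0// => k _; rewrite sqr_ge0.
by have := cabs_ge0 (A i j); nra.
Qed.

Lemma rcE m (v : 'rV[R]_m) k : (map_mx (real_complex R) v) 0 k = (v 0 k)%:C.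
Proof. by rewrite mxE. Qed.

(** Put U = Q0 Q^-1, V = U^-1 and E = Q0 (B - B0) Q0^H. Then U U^H = 1 + E and U diag(y) V = (1 + E)
    diag(x), so U_ij (y_j - x_i) and V_ji (y_j - x_i) are O(m), being entries of E diag(x) U and V E
    diag(x). The weights U_ij V_ji have row and column sums 1. The left side is the weighted sum of
    the remainders of [abs_atan_taylor] at the pairs (x_i, y_j), and each remainder is quadratic in
    y_j - x_i. This is the argument behind Klein's trace inequality. *)
Lemma klein_estimate n (B0 : 'M[R]_(n + n)) Q0 x : sdiag B0 Q0 x ->
  exists (c d : R), [/\ 0 <= c, 0 < d & forall B Q y (m : R),
    sdiag B Q y -> 0 <= m <= d -> (forall i j, `|B i j - B0 i j| <= m) ->
    `|\sum_k `|atan (y 0 k)| - \sum_k `|atan (x 0 k)| - dTheta Q0 x (B - B0)|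
      <= c * m ^+ 2].
Proof.
set N := (n + n)%N => sd0.
have x0 := sdiag_neq0 sd0; have K0 := sdiag_K sd0; have [Q0u QB0 QK0] := sd0.
pose q : R := \sum_(i < N) \sum_(k < N) cabs (Q0 i k).
have rowq i : \sum_(k < N) cabs (Q0 i k) <= q.
  rewrite /q [leRHS](bigD1 i)//= lerDl sumr_ge0// => k _; rewrite sumr_ge0// => l _.
  exact: cabs_ge0.
have q0 : 0 <= q by rewrite sumr_ge0// => i _; rewrite sumr_ge0// => k _; exact: cabs_ge0.
pose c1 := q ^+ 2.
have c10 : 0 <= c1 by rewrite sqr_ge0.
pose X : R := \sum_(k < N) `|x 0 k|.
pose Kc : R := \sum_(k < N) (1 + 2 / `|x 0 k|).
have X0 : 0 <= X by rewrite sumr_ge0.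
have leX k : `|x 0 k| <= X by rewrite /X (bigD1 k)//= lerDl sumr_ge0.
have Kc1 k : 0 <= 1 + 2 / `|x 0 k| by rewrite addr_ge0// divr_ge0.
have leKc k : 1 + 2 / `|x 0 k| <= Kc by rewrite /Kc (bigD1 k)//= lerDl sumr_ge0.
have Kc0 : 0 <= Kc by rewrite sumr_ge0.
pose cc : R := N%:R * (N%:R * (Kc * ((N%:R * (c1 * X * 2)) ^+ 2))).
have dpos : 0 < (2 * N%:R * c1 + 1)^-1.
  by rewrite invr_gt0 ltr_wpDl// !mulr_ge0.
(* The threshold ensures N e <= 1/2, where e = q^2 m bounds the entries of E. *)
exists cc, (2 * N%:R * c1 + 1)^-1; split=> //.
  by rewrite /cc !mulr_ge0// sqr_ge0.
move=> B Q y m sd /andP[m0 md] Bm; have [Qu QB QK] := sd.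
pose e := c1 * m.
have e0 : 0 <= e by rewrite mulr_ge0.
have Ne : N%:R * e <= 2^-1.
  have : m * (2 * N%:R * c1 + 1) <= 1.
    by rewrite -ler_pdivlMr ?mul1r// -invr_gt0.
  rewrite /e; have h1 : 0 <= N%:R :> R by []. lra.
pose E := Q0 *m cmx (B - B0) *m Q0^t*.
have Ee i j : cabs (E i j) <= e.
  rewrite mxE; apply: le_trans (ler_cabs_sum _ _ _) _.
  apply: (@le_trans _ _ (\sum_(l < N) q * m * cabs (Q0 j l))).
    apply: ler_sum => l _; rewrite cabsM !mxE.
    have -> : cabs (Num.conj (Q0 j l)) = cabs (Q0 j l).
      exact: cabs_conj.
    rewrite ler_wpM2r ?cabs_ge0//; apply: le_trans (ler_cabs_sum _ _ _) _.
    apply: (@le_trans _ _ (\sum_(k < N) cabs (Q0 i k) * m)).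
      by apply: ler_sum => k _; rewrite cabsM !mxE cabsR ler_wpM2l// cabs_ge0.
    by rewrite -mulr_suml ler_wpM2r.
  by rewrite -mulr_sumr /e /c1 expr2 -!mulrA ler_wpM2l// mulrC ler_wpM2r.
pose U := Q0 *m invmx Q; pose V := Q *m invmx Q0.
have UV : U *m V = 1%:M by rewrite /U /V mulmxA mulmxKV// mulmxV.
have VU : V *m U = 1%:M by apply: mulmx1C.
pose DX := diag_mx (map_mx (real_complex R) x).
pose DY := diag_mx (map_mx (real_complex R) y).
have EU : 1%:M + E = U *m U^t*.
  rewrite /E cmxB mulmxBr mulmxBl QB0 addrC subrK /U trmxC_mul !mulmxA.
  have -> : cmx B = invmx Q *m (invmx Q)^t*.
    have h : (Q^t*) \in unitmx by rewrite map_unitmx unitmx_tr.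
    apply: (can_inj (mulKmx Qu)); apply: (can_inj (mulmxK h)).
    rewrite QB mulmxA (mulmxV Qu) mul1mx -trmxC_mul (mulmxV Qu).
    by rewrite trmx1 map_mx1.
  by rewrite !mulmxA.
have UDV : U *m DY *m V = DX + E *m DX.
  (* Here K Q0^-1 = Q0^H diag(x) turns the perturbation Q0 (B - B0) K Q0^-1 into E diag(x). *)
  have -> : E *m DX = Q0 *m cmx (B - B0) *m Kmx R n *m invmx Q0.
    by rewrite K0 !mulmxA mulmxK.
  have -> : DX = Q0 *m cmx B0 *m Kmx R n *m invmx Q0 by rewrite QK0 mulmxK.
  rewrite cmxB mulmxBr !mulmxBl addrC subrK /U /V !mulmxA.
  by rewrite -(mulmxA _ DY) -QK !mulmxA mulmxKV.
clearbody U V.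
have U2 i j : cabs (U i j) <= 2.
  apply: cabs_le_of_sum; rewrite -row_norm_sum -EU mxE cReD mxE eqxx /=.
  have : 1%N%:R <= N%:R :> R by rewrite ler_nat; exact: leq_ltn_trans (leq0n i) (ltn_ord i).
  have h := Ee i i; have h2 := ler_Re_cabs (E i i); have h3 := ler_norm (Re (E i i)).
  move=> h4; have : e <= N%:R * e by rewrite ler_peMl.
  lra.
(* V V^H = 1 - V E V^H bounds the squared row norm S by 1 + N e S <= 1 + S / 2, hence by 2. *)
have V2 i j : cabs (V i j) <= 2.
  apply: cabs_le_of_sum; set S := \sum_k _.
  have VEV : V *m V^t* = 1%:M - V *m E *m V^t*.
    have -> : E = U *m U^t* - 1%:M by rewrite -EU addrC addKr.
    rewrite mulmxBr mulmxBl mulmx1 !mulmxA VU mul1mx -trmxC_mul VU.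
    by rewrite trmx1 map_mx1 opprB addrC subrK.
  have SE : S = 1 - Re ((V *m E *m V^t*) i i).
    by rewrite /S -row_norm_sum VEV mxE cReD mxE eqxx mxE cReN.
  have : cabs ((V *m E *m V^t*) i i) <= e * (N%:R * S).
    rewrite mxE; apply: le_trans (ler_cabs_sum _ _ _) _.
    apply: (@le_trans _ _ (\sum_(l < N) \sum_(k < N)
       e * ((cabs (V i k) ^+ 2 + cabs (V i l) ^+ 2) / 2))).
      apply: ler_sum => l _; rewrite cabsM !mxE.
      have -> : cabs (Num.conj (V i l)) = cabs (V i l).
        exact: cabs_conj.
      apply: le_trans (ler_wpM2r (cabs_ge0 _) (ler_cabs_sum _ _ _)) _.
      rewrite mulr_suml; apply: ler_sum => k _; rewrite cabsM.
      rewrite mulrAC mulrC ler_pM ?mulr_ge0 ?cabs_ge0//.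
      by have := sqr_ge0 (cabs (V i k) - cabs (V i l)); nra.
    have -> : \sum_(l < N) \sum_(k < N)
       e * ((cabs (V i k) ^+ 2 + cabs (V i l) ^+ 2) / 2) = e * (N%:R * S).
      under eq_bigr do rewrite -mulr_sumr -mulr_suml big_split /= sumr_const card_ord.
      rewrite -mulr_sumr -mulr_suml big_split /= sumr_const card_ord.
      by rewrite sumrMnl -/S -mulr_natl; congr (_ * _); field.
    by [].
  have := ler_Re_cabs ((V *m E *m V^t*) i i).
  have := ler_norm (- Re ((V *m E *m V^t*) i i)); rewrite normrN.
  have : 0 <= S by rewrite sumr_ge0// => k _; rewrite sqr_ge0.
  move=> S0 h1 h2 h3; have : e * (N%:R * S) <= 2^-1 * S.
    by rewrite mulrA [e * _]mulrC ler_wpM2r.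
  lra.
pose D := E *m DX.
have D2 i j : cabs (D i j) <= e * X.
  by rewrite /D mul_diagE cabsM rcE cabsR ler_pM ?cabs_ge0.
have eX0 : 0 <= e * X by rewrite mulr_ge0.
have DU i j : cabs (U i j) * `|y 0 j - x 0 i| <= N%:R * (e * X * 2).
  have <- : cabs ((D *m U) i j) = cabs (U i j) * `|y 0 j - x 0 i|.
    have -> : D *m U = U *m DY - DX *m U.
      have -> : U *m DY = (DX + D) *m U by rewrite -UDV -mulmxA VU mulmx1.
      by rewrite mulmxDl addrC addKr.
    rewrite mxE [X in _ + X]mxE mul_diagE diag_mulVE !rcE mulrC -mulrBl -rmorphB cabsM cabsR.
    by rewrite mulrC.
  exact: cabs_mulmx.
have VD i j : cabs (V j i) * `|y 0 j - x 0 i| <= N%:R * (e * X * 2).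
  have <- : cabs ((V *m D) j i) = cabs (V j i) * `|y 0 j - x 0 i|.
    have -> : V *m D = DY *m V - V *m DX.
      have -> : DY *m V = V *m (DX + D) by rewrite -UDV -mulmxA mulmxA VU mul1mx.
      by rewrite mulmxDr addrC addKr.
    rewrite mxE [X in _ + X]mxE mul_diagE diag_mulVE !rcE [X in _ - X]mulrC -mulrBl -rmorphB cabsM cabsR.
    by rewrite mulrC.
  by rewrite [e * X * 2]mulrC; exact: cabs_mulmx.
pose s i := `|x 0 i| / (x 0 i * (1 + x 0 i ^+ 2)).
pose f i j := `|atan (y 0 j)| - `|atan (x 0 i)| - s i * (y 0 j - x 0 i).
(* Since rows and columns of the weights sum to 1, S is the difference of the two angle sums minus
   the linear term. *)
pose S := \sum_i \sum_j U i j * V j i * (f i j)%:C.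
have UVi i : \sum_j U i j * V j i = 1 by have /matrixP/(_ i i) := UV; rewrite !mxE eqxx.
have VUj j : \sum_i U i j * V j i = 1.
  have /matrixP/(_ j j) := VU; rewrite !mxE eqxx; apply: etrans.
  by apply: eq_bigr => i _; rewrite mulrC.
have -> : \sum_k `|atan (y 0 k)| - \sum_k `|atan (x 0 k)| - dTheta Q0 x (B - B0) = Re S.
  have -> : S = (\sum_k `|atan (y 0 k)|)%:C - (\sum_k `|atan (x 0 k)|)%:C
      - \sum_i (s i)%:C * (E i i * (x 0 i)%:C).
    rewrite /S.
    have -> : (\sum_k `|atan (y 0 k)|)%:C = \sum_i \sum_j U i j * V j i * `|atan (y 0 j)|%:C.
      rewrite exchange_big /= rmorph_sum; apply: eq_bigr => j _.
      by rewrite -mulr_suml VUj mul1r.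
    have -> : (\sum_k `|atan (x 0 k)|)%:C = \sum_i \sum_j U i j * V j i * `|atan (x 0 i)|%:C.
      by rewrite rmorph_sum; apply: eq_bigr => i _; rewrite -mulr_suml UVi mul1r.
    have -> : \sum_i (s i)%:C * (E i i * (x 0 i)%:C) =
       \sum_i \sum_j U i j * V j i * ((s i)%:C * ((y 0 j)%:C - (x 0 i)%:C)).
      apply: eq_bigr => i _.
      have <- : \sum_j U i j * V j i * ((y 0 j)%:C - (x 0 i)%:C) = E i i * (x 0 i)%:C.
        have : D i i = (U *m DY *m V - DX) i i by rewrite UDV addrC addKr.
        rewrite {1}/D mul_diagE rcE => ->; rewrite [RHS]mxE [X in _ = X + _]mxE [X in _ = _ + X]mxE.
        under eq_bigr do rewrite mulrBr.
        rewrite sumrB -mulr_suml UVi mul1r; congr (_ - _); last first.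
          by rewrite mxE eqxx mulr1n rcE.
        by apply: eq_bigr => j _; rewrite mul_diagE rcE mulrAC.
      by rewrite mulr_sumr; apply: eq_bigr => j _; rewrite mulrCA.
    rewrite -!sumrB; apply: eq_bigr => i _; rewrite -!sumrB; apply: eq_bigr => j _.
    by rewrite /f !rmorphB rmorphM rmorphB !mulrBr.
  rewrite !cReD !cReN cRe_sum; congr (_ - _); apply: eq_bigr => i _.
  rewrite [E i i * _]mulrC 2!cReMr mulrA; congr (_ * _).
  by rewrite /s; field; rewrite x0 /= gt_eqF// ltr_pwDl ?sqr_ge0.
apply: le_trans (ler_Re_cabs _) _.
have -> : cc * m ^+ 2 = \sum_(i < N) \sum_(j < N) Kc * (N%:R * (e * X * 2)) ^+ 2.
  rewrite !sumr_const !card_ord /cc /e -[RHS]mulr_natl -[X in _ = _ * X]mulr_natl.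
  by ring.
apply: le_trans (ler_cabs_sum _ _ _) _; apply: ler_sum => i _.
apply: le_trans (ler_cabs_sum _ _ _) _; apply: ler_sum => j _.
rewrite !cabsM cabsR.
apply: (@le_trans _ _ (cabs (U i j) * cabs (V j i) *
   ((1 + 2 / `|x 0 i|) * (y 0 j - x 0 i) ^+ 2))).
  by rewrite ler_wpM2l ?mulr_ge0 ?cabs_ge0// abs_atan_taylor.
have -> : cabs (U i j) * cabs (V j i) * ((1 + 2 / `|x 0 i|) * (y 0 j - x 0 i) ^+ 2) =
  (1 + 2 / `|x 0 i|) * ((cabs (U i j) * `|y 0 j - x 0 i|) * (cabs (V j i) * `|y 0 j - x 0 i|)).
  by rewrite -(real_normK (num_real (y 0 j - x 0 i))); ring.
by rewrite ler_pM ?mulr_ge0 ?cabs_ge0 ?expr2// ler_pM ?mulr_ge0 ?cabs_ge0.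
Qed.

(** [klein_estimate] with B = B0 and m = 0: any two diagonalisations of the same matrix give the
    same angle sum, so the choice made in [Theta] is immaterial. *)
Lemma Theta_sdiag n (B : 'M[R]_(n + n)) Q x : sdiag B Q x ->
  Theta B = \sum_k `|atan (x 0 k)|.
Proof.
move=> sd; rewrite /Theta.
have [Q' sd'] : exists Q', sdiag B Q' (xget (0 : 'rV[R]_(n + n)) [set x | exists Q, sdiag B Q x]).
  case: xgetP => [y -> //|/(_ x)[]]; by exists Q.
set y := xget _ _ in sd' *.
have [c [d [c0 d0 h]]] := klein_estimate sd.
have := h _ _ _ 0 sd'; rewrite lexx (ltW d0) => /(_ isT).
have -> : dTheta Q x (B - B) = 0.
  rewrite /dTheta big1// => k _.
  by rewrite subrr cmxE map_mx0 mulmx0 mul0mx mxE mulr0.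
rewrite subr0 expr0n mulr0 normr_le0 subr_eq0 => h0.
by apply/eqP/h0 => i j; rewrite subrr normr0.
Qed.

Lemma Theta_expansion n (B0 : 'M[R]_(n + n)) Q0 x : sdiag B0 Q0 x ->
  exists (c d : R), [/\ 0 <= c, 0 < d & forall (B : 'M[R]_(n + n)) (m : R),
    B^T = B -> posdef B -> 0 <= m <= d -> (forall i j, `|B i j - B0 i j| <= m) ->
    `|Theta B - Theta B0 - dTheta Q0 x (B - B0)| <= c * m ^+ 2].
Proof.
move=> sd; have [c [d [c0 d0 h]]] := klein_estimate sd.
exists c, d; split=> // B m Bs Bp md Bm.
have [Q [y sdB]] := sdiag_exists Bs Bp.
by rewrite (Theta_sdiag sd) (Theta_sdiag sdB); apply: (h B Q y).
Qed.
End Klein.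

(** * The Cayley chart of the symplectic group *)

Section Cayley.
Variable R : realType.
Local Notation C := R[i].
Local Notation Re := complex.Re.
Local Notation Im := complex.Im.
Local Open Scope complex_scope.
Local Open Scope sesquilinear_scope.

Definition cay n (W : 'M[R]_(n + n)) : 'M[R]_(n + n) :=
  - ((W - 1%:M) *m invmx (W + 1%:M) *m Jmx n).

Definition cayC n (W : 'M[R]_(n + n)) : 'M[R]_(n + n) := invmx (W + 1%:M) *m W.

Lemma trmxC_conj n (P A : 'M[C]_n) : A^t* = A -> (P *m A *m P^t*)^t* = P *m A *m P^t*.
Proof. by move=> h; rewrite !trmxC_mul trmxCK h mulmxA. Qed.

Section Identities.
Variables (n : nat) (W : 'M[R]_(n + n)).
Local Notation J := (Jmx n : 'M[R]_(n + n)).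
Hypothesis sW : W *m J *m W^T = J.

Lemma JmxK : J *m - J = 1%:M.
Proof. by rewrite mulmxN Jmx_sqr opprK. Qed.

Lemma Jmx_unit : J \in unitmx.
Proof. by have /mulmx1_unit[] := JmxK. Qed.

Lemma symp_inv : W *m (- (J *m W^T *m J)) = 1%:M.
Proof. by rewrite mulmxN !mulmxA sW Jmx_sqr opprK. Qed.

Lemma symp_unit : W \in unitmx.
Proof. by have /mulmx1_unit[] := symp_inv. Qed.

Lemma symp_tr : W^T *m J *m W = J.
Proof.
have := mulmx1C symp_inv; rewrite mulNmx => h.
by apply: (can_inj (mulKmx Jmx_unit)); rewrite !mulmxA Jmx_sqr -h opprK.
Qed.

Lemma symp_det : (\det W) ^+ 2 = 1.
Proof.
have /(congr1 determinant) := sW; rewrite !det_mulmx det_tr mulrAC -expr2.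
rewrite -[RHS]mul1r; apply: mulIf; rewrite -unitfE -unitmxE.
exact: Jmx_unit.
Qed.

Hypothesis uW : W + 1%:M \in unitmx.
Local Notation Wi := (invmx (W + 1%:M)).
Local Notation B := (cay W).

Lemma cay_mulJ : B *m J = (W - 1%:M) *m Wi.
Proof. by rewrite /cay mulNmx -(mulmxA _ J J) Jmx_sqr mulmxN mulmx1 opprK. Qed.

Lemma cay_sub1 : 1%:M - B *m J = 2 *: Wi.
Proof.
rewrite cay_mulJ -{1}(mulmxV uW) -mulmxBl opprB addrC addrA subrK.
by rewrite mulmxDl mul1mx -mulr2n scaler_nat.
Qed.

Lemma cay_add1 : 1%:M + B *m J = 2 *: (W *m Wi).
Proof.
rewrite cay_mulJ -{1}(mulmxV uW) -mulmxDl addrACA subrr addr0.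
by rewrite mulmxDl -mulr2n scaler_nat.
Qed.

Lemma symp_comm : W *m Wi = Wi *m W.
Proof.
apply: (can_inj (mulKmx uW)); rewrite [RHS]mulKVmx// mulmxA.
have -> : (W + 1%:M) *m W = W *m (W + 1%:M).
  by rewrite mulmxDl mulmxDr mul1mx mulmx1.
by rewrite mulmxK.
Qed.

(** With the inverses cleared, this reads (W^T + 1) J = W^T J (W + 1), which is W^T J W = J. *)
Lemma J_Wi : J *m Wi = (cayC W)^T *m J.
Proof.
rewrite /cayC trmx_mul trmx_inv linearD /= trmx1.
have uT : W^T + 1%:M \in unitmx by rewrite -[_ + _]trmxK linearD /= trmx1 trmxK unitmx_tr.
have cT : W^T *m invmx (W^T + 1%:M) = invmx (W^T + 1%:M) *m W^T.
  apply: (can_inj (mulKmx uT)); rewrite [RHS]mulKVmx// mulmxA.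
  have -> : (W^T + 1%:M) *m W^T = W^T *m (W^T + 1%:M).
    by rewrite mulmxDl mulmxDr mul1mx mulmx1.
  by rewrite mulmxK.
rewrite cT; apply: (can_inj (mulKmx uT)); apply: (can_inj (mulmxK uW)).
rewrite !mulmxA mulmxKV// mulmxV// mul1mx.
by rewrite mulmxDl mulmxDr mul1mx mulmx1 symp_tr addrC.
Qed.

(** The transpose is reduced with J (W + 1)^-T = C J, the transposed form of [J_Wi], and with W J
    W^T = J. *)
Lemma cay_tr : B^T = B.
Proof.
rewrite /cay linearN /= !trmx_mul Jmx_tr mulNmx opprK.
have -> : J *m (Wi^T *m (W - 1%:M)^T) = (J *m Wi^T) *m (W - 1%:M)^T by rewrite mulmxA.
have h : J *m Wi^T = cayC W *m J.
  have := J_Wi => /(congr1 trmx); rewrite [LHS]trmx_mul [RHS]trmx_mul trmxK Jmx_tr mulmxN mulNmx.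
  move=> /oppr_inj h.
  have : J *m (Wi^T *m J) *m J = J *m (J *m cayC W) *m J by rewrite -h.
  by rewrite !mulmxA Jmx_sqr -(mulmxA _ J J) Jmx_sqr mulmxN mulmx1 !mulNmx mul1mx => /oppr_inj.
rewrite h linearB /= trmx1 mulmxBr mulmx1 /cayC.
have -> : Wi *m W *m J *m W^T = Wi *m J by rewrite -!mulmxA (mulmxA W) sW.
rewrite -mulmxBl -[RHS]mulNmx; congr (_ *m _).
by rewrite mulmxBl mul1mx symp_comm opprB.
Qed.

(** The left side is the derivative of cay W = 2 (W + 1)^-1 J - J when W' = W A J; [J_Wi] turns it
    into a congruence of A. *)
Lemma cay_velocity (A : 'M[R]_(n + n)) :
  - (2 *: (Wi *m (W *m A *m J) *m Wi *m J)) = 2 *: (cayC W *m A *m (cayC W)^T).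
Proof.
rewrite -scalerN; congr (_ *: _).
have -> : Wi *m (W *m A *m J) *m Wi *m J = cayC W *m A *m (J *m Wi *m J).
  by rewrite /cayC !mulmxA.
by rewrite J_Wi -(mulmxA _ J J) Jmx_sqr mulmxN mulmx1 mulmxN opprK.
Qed.

(** The transpose of 1 - B J is 1 + J B, which J conjugates to 1 + B J. *)
Lemma det_cay_sub1 : \det (1%:M - B *m J) = \det (1%:M + B *m J).
Proof.
rewrite -det_tr linearB /= trmx1 trmx_mul Jmx_tr cay_tr mulNmx opprK.
have -> : 1%:M + J *m B = J *m (1%:M + B *m J) *m - J.
  rewrite mulmxDr mulmx1 mulmxDl JmxK; congr (_ + _).
  by rewrite -!mulmxA JmxK mulmx1.
by rewrite !det_mulmx mulrAC -det_mulmx JmxK det1 mul1r.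
Qed.

Lemma cayC_unit : cayC W \in unitmx.
Proof. by rewrite unitmx_mul unitmx_inv uW symp_unit. Qed.

Lemma posdef_velocity (A : 'M[R]_(n + n)) : posdef A ->
  posdef (2 *: (cayC W *m A *m (cayC W)^T)).
Proof.
move=> Ap v v0; rewrite -scalemxAr -scalemxAl mxE mulr_gt0//.
have -> : v *m (cayC W *m A *m (cayC W)^T) *m v^T =
  (v *m cayC W) *m A *m (v *m cayC W)^T.
  by rewrite [(v *m _)^T]trmx_mul; move: (cayC W) => Y; rewrite !mulmxA.
by apply: Ap; rewrite mulmx_free_eq0// row_free_unit cayC_unit.
Qed.

(** Both sides equal det (1 - B J) det (1 + B J) = det (1 - (B J)^2), where -(B J)^2 is the square
    of -i B J; the two factors agree by [det_cay_sub1]. *)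
Lemma sdiag_prod1 Q x : sdiag B Q x ->
  \prod_k (1 + x 0 k ^+ 2) = (2 ^+ (n + n) / \det (W + 1%:M)) ^+ 2.
Proof.
move=> [Qu QB QK].
have -> : 2 ^+ (n + n) / \det (W + 1%:M) = \det (1%:M - B *m J).
  by rewrite cay_sub1 detZ det_inv.
rewrite expr2 {2}det_cay_sub1 -det_mulmx.
have -> : (1%:M - B *m J) *m (1%:M + B *m J) = 1%:M - B *m J *m (B *m J).
  move: (B *m J) => X.
  by rewrite mulmxDr mulmx1 mulmxBl mul1mx addrA subrK.
apply: complexI; rewrite -det_cmx cmxB cmx1 !cmxM.
pose T := cmx B *m Kmx R n.
have TE : cmx B *m cmx J *m (cmx B *m cmx J) = - (T *m T).
  rewrite /T /Kmx -!scalemxAr -!scalemxAl scalerA.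
  have -> : - 'i%C * - 'i%C = -1 :> C.
    by apply/eqP; rewrite eq_complex /=; apply/andP; split; apply/eqP; ring.
  by rewrite scaleN1r opprK.
have QT : Q *m T = diag_mx (map_mx (real_complex R) x) *m Q by rewrite /T mulmxA QK.
rewrite TE opprK; clearbody T.
have -> : 1%:M + T *m T = invmx Q *m diag_mx (map_mx (real_complex R) (\row_k (1 + x 0 k ^+ 2))) *m Q.
  apply: (can_inj (mulKmx Qu)); rewrite !mulmxA (mulmxV Qu) mul1mx.
  rewrite mulmxDr mulmx1 mulmxA QT -mulmxA QT mulmxA mulmx_diag -{1}[Q]mul1mx -mulmxDl.
  congr (_ *m _); apply/matrixP => i j; rewrite !mxE.
  by case: eqP => [->|_]; rewrite ?mulr1n ?mulr0n ?addr0// rmorphD rmorphXn expr2.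
rewrite !det_mulmx mulrAC -det_mulmx (mulVmx Qu) det1 mul1r det_diag rmorph_prod.
by apply: eq_bigr => k _; rewrite !mxE.
Qed.

(** Moduli of determinants in Q B K = diag(x) Q; |det K| = 1 because K^2 = 1. *)
Lemma sdiag_prod Q x : sdiag B Q x -> posdef B -> \prod_k `|x 0 k| = \det B.
Proof.
move=> [Qu QB QK] Bp.
have : cabs (\det (Q *m cmx B *m Kmx R n)) =
  cabs (\det (diag_mx (map_mx (real_complex R) x) *m Q)) by rewrite QK.
rewrite !det_mulmx det_cmx det_diag !cabsM.
have K1 : cabs (\det (Kmx R n)) = 1.
  have := congr1 determinant (Kmx_sqr R n).
  rewrite det_mulmx det1 => /(congr1 (@cabs R)); rewrite cabsM.
  rewrite -[1 in RHS]/(1%:C) cabsR normr1 => h.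
  by have := cabs_ge0 (\det (Kmx R n)); nra.
have Q0 : cabs (\det Q) != 0.
  apply: contraTneq Qu => h; rewrite unitmxE unitfE negbK; apply/eqP.
  exact: ComplexField.Normc.eq0_normc.
rewrite K1 mulr1 cabsR (gtr0_norm (posdef_det_gt0 cay_tr Bp)) mulrC => /(mulIf Q0) ->.
elim/big_ind2: _ => [|a b c d -> ->|k _]; first by rewrite -[1 in RHS]/(1%:C) cabsR normr1.
  by rewrite cabsM.
by rewrite mxE cabsR.
Qed.

(** [dTheta] is the trace of M = s Q B' Q^H s with s_k^2 = |x_k| / (1 + x_k^2). With N = 2n, det M
    is the product of det B / prod (1 + x_k^2), of |det Q|^2 = 1 / det B and of det B' = 2^N det A /
    det (W + 1)^2; by [sdiag_prod1] what remains is det A / 2^N. So [det_le_trace] gives tr M >= N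
    (det A)^(1/N) / 2, that is, n (det A)^(1/(2n)). *)
Lemma dTheta_lower (A : 'M[R]_(n + n)) Q x : (0 < n)%N ->
  A^T = A -> posdef A -> posdef B -> sdiag B Q x ->
  n%:R * powR (\det A) ((n + n)%:R^-1) <=
    dTheta Q x (2 *: (cayC W *m A *m (cayC W)^T)).
Proof.
move=> n0 As Ap Bp sd; have [Qu QB QK] := sd.
move sB' : (2 *: _) => B'; set N := (n + n)%N.
have N0 : (0 < N)%N by rewrite addn_gt0 n0.
have B's : B'^T = B'.
  rewrite -sB' linearZ /=; move: (cayC W) => Y.
  by rewrite !trmx_mul trmxK As mulmxA.
have B'p : posdef B' by rewrite -sB'; exact: posdef_velocity.
have p1 k : 0 < 1 + x 0 k ^+ 2 by rewrite ltr_pwDl ?sqr_ge0.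
pose c k := `|x 0 k| / (1 + x 0 k ^+ 2).
have cp k : 0 < c k by rewrite divr_gt0// normr_gt0 (sdiag_neq0 sd).
pose s : 'rV[C]_N := \row_k (Num.sqrt (c k))%:C.
have sR k : s 0 k \is Num.real by rewrite mxE; apply/complex_realP; eexists.
have su : diag_mx s \in unitmx.
  rewrite unitmxE det_diag unitfE; apply/prodf_neq0 => k _.
  rewrite mxE; apply/eqP => /complexI/eqP; rewrite sqrtr_eq0 leNgt cp//.
pose G := Q *m cmx B' *m Q^t*.
pose M := diag_mx s *m G *m diag_mx s.
have ME : M = (diag_mx s *m Q) *m cmx B' *m (diag_mx s *m Q)^t*.
  by rewrite trmxC_mul trmxC_diag// /M /G !mulmxA.
have Mh : M^t* = M.
  by rewrite ME; apply: trmxC_conj; rewrite cmx_trC B's.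
have Mp : posdefC M.
  by rewrite ME; apply: posdefC_conj; [rewrite unitmx_mul su|exact: posdef_cmx].
have ss : \prod_k s 0 k * \prod_k s 0 k = (\prod_k c k)%:C.
  rewrite -big_split rmorph_prod; apply: eq_bigr => k _ /=.
  by rewrite mxE -rmorphM -expr2 sqr_sqrtr// ltW.
have detM : \det M = (\det A / 2 ^+ N)%:C.
  rewrite /M /G !det_mulmx det_diag det_cmx det_map_mx det_tr.
  set dQ := \det Q; set dB := (\det B')%:C.
  have -> : forall p : C, p * (dQ * dB * Num.conj dQ) * p = p * p * (dB * (dQ * Num.conj dQ)).
    by move=> p; ring.
  rewrite ss mulC_conj /dB -!rmorphM; congr (_%:C).
  have -> : \prod_k c k = \det B / \prod_k (1 + x 0 k ^+ 2).
    by rewrite -(sdiag_prod sd Bp) -prodf_div.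
  rewrite (sdiag_prod1 sd) -sB' detZ !det_mulmx det_tr /cayC det_mulmx det_inv.
  have w0 : \det (W + 1%:M) != 0 by rewrite -unitfE -unitmxE.
  have b0 : \det B != 0 by rewrite gt_eqF// posdef_det_gt0// cay_tr.
  have -> : cabs dQ ^+ 2 = (\det B)^-1.
    by apply: (mulIf b0); rewrite (sdiag_det sd) mulVf.
  have -> : forall w d e : R, 2 ^+ N * ((w * d) * e * (w * d)) = 2 ^+ N * (w * w * e * d ^+ 2).
    by move=> *; ring.
  have t0 : 2 ^+ N != 0 :> R by rewrite expf_neq0.
  by rewrite symp_det; field; rewrite b0 w0 !andbT; exact: t0.
have trM : \tr M = (dTheta Q x B')%:C.
  have e : \tr M = \sum_k (c k)%:C * G k k.
    apply: eq_bigr => k _; rewrite /M mul_diagE diag_mulVE.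
    rewrite mxE mulrAC -rmorphM -expr2 sqr_sqrtr// ltW//.
  have Gr k : G k k = (Re (G k k))%:C.
    have Gh : G^t* = G by apply: trmxC_conj; rewrite cmx_trC B's.
    have /matrixP/(_ k k) := Gh; rewrite 2!mxE => h.
    have : G k k \is Num.real by apply/CrealP; exact: h.
    by move=> /complex_realP[r ->].
  rewrite e rmorph_sum; apply: eq_bigr => k _; rewrite [in LHS]Gr.
  exact: (esym (rmorphM (real_complex R) _ _)).
have := det_le_trace Mh Mp; rewrite detM trM.
rewrite -[N%:R]/(N%:R : C) -(rmorph_nat (real_complex R)) -fmorphV -rmorphM -rmorphXn lecR.
set d := dTheta _ _ _.
have d0 : 0 <= d.
  rewrite /d /dTheta sumr_ge0// => k _; rewrite mulr_ge0 ?ltW ?cp//.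
  have := posdefC_diag k (posdefC_conj Qu (posdef_cmx B's B'p)).
  by rewrite ltcE => /andP[].
set a := powR _ _.
have aN : a ^+ N = \det A.
  rewrite -powR_mulrn ?powR_ge0// -powRrM mulVf ?pnatr_eq0 -?lt0n//.
  by rewrite powRr1// ltW// posdef_det_gt0.
rewrite -aN -expr_div_n => h.
have : a / 2 <= d / N%:R.
  rewrite -(ler_pXn2r N0)// nnegrE ?divr_ge0 ?powR_ge0//.
rewrite ler_pdivlMr ?ltr0n// => h2; apply: le_trans h2.
by rewrite le_eqVlt /N natrD; apply/orP; left; apply/eqP; field.
Qed.

End Identities.
End Cayley.

(** * The circle map [upsilon] in the Cayley chart *)

Section Upsilon.
Variable R : realType.
Local Notation C := R[i].
Local Notation Re := complex.Re.
Local Notation Im := complex.Im.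
Local Open Scope complex_scope.
Local Open Scope sesquilinear_scope.

Definition cis (a : R) : C := cos a +i* sin a.

Lemma cisD a b : cis (a + b) = cis a * cis b.
Proof.
apply/eqP; rewrite eq_complex /= cosD sinD; apply/andP; split; apply/eqP => //.
by rewrite addrC.
Qed.

Lemma cis0 : cis 0 = 1.
Proof. by rewrite /cis cos0 sin0. Qed.

Lemma cis_sum (I : Type) (s : seq I) (P : pred I) (F : I -> R) :
  cis (\sum_(i <- s | P i) F i) = \prod_(i <- s | P i) cis (F i).
Proof.
apply: (big_morph cis); [exact: cisD|exact: cis0].
Qed.

(** Real and imaginary parts of (1 + ix) / (1 - ix), the eigenvalue of W attached to the eigenvalue
    x of -i B J. *)
Definition cayv (x : R) : C :=
  ((1 - x ^+ 2) / (1 + x ^+ 2)) +i* (2 * x / (1 + x ^+ 2)).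

Lemma cayv_gt0 (x : R) : 0 < 1 + x ^+ 2.
Proof. by rewrite ltr_pwDl ?sqr_ge0. Qed.

Lemma cayvE (x : R) : cayv x * (1 -i* x) = 1 +i* x.
Proof.
have p := cayv_gt0 x; apply/eqP; rewrite eq_complex /=.
by apply/andP; split; apply/eqP; field; rewrite gt_eqF.
Qed.

Lemma cayv_cis (x : R) : cayv x = cis (2 * atan x).
Proof.
have p := cayv_gt0 x.
have c2 : cos (atan x) ^+ 2 = (1 + x ^+ 2)^-1.
  by rewrite cos_atan exprVn sqr_sqrtr// ltW.
have c0 : cos (atan x) != 0.
  by apply/eqP => h; move: c2; rewrite h expr0n => /esym/eqP; rewrite invr_eq0 gt_eqF.
have sE : sin (atan x) = x * cos (atan x).
  by rewrite -[X in _ = X * _]atanK /tan divfK.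
rewrite /cayv /cis [2 * atan x]mulr_natl sin_mulr2n cos_mulr2n sE.
have -> : cos (atan x) ^+ 2 *+ 2 - 1 = (1 - x ^+ 2) / (1 + x ^+ 2).
  by rewrite c2 -mulr_natl; field; rewrite gt_eqF.
have -> // : cos (atan x) * (x * cos (atan x)) *+ 2 = 2 * x / (1 + x ^+ 2).
by rewrite mulrCA -expr2 c2 -mulr_natl mulrA.
Qed.

Lemma cayv_inj : injective cayv.
Proof.
move=> x y /eqP; rewrite eq_complex /= => /andP[/eqP h1 /eqP h2].
have px := cayv_gt0 x; have py := cayv_gt0 y.
have e1 (z : R) : (1 - z ^+ 2) / (1 + z ^+ 2) = 2 / (1 + z ^+ 2) - 1.
  by field; rewrite gt_eqF// cayv_gt0.
have h : (1 + x ^+ 2)^-1 = (1 + y ^+ 2)^-1 by move: h1; rewrite !e1; lra.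
move: h2; rewrite h => /(mulIf (_ : _ != 0)) h2.
by apply: (@mulfI _ 2); rewrite ?pnatr_eq0//; apply: h2; rewrite invr_eq0 gt_eqF.
Qed.

Lemma row_mul_diag N (d : 'rV[C]_N) (A : 'M[C]_N) k :
  row k (diag_mx d *m A) = d 0 k *: row k A.
Proof. by rewrite row_mul row_diag_mx -scalemxAl -rowE. Qed.

Lemma conj_cmx N (A : 'M[R]_N) : map_mx Num.conj (cmx A) = cmx A.
Proof. by apply/matrixP => i j; rewrite !mxE; exact: conjc_real. Qed.

Section Semisimple.
Variables (N : nat) (M Q : 'M[C]_N) (lam : 'rV[C]_N).
Hypotheses (Qu : Q \in unitmx) (QM : Q *m M = diag_mx lam *m Q).

Lemma semisimple_expr (l : C) m :
  Q *m ((M - l%:M) ^+ m) = diag_mx (\row_k (lam 0 k - l) ^+ m) *m Q.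
Proof.
elim: m => [|m IH].
  rewrite expr0 mulmx1; have -> : diag_mx (\row_k (lam 0 k - l) ^+ 0) = 1%:M.
    by apply/matrixP => i j; rewrite !mxE expr0.
  by rewrite mul1mx.
rewrite exprSr -[(M - l%:M) ^+ m * _]/((M - l%:M) ^+ m *m (M - l%:M)) mulmxA IH.
have -> : diag_mx (\row_k (lam 0 k - l) ^+ m.+1) =
    diag_mx (\row_k (lam 0 k - l) ^+ m) *m (diag_mx lam - l%:M).
  apply/matrixP => i j; rewrite mul_diag_mx !mxE.
  by case: eqP => [->|_]; rewrite ?mulr1n ?mulr0n ?subr0 ?mulr0// exprSr.
by rewrite -!mulmxA mulmxBr mulmxBl QM mul_mx_scalar mul_scalar_mx.
Qed.

Lemma semisimple_eigenvalue l : eigenvalue M l = (l \in [seq lam 0 k | k : 'I_N]).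
Proof.
apply/eigenvalueP/mapP => [[v vM v0]|[k _ ->]]; last first.
  exists (row k Q); first by rewrite -row_mul QM row_mul_diag.
  apply: contraTneq Qu => h; rewrite -row_free_unit; apply/negP => /row_freeP[B QB].
  have /rowP/(_ k) : row k (Q *m B) = 0 by rewrite row_mul h mul0mx.
  by rewrite QB !mxE eqxx => /eqP; rewrite oner_eq0.
pose u := v *m invmx Q.
have uD : u *m diag_mx lam = l *: u.
  have -> : diag_mx lam = Q *m M *m invmx Q by rewrite QM mulmxK.
  by rewrite /u !mulmxA mulmxKV// vM scalemxAl.
have /rV0Pn[k uk] : u != 0.
  by apply: contraNneq v0 => h; rewrite -(mulmxKV Qu v) -/u h mul0mx.
exists k; first by rewrite mem_enum.
have /rowP/(_ k) := uD; rewrite mul_mx_diag !mxE mulrC => /(mulIf _) -> //.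
by move: uk; rewrite /u mxE.
Qed.

(** In the eigenbasis (M - l)^N is diagonal with entries (lam_k - l)^N, so a vector of its kernel
    has no coordinate along another eigenvalue. *)
Lemma semisimple_geneig l (v : 'rV[C]_N) : (v <= geneig M l)%MS ->
  forall k, (v *m invmx Q) 0 k != 0 -> lam 0 k = l.
Proof.
move=> /sub_kermxP vM k; set u := v *m invmx Q => uk.
have uD : u *m diag_mx (\row_k (lam 0 k - l) ^+ N) = 0.
  have -> : diag_mx (\row_k (lam 0 k - l) ^+ N) = Q *m ((M - l%:M) ^+ N) *m invmx Q.
    by rewrite semisimple_expr mulmxK.
  by rewrite /u !mulmxA mulmxKV// vM mul0mx.
have /rowP/(_ k) := uD; rewrite mul_mx_diag !mxE => /eqP; rewrite mulf_eq0.
rewrite -[X in X == 0](_ : u 0 k = _) ?(negbTE uk) ?mxE//=.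
by rewrite expf_eq0 subr_eq0 => /andP[_ /eqP].
Qed.

(** A diagonalisable matrix has no nilpotent part, so the rows of Q for l already span the
    generalised eigenspace; dimensions are then obtained by counting indices. *)
Lemma semisimple_rows l :
  let P := [pred k | lam 0 k == l] in
  let S := rowsub (fun i : 'I_#|P| => enum_val i) Q in
  [/\ row_free S, (S <= geneig M l)%MS & (geneig M l <= S)%MS].
Proof.
move=> P S; pose f := fun i : 'I_#|P| => (enum_val i : 'I_N).
have SE : S = rowsub f 1%:M *m Q by rewrite /S -[in LHS](mul1mx Q) mul_rowsub_mx.
split.
- rewrite SE; apply/row_freeP; exists (invmx Q *m (rowsub f 1%:M)^T).
  rewrite !mulmxA mulmxK//; apply/matrixP => i j; rewrite !mxE (bigD1 (f i))//= big1.
    by rewrite !mxE eqxx mul1r addr0 eq_sym (inj_eq enum_val_inj).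
  by move=> k ki; rewrite !mxE eq_sym (negbTE ki) mul0r.
- apply/sub_kermxP; apply/row_matrixP => i; rewrite row_mul row_rowsub row0.
  rewrite -row_mul semisimple_expr row_mul_diag mxE.
  have /eqP -> : lam 0 (enum_val i) == l by have := enum_valP i.
  have Np : (0 < N)%N by exact: leq_ltn_trans (leq0n _) (ltn_ord (enum_val i)).
  by rewrite subrr expr0n gtn_eqF// scale0r.
- apply/row_subP => i; set v := row i _.
  have vg : (v <= geneig M l)%MS by exact: row_sub.
  have h := semisimple_geneig vg.
  apply/submxP; exists (\row_j (v *m invmx Q) 0 (f j)).
  rewrite -[LHS](mulmxKV Qu) SE mulmxA; congr (_ *m _).
  apply/rowP => k; rewrite [RHS]mxE.
  have [kP|kP] := boolP (k \in P).
    rewrite (bigD1 (enum_rank_in kP k))//= big1 ?addr0.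
      rewrite [X in _ = X * _]mxE [X in _ = _ * X]mxE [X in _ = _ * X]mxE.
      by rewrite /f enum_rankK_in// eqxx mulr1.
    move=> j jk; rewrite !mxE [X in _ * X](_ : _ = 0) ?mulr0//.
    case: eqP => // fk; case/eqP: jk; apply: enum_val_inj.
    by rewrite enum_rankK_in.
  rewrite big1 => [|j _].
    by apply: contraNeq kP => /h /eqP.
  rewrite !mxE [X in _ * X](_ : _ = 0) ?mulr0//.
  by case: eqP => // fk; move: kP; rewrite -fk enum_valP.
Qed.

End Semisimple.

Section UpsilonCayley.
Variables (n : nat) (W : 'M[R]_(n + n)).
Local Notation J := (Jmx n : 'M[R]_(n + n)).
Hypotheses (sW : W *m J *m W^T = J) (uW : W + 1%:M \in unitmx) (Bp : posdef (cay W)).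
Variables (Q : 'M[C]_(n + n)) (x : 'rV[R]_(n + n)).
Hypothesis sd : sdiag (cay W) Q x.
Local Notation B := (cay W).
Local Notation lam := (\row_k cayv (x 0 k)).

Lemma cay_W' : (1%:M - B *m J) *m W = 1%:M + B *m J.
Proof. by rewrite cay_sub1// cay_add1// symp_comm// scalemxAl. Qed.

Lemma cmxJ_K : cmx J = 'i%C *: Kmx R n.
Proof.
rewrite /Kmx scalerA; have -> : 'i%C * - 'i%C = 1 :> C.
  by apply/eqP; rewrite eq_complex /=; apply/andP; split; apply/eqP; ring.
by rewrite scale1r.
Qed.

(** Q diagonalises B J = i B K with entries i x_k; the relation (1 - B J) W = 1 + B J determines W
    in the same basis. *)
Lemma sdiag_W : Q *m cmx W = diag_mx lam *m Q.
Proof.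
have [Qu QB QK] := sd.
pose d := map_mx (real_complex R) x.
have QX : Q *m cmx (B *m J) = diag_mx ('i%C *: d) *m Q.
  have e : cmx (B *m J) = 'i%C *: (cmx B *m Kmx R n) by rewrite cmxM cmxJ_K -scalemxAr.
  rewrite e -scalemxAr mulmxA QK -/d scalemxAl; congr (_ *m _).
  by apply/matrixP => i j; rewrite !mxE mulrnAr.
have h := congr1 (fun X => Q *m cmx X) cay_W'.
rewrite /= cmxM cmxB cmxD cmx1 in h.
have h1 : Q *m (1%:M - cmx (B *m J)) = diag_mx (\row_k (1 -i* x 0 k)) *m Q.
  rewrite mulmxBr mulmx1 QX -{1}[Q]mul1mx -mulmxBl; congr (_ *m _).
  apply/matrixP => i j; rewrite !mxE; case: eqP => _; rewrite ?mulr1n ?mulr0n ?subr0//.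
  by apply/eqP; rewrite eq_complex /=; apply/andP; split; apply/eqP; ring.
have h2 : Q *m (1%:M + cmx (B *m J)) = diag_mx (\row_k (1 +i* x 0 k)) *m Q.
  rewrite mulmxDr mulmx1 QX -{1}[Q]mul1mx -mulmxDl; congr (_ *m _).
  apply/matrixP => i j; rewrite !mxE; case: eqP => _; rewrite ?mulr1n ?mulr0n ?addr0//.
  by apply/eqP; rewrite eq_complex /=; apply/andP; split; apply/eqP; ring.
rewrite mulmxA h1 h2 -mulmxA in h.
have u1 : diag_mx (\row_k (1 -i* x 0 k)) \in unitmx.
  rewrite unitmxE det_diag unitfE; apply/prodf_neq0 => k _.
  by rewrite mxE eq_complex /= oner_eq0.
apply: (can_inj (mulKmx u1)); rewrite h mulmxA; congr (_ *m _).
rewrite mulmx_diag; congr diag_mx; apply/rowP => k; rewrite !mxE.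
by rewrite mulrC cayvE.
Qed.

Lemma krein_quad (v : 'rV[C]_(n + n)) : krein v v = (v *m Kmx R n *m v^t*) 0 0.
Proof.
rewrite /krein /Kmx -scalemxAr -scalemxAl mxE [X in _ * X]mxE mulr_sumr.
by apply: eq_bigr => k _; rewrite -mulrA; congr (_ * (_ * _)); rewrite !mxE.
Qed.

(** On this eigenspace v B K = x_k0 v, and K^2 = 1 turns it into v B = x_k0 v K. As B is positive
    definite, the Krein form is definite there, with the sign of x_k0. *)
Lemma geneig_krein k0 (v : 'rV[C]_(n + n)) : (v <= geneig (cmx W) (cayv (x 0 k0)))%MS ->
  (x 0 k0)%:C * krein v v = (v *m cmx B *m v^t*) 0 0.
Proof.
have [Qu QB QK] := sd => vg.
have h := semisimple_geneig Qu sdiag_W vg.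
move: h; move uE : (v *m invmx Q) => u h.
have vE : v = u *m Q by rewrite -uE mulmxKV.
have vT : v *m cmx B *m Kmx R n = (x 0 k0)%:C *: v.
  rewrite {1}vE -!mulmxA (mulmxA Q) QK mulmxA [in RHS]vE scalemxAl.
  congr (_ *m _); apply/rowP => k; rewrite mul_mx_diag !mxE.
  have [->|uk] := eqVneq (u 0 k) 0; first by rewrite mul0r mulr0.
  by have := h k uk; rewrite mxE => /cayv_inj ->; rewrite mulrC.
have : v *m cmx B = (x 0 k0)%:C *: (v *m Kmx R n).
  by rewrite scalemxAl -vT -mulmxA Kmx_sqr mulmx1.
by rewrite krein_quad => ->; rewrite -scalemxAl [RHS]mxE.
Qed.

(** By [geneig_krein] the form is definite on the whole eigenspace, so its positive index is the
    full multiplicity or 0. *)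
Lemma krein_p_cay k0 : krein_p (cmx W) (cayv (x 0 k0)) =
  if 0 < x 0 k0 then #|[pred k | (lam 0 k) == cayv (x 0 k0)]| else 0%N.
Proof.
have [Qu QB QK] := sd; have Bs := cay_tr sW uW.
have kp := geneig_krein (k0 := k0).
have Bq (v : 'rV[C]_(n + n)) : v != 0 -> 0 < (v *m cmx B *m v^t*) 0 0.
  exact: posdef_cmx.
have [Sf Sg gS] := semisimple_rows Qu sdiag_W (cayv (x 0 k0)).
set P := [pred k | _] in Sf Sg gS *; set S := rowsub _ _ in Sf Sg gS *.
rewrite /krein_p; case: ifPn => xk; apply/eqP; rewrite eqn_leq.
- apply/andP; split.
    apply/bigmax_leqP => r /asboolP[S' [S'g S'f _]].
    have /eqP <- : \rank S' == r by [].
    by have /mxrankS := submx_trans S'g gS; rewrite (eqP Sf).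
  have Pn : (#|P| < (n + n).+1)%N.
    by rewrite ltnS; apply: leq_trans (max_card _) _; rewrite card_ord.
  apply: (@bigop.bigmax_sup _ (Ordinal Pn)) => //.
  apply/asboolP; exists S; split=> // c c0.
  have cS : c *m S != 0 by rewrite mulmx_free_eq0.
  have : 0 < (x 0 k0)%:C * krein (c *m S) (c *m S).
    by rewrite kp; [exact: Bq|exact: submx_trans (submxMl _ _) Sg].
  move: (krein _ _) => [a b]; rewrite ltcE /= !mul0r addr0 subr0 => /andP[/eqP h1 h2].
  move: h1 => /eqP; rewrite mulf_eq0 gt_eqF//= => /eqP ->; split=> //.
  by move: h2; rewrite pmulr_rgt0.
- rewrite andbT; apply/bigmax_leqP => r /asboolP[S' [S'g S'f S'p]].
  case: (posnP r) => [->//|r0].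
  pose c : 'rV[C]_r := delta_mx 0 (Ordinal r0).
  have c0 : c != 0.
    apply/eqP => /matrixP/(_ 0 (Ordinal r0)); rewrite !mxE !eqxx => /eqP.
    by rewrite oner_eq0.
  have cS : c *m S' != 0 by rewrite mulmx_free_eq0.
  have [k1 k2] := S'p c c0.
  have : 0 < (x 0 k0)%:C * krein (c *m S') (c *m S').
    by rewrite kp; [exact: Bq|exact: submx_trans (submxMl _ _) S'g].
  rewrite ltcE => /andP[_]; rewrite cReMr /= pmulr_lgt0//.
  by move=> h; rewrite h in xk.
Qed.

Lemma prod_indicator_count (s : seq C) (P : pred 'I_(n + n)) (f : 'I_(n + n) -> C) :
  uniq s -> (forall k, f k \in s) ->
  \prod_(l <- s) l ^+ #|[pred k | P k && (f k == l)]| = \prod_(k | P k) f k.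
Proof.
move=> us fs.
have -> : \prod_(l <- s) l ^+ #|[pred k | P k && (f k == l)]| =
   \prod_(l <- s) \prod_(k | P k) (if f k == l then f k else 1).
  apply: eq_bigr => l _; rewrite -big_mkcondr /=.
  under eq_bigr => k /andP[_ /eqP ->] do over.
  by rewrite prodr_const.
rewrite exchange_big /=; apply: eq_bigr => k _.
rewrite (bigD1_seq (f k))//= eqxx big1 ?mulr1// => l.
by rewrite eq_sym => /negbTE ->.
Qed.

Lemma anticommute N (P Pb T D : 'M[C]_N) : Pb \in unitmx ->
  P *m T = D *m P -> Pb *m T = - (D *m Pb) ->
  (P *m invmx Pb) *m D = - (D *m (P *m invmx Pb)).
Proof.
move=> Pu PT PbT; have e : invmx Pb *m D = - (T *m invmx Pb).
  apply: (can_inj (mulKmx Pu)).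
  by rewrite mulKVmx// mulmxN mulmxA PbT mulNmx opprK mulmxK.
by rewrite -mulmxA e mulmxN !mulmxA PT.
Qed.

(** The conjugate of Q diagonalises B K with eigenvalues -x, so the spectrum is symmetric about 0.
    Instead of pairing indices, the matrix U = Q (conj Q)^-1 anticommutes with diag(x), hence U_ij
    is nonzero only when x_j = -x_i; averaging atan x_i + atan x_j with the weights U_ij (U^-1)_ji
    gives twice the sum. *)
Lemma sum_atan0 : \sum_k atan (x 0 k) = 0.
Proof.
have [Qu QB QK] := sd.
pose Qb := map_mx Num.conj Q.
have Qbu : Qb \in unitmx by rewrite map_unitmx.
pose D := diag_mx (map_mx (real_complex R) x).
have Kb : map_mx Num.conj (Kmx R n) = - Kmx R n.
  rewrite /Kmx map_mxZ -scaleNr; congr (_ *: _).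
    by apply/eqP; rewrite eq_complex /=; apply/andP; split; apply/eqP; ring.
  exact: conj_cmx.
have QbK : Qb *m cmx B *m Kmx R n = - (D *m Qb).
  have := congr1 (map_mx Num.conj) QK; rewrite !map_mxM Kb mulmxN.
  rewrite conj_cmx.
  have -> : map_mx Num.conj (diag_mx (map_mx (real_complex R) x)) = D.
    apply/matrixP => i j; rewrite !mxE; case: eqP => _; rewrite ?mulr1n ?mulr0n ?conjC0//.
    exact: conjc_real.
  by move=> <-; rewrite opprK.
pose U := Q *m invmx Qb; pose V := Qb *m invmx Q.
have UV : U *m V = 1%:M by rewrite /U /V mulmxA mulmxKV// mulmxV.
have VU : V *m U = 1%:M by apply: mulmx1C.
have UD : U *m D = - (D *m U).
  by apply: (@anticommute _ _ Qb (cmx B *m Kmx R n)); rewrite // mulmxA.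
clearbody U V.
have Uij i j : U i j != 0 -> atan (x 0 i) + atan (x 0 j) = 0.
  move=> u0; have /matrixP/(_ i j) := UD.
  rewrite mul_diagE [in RHS]mxE diag_mulVE !rcE -mulNr mulrC => /(mulIf u0) h.
  have : (x 0 j)%:C = (- x 0 i)%:C by rewrite h rmorphN.
  by move=> /complexI ->; rewrite atanN subrr.
have : (\sum_k atan (x 0 k))%:C + (\sum_k atan (x 0 k))%:C = 0.
  have UVi i : \sum_j U i j * V j i = 1 by have /matrixP/(_ i i) := UV; rewrite !mxE eqxx.
  have VUj j : \sum_i U i j * V j i = 1.
    have /matrixP/(_ j j) := VU; rewrite !mxE eqxx; apply: etrans.
    by apply: eq_bigr => i _; rewrite mulrC.
  have {1}-> : (\sum_k atan (x 0 k))%:C = \sum_i \sum_j U i j * V j i * (atan (x 0 i))%:C.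
    by rewrite rmorph_sum; apply: eq_bigr => i _; rewrite -mulr_suml UVi mul1r.
  have -> : (\sum_k atan (x 0 k))%:C = \sum_i \sum_j U i j * V j i * (atan (x 0 j))%:C.
    rewrite exchange_big /= rmorph_sum; apply: eq_bigr => j _.
    by rewrite -mulr_suml VUj mul1r.
  rewrite -big_split big1// => i _; rewrite -big_split big1//= => j _.
  have [->|u0] := eqVneq (U i j) 0; first by rewrite !mul0r addr0.
  by rewrite -mulrDr -rmorphD Uij// rmorph0 mulr0.
rewrite -rmorphD => /complexI h; lra.
Qed.

(** The eigenvalues are e^(2i atan x_k), on the circle and not real since x_k is nonzero, so the
    sign (-1)^m is 1. Only those with x_k > 0 have p > 0; their total angle is twice the sum of atan
    x_k over x_k > 0, which is the sum of all |atan x_k| by [sum_atan0]. *)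
Lemma upsilon_sdiag : upsilon W = cis (\sum_k `|atan (x 0 k)|).
Proof.
have [Qu QB QK] := sd; have x0 := sdiag_neq0 sd.
have eig l : eigenvalue (cmx W) l = (l \in [seq cayv (x 0 k) | k : 'I_(n + n)]).
  rewrite (semisimple_eigenvalue Qu sdiag_W); congr (_ \in _).
  by apply: eq_map => k; rewrite mxE.
have [us es] : uniq (eigenlist (cmx W)) /\
    forall l, (l \in eigenlist (cmx W)) = eigenvalue (cmx W) l.
  rewrite /eigenlist; case: xgetP => [s -> //|/(_ (undup [seq cayv (x 0 k) | k : 'I_(n + n)]))].
  by case; split; [exact: undup_uniq|move=> l; rewrite mem_undup eig].
rewrite /upsilon; set s := eigenlist _ in us es *.
have sP l : l \in s -> exists k, l = cayv (x 0 k).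
  by rewrite es eig => /mapP[k _ ->]; exists k.
have im0 k : Im (cayv (x 0 k)) != 0.
  by rewrite /= mulf_neq0// ?mulf_neq0 ?pnatr_eq0// invr_eq0 gt_eqF// cayv_gt0.
rewrite [X in X./2]big1_seq; last first.
  move=> l /andP[nl /sP[k lk]]; move: nl; rewrite lk /neg_real => /andP[h _].
  by move: (im0 k); rewrite h.
rewrite expr0 mul1r big_seq_cond.
rewrite (eq_bigl (fun l => l \in s)); last first.
  move=> l; case: (boolP (l \in s)) => //= /sP[k ->].
  have -> /= : on_circle (cayv (x 0 k)).
    rewrite /on_circle /=; apply/eqP; field; rewrite gt_eqF// cayv_gt0//.
  apply/andP; split; apply: contra (im0 k) => /eqP ->; first by [].
  by rewrite /= oppr0.
rewrite -big_seq.
have -> : \prod_(l <- s) l ^+ krein_p (cmx W) l =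
   \prod_(l <- s) l ^+ #|[pred k | (0 < x 0 k) && (cayv (x 0 k) == l)]|.
  rewrite big_seq [RHS]big_seq; apply: eq_bigr => l /sP[k ->].
  rewrite krein_p_cay; congr (_ ^+ _); case: ifPn => xk.
    apply: eq_card => j; rewrite !inE mxE.
    by case: eqP => [/cayv_inj ->|]; rewrite ?xk ?andbF.
  symmetry; apply: eq_card0 => j; rewrite !inE.
  by apply/negP => /andP[xj /eqP/cayv_inj e]; move: xk; rewrite -e xj.
rewrite prod_indicator_count//; last first.
  by move=> k; rewrite es eig; apply/mapP; exists k; rewrite ?mem_enum.
under eq_bigr do rewrite cayv_cis.
rewrite -cis_sum; congr cis.
have atp k : 0 < x 0 k -> 0 <= atan (x 0 k) by move=> h; rewrite -atan0; apply/ltW/lt_atan.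
have atn k : ~~ (0 < x 0 k) -> atan (x 0 k) < 0.
  move=> h; rewrite -atan0; apply: lt_atan; rewrite lt_neqAle x0 leNgt//.
have h := sum_atan0; rewrite (bigID (fun k => 0 < x 0 k))/= in h.
rewrite [RHS](bigID (fun k => 0 < x 0 k))/=; move: h.
set S1 := \sum_(k | 0 < x 0 k) atan _; set S2 := \sum_(k | ~~ _) atan _ => h.
have -> : \sum_(k | 0 < x 0 k) `|atan (x 0 k)| = S1.
  by apply: eq_bigr => k xk; rewrite ger0_norm// atp.
have -> : \sum_(k | ~~ (0 < x 0 k)) `|atan (x 0 k)| = - S2.
  by rewrite /S2 -sumrN; apply: eq_bigr => k xk; rewrite ltr0_norm// atn.
rewrite -mulr_sumr -/S1; lra.
Qed.

End UpsilonCayley.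

Lemma expi_cis (a : R) : expi (a / (2 * pi)) = cis a.
Proof.
have p : 2 * pi != 0 :> R by rewrite mulf_neq0 ?pnatr_eq0// gt_eqF// pi_gt0.
by rewrite /expi /cis mulrC divfK.
Qed.

Lemma upsilon_cay n (W : 'M[R]_(n + n)) : W *m Jmx n *m W^T = Jmx n ->
  W + 1%:M \in unitmx -> posdef (cay W) ->
  upsilon W = expi (Theta (cay W) / (2 * pi)).
Proof.
move=> sW uW Bp; have [Q [x sd]] := sdiag_exists (cay_tr sW uW) Bp.
by rewrite expi_cis (Theta_sdiag sd); exact: (upsilon_sdiag sW uW Bp sd).
Qed.

(** The only eigenvalue is 1, which is excluded both from the multiplicity sum and from the
    product. *)
Lemma upsilon1 n : upsilon (1%:M : 'M[R]_(n + n)) = expi 0.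
Proof.
rewrite -(mul0r (2 * pi)^-1) expi_cis cis0 /upsilon cmx1.
have e1 : 1%:M *m (1%:M : 'M[C]_(n + n)) = diag_mx (const_mx 1) *m 1%:M.
  by rewrite diag_const_mx.
have eig l : eigenvalue (1%:M : 'M[C]_(n + n)) l -> l = 1.
  rewrite (semisimple_eigenvalue (unitmx1 _ _) e1) => /mapP[k _ ->].
  by rewrite mxE.
have es l : l \in eigenlist (1%:M : 'M[C]_(n + n)) -> l = 1.
  rewrite /eigenlist; case: xgetP => [s -> [_ es]|_]; last by rewrite in_nil.
  by rewrite es => /eig.
rewrite [X in X./2]big1_seq => [|l /andP[]]; last first.
  by move=> h /es e; move: h; rewrite e /neg_real /= ltNge ler01 andbF.
rewrite big1_seq ?mulr1// => l /andP[h /es e].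
by move: h; rewrite e eqxx andbF.
Qed.

End Upsilon.

(** * Directional calculus and flows *)

Section DirectionalCalculus.
Variable R : realType.
Implicit Types V W : normedModType R.

Lemma is_derive_line V W (f : V -> W) (x v : V) (s : R) :
  derivable f (x + s *: v) v ->
  is_derive s 1 (fun r => f (x + r *: v)) ('D_v f (x + s *: v)).
Proof.
move=> df.
have E : (fun h : R => h^-1 *: (((fun r => f (x + r *: v)) \o shift s) (h *: 1)
    - f (x + s *: v))) =
    (fun h : R => h^-1 *: ((f \o shift (x + s *: v)) (h *: v) - f (x + s *: v))).
  apply/funext => h; congr (_ *: (f _ - _)) => /=.
  by rewrite /shift /= scalerDl [h *: 1]mulr1 addrCA.
by split; [rewrite /derivable E|rewrite /derive E].
Qed.

Lemma MVT_dir V (f : V -> R) (x v : V) (h : R) :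
  (forall s, `|s| <= `|h| -> derivable f (x + s *: v) v) ->
  exists2 c, `|c| <= `|h| & f (x + h *: v) - f x = h * 'D_v f (x + c *: v).
Proof.
move=> df; pose g := fun r => f (x + r *: v).
have dg (s : R) : `|s| <= `|h| -> is_derive s 1 g ('D_v f (x + s *: v)).
  by move=> sh; apply: is_derive_line; exact: df.
have g0 : g 0 = f x by rewrite /g scale0r addr0.
have [h0|h0] := leP 0 h.
- have inn (s : R) : s \in `[0, h] -> `|s| <= `|h|.
    by rewrite in_itv /= => /andP[s0 sh]; rewrite !ger0_norm.
  have d1 (s : R) : s \in `]0, h[ -> is_derive s 1 g ('D_v f (x + s *: v)).
    by rewrite in_itv/= => /andP[/ltW s0 /ltW s1]; apply/dg/inn; rewrite in_itv/= s0 s1.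
  have c1 : {within `[0, h], continuous g}.
    by apply: derivable_within_continuous => s sh; have [] := dg s (inn s sh).
  have [c ch] := MVT_segment h0 d1 c1.
  rewrite g0 subr0 => e; exists c; first exact: inn.
  by rewrite mulrC -e.
- have inn (s : R) : s \in `[h, 0] -> `|s| <= `|h|.
    by rewrite in_itv /= => /andP[s0 sh]; rewrite !ler0_norm ?lerN2// ltW.
  have d1 (s : R) : s \in `]h, 0[ -> is_derive s 1 g ('D_v f (x + s *: v)).
    by rewrite in_itv/= => /andP[/ltW s0 /ltW s1]; apply/dg/inn; rewrite in_itv/= s0 s1.
  have c1 : {within `[h, 0], continuous g}.
    by apply: derivable_within_continuous => s sh; have [] := dg s (inn s sh).
  have [c ch] := MVT_segment (ltW h0) d1 c1.
  rewrite g0 sub0r => e; exists c; first exact: inn.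
  have -> : f (x + h *: v) - f x = - (f x - g h) by rewrite opprB.
  by rewrite e mulrN opprK mulrC.
Qed.

Lemma cvgr_sum (T I : Type) (F : set_system T) (FF : Filter F) (r : seq I)
  (P : pred I) (f : I -> T -> R) (a : I -> R) :
  (forall i, P i -> f i x @[x --> F] --> a i) ->
  \sum_(i <- r | P i) f i x @[x --> F] --> \sum_(i <- r | P i) a i.
Proof.
move=> fa; elim: r => [|i r IH].
  by rewrite big_nil; under eq_fun do rewrite big_nil; exact: cvg_cst.
rewrite big_cons; under eq_fun do rewrite big_cons.
by case: ifPn => // Pi; apply: cvgD => //; exact: fa.
Qed.

Lemma cvgr_prod (T I : Type) (F : set_system T) (FF : Filter F) (r : seq I)
  (P : pred I) (f : I -> T -> R) (a : I -> R) :
  (forall i, P i -> f i x @[x --> F] --> a i) ->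
  \prod_(i <- r | P i) f i x @[x --> F] --> \prod_(i <- r | P i) a i.
Proof.
move=> fa; elim: r => [|i r IH].
  by rewrite big_nil; under eq_fun do rewrite big_nil; exact: cvg_cst.
rewrite big_cons; under eq_fun do rewrite big_cons.
by case: ifPn => // Pi; apply: cvgM => //; exact: fa.
Qed.

Lemma rV_norm_le N (v : 'rV[R]_N) (e : R) : 0 <= e ->
  (forall i, `|v 0 i| <= e) -> `|v| <= e.
Proof.
move=> e0 ve; rewrite /Num.Def.normr /= mx_normrE (bigmax_le _ e0)//= => -[i j] _ /=.
by rewrite ord1 ve.
Qed.

Lemma rV_coord_le N (v : 'rV[R]_N) i : `|v 0 i| <= `|v|.
Proof.
rewrite [leRHS]/Num.Def.normr /= mx_normrE.
exact: (le_bigmax _ (fun i : 'I_1 * 'I_N => `|v i.1 i.2|) (0, i)).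
Qed.

(** The increment is telescoped along coordinate moves; on each edge the mean value theorem replaces
    the difference by a partial derivative at a nearby point. *)
Lemma C1_expansion N (f : 'rV[R]_N -> R) (x : 'rV[R]_N) :
  (\forall y \near x, forall i, derivable f y (evec i)) ->
  (forall i, {for x, continuous (fun y => 'D_(evec i) f y)}) ->
  forall e, 0 < e -> exists2 d, 0 < d & forall v, `|v| < d ->
    `|f (x + v) - f x - \sum_i v 0 i * 'D_(evec i) f x| <= e * `|v|.
Proof.
move=> /nbhs_ballP[d1 /= d10 h1] h2 e e0.
have N1 : 0 < N%:R + 1 :> R by rewrite ltr_wpDl.
have e1 : 0 < e / (N%:R + 1) by rewrite divr_gt0.
have : \forall y \near x, forall i, `|'D_(evec i) f x - 'D_(evec i) f y| < e / (N%:R + 1).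
  suff h i : \forall y \near x, `|'D_(evec i) f x - 'D_(evec i) f y| < e / (N%:R + 1).
    exact: (@filter_forall _ 'I_N _ (nbhs x) _ h).
  by have /cvgrPdist_lt/(_ _ e1) := h2 i.
move=> /nbhs_ballP[d2 /= d20 h3].
exists (Num.min d1 d2); first by rewrite lt_min d10.
move=> v; rewrite lt_min => /andP[v1 v2].
(* [p k] keeps the first k coordinates of v, so that v is reached from 0 one coordinate at a
   time. *)
pose p (k : nat) : 'rV[R]_N := \row_i (if (i < k)%N then v 0 i else 0).
have pE (k : 'I_N) : p k.+1 = p k + v 0 k *: evec k.
  apply/rowP => i; rewrite !mxE ltnS leq_eqVlt /=.
  have [->|ik] := eqVneq i k; first by rewrite eqxx ltnn mulr1 add0r.
  by rewrite -val_eqE /= in ik; rewrite (negbTE ik) mulr0 addr0.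
have pn : p N = v by apply/rowP => i; rewrite mxE ltn_ord.
have p0 : p 0%N = 0 by apply/rowP => i; rewrite !mxE ltn0.
have tele : f (x + v) - f x = \sum_(k < N) (f (x + p k.+1) - f (x + p k)).
  rewrite -(big_mkord xpredT (fun k => f (x + p k.+1) - f (x + p k))).
  by rewrite telescope_sumr// pn p0 addr0.
have bnd (k : 'I_N) (s : R) : `|s| <= `|v 0 k| -> `|p k + s *: evec k| <= `|v|.
  move=> sv; apply: rV_norm_le => // i; rewrite !mxE /=.
  have [->|ik] := eqVneq i k.
    by rewrite ltnn add0r mulr1; apply: le_trans sv _; exact: rV_coord_le.
  rewrite mulr0 addr0; case: ifP => _; [exact: rV_coord_le|by rewrite normr0].
rewrite tele -sumrB.
apply: le_trans (ler_norm_sum _ _ _) _.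
apply: (@le_trans _ _ (\sum_(k < N) (e / (N%:R + 1)) * `|v|)); last first.
  rewrite -mulr_suml ler_wpM2r// sumr_const card_ord -[leLHS]mulr_natl mulrCA ger_pMr//.
  by rewrite ler_pdivrMr// mul1r lerDl.
apply: ler_sum => k _; rewrite pE addrA.
have [s sv|c cv ->] := @MVT_dir _ f (x + p k) (evec k) (v 0 k).
  apply: h1; rewrite -ball_normE /ball_ /= -addrA opprD addrA subrr sub0r normrN.
  exact: le_lt_trans (bnd _ _ sv) v1.
rewrite -mulrBr normrM mulrC ler_pM// ?rV_coord_le// distrC.
apply/ltW/h3; rewrite -ball_normE /ball_ /= -addrA opprD addrA subrr sub0r normrN.
exact: le_lt_trans (bnd _ _ cv) v2.
Qed.

Definition lform N (d v : 'rV[R]_N) : R := \sum_i v 0 i * d 0 i.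

Lemma lform_linear N (d : 'rV[R]_N) : linear (lform d : 'rV[R]_N -> R).
Proof.
move=> a u v; rewrite /lform [X in _ = X + _]scaler_sumr -big_split.
by apply: eq_bigr => i _; rewrite !mxE mulrDl -mulrA.
Qed.

HB.instance Definition _ N (d : 'rV[R]_N) :=
  GRing.isLinear.Build R 'rV[R]_N R _ (lform d) (@lform_linear N d).

Lemma lform_continuous N (d : 'rV[R]_N) : continuous (lform d : 'rV[R]_N -> R).
Proof.
move=> x; apply: (@cvgr_sum _ _ (nbhs x) _) => i _.
by apply: cvgM; [exact: coord_continuous|exact: cvg_cst].
Qed.

Lemma C1_differentiable N (f : 'rV[R]_N -> R) (x : 'rV[R]_N) :
  (\forall y \near x, forall i, derivable f y (evec i)) ->
  (forall i, {for x, continuous (fun y => 'D_(evec i) f y)}) ->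
  differentiable (f : 'rV[R]_N -> R) x /\
  forall v, 'D_v f x = \sum_i v 0 i * 'D_(evec i) f x.
Proof.
move=> h1 h2; have hexp := C1_expansion h1 h2.
pose d : 'rV[R]_N := \row_i 'D_(evec i) f x.
have lE v : lform d v = \sum_i v 0 i * 'D_(evec i) f x.
  by apply: eq_bigr => i _; rewrite mxE.
have eps e : 0 < e -> \forall v \near (0 : 'rV[R]_N),
    `|f (v + x) - (f x + lform d v)| <= e * `|v|.
  move=> e0; have [r r0 hr] := hexp e e0.
  apply/nbhs_ballP; exists r => // v; rewrite -ball_normE /ball_ /= sub0r normrN => vr.
  by have := hr v vr; rewrite -lE opprD addrA [x + v]addrC.
have dE : 'd f x = lform d :> ('rV[R]_N -> R).
  by apply: diff_unique; [exact: lform_continuous|apply/eqaddoP => e; exact: eps].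
have dif : differentiable f x.
  apply/diff_locallyP; rewrite dE; split; first exact: lform_continuous.
  by apply/eqaddoP => e; exact: eps.
by split=> // v; rewrite deriveE// dE lE.
Qed.

Lemma chain_curve V W (f : V -> W) (g : R -> V) (t : R) (v : V) :
  differentiable f (g t) -> is_derive t 1 g v ->
  is_derive t 1 (f \o g) ('D_v f (g t)).
Proof.
move=> df dg; have [dg1 dg2] := dg.
have dg' : differentiable g t by apply/derivable1_diffP.
have dfg : differentiable (f \o g) t by apply: differentiable_comp.
split; first exact/derivable1_diffP.
have e : 'd g t 1 = v by rewrite -deriveE.
by rewrite deriveE// diff_comp//= e -deriveE.
Qed.

Lemma chain_dir V V' W (f : V -> W) (g : V' -> V) (z u : V') :
  differentiable f (g z) -> derivable g z u ->
  is_derive z u (f \o g) ('D_('D_u g z) f (g z)).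
Proof.
move=> df dg.
have dg0 : is_derive (0 : R) 1 (fun r => g (z + r *: u)) ('D_u g z).
  have := @is_derive_line V' V g z u 0; rewrite scale0r addr0; exact.
have df0 : differentiable f ((fun r : R => g (z + r *: u)) 0).
  by rewrite scale0r addr0.
have [h1 h2] := chain_curve df0 dg0.
have E : (fun h : R => h^-1 *: (((f \o (fun r : R => g (z + r *: u))) \o shift 0) (h *: 1)
    - (f \o (fun r : R => g (z + r *: u))) 0)) =
    (fun h : R => h^-1 *: (((f \o g) \o shift z) (h *: u) - (f \o g) z)).
  apply/funext => h; rewrite /= /shift /= scale0r addr0 addr0.
  by rewrite [h *: 1]mulr1 [z + _]addrC.
move: h1 h2; rewrite /derivable /derive E scale0r addr0 => h1 h2.
by split.
Qed.

(** Both mixed derivatives are limits of the same second difference quotient, which is symmetric in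
    v and w. *)
Lemma schwarz V (f : V -> R) (x v w : V) :
  (\forall y \near x, [/\ derivable f y v, derivable f y w,
     derivable (fun y => 'D_v f y) y w & derivable (fun y => 'D_w f y) y v]) ->
  {for x, continuous (fun y => 'D_w (fun y => 'D_v f y) y)} ->
  {for x, continuous (fun y => 'D_v (fun y => 'D_w f y) y)} ->
  'D_w (fun y => 'D_v f y) x = 'D_v (fun y => 'D_w f y) x.
Proof.
move=> /nbhs_ballP[d1 /= d10 h1] c1 c2.
suff half (a b : V) : (forall y, ball x d1 y -> derivable f y a) ->
    (forall y, ball x d1 y -> derivable (fun y => 'D_a f y) y b) ->
    {for x, continuous (fun y => 'D_b (fun y => 'D_a f y) y)} ->
    forall e, 0 < e -> exists2 d, 0 < d & forall h, 0 < h -> h < d ->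
      `|(f (x + h *: a + h *: b) - f (x + h *: a) - f (x + h *: b) + f x) / h ^+ 2
        - 'D_b (fun y => 'D_a f y) x| < e.
  apply/eqP; rewrite -subr_eq0 -normr_eq0; apply/negPn/negP => ne0.
  set A := 'D_w _ x in ne0 *; set B := 'D_v _ x in ne0 *.
  have e0 : 0 < `|A - B| / 2 by rewrite divr_gt0// lt_def ne0 normr_ge0.
  have [da da0 ha] := half v w (fun y hy => let: And4 p _ _ _ := h1 y hy in p)
    (fun y hy => let: And4 _ _ p _ := h1 y hy in p) c1 _ e0.
  have [db db0 hb] := half w v (fun y hy => let: And4 _ p _ _ := h1 y hy in p)
    (fun y hy => let: And4 _ _ _ p := h1 y hy in p) c2 _ e0.
  pose h := Num.min da db / 2.
  have m0 : 0 < Num.min da db by rewrite lt_min da0.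
  have hm : h < Num.min da db by rewrite ltr_pdivrMr// ltr_pMr// ltrDl.
  have h0 : 0 < h by rewrite divr_gt0.
  move: hm; rewrite lt_min => /andP[hda hdb].
  have := ha h h0 hda; have := hb h h0 hdb; rewrite -/A -/B.
  have -> : f (x + h *: w + h *: v) - f (x + h *: w) - f (x + h *: v) + f x =
    f (x + h *: v + h *: w) - f (x + h *: v) - f (x + h *: w) + f x.
    by rewrite [x + h *: w + _]addrAC; ring.
  move: (_ / h ^+ 2) => q hq1 hq2; clearbody A B.
  have : `|A - B| < `|A - B| / 2 + `|A - B| / 2.
    apply: le_lt_trans (ltrD hq2 hq1).
    have -> : A - B = (q - B) - (q - A) by ring.
    by apply: le_trans (ler_normB _ _) _; rewrite addrC.
  by rewrite -splitr ltxx.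
move=> da db cb e e0.
have /cvgrPdist_lt/(_ _ e0)/nbhs_ballP[d2 /= d20 h2] := cb.
pose M := `|a| + `|b| + 1.
have M0 : 0 < M by rewrite ltr_wpDl// addr_ge0.
exists (Num.min d1 d2 / M); first by rewrite divr_gt0// lt_min d10.
move=> h h0; rewrite ltr_pdivlMr// lt_min => /andP[hd1 hd2].
have inb (s r : R) d : h * M < d -> `|s| <= h -> `|r| <= h -> ball x d (x + s *: a + r *: b).
  move=> hd sh rh; rewrite -ball_normE /ball_ /= -addrA opprD addrA subrr sub0r normrN.
  apply: le_lt_trans hd; apply: le_trans (ler_normD _ _) _; rewrite !normrZ /M !mulrDr mulr1.
  by rewrite -[leLHS]addr0 lerD ?(ltW h0)// lerD// ler_wpM2r.
have hh : `|h| = h by rewrite gtr0_norm.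
have n0 : `|0 : R| <= h by rewrite normr0 ltW.
(* One mean value theorem along a, applied to y |-> f (y + h b) - f y, and one along b express the
   quotient as a mixed derivative at a point near x. *)
pose F y := f (y + h *: b) - f y.
have dF (s : R) : `|s| <= `|h| ->
    is_derive s 1 (fun r : R => F (x + r *: a))
      ('D_a f (x + s *: a + h *: b) - 'D_a f (x + s *: a)).
  rewrite hh => sh; rewrite /F.
  have e1 : (fun r : R => f (x + r *: a + h *: b)) = (fun r => f (x + h *: b + r *: a)).
    by apply/funext => r; rewrite addrAC.
  have i1 : is_derive s 1 (fun r : R => f (x + r *: a + h *: b)) ('D_a f (x + s *: a + h *: b)).
    rewrite e1 [x + s *: a + _]addrAC; apply: is_derive_line; rewrite addrAC; apply: da.
    by apply: inb => //; rewrite hh.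
  have i2 : is_derive s 1 (fun r : R => f (x + r *: a)) ('D_a f (x + s *: a)).
    apply: is_derive_line; apply: da.
    by have := inb s 0 d1 hd1 sh n0; rewrite scale0r addr0.
  exact: (is_deriveB i1 i2).
have [c /andP[c0 ch] ce] : exists2 c, 0 <= c <= h &
   F (x + h *: a) - F x = h * ('D_a f (x + c *: a + h *: b) - 'D_a f (x + c *: a)).
  have inn (s : R) : s \in `[0, h] -> `|s| <= `|h|.
    by rewrite in_itv /= => /andP[s0 sh]; rewrite !ger0_norm// ltW.
  have d1' (s : R) : s \in `]0, h[ -> is_derive s 1 (fun r : R => F (x + r *: a))
      ('D_a f (x + s *: a + h *: b) - 'D_a f (x + s *: a)).
    by rewrite in_itv/= => /andP[/ltW s0 /ltW s1]; apply/dF/inn; rewrite in_itv/= s0 s1.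
  have c1' : {within `[0, h], continuous (fun r : R => F (x + r *: a))}.
    by apply: derivable_within_continuous => s sh; have [] := dF s (inn s sh).
  have [c ch] := MVT_segment (ltW h0) d1' c1'.
  rewrite scale0r addr0 subr0 mulrC => e'; exists c; first by move: ch; rewrite in_itv.
  exact: e'.
have cn : `|c| <= h by rewrite ger0_norm.
have [s sh|c' c'h ce'] := @MVT_dir V (fun y => 'D_a f y) (x + c *: a) b h.
  by apply: db; apply: inb => //; rewrite -hh.
have -> : (f (x + h *: a + h *: b) - f (x + h *: a) - f (x + h *: b) + f x) / h ^+ 2 =
    'D_b (fun y => 'D_a f y) (x + c *: a + c' *: b).
  have -> : f (x + h *: a + h *: b) - f (x + h *: a) - f (x + h *: b) + f x =
    F (x + h *: a) - F x by rewrite /F opprB addrA addrAC.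
  by rewrite ce ce'; field; rewrite gt_eqF.
rewrite distrC; apply: h2; apply: inb => //; by rewrite -hh.
Qed.

End DirectionalCalculus.

(** * Restriction to affine slices and passage to the closure *)

Section Slices.
Variable R : realType.
Implicit Types V W : normedModType R.

(** Substitutions z |-> a + L z restrict functions of (t, z) or (s, t, z) to slices. [L] is a plain
    function with a linearity identity, so pairings such as z |-> (0, z) can be used directly. *)
Lemma derive_slice V V' W (f : V -> W) (a : V) (L : V' -> V) :
  (forall (h : R) v z, L (h *: v + z) = h *: L v + L z) ->
  forall z v, (derivable (fun z => f (a + L z)) z v <-> derivable f (a + L z) (L v)) /\
    'D_v (fun z => f (a + L z)) z = 'D_(L v) f (a + L z).
Proof.
move=> Ll z v.
have E : (fun h : R => h^-1 *: (((fun z => f (a + L z)) \o shift z) (h *: v) - f (a + L z))) =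
  (fun h : R => h^-1 *: ((f \o shift (a + L z)) (h *: L v) - f (a + L z))).
  by apply/funext => h; congr (_ *: (f _ - _)); rewrite /= Ll addrCA.
by split; [rewrite /derivable E|rewrite /derive E].
Qed.

Lemma iterD_slice V V' W (f : V -> W) (a : V) (L : V' -> V) (vs : seq V') :
  (forall (h : R) v z, L (h *: v + z) = h *: L v + L z) ->
  iterD vs (fun z => f (a + L z)) = (fun z => iterD [seq L v | v <- vs] f (a + L z)).
Proof.
move=> Ll; elim: vs => [//|v vs IH] /=; apply/funext => z.
by rewrite IH; have [_ ->] := derive_slice (iterD (map L vs) f) a Ll z v.
Qed.

Lemma smooth_slice V V' W (f : V -> W) (a : V) (L : V' -> V) (U : set V) :
  (forall (h : R) v z, L (h *: v + z) = h *: L v + L z) -> continuous L ->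
  smooth_on U f -> smooth_on [set z | U (a + L z)] (fun z => f (a + L z)).
Proof.
move=> Ll Lc sf vs z Uz; rewrite (iterD_slice _ _ _ Ll); have [c d] := sf (map L vs) _ Uz.
split=> [|v].
  have cL : {for z, continuous (fun z => a + L z)}.
    by apply: cvgD; [exact: cvg_cst|exact: Lc].
  exact: (continuous_comp cL c).
by have [[_ h] _] := derive_slice (iterD (map L vs) f) a Ll z v; apply: h; exact: d.
Qed.

Lemma open_slice V V' (a : V) (L : V' -> V) (U : set V) : continuous L ->
  open U -> open [set z | U (a + L z)].
Proof.
move=> Lc oU; apply: (@open_comp _ _ (fun z => a + L z)) => // z _.
by apply: cvgD; [exact: cvg_cst|exact: Lc].
Qed.

Lemma cont_near_eq (T S : topologicalType) (f g : T -> S) (x : T) :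
  (\forall y \near x, g y = f y) -> {for x, continuous g} -> {for x, continuous f}.
Proof.
move=> fg cg; have e := nbhs_singleton fg.
rewrite /prop_for /continuous_at -e; apply: cvg_trans cg.
exact: near_eq_cvg.
Qed.

Lemma near_open (T : topologicalType) (U : set T) (P : T -> Prop) x :
  open U -> U x -> (forall y, U y -> P y) -> \forall y \near x, P y.
Proof. by move=> oU Ux UP; apply: filterS UP _; exact: open_nbhs_nbhs. Qed.

Lemma smooth_coord V N (U : set V) (F : V -> 'rV[R]_N) j : open U -> smooth_on U F ->
  smooth_on U (fun x => F x 0 j) /\
  forall vs x, U x -> iterD vs (fun x => F x 0 j) x = iterD vs F x 0 j.
Proof.
move=> oU sF.
have e vs x : U x -> iterD vs (fun x => F x 0 j) x = iterD vs F x 0 j.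
  elim: vs x => [//|v vs IH] x Ux /=.
  rewrite (near_eq_derive v (near_open oU Ux IH)).
  by have [_ d] := sF vs x Ux; rewrite (derive_mx (d v)) mxE.
split=> // vs x Ux; have [c d] := sF vs x Ux; split.
  apply: (@cont_near_eq _ _ _ (fun x => iterD vs F x 0 j)).
    by apply: (near_open oU Ux) => y Uy; rewrite e.
  exact: (continuous_comp c (@coord_continuous R 1 N 0 j _)).
move=> v; have /derivable_mxP/(_ 0 j) := d v; apply: near_eq_derivable.
by apply: (near_open oU Ux) => y Uy; rewrite e.
Qed.

Lemma smooth_schwarz V (U : set V) (f : V -> R) x v w : open U -> smooth_on U f -> U x ->
  'D_w (fun y => 'D_v f y) x = 'D_v (fun y => 'D_w f y) x.
Proof.
move=> oU sf Ux; apply: schwarz.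
- apply: (near_open oU Ux) => y Uy; have [_ d] := sf [::] y Uy.
  have [_ dv] := sf [:: v] y Uy; have [_ dw] := sf [:: w] y Uy.
  by split; [exact: d|exact: d|exact: dv|exact: dw].
- by have [c _] := sf [:: w; v] x Ux.
- by have [c _] := sf [:: v; w] x Ux.
Qed.

Lemma smooth_differentiable N (U : set 'rV[R]_N) (f : 'rV[R]_N -> R) vs x :
  open U -> smooth_on U f -> U x -> differentiable (iterD vs f) x /\
  forall v, 'D_v (iterD vs f) x = \sum_i v 0 i * 'D_(evec i) (iterD vs f) x.
Proof.
move=> oU sf Ux; apply: C1_differentiable.
  apply: (near_open oU Ux) => y Uy i; have [_ d] := sf vs y Uy; exact: d.
by move=> i; have [c _] := sf (evec i :: vs) x Ux.
Qed.

(** Carries identities obtained by differentiation at points of the open set O to its boundary. *)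
Lemma closure_eq (T : topologicalType) (O : set T) (a b : T -> R) z : closure O z ->
  {for z, continuous a} -> {for z, continuous b} -> (forall y, O y -> a y = b y) ->
  a z = b z.
Proof.
move=> cz ca cb ab; apply/eqP; rewrite -subr_eq0 -normr_eq0; apply/negPn/negP => ne.
have e0 : 0 < `|a z - b z| / 2 by rewrite divr_gt0// lt_def ne normr_ge0.
move/cvgrPdist_lt/(_ _ e0) : ca => ca; move/cvgrPdist_lt/(_ _ e0) : cb => cb.
have [y [Oy [ay by']]] := cz _ (filterI ca cb).
have : `|a z - b z| < `|a z - b z| / 2 + `|a z - b z| / 2.
  apply: le_lt_trans (ltrD ay by').
  have -> : a z - b z = (a z - a y) - (b z - b y) by rewrite (ab y Oy); ring.
  exact: ler_normB.
by rewrite -splitr ltxx.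
Qed.

Lemma ball0 (r h : R) : `|h| < r -> ball (0 : R) r h.
Proof. by move=> hr; rewrite -ball_normE /ball_ /= sub0r normrN. Qed.

Lemma cont_pair (T S S' : topologicalType) (f : T -> S) (g : T -> S') x :
  {for x, continuous f} -> {for x, continuous g} ->
  {for x, continuous (fun y => (f y, g y))}.
Proof. by move=> cf cg; exact: (cvg_pair cf cg). Qed.

Lemma cont_pairl (T S : topologicalType) (t : S) (y : T) :
  {for y, continuous (fun y => (t, y))}.
Proof.
have c1 : {for y, continuous (cst t : T -> S)} := @cst_continuous T S t y.
have c2 : {for y, continuous (@id T)} by move=> A.
exact: cont_pair c1 c2.
Qed.

Lemma cont_pairr (T S : topologicalType) (t : S) (y : T) :
  {for y, continuous (fun y => (y, t))}.
Proof.
have c1 : {for y, continuous (cst t : T -> S)} := @cst_continuous T S t y.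
have c2 : {for y, continuous (@id T)} by move=> A.
exact: cont_pair c2 c1.
Qed.

Lemma cont_sum (T : topologicalType) (I : Type) (r : seq I) (P : pred I)
  (f : I -> T -> R) x : (forall i, P i -> {for x, continuous (f i)}) ->
  {for x, continuous (fun y => \sum_(i <- r | P i) f i y)}.
Proof. exact: (@cvgr_sum R T I (nbhs x) _ r P f (fun i => f i x)). Qed.

Lemma cont_prod (T : topologicalType) (I : Type) (r : seq I) (P : pred I)
  (f : I -> T -> R) x : (forall i, P i -> {for x, continuous (f i)}) ->
  {for x, continuous (fun y => \prod_(i <- r | P i) f i y)}.
Proof. exact: (@cvgr_prod R T I (nbhs x) _ r P f (fun i => f i x)). Qed.

Lemma contM (T : topologicalType) (f g : T -> R) x : {for x, continuous f} ->
  {for x, continuous g} -> {for x, continuous (fun y => f y * g y)}.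
Proof. by move=> cf cg; exact: (cvgM cf cg). Qed.

Lemma contD (T : topologicalType) (f g : T -> R) x : {for x, continuous f} ->
  {for x, continuous g} -> {for x, continuous (fun y => f y + g y)}.
Proof. by move=> cf cg; exact: (cvgD cf cg). Qed.

Lemma cont_cst (T : topologicalType) (c : R) (x : T) : {for x, continuous (fun _ : T => c)}.
Proof. exact: (@cst_continuous T R c x). Qed.

(** At every t of [0, 1], ends included, there are small steps h of one sign that stay in [0, 1];
    along them the two limits are limits of the same quotients. *)
Lemma deriv01_unique (c : R -> R) t l l' : I01 t ->
  is_derive t 1 c l ->
  (forall e, 0 < e -> exists2 d, 0 < d & forall h, h != 0 -> 0 <= t + h <= 1 -> `|h| < d ->
     `|h^-1 * (c (t + h) - c t) - l'| < e) -> l = l'.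
Proof.
move=> /andP[t0 t1] [dc <-] hl; apply/eqP; rewrite -subr_eq0 -normr_eq0.
apply/negPn/negP => ne; set l0 := 'D_1 c t in ne *.
have e0 : 0 < `|l0 - l'| / 2 by rewrite divr_gt0// lt_def ne normr_ge0.
have [d d0 hd] := hl _ e0.
have cv : h^-1 *: ((c \o shift t) (h *: 1) - c t) @[h --> 0^'] --> l0 by exact: dc.
move/cvgrPdist_lt/(_ _ e0) : cv => /nbhs_ballP[r /= r0 hr].
pose q := Num.min (Num.min d r) 1 / 2.
have m0 : 0 < Num.min (Num.min d r) 1 by rewrite !lt_min d0 r0 ltr01.
have q0 : 0 < q by rewrite divr_gt0.
have qm : q < Num.min (Num.min d r) 1 by rewrite ltr_pdivrMr// ltr_pMr// ltrDl.
move: (qm); rewrite !lt_min => /andP[/andP[qd qr] q1].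
have q12 : q <= 1 / 2 by rewrite ler_pM2r// ge_min lexx orbT.
pose h := if t <= 1 / 2 then q else - q.
have hn : `|h| = q by rewrite /h; case: ifP => _; rewrite ?normrN gtr0_norm.
have h0 : h != 0 by rewrite -normr_gt0 hn.
have th : 0 <= t + h <= 1.
  by rewrite /h; case: ifPn => [ht|]; [|rewrite -ltNge => ht]; apply/andP; split; lra.
have a1 := hd h h0 th; rewrite hn in a1; have {}a1 := a1 qd.
have bh : ball (0 : R) r h by apply: ball0; rewrite hn.
have a2 := hr h bh h0.
rewrite /shift /= [h *: 1]mulr1 [h + t]addrC in a2.
have : `|l0 - l'| < `|l0 - l'| / 2 + `|l0 - l'| / 2.
  apply: le_lt_trans (ltrD a2 a1).
  have -> : l0 - l' = (l0 - h^-1 *: (c (t + h) - c t)) + (h^-1 * (c (t + h) - c t) - l').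
    by rewrite addrA subrK.
  exact: ler_normD.
by rewrite -splitr ltxx.
Qed.

End Slices.

(** * The flow and its linearisation *)

Section FlowData.
Variables (R : realType) (n : nat) (O : set 'rV[R]_(n + n)).
Variables (K : R -> 'rV[R]_(n + n) -> R) (G : R -> 'rV[R]_(n + n) -> 'rV[R]_(n + n)).
Local Notation N := (n + n)%N.
Local Notation J := (Jmx n : 'M[R]_(n + n)).
Local Notation Gp := (fun p : R * 'rV[R]_(n + n) => G p.1 p.2).
Local Notation Kp := (fun p : R * 'rV[R]_(n + n) => K p.1 p.2).
Local Notation Gj j := (fun p : R * 'rV[R]_(n + n) => G p.1 p.2 0 j).
Variables (UG UK : set (R * 'rV[R]_(n + n))).
Hypotheses (oO : open O) (oUG : open UG) (oUK : open UK).
Hypotheses (subG : I01 `*` closure O `<=` UG) (subK : I01 `*` closure O `<=` UK).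
Hypotheses (sG : smooth_on UG Gp) (sK : smooth_on UK Kp).
Hypothesis GO : forall t z, I01 t -> closure O z -> closure O (G t z).
Hypothesis ode : forall t z, I01 t -> closure O z ->
  deriv01 (fun s => G s z) t (grad (K t) (G t z) *m J).

Local Notation d1 := ((1, 0) : R * 'rV[R]_(n + n)).
Local Notation dz v := ((0, v) : R * 'rV[R]_(n + n)).

Lemma pair_slice_z (W : normedModType R) (f : R * 'rV[R]_N -> W) t z v :
  (derivable (fun y => f (t, y)) z v <-> derivable f (t, z) (dz v)) /\
  'D_v (fun y => f (t, y)) z = 'D_(dz v) f (t, z).
Proof.
have Ll (h : R) (w y : 'rV[R]_N) : (fun y => (0, y) : R * 'rV[R]_N) (h *: w + y) =
   h *: (0, w) + (0, y).
  by rewrite /GRing.scale /= /GRing.add /= /add_pair /= ?scaler0 ?addr0 ?mulr0.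
have := derive_slice f (t, 0) Ll z v.
have e y : (t, 0) + (0, y) = (t, y) :> R * 'rV[R]_N.
  by congr (_, _); rewrite /= ?addr0 ?add0r.
rewrite e; have -> // : (fun z0 : 'rV_N => f ((t, 0) + (0, z0))) = (fun y => f (t, y)).
by apply/funext => y; rewrite e.
Qed.

Lemma pair_slice_t (W : normedModType R) (f : R * 'rV[R]_N -> W) t z :
  derivable f (t, z) d1 -> is_derive t 1 (fun s => f (s, z)) ('D_d1 f (t, z)).
Proof.
have e (s : R) : (0, z) + s *: d1 = (s, z).
  by congr (_, _); rewrite /= ?scaler0 ?addr0 // add0r [_ *: _]mulr1.
move=> df; have := @is_derive_line R _ W f (0, z) d1 t; rewrite e => /(_ df).
by have -> : (fun r : R => f ((0, z) + r *: d1)) = (fun s => f (s, z))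
  by apply/funext => s; rewrite e.
Qed.

Lemma flow_dmx t z i j : UG (t, z) ->
  dmx (G t) z i j = 'D_(dz (evec i)) (Gj j) (t, z).
Proof.
move=> Uz; rewrite mxE; have [_ ->] := pair_slice_z Gp t z (evec i).
by have [_ /(_ [:: dz (evec i)] _ Uz)] := smooth_coord j oUG sG.
Qed.

Lemma flow_dmx_cont i j p : UG p -> {for p, continuous (fun p => dmx (G p.1) p.2 i j)}.
Proof.
move=> Up; apply: (@cont_near_eq _ _ _ (fun p => 'D_(dz (evec i)) (Gj j) p)).
  by apply: (near_open oUG Up) => -[t z] Uz /=; rewrite flow_dmx.
by have [/(_ [:: dz (evec i)] p Up)[] ] := smooth_coord j oUG sG.
Qed.

Lemma flow_cont p : UG p -> {for p, continuous Gp}.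
Proof. by move=> Up; have [] := sG [::] Up. Qed.

(** The differential equation is stated with derivatives within [0, 1], while the smooth extension
    [G] has a two-sided derivative in t; [deriv01_unique] identifies them. *)
Lemma flow_velocity t z j : I01 t -> closure O z ->
  'D_d1 (Gj j) (t, z) = (grad (K t) (G t z) *m J) 0 j.
Proof.
move=> It cz; have Uz : UG (t, z) by apply: subG.
have [sj ej] := smooth_coord j oUG sG.
have [_ d] := sj [::] _ Uz; have dt := pair_slice_t (d d1).
apply: (deriv01_unique It dt) => e e0.
move: (ode It cz) => /cvgrPdist_lt/(_ _ e0).
rewrite /within /= => /nbhs_ballP[r /= r0 hr]; exists r => // h h0 th hr'.
have := hr h (ball0 hr') (conj h0 th).
rewrite distrC; apply: le_lt_trans.
have := rV_coord_le (h^-1 *: (G (t + h) z - G t z) - grad (K t) (G t z) *m J) j.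
by move: (grad (K t) (G t z) *m Jmx n) => B; rewrite !mxE.
Qed.

Lemma hess_K t y i j : UK (t, y) -> hess (K t) y i j =
  'D_(dz (evec i)) (fun p => 'D_(dz (evec j)) Kp p) (t, y).
Proof.
move=> Uy; rewrite mxE.
have -> : (fun w => 'D_(evec j) (K t) w) = (fun w => 'D_(dz (evec j)) Kp (t, w)).
  by apply/funext => w; have [_ ->] := pair_slice_z Kp t w (evec j).
by have [_ ->] := pair_slice_z (fun p => 'D_(dz (evec j)) Kp p) t y (evec i).
Qed.

Lemma hess_sym t y : UK (t, y) -> (hess (K t) y)^T = hess (K t) y.
Proof.
move=> Uy; apply/matrixP => i j; rewrite [LHS]mxE (hess_K j i Uy) (hess_K i j Uy).
exact: (smooth_schwarz _ _ oUK sK Uy).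
Qed.

Lemma hess_cont i j p : UK p -> {for p, continuous (fun p => hess (K p.1) p.2 i j)}.
Proof.
move=> Up; apply: (@cont_near_eq _ _ _
   (fun p => 'D_(dz (evec i)) (fun p => 'D_(dz (evec j)) Kp p) p)).
  by apply: (near_open oUK Up) => -[t z] Uz /=; rewrite hess_K.
by have [] := sK [:: dz (evec i); dz (evec j)] Up.
Qed.

Lemma flow_pair_cont p : UG p -> {for p, continuous (fun p => (p.1, G p.1 p.2))}.
Proof.
by move=> Up; apply: cont_pair; [exact: cvg_fst|exact: flow_cont].
Qed.

Lemma flow_hess_cont i j p : UG p -> UK (p.1, G p.1 p.2) ->
  {for p, continuous (fun p => hess (K p.1) (G p.1 p.2) i j)}.
Proof.
move=> Up UKp; have := continuous_comp (flow_pair_cont Up) (@hess_cont i j _ UKp).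
exact.
Qed.

Lemma smooth_Kt t : smooth_on [set y | UK (t, y)] (K t) /\ open [set y | UK (t, y)].
Proof.
have Ll (h : R) (w y : 'rV[R]_N) : (fun y => (0, y) : R * 'rV[R]_N) (h *: w + y) =
   h *: (0, w) + (0, y).
  by rewrite /GRing.scale /= /GRing.add /= /add_pair /= ?scaler0 ?addr0 ?mulr0.
have Lc : continuous (fun y : 'rV[R]_N => (0, y) : R * 'rV[R]_N).
  by move=> y; exact: cont_pairl.
have e (y : 'rV[R]_N) : (t, 0) + (0, y) = (t, y) :> R * 'rV[R]_N.
  by congr (_, _); rewrite /= ?addr0 ?add0r.
have := @smooth_slice R _ _ _ _ (t, 0) _ _ Ll Lc sK; have := @open_slice R _ _ (t, 0) _ _ Lc oUK.
have -> : [set z : 'rV[R]_N | UK ((t, 0) + (0, z))] = [set y | UK (t, y)].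
  by apply/seteqP; split => y /=; rewrite e.
have -> : (fun z : 'rV[R]_N => K ((t, 0) + (0, z)).1 ((t, 0) + (0, z)).2) = K t.
  by apply/funext => y; rewrite e.
by [].
Qed.

Lemma flow_dmx_derivable t z i : UG (t, z) ->
  derivable (G t) z (evec i).
Proof.
move=> Uz; have [[_ h] _] := pair_slice_z Gp t z (evec i); apply: h.
by have [_ d] := sG [::] Uz; exact: d.
Qed.

Lemma grad_flow_derive t z i k : I01 t -> closure O z ->
  is_derive z (evec i) (fun y => 'D_(evec k) (K t) (G t y))
    ((dmx (G t) z *m hess (K t) (G t z)) i k).
Proof.
move=> It cz; have Uz : UG (t, z) by apply: subG.
have UKz : UK (t, G t z) by apply: subK; split => //=; exact: GO.
have [sKt oKt] := smooth_Kt t.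
have [df dl] := @smooth_differentiable R N _ _ [:: evec k] (G t z) oKt sKt UKz.
have dG : derivable (G t) z (evec i) by exact: flow_dmx_derivable.
have := chain_dir df dG; rewrite dl.
have -> : \sum_i0 'D_(evec i) (G t) z 0 i0 * 'D_(evec i0) (iterD [:: evec k] (K t)) (G t z) =
  (dmx (G t) z *m hess (K t) (G t z)) i k.
  by rewrite [RHS]mxE; apply: eq_bigr => l _; rewrite !mxE.
exact.
Qed.

(** The derivatives in t and z are exchanged. The equation for the t-derivative is known on the
    closure of O only, so it is differentiated in z at interior points, and the identity passes to
    the closure by continuity. *)
Lemma flow_dmx_rate t z i j : I01 t -> closure O z ->
  'D_d1 (fun p => 'D_(dz (evec i)) (Gj j) p) (t, z) =
  (dmx (G t) z *m hess (K t) (G t z) *m J) i j.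
Proof.
move=> It cz; have [sj ej] := smooth_coord j oUG sG.
have inU y : closure O y -> UG (t, y) by move=> ?; apply: subG.
have inK y : closure O y -> UK (t, G t y) by move=> ?; apply: subK; split => //=; exact: GO.
have slc (T : topologicalType) (f : R * 'rV[R]_N -> T) y : {for (t, y), continuous f} ->
    {for y, continuous (fun y => f (t, y))}.
  move=> cf; have cp : {for y, continuous (fun y : 'rV[R]_N => (t, y))}.
    exact: cont_pairl.
  exact: (continuous_comp cp cf).
apply: (closure_eq cz (a := fun z => 'D_d1 (fun p => 'D_(dz (evec i)) (Gj j) p) (t, z))
  (b := fun z => (dmx (G t) z *m hess (K t) (G t z) *m J) i j)).
- apply: (slc _ (fun p => 'D_d1 (fun p => 'D_(dz (evec i)) (Gj j) p) p)).
  by have [] := sj [:: d1; dz (evec i)] _ (inU _ cz).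
- have -> : (fun z => (dmx (G t) z *m hess (K t) (G t z) *m J) i j) =
     (fun z => \sum_k (\sum_l dmx (G t) z i l * hess (K t) (G t z) l k) * J k j).
    by apply/funext => y; rewrite mxE; apply: eq_bigr => k _; rewrite mxE.
  apply: cont_sum => k _; apply: contM; last exact: cont_cst.
  apply: cont_sum => l _; apply: contM.
    exact: (slc _ (fun p => dmx (G p.1) p.2 i l) z (flow_dmx_cont (inU _ cz))).
  exact: (slc _ (fun p => hess (K p.1) (G p.1 p.2) l k) z (flow_hess_cont (inU _ cz) (inK _ cz))).
- move=> y Oy; have cy : closure O y by exact: subset_closure.
  rewrite (smooth_schwarz _ _ oUG sj (inU _ cy)).
  have [_ <-] := pair_slice_z (fun p => 'D_d1 (Gj j) p) t y (evec i).
  have -> : 'D_(evec i) (fun y => 'D_d1 (Gj j) (t, y)) y =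
     'D_(evec i) (fun y => \sum_k 'D_(evec k) (K t) (G t y) * J k j) y.
    apply: near_eq_derive; apply: (near_open oO Oy) => w Ow.
    rewrite flow_velocity//; last exact: subset_closure.
    by rewrite mxE; apply: eq_bigr => k _; rewrite mxE.
  have dk k : is_derive y (evec i) (fun y => J k j *: 'D_(evec k) (K t) (G t y))
      (J k j *: (dmx (G t) y *m hess (K t) (G t y)) i k).
    by apply: is_deriveZ; exact: grad_flow_derive.
  have e : (fun y => \sum_k 'D_(evec k) (K t) (G t y) * J k j) =
      \sum_k (fun y => J k j *: 'D_(evec k) (K t) (G t y)).
    by apply/funext => w; rewrite fct_sumE; apply: eq_bigr => k _; rewrite mulrC.
  rewrite e; have [_ ->] := is_derive_sum dk.
  by rewrite [RHS]mxE; apply: eq_bigr => k _; rewrite mulrC.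
Qed.

Lemma flow_dmx_is_derive t z i j : I01 t -> closure O z ->
  is_derive t 1 (fun s => dmx (G s) z i j)
    ((dmx (G t) z *m hess (K t) (G t z) *m J) i j).
Proof.
move=> It cz; have Uz : UG (t, z) by apply: subG.
have [sj ej] := smooth_coord j oUG sG.
have [_ d] := sj [:: dz (evec i)] _ Uz.
have := pair_slice_t (d d1); rewrite flow_dmx_rate//.
apply: near_eq_is_derive.
have : \forall p \near (t, z), UG p by apply: (near_open oUG Uz).
move=> nU; have cs : {for t, continuous (fun s : R => (s, z))}.
  exact: cont_pairr.
have h : \forall s \near t, UG (s, z) by exact: (cs _ nU).
near=> s; have Us : UG (s, z) by near: s; exact: h.
by rewrite flow_dmx.
Unshelve. all: by end_near.
Qed.

End FlowData.

(** * Iterated integrals *)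

Section Integration1D.
Variable R : realType.
Local Notation mu := (@lebesgue_measure R).

Lemma integrable_bounded_supp (g : R -> R) (M C : R) :
  measurable_fun setT g -> (forall x, `|g x| <= C) ->
  (forall x, M < `|x| -> g x = 0) -> mu.-integrable setT (EFin \o g).
Proof.
move=> mg gC gM.
have i1 := @integrable_indic_itv R (- M) M true false.
have i2 := integrableZl measurableT `|C| i1.
apply: le_integrable i2 => //; first exact: measurableT_comp.
move=> x _ /=; rewrite lee_fin normrM normr_id indicE.
have [xM|xM] := leP `|x| M.
  rewrite mem_set /= ?in_itv/= -?ler_norml// normr1 mulr1.
  exact: le_trans (gC x) (ler_norm _).
by rewrite gM// normr0 mulr_ge0.
Qed.

Lemma Rintegral_bounded_supp (g : R -> R) (M C : R) : 0 <= M ->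
  measurable_fun setT g -> (forall x, `|g x| <= C) ->
  (forall x, M < `|x| -> g x = 0) -> `|Rintegral mu setT g| <= C * (2 * M).
Proof.
move=> M0 mg gC gM; have ig := integrable_bounded_supp mg gC gM.
have C0 : 0 <= C by apply: le_trans (gC 0).
apply: le_trans (le_normr_Rintegral _ _) _ => //.
pose g2 x := C * \1_(`[- M, M] : set R) x.
have g2C x : `|g2 x| <= C.
  rewrite /g2 indicE; case: (_ \in _); rewrite ?mulr1 ?mulr0 ?normr0//.
  by rewrite ger0_norm.
have m1 : measurable_fun setT (\1_(`[- M, M] : set R) : R -> R).
  exact: measurable_indic.
have g2M x : M < `|x| -> g2 x = 0.
  move=> xM; rewrite /g2 indicE memNset ?mulr0//= in_itv/= -ler_norml.
  by apply/negP; rewrite -ltNge.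
have -> : C * (2 * M) = Rintegral mu setT g2.
  have e : fine (mu (`[- M, M] : set R)) = 2 * M.
    rewrite lebesgue_measure_itv /= lte_fin.
    case: ifPn => [_|]; first by rewrite -EFinB /= opprK -mulr2n mulr_natl.
    rewrite -leNgt => h; have -> : M = 0 by apply/eqP; rewrite eq_le M0 andbT; lra.
    by rewrite /= !mulr0.
  rewrite /g2 RintegralZl//; last exact: (@integrable_indic_itv R (- M) M true false).
  by congr (_ * _); rewrite /Rintegral integral_indic// setIT -e.
apply: le_Rintegral => //.
- apply: (@integrable_bounded_supp _ M C).
  + exact: measurableT_comp.
  + by move=> x; rewrite normr_id.
  + by move=> x xM; rewrite gM// normr0.
- apply: (@integrable_bounded_supp _ M C) => //.
  by apply: measurable_funM => //; exact: measurable_cst.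
- move=> x _; have [xM|xM] := leP `|x| M; last by rewrite gM// normr0 -[leRHS]/(g2 x) g2M.
  by rewrite /g2 indicE mem_set /= ?in_itv/= -?ler_norml// mulr1.
Qed.

Let sh (h : R) : measurableTypeR R -> measurableTypeR R := fun x => x + h.

Let measurable_sh h : measurable_fun setT (sh h).
Proof. by apply: measurable_funD => //; exact: measurable_cst. Qed.

(** Shifting preserves the length of half-open intervals, and these lengths determine Lebesgue
    measure. *)
Lemma lebesgue_measure_shift (h : R) (A : set (measurableTypeR R)) : measurable A ->
  mu A = pushforward mu (sh h) A.
Proof.
move=> mA.
pose nu : {measure set (measurableTypeR R) -> \bar R} := pushforward mu (sh h).
apply: (@lebesgue_measure_unique R (nu (@measurable_sh h))) => //.
move=> X [[a b] /= _ <-].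
rewrite /nu /= /pushforward /=.
have -> : sh h @^-1` [set` `]a, b]] = [set` `]a - h, b - h]].
  by apply/seteqP; split => x /=; rewrite !in_itv /= /sh ltrBlDr lerBrDr.
rewrite !lebesgue_measure_itv /= !lte_fin ltrD2r; case: ifP => // _.
by rewrite -!EFinB; congr (_%:E); lra.
Qed.

Lemma Rintegral_shift (g : R -> R) (h : R) : measurable_fun setT g ->
  mu.-integrable setT (EFin \o (fun x => g (x + h))) ->
  Rintegral mu setT (fun x => g (x + h)) = Rintegral mu setT g.
Proof.
move=> mg ig; rewrite /Rintegral; congr fine.
have mg' : measurable_fun setT (EFin \o g : measurableTypeR R -> \bar R).
  exact: measurableT_comp.
have := @integral_pushforward _ _ _ _ R (sh h) (@measurable_sh h) mu setT (EFin \o g) mg'.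
rewrite preimage_setT => /(_ ig measurableT) /= <-.
by apply/esym/eq_measure_integral => A mA _; exact: lebesgue_measure_shift.
Qed.

End Integration1D.

(** * Integration over one coordinate after another *)

Section IteratedIntegral.
Variables (R : realType) (N : nat).
Local Notation mu := (@lebesgue_measure R).
Implicit Types (f g : 'rV[R]_N -> R) (js : seq 'I_N) (z : 'rV[R]_N) (M C : R).

Lemma setcoordE z j x i : (setcoord z j x) 0 i = if i == j then x else z 0 i.
Proof.
rewrite /setcoord !mxE /=; case: eqP => [->|_]; first by rewrite mulr1 addrC subrK.
by rewrite mulr0 addr0.
Qed.

(* The measurability clause is exactly what makes all the iterated integrals of [f] meaningful. *)
Definition tame M C f := [/\ (forall z, `|f z| <= C),
  (forall z i, M < `|z 0 i| -> f z = 0) &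
  forall j js z, uniq (j :: js) ->
    measurable_fun setT (fun x => iint js f (setcoord z j x))].

Lemma tame_C0 M C f : tame M C f -> 0 <= C.
Proof. by move=> [h _ _]; apply: le_trans (h 0). Qed.

Lemma iint_supp M C f js z i : tame M C f -> uniq js -> i \notin js ->
  M < `|z 0 i| -> iint js f z = 0.
Proof.
move=> [_ fM _]; elim: js z => [|j js IH] z /= ujs ijs zi; first exact: (fM z i).
move: ijs ujs; rewrite inE negb_or => /andP[ij ijs] /andP[_ ujs].
rewrite (_ : (fun x => _) = cst 0) ?Rintegral_cst ?mul0r//.
by apply/funext => x; apply: IH => //; rewrite setcoordE (negbTE ij).
Qed.

Lemma iint_bound M C f js z : 0 <= M -> tame M C f -> uniq js ->
  `|iint js f z| <= C * (2 * M) ^+ size js.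
Proof.
move=> M0 tf; elim: js z => [|j js IH] z /= ujs; first by rewrite mulr1; have [] := tf.
have /andP[jjs ujs'] := ujs.
rewrite exprSr mulrA; apply: Rintegral_bounded_supp => //.
- by have [_ _ h] := tf; exact: h.
- by move=> x; apply: IH.
- by move=> x xM; apply: (iint_supp (i := j) tf) => //; rewrite setcoordE eqxx.
Qed.

Lemma iint_integrable M C f j js z : 0 <= M -> tame M C f -> uniq (j :: js) ->
  mu.-integrable setT (EFin \o (fun x => iint js f (setcoord z j x))).
Proof.
move=> M0 tf ujs; have /andP[jjs ujs'] := ujs.
apply: (@integrable_bounded_supp _ _ M (C * (2 * M) ^+ size js)).
- by have [_ _ h] := tf; exact: h.
- by move=> x; apply: iint_bound.
- by move=> x xM; apply: (iint_supp (i := j) tf) => //; rewrite setcoordE eqxx.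
Qed.

Lemma iintD M C C' f g js z : 0 <= M -> tame M C f -> tame M C' g -> uniq js ->
  iint js (fun z => f z + g z) z = iint js f z + iint js g z.
Proof.
move=> M0 tf tg; elim: js z => [//|j js IH] z /= ujs; have /andP[_ ujs'] := ujs.
rewrite -RintegralD//; first by apply: eq_Rintegral => x _; rewrite IH.
  exact: iint_integrable tf ujs.
exact: iint_integrable tg ujs.
Qed.

Lemma iintZ M C f k js z : 0 <= M -> tame M C f -> uniq js ->
  iint js (fun z => k * f z) z = k * iint js f z.
Proof.
move=> M0 tf; elim: js z => [//|j js IH] z /= ujs; have /andP[_ ujs'] := ujs.
rewrite -RintegralZl//; first by apply: eq_Rintegral => x _; rewrite IH.
exact: iint_integrable tf ujs.
Qed.

Lemma tameD M C C' f g : 0 <= M -> tame M C f -> tame M C' g ->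
  tame M (C + C') (fun z => f z + g z).
Proof.
move=> M0 tf tg; have [f1 f2 f3] := tf; have [g1 g2 g3] := tg; split.
- by move=> z; apply: le_trans (ler_normD _ _) _; apply: lerD.
- by move=> z i zi; rewrite (f2 z i zi) (g2 z i zi) addr0.
- move=> j js z ujs; have /andP[_ ujs'] := ujs.
  rewrite (_ : (fun x => _) = (fun x => iint js f (setcoord z j x)) \+
     (fun x => iint js g (setcoord z j x))).
    by apply: measurable_funD; [exact: f3|exact: g3].
  by apply/funext => x; rewrite (iintD _ M0 tf tg).
Qed.

Lemma tameZ M C f k : 0 <= M -> tame M C f -> tame M (`|k| * C) (fun z => k * f z).
Proof.
move=> M0 tf; have [f1 f2 f3] := tf; split.
- by move=> z; rewrite normrM ler_wpM2l.
- by move=> z i zi; rewrite (f2 z i zi) mulr0.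
- move=> j js z ujs; have /andP[_ ujs'] := ujs.
  rewrite (_ : (fun x => _) = (fun x => k * iint js f (setcoord z j x))).
    by apply: measurable_funM => //; exact: f3.
  by apply/funext => x; rewrite (iintZ _ _ M0 tf).
Qed.

Lemma iint_le M C C' f g js z : 0 <= M -> tame M C f -> tame M C' g -> uniq js ->
  (forall z, f z <= g z) -> iint js f z <= iint js g z.
Proof.
move=> M0 tf tg + fg; elim: js z => [//|j js IH] z /= ujs.
have /andP[_ ujs'] := ujs; apply: le_Rintegral => //.
- exact: iint_integrable tf ujs.
- exact: iint_integrable tg ujs.
- by move=> x _; exact: IH.
Qed.

Lemma norm_lim_le (u : nat -> R) l c :
  u k @[k --> \oo] --> l -> (forall k, `|u k| <= c) -> `|l| <= c.
Proof.
move=> ul uc; apply: (ler_cvg_to (cvg_norm ul) (cvg_cst c)).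
by apply: nearW => k; exact: uc.
Qed.

(** Dominated convergence in one variable at a time; the common bound and support provide the
    dominating function. Measurability of the partial integrals of the limit is obtained along the
    way. *)
Lemma iint_cvg M C (f_ : nat -> 'rV[R]_N -> R) f js z : 0 <= M ->
  (forall k, tame M C (f_ k)) -> (forall z, f_ k z @[k --> \oo] --> f z) ->
  uniq js -> iint js (f_ k) z @[k --> \oo] --> iint js f z.
Proof.
move=> M0 tf ff; elim: js z => [|j js IH] z /= ujs; first exact: ff.
have /andP[jjs ujs'] := ujs.
pose D := C * (2 * M) ^+ size js.
have D0 : 0 <= D by rewrite mulr_ge0 ?(tame_C0 (tf 0%N))// exprn_ge0// mulr_ge0.
pose g : R -> R := fun x => D * \1_(`[- M, M] : set R) x.
have ig : mu.-integrable setT (EFin \o g).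
  apply: (@integrable_bounded_supp _ g M D).
  - by apply: measurable_funM; [exact: measurable_cst|exact: measurable_indic].
  - move=> x; rewrite /g indicE; case: (_ \in _); rewrite ?mulr1 ?mulr0 ?normr0//.
    by rewrite ger0_norm.
  - move=> x xM; rewrite /g indicE memNset ?mulr0//= in_itv/= -ler_norml.
    by apply/negP; rewrite -ltNge.
have dom n x : `|iint js (f_ n) (setcoord z j x)| <= g x.
  rewrite /g indicE; have [xM|xM] := leP `|x| M.
    rewrite mem_set ?mulr1//=; first by apply: iint_bound.
    by rewrite in_itv/= -ler_norml.
  rewrite (iint_supp (i := j) (tf n))// ?setcoordE ?eqxx// normr0.
  by rewrite mulr_ge0.
have ml : measurable_fun setT (fun x => iint js f (setcoord z j x)).
  apply: (@measurable_fun_cvg _ _ _ _ (fun n x => iint js (f_ n) (setcoord z j x))).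
    by move=> n; have [_ _ h] := tf n; exact: h.
  by move=> x _; exact: IH.
have il : mu.-integrable setT (EFin \o (fun x => iint js f (setcoord z j x))).
  apply: le_integrable ig => //; first exact: measurableT_comp.
  move=> x _ /=; rewrite lee_fin [leRHS]ger0_norm; last by rewrite /g mulr_ge0.
  exact: (norm_lim_le (IH (setcoord z j x) ujs')).
have icvg := @dominated_cvg _ _ _ mu setT measurableT
  (fun n => EFin \o (fun x => iint js (f_ n) (setcoord z j x)))
  (EFin \o (fun x => iint js f (setcoord z j x))) (EFin \o g).
rewrite /Rintegral; apply: fine_cvg; rewrite fineK; last exact: integrable_fin_num.
apply: icvg => //.
- by move=> n; apply: measurableT_comp => //; have [_ _ h] := tf n; exact: h.
- by move=> x _; apply: cvg_EFin; [exact: nearW|exact: IH].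
- by move=> n x _; rewrite /= lee_fin.
Qed.

Lemma tame_cvg M C (f_ : nat -> 'rV[R]_N -> R) f : 0 <= M ->
  (forall k, tame M C (f_ k)) -> (forall z, f_ k z @[k --> \oo] --> f z) ->
  tame M C f.
Proof.
move=> M0 tf ff; split.
- by move=> z; apply: (norm_lim_le (ff z)) => k; have [] := tf k.
- move=> z i zi; apply/eqP; rewrite -normr_le0; apply: (norm_lim_le (ff z)) => k.
  by have [_ h _] := tf k; rewrite (h z i zi) normr0.
- move=> j js z ujs; have /andP[_ ujs'] := ujs.
  apply: (@measurable_fun_cvg _ _ _ _ (fun n x => iint js (f_ n) (setcoord z j x))).
    by move=> n; have [_ _ h] := tf n; exact: h.
  by move=> x _; exact: (@iint_cvg M C f_ f js (setcoord z j x) M0 tf ff ujs').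
Qed.

(** Only x ranges over the compact set; y is any point nearby. Continuity is assumed at the points
    of K alone, which is what is available on the closure of the domain. *)
Lemma compact_unif (T : pseudoMetricType R) (K : set T) (f : T -> R) :
  compact K -> (forall x, K x -> {for x, continuous f}) ->
  forall e, 0 < e -> exists2 d, 0 < d &
    forall x y, K x -> ball x d y -> `|f x - f y| < e.
Proof.
move=> /compact_near_coveringP cK cf e e0.
have [k _ hk] : \forall k \near \oo, K `<=` (fun x => forall y,
    ball x (k.+1%:R^-1 : R) y -> `|f x - f y| < e).
  apply: cK => x Kx; have e2 : 0 < e / 2 by rewrite divr_gt0.
  have /cvgrPdist_lt/(_ _ e2)/nbhs_ballP[r /= r0 hr] := cf x Kx.
  have r2 : 0 < r / 2 by rewrite divr_gt0.
  exists (ball x (r / 2), [set k : nat | (k.+1%:R^-1 : R) < r / 2]).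
    split=> /=; first exact: nbhsx_ballx.
    exact: (near_infty_natSinv_lt (PosNum r2)).
  move=> [x' k] /= [bx kr] y by'.
  have h1 := hr x' (le_ball _ bx); have h2 : ball x r y.
    rewrite (splitr r); apply: ball_triangle bx _; exact: le_ball (ltW kr) _ by'.
  have {}h1 : `|f x - f x'| < e / 2 by apply: h1; lra.
  have {}h2 := hr y h2.
  have -> : f x' - f y = (f x - f y) - (f x - f x') by ring.
  rewrite (splitr e); apply: le_lt_trans (ler_normB _ _) _; exact: ltrD.
exists (k.+1%:R^-1); first by rewrite invr_gt0.
by move=> x y Kx; exact: hk k (leqnn k) x Kx y.
Qed.

Definition unif_mod f := forall e, 0 < e -> exists2 d, 0 < d &
  forall z z' : 'rV[R]_N, `|z - z'| < d -> `|f z - f z'| <= e.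

Lemma box_compact M : compact [set z : 'rV[R]_N | forall i, `|z 0 i| <= M].
Proof.
have -> : [set z : 'rV[R]_N | forall i, `|z 0 i| <= M] =
    [set v : 'rV[R]_N | forall i, [set` `[- M, M]] (v ord0 i)].
  by apply/seteqP; split => v /= h i; have := h i; rewrite in_itv/= -ler_norml.
exact: (@rV_compact R N (fun=> [set` `[- M, M]]) (fun=> @segment_compact R (- M) M)).
Qed.

Lemma Cc_unif M f : continuous f -> (forall z i, M < `|z 0 i| -> f z = 0) ->
  unif_mod f.
Proof.
move=> cf fM e e0.
have [d d0 hd] := compact_unif (@box_compact (M + 1)) (fun x _ => cf x) e0.
(* A radius at most 1 ensures that if z has a coordinate beyond M + 1, both z and z' lie outside the
   support. *)
exists (Num.min d 1); first by rewrite lt_min d0 ltr01.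
move=> z z'; rewrite lt_min => /andP[zd z1].
have [zK|zK] := pselect (forall i, `|z 0 i| <= M + 1).
  by apply/ltW/hd => //; rewrite -ball_normE.
have [i zi] : exists i, M + 1 < `|z 0 i|.
  apply: contrapT => h; apply: zK => i; rewrite leNgt; apply/negP => zi.
  by apply: h; exists i.
rewrite (fM z i) ?(fM z' i) ?subrr ?normr0 ?(ltW e0)//; last by lra.
have : `|(z - z') 0 i| < 1.
  apply: le_lt_trans z1; rewrite [leRHS]/Num.Def.normr /= mx_normrE.
  exact: (le_bigmax _ (fun i : 'I_1 * 'I_N => `|(z - z') i.1 i.2|) (0, i)).
rewrite !mxE => h; have := ler_normB (z 0 i) (z 0 i - z' 0 i).
have -> : z 0 i - (z 0 i - z' 0 i) = z' 0 i by ring.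
have := lerB_dist (z 0 i) (z 0 i - z' 0 i).
have -> : z 0 i - (z 0 i - z' 0 i) = z' 0 i by ring.
lra.
Qed.

Lemma setcoord_dist z z' j x : `|setcoord z j x - setcoord z' j x| <= `|z - z'|.
Proof.
rewrite [leLHS]/Num.Def.normr /= mx_normrE (bigmax_le _ (normr_ge0 _))//= => -[i k] _ /=.
rewrite ord1 mxE [X in _ + X]mxE !setcoordE; case: eqP => _; first by rewrite subrr normr0.
have -> : z 0 k - z' 0 k = (z - z') 0 k by rewrite !mxE.
rewrite [leRHS]/Num.Def.normr /= mx_normrE.
exact: (le_bigmax _ (fun i : 'I_1 * 'I_N => `|(z - z') i.1 i.2|) (0, k)).
Qed.

Lemma setcoord_dist1 z j x y : `|setcoord z j x - setcoord z j y| <= `|x - y|.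
Proof.
rewrite [leLHS]/Num.Def.normr /= mx_normrE (bigmax_le _ (normr_ge0 _))//= => -[i k] _ /=.
rewrite ord1 mxE [X in _ + X]mxE !setcoordE; case: eqP => _ //.
by rewrite subrr normr0.
Qed.

Lemma slice_continuous g j z : unif_mod g -> continuous (fun x => g (setcoord z j x)).
Proof.
move=> ug x; apply/cvgrPdist_le => e e0; have [d d0 hd] := ug e e0.
apply/nbhs_ballP; exists d => // y xy.
by apply: hd; apply: le_lt_trans (setcoord_dist1 _ _ _ _) _; exact: xy.
Qed.

(** Induction over the coordinates: integrating over an interval of length 2 M preserves uniform
    continuity, with the tolerance divided by 2 M + 1 at each stage. *)
Lemma iint_Cc M C f js : 0 <= M -> (forall z, `|f z| <= C) ->
  (forall z i, M < `|z 0 i| -> f z = 0) -> unif_mod f -> uniq js ->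
  [/\ unif_mod (iint js f), (forall z, `|iint js f z| <= C * (2 * M) ^+ size js) &
      forall z i, i \notin js -> M < `|z 0 i| -> iint js f z = 0].
Proof.
move=> M0 fC fM uf; elim: js => [|j js IH] /=.
  by move=> _; split=> // [z|z i _]; [rewrite expr0 mulr1|exact: fM].
move=> /andP[jjs ujs]; have [u1 b1 s1] := IH ujs.
have ms z : measurable_fun setT (fun x => iint js f (setcoord z j x)).
  by apply: continuous_measurable_fun; exact: slice_continuous.
have sz z x : M < `|x| -> iint js f (setcoord z j x) = 0.
  by move=> xM; apply: (s1 _ j) => //; rewrite setcoordE eqxx.
have iz z := integrable_bounded_supp (ms z) (fun x => b1 (setcoord z j x)) (sz z).
split.
- move=> e e0; have M1 : 0 < 2 * M + 1 by rewrite ltr_wpDl// mulr_ge0.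
  have [d d0 hd] := u1 (e / (2 * M + 1)) (divr_gt0 e0 M1).
  exists d => // z z' zz; rewrite -RintegralB//.
  apply: le_trans (@Rintegral_bounded_supp _ _ M (e / (2 * M + 1)) M0 _ _ _) _.
  + exact: measurable_funB.
  + by move=> x; apply: hd; exact: le_lt_trans (setcoord_dist _ _ _ _) zz.
  + by move=> x xM; rewrite !sz// subrr.
  + rewrite mulrAC ler_pdivrMr// ler_wpM2l ?(ltW e0)//; lra.
- move=> z; rewrite exprSr mulrA.
  exact: (Rintegral_bounded_supp M0 (ms z) (fun x => b1 _) (sz z)).
- move=> z i; rewrite inE negb_or => /andP[ij ijs] zi.
  rewrite (_ : (fun x => _) = cst 0) ?Rintegral_cst ?mul0r//.
  by apply/funext => x; apply: (s1 _ i) => //; rewrite setcoordE (negbTE ij).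
Qed.

Lemma tame_Cc M C f : 0 <= M -> continuous f -> (forall z, `|f z| <= C) ->
  (forall z i, M < `|z 0 i| -> f z = 0) -> tame M C f.
Proof.
move=> M0 cf fC fM; have uf := Cc_unif cf fM; split=> // j js z /andP[_ ujs].
have [u1 _ _] := iint_Cc M0 fC fM uf ujs.
by apply: continuous_measurable_fun; exact: slice_continuous.
Qed.

(** A shift in an integrated coordinate is absorbed by translation invariance in one dimension; a
    shift in another coordinate just moves the base point. *)
Lemma iint_trans M C f js z h j : 0 <= M -> tame M C f -> uniq js ->
  iint js (fun z => f (z + h *: evec j)) z = iint js f (z + h *: evec j).
Proof.
move=> M0 tf; elim: js z => [//|i js IH] z /= ujs; have /andP[ijs ujs'] := ujs.
have [ij|ij] := eqVneq i j; last first.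
  apply: eq_Rintegral => x _; rewrite IH//; congr iint; apply/rowP => k.
  rewrite mxE !setcoordE !mxE /=; case: eqP => // ->.
  by rewrite (negbTE ij) mulr0 addr0.
subst j; pose g x := iint js f (setcoord (z + h *: evec i) i x).
have mg : measurable_fun setT g by have [_ _ p] := tf; exact: p.
transitivity (Rintegral mu setT (fun x => g (x + h))); last apply: Rintegral_shift => //.
  apply: eq_Rintegral => x _; rewrite IH// /g; congr iint; apply/rowP => k.
  rewrite mxE !setcoordE !mxE /=; case: eqP => // _; by rewrite mulr1.
apply: (@integrable_bounded_supp _ _ (M + `|h|) (C * (2 * M) ^+ size js)).
- apply: measurableT_comp => //; apply: measurable_funD => //; exact: measurable_cst.
- by move=> x; apply: iint_bound.
- move=> x xM; apply: (iint_supp (i := i) tf) => //; rewrite setcoordE eqxx.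
  have := ler_normB (x + h) h; rewrite addrK; lra.
Qed.

Lemma iint_indep f js z h j : j \in js -> iint js f (z + h *: evec j) = iint js f z.
Proof.
elim: js z => [//|i js IH] z; rewrite inE /= => jjs.
apply: eq_Rintegral => x _; have [ij|ij] := eqVneq j i.
  congr iint; apply/rowP => k; rewrite !setcoordE !mxE /=; case: eqP => // /eqP.
  by rewrite ij => /negbTE ->; rewrite mulr0 addr0.
move: jjs; rewrite (negbTE ij) /= => jjs; rewrite -[RHS](IH _ jjs); congr iint.
apply/rowP => k; rewrite [RHS]mxE !setcoordE !mxE /=; case: eqP => // ->.
by rewrite eq_sym (negbTE ij) mulr0 addr0.
Qed.

Definition Itot f := iint (enum 'I_N) f 0.

Lemma Itot_trans M C f h j : 0 <= M -> tame M C f ->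
  Itot (fun z => f (z + h *: evec j)) = Itot f.
Proof.
move=> M0 tf; rewrite /Itot (iint_trans _ _ _ M0 tf) ?enum_uniq//.
by apply: iint_indep; rewrite mem_enum.
Qed.

Lemma Itot_bound M C f : 0 <= M -> tame M C f -> `|Itot f| <= C * (2 * M) ^+ N.
Proof.
move=> M0 tf; have := iint_bound 0 M0 tf (enum_uniq 'I_N).
by rewrite size_enum_ord.
Qed.

End IteratedIntegral.

(** * Derivatives of matrix-valued curves *)

Section MatrixDerivative.
Variable R : realType.
Local Notation C := R[i].
Local Notation Re := complex.Re.
Local Notation Im := complex.Im.
Local Open Scope complex_scope.
Implicit Types t : R.

Definition cder (f : R -> C) (t : R) (d : C) :=
  is_derive t 1 (fun s => Re (f s)) (Re d) /\ is_derive t 1 (fun s => Im (f s)) (Im d).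

Lemma cder_cst (c : C) t : cder (fun=> c) t 0.
Proof. by split; exact: is_derive_cst. Qed.

Lemma cderD f g t a b : cder f t a -> cder g t b -> cder (fun s => f s + g s) t (a + b).
Proof.
move=> [f1 f2] [g1 g2]; split.
  rewrite cReD (_ : (fun s => _) = (fun s => Re (f s)) + (fun s => Re (g s))).
    exact: is_deriveD.
  by apply/funext => s; rewrite cReD.
rewrite cImD (_ : (fun s => _) = (fun s => Im (f s)) + (fun s => Im (g s))).
  exact: is_deriveD.
by apply/funext => s; rewrite cImD.
Qed.

Lemma is_derive_mul (f g : R -> R) t a b : is_derive t 1 f a -> is_derive t 1 g b ->
  is_derive t 1 (fun s => f s * g s) (f t * b + g t * a).
Proof. by move=> df dg; exact: (is_deriveM df dg). Qed.

Lemma is_derive_add (f g : R -> R) t a b : is_derive t 1 f a -> is_derive t 1 g b ->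
  is_derive t 1 (fun s => f s + g s) (a + b).
Proof. by move=> df dg; exact: (is_deriveD df dg). Qed.

Lemma is_derive_sub (f g : R -> R) t a b : is_derive t 1 f a -> is_derive t 1 g b ->
  is_derive t 1 (fun s => f s - g s) (a - b).
Proof. by move=> df dg; exact: (is_deriveB df dg). Qed.

Lemma is_derive_bigsum (I : Type) (r : seq I) (P : pred I) (f : I -> R -> R) (d : I -> R) t :
  (forall i, P i -> is_derive t 1 (f i) (d i)) ->
  is_derive t 1 (fun s => \sum_(i <- r | P i) f i s) (\sum_(i <- r | P i) d i).
Proof.
move=> fd; elim: r => [|i r IH].
  by rewrite big_nil; under eq_fun do rewrite big_nil; exact: is_derive_cst.
rewrite big_cons; under eq_fun do rewrite big_cons.
by case: ifPn => // Pi; apply: is_derive_add => //; exact: fd.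
Qed.

Lemma derivable_bigprod (I : Type) (r : seq I) (P : pred I) (f : I -> R -> R) t :
  (forall i, P i -> derivable (f i) t 1) ->
  derivable (fun s => \prod_(i <- r | P i) f i s) t 1.
Proof.
move=> fd; elim: r => [|i r IH].
  by under eq_fun do rewrite big_nil; exact: derivable_cst.
under eq_fun do rewrite big_cons.
case: ifPn => // Pi; exact: (@derivableM _ _ (f i) (fun s => \prod_(j <- r | P j) f j s) _ _ (fd i Pi) IH).
Qed.

Lemma cderM f g t a b : cder f t a -> cder g t b ->
  cder (fun s => f s * g s) t (f t * b + a * g t).
Proof.
move=> [f1 f2] [g1 g2]; split.
  have -> : (fun s => Re (f s * g s)) = (fun s => Re (f s) * Re (g s) - Im (f s) * Im (g s)).
    by apply/funext => s; rewrite cReM.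
  apply: (is_derive_eq (is_derive_sub (is_derive_mul f1 g1) (is_derive_mul f2 g2))).
  by rewrite cReD !cReM; ring.
have -> : (fun s => Im (f s * g s)) = (fun s => Re (f s) * Im (g s) + Im (f s) * Re (g s)).
  by apply/funext => s; rewrite cImM.
apply: (is_derive_eq (is_derive_add (is_derive_mul f1 g2) (is_derive_mul f2 g1))).
by rewrite cImD !cImM; ring.
Qed.

Lemma cder_sum (I : Type) (r : seq I) (P : pred I) (f : I -> R -> C) (d : I -> C) t :
  (forall i, P i -> cder (f i) t (d i)) ->
  cder (fun s => \sum_(i <- r | P i) f i s) t (\sum_(i <- r | P i) d i).
Proof.
move=> fd; elim: r => [|i r IH].
  by rewrite big_nil; under eq_fun do rewrite big_nil; exact: cder_cst.
rewrite big_cons; under eq_fun do rewrite big_cons.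
by case: ifPn => // Pi; apply: cderD => //; exact: fd.
Qed.

Lemma cder_prod (I : eqType) (r : seq I) (f : I -> R -> C) (d : I -> C) t :
  uniq r -> (forall i, cder (f i) t (d i)) ->
  cder (fun s => \prod_(i <- r) f i s) t
    (\sum_(k <- r) d k * \prod_(i <- r | i != k) f i t).
Proof.
move=> + fd; elim: r => [|j r IH] /=.
  by move=> _; rewrite big_nil; under eq_fun do rewrite big_nil; exact: cder_cst.
move=> /andP[jr ur]; under eq_fun do rewrite big_cons.
have := cderM (fd j) (IH ur).
rewrite big_cons big_cons eqxx /= addrC.
have -> : \prod_(i <- r | i != j) f i t = \prod_(i <- r) f i t.
  rewrite big_seq_cond [RHS]big_seq; apply: eq_bigl => i.
  by case: (boolP (i \in r)) => //= ir; apply: contraNneq jr => <-.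
have -> // : f j t * (\sum_(k <- r) d k * \prod_(i <- r | i != k) f i t) =
  \sum_(k <- r) d k * \prod_(i <- j :: r | i != k) f i t.
rewrite mulr_sumr big_seq [RHS]big_seq; apply: eq_bigr => k kr.
rewrite big_cons ifT; first by rewrite mulrCA.
by apply: contraNneq jr => ->.
Qed.

(** Jacobi's formula. Differentiating the permutation expansion produces, for each k, the
    determinant with row k replaced by its derivative; expanded along that row it is the k-th
    diagonal entry of M' adj M. *)
Lemma cder_det n (M : R -> 'M[C]_n) (M' : 'M[C]_n) t :
  (forall i j, cder (fun s => M s i j) t (M' i j)) ->
  cder (fun s => \det (M s)) t (\tr (M' *m \adj (M t))).
Proof.
move=> dM.
have -> : \tr (M' *m \adj (M t)) =
  \sum_(s : {perm 'I_n}) (-1) ^+ s * (\sum_(k : 'I_n) M' k (s k) *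
     \prod_(i <- index_enum 'I_n | i != k) M t i (s i)).
  pose Mk k := \matrix_(i, j) (if i == k then M' k j else M t i j).
  have e k : \sum_j M' k j * cofactor (M t) k j = \det (Mk k).
    rewrite (expand_det_row _ k); apply: eq_bigr => j _; rewrite mxE eqxx; congr (_ * _).
    rewrite /cofactor; congr (_ * \det _); apply/matrixP => a b; rewrite !mxE.
    by rewrite eq_sym (negbTE (neq_lift _ _)).
  rewrite /mxtrace.
  under eq_bigr => k _.
    rewrite mxE (eq_bigr (fun j => M' k j * cofactor (M t) k j)); last by move=> j _; rewrite mxE.
    rewrite e /determinant; over.
  rewrite exchange_big /=; apply: eq_bigr => s _; rewrite mulr_sumr; apply: eq_bigr => k _.
  congr (_ * _); rewrite (bigD1 k)//= mxE eqxx; congr (_ * _).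
  by apply: eq_bigr => i ik; rewrite mxE (negbTE ik).
rewrite /determinant; apply: cder_sum => s _.
have := cderM (cder_cst ((-1) ^+ s) t)
  (cder_prod (index_enum_uniq _) (fun i => dM i (s i))).
by rewrite mul0r addr0.
Qed.

Definition mxder n (M : R -> 'M[R]_n) t (M' : 'M[R]_n) :=
  forall i j, is_derive t 1 (fun s => M s i j) (M' i j).

Lemma mxder_cst n (A : 'M[R]_n) t : mxder (fun=> A) t 0.
Proof. by move=> i j; rewrite mxE; exact: is_derive_cst. Qed.

Lemma mxderD n (M P : R -> 'M[R]_n) t M' P' : mxder M t M' -> mxder P t P' ->
  mxder (fun s => M s + P s) t (M' + P').
Proof.
move=> dM dP i j; rewrite mxE; under eq_fun do rewrite mxE.
exact: is_derive_add.
Qed.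

Lemma mxderM n (M P : R -> 'M[R]_n) t M' P' : mxder M t M' -> mxder P t P' ->
  mxder (fun s => M s *m P s) t (M' *m P t + M t *m P').
Proof.
move=> dM dP i j; rewrite mxE [X in X + _]mxE [X in _ + X]mxE -big_split /=.
under eq_fun do rewrite mxE.
apply: is_derive_bigsum => k _; apply: (is_derive_eq (is_derive_mul (dM i k) (dP k j))).
by rewrite addrC [P t k j * _]mulrC.
Qed.

Lemma mxder_unique n (M : R -> 'M[R]_n) t M' M'' : mxder M t M' -> mxder M t M'' -> M' = M''.
Proof.
move=> d1 d2; apply/matrixP => i j; have [_ <-] := d1 i j; by have [_ <-] := d2 i j.
Qed.

Lemma derivable_det n (M : R -> 'M[R]_n) t :
  (forall i j, derivable (fun s => M s i j) t 1) -> derivable (fun s => \det (M s)) t 1.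
Proof.
move=> dM; rewrite /determinant.
have h (s : {perm 'I_n}) : is_derive t 1 (fun r => (-1) ^+ s * \prod_i M r i (s i))
    ('D_1 (fun r => (-1) ^+ s * \prod_i M r i (s i)) t).
  apply: derivableP.
  have d : derivable (fun r => \prod_i M r i (s i)) t 1.
    by apply: derivable_bigprod => i _; exact: dM.
  exact: (@derivableM _ _ (fun=> (-1) ^+ s) (fun r => \prod_i M r i (s i)) _ _ (derivable_cst _ _ _) d).
by have [] := @is_derive_bigsum _ (index_enum {perm 'I_n}) xpredT _ _ t (fun s _ => h s).
Qed.

(** The cofactor formula gives differentiability of the entries; the value follows by
    differentiating M M^-1 = 1. *)
Lemma mxder_inv n (M : R -> 'M[R]_n) t M' : mxder M t M' ->
  (\forall s \near t, M s \in unitmx) ->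
  mxder (fun s => invmx (M s)) t (- (invmx (M t) *m M' *m invmx (M t))).
Proof.
move=> dM nu; have ut := nbhs_singleton nu.
have dent i j : derivable (fun s => M s i j) t 1 by have [] := dM i j.
have dI i j : derivable (fun s => invmx (M s) i j) t 1.
  have d1 : derivable (fun s => (\det (M s))^-1 * cofactor (M s) j i) t 1.
    apply: (@derivableM _ _ (fun s => (\det (M s))^-1) (fun s => cofactor (M s) j i)).
      apply: (@derivableV _ _ (fun s => \det (M s))); last exact: derivable_det.
      by rewrite -unitfE -unitmxE.
    rewrite /cofactor; apply: (@derivableZ _ _ _ (fun s => \det (row' j (col' i (M s))))).
    apply: derivable_det => a b; under eq_fun do rewrite !mxE; exact: dent.
  apply: near_eq_derivable d1.
  by apply: filterS nu => s us; rewrite /invmx us !mxE.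
pose I' : 'M[R]_n := \matrix_(i, j) 'D_1 (fun s => invmx (M s) i j) t.
have dI' : mxder (fun s => invmx (M s)) t I'.
  by move=> i j; rewrite mxE; apply: derivableP; exact: dI.
have e : M' *m invmx (M t) + M t *m I' = 0.
  apply: (mxder_unique (mxderM dM dI')) => i j.
  have := mxder_cst 1%:M t i j; apply: near_eq_is_derive.
  by apply: filterS nu => s us; rewrite mulmxV.
suff -> : - (invmx (M t) *m M' *m invmx (M t)) = I' by [].
rewrite -mulmxA -mulmxN; apply: (can_inj (mulKmx ut)); rewrite mulKVmx//.
by apply/eqP; rewrite eq_sym -addr_eq0 addrC e.
Qed.

End MatrixDerivative.

(** * Continuous lifts of the argument *)

Section ArgumentLift.
Variable R : realType.
Implicit Types (p q : R -> R -> R) (a : R -> R).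

(** A continuous choice of the argument of u + iv along [0, 1]. Nothing is asked of the angle
    outside, except that continuity at the ends is two-sided. *)
Definition arglift (u v : R -> R) a := forall t, I01 t ->
  [/\ {for t, continuous a},
      u t = Num.sqrt (u t ^+ 2 + v t ^+ 2) * cos (a t) &
      v t = Num.sqrt (u t ^+ 2 + v t ^+ 2) * sin (a t)].

Lemma cos_atan_div (x y : R) : 0 < x ->
  x = Num.sqrt (x ^+ 2 + y ^+ 2) * cos (atan (y / x)) /\
  y = Num.sqrt (x ^+ 2 + y ^+ 2) * sin (atan (y / x)).
Proof.
move=> x0; have p1 : 0 < 1 + (y / x) ^+ 2 by rewrite ltr_pwDl ?sqr_ge0.
have e : Num.sqrt (x ^+ 2 + y ^+ 2) = x * Num.sqrt (1 + (y / x) ^+ 2).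
  have -> : x ^+ 2 + y ^+ 2 = x ^+ 2 * (1 + (y / x) ^+ 2) by field; rewrite gt_eqF.
  by rewrite sqrtrM ?sqr_ge0// sqrtr_sqr gtr0_norm.
have s0 : Num.sqrt (1 + (y / x) ^+ 2) != 0 by rewrite gt_eqF// sqrtr_gt0.
have c : cos (atan (y / x)) = (Num.sqrt (1 + (y / x) ^+ 2))^-1 by rewrite cos_atan.
have s : sin (atan (y / x)) = (y / x) * cos (atan (y / x)).
  by rewrite -[X in _ = X * _]atanK /tan divfK// c invr_eq0.
rewrite s c e; split; first by rewrite mulfK.
by move: s0; set w := Num.sqrt _ => w0; field; rewrite w0 gt_eqF.
Qed.

(* The new argument is the old one plus the principal argument of the quotient. *)
Lemma arglift_step (u v u' v' : R -> R) a : arglift u v a ->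
  (forall t, I01 t -> [/\ {for t, continuous u}, {for t, continuous v},
     {for t, continuous u'} & {for t, continuous v'}]) ->
  (forall t, I01 t -> 0 < u t * u' t + v t * v' t) ->
  exists2 a', arglift u' v' a' &
    forall t, I01 t -> u' t = u t -> v' t = v t -> a' t = a t.
Proof.
move=> la cu pos.
pose X t := u t * u' t + v t * v' t; pose Y t := u t * v' t - v t * u' t.
exists (fun t => a t + atan (Y t / X t)).
  move=> t It; have [ca e1 e2] := la t It; have [c1 c2 c3 c4] := cu t It.
  have X0 : 0 < X t by exact: pos.
  have cX : {for t, continuous X} by apply: contD; apply: contM.
  have cY : {for t, continuous Y} by apply: cvgB; apply: cvgM.
  split.
  - apply: contD => //.
    have cq : {for t, continuous (fun t => Y t / X t)}.
      by apply: contM => //; apply: cvgV => //; rewrite gt_eqF.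
    exact: (continuous_comp cq (@continuous_atan R _)).
  - have [h1 h2] := cos_atan_div (Y t) X0.
    set b := atan _ in h1 h2 *; set r := Num.sqrt (u t ^+ 2 + v t ^+ 2) in e1 e2.
    set r' := Num.sqrt (u' t ^+ 2 + v' t ^+ 2).
    have XY : X t ^+ 2 + Y t ^+ 2 = (u t ^+ 2 + v t ^+ 2) * (u' t ^+ 2 + v' t ^+ 2).
      by rewrite /X /Y; ring.
    have rr : Num.sqrt (X t ^+ 2 + Y t ^+ 2) = r * r'.
      by rewrite XY sqrtrM// addr_ge0// sqr_ge0.
    rewrite rr in h1 h2.
    have r0 : r != 0.
      apply: contraTneq X0 => r0; rewrite -leNgt /X e1 e2 r0 !mul0r.
      by rewrite add0r.
    have r2 : u t ^+ 2 + v t ^+ 2 = r ^+ 2 by rewrite sqr_sqrtr// addr_ge0// sqr_ge0.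
    apply: (mulfI r0); apply: (mulfI r0); rewrite cosD.
    have -> : r * (r * u' t) = u t * X t - v t * Y t.
      by rewrite mulrA -expr2 -r2 /X /Y; ring.
    rewrite h1 h2; rewrite {1}e1 {1}e2; ring.
  - have [h1 h2] := cos_atan_div (Y t) X0.
    set b := atan _ in h1 h2 *; set r := Num.sqrt (u t ^+ 2 + v t ^+ 2) in e1 e2.
    set r' := Num.sqrt (u' t ^+ 2 + v' t ^+ 2).
    have XY : X t ^+ 2 + Y t ^+ 2 = (u t ^+ 2 + v t ^+ 2) * (u' t ^+ 2 + v' t ^+ 2).
      by rewrite /X /Y; ring.
    have rr : Num.sqrt (X t ^+ 2 + Y t ^+ 2) = r * r'.
      by rewrite XY sqrtrM// addr_ge0// sqr_ge0.
    rewrite rr in h1 h2.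
    have r0 : r != 0.
      apply: contraTneq X0 => r0; rewrite -leNgt /X e1 e2 r0 !mul0r.
      by rewrite add0r.
    have r2 : u t ^+ 2 + v t ^+ 2 = r ^+ 2 by rewrite sqr_sqrtr// addr_ge0// sqr_ge0.
    apply: (mulfI r0); apply: (mulfI r0); rewrite sinD.
    have -> : r * (r * v' t) = v t * X t + u t * Y t.
      by rewrite mulrA -expr2 -r2 /X /Y; ring.
    rewrite h1 h2; rewrite {1}e1 {1}e2; ring.
move=> t It uu vv; rewrite /Y uu vv [v t * u t]mulrC subrr mul0r atan0 addr0//.
Qed.

Lemma I01_compact : compact (@I01 R).
Proof.
have -> : @I01 R = `[0, 1]%classic by apply/seteqP; split => t /=; rewrite in_itv.
exact: segment_compact.
Qed.

(** On the compact square p^2 + q^2 >= m > 0, and uniform continuity gives slices at nearby s a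
    positive inner product; [arglift_step] carries the argument through finitely many slices. The
    last clause keeps the angle unchanged at times where (p, q) does not depend on s, in particular
    at fixed ends. *)
Lemma arglift_homotopy p q a :
  (forall s t, I01 s -> I01 t -> {for (s, t), continuous (fun z : R * R => p z.1 z.2)} /\
     {for (s, t), continuous (fun z : R * R => q z.1 z.2)}) ->
  (forall s t, I01 s -> I01 t -> 0 < p s t ^+ 2 + q s t ^+ 2) ->
  arglift (p 0) (q 0) a ->
  exists2 a', arglift (p 1) (q 1) a' & forall t, I01 t ->
    (forall s, I01 s -> p s t = p 0 t /\ q s t = q 0 t) -> a' t = a t.
Proof.
move=> cpq pos la.
pose S : set (R * R) := I01 `*` I01.
have cS : compact S by apply: compact_setX; exact: I01_compact.
pose f (z : R * R) := p z.1 z.2 ^+ 2 + q z.1 z.2 ^+ 2.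
have cf z : S z -> {for z, continuous f}.
  case: z => s t [/= Is It]; have [c1 c2] := cpq s t Is It.
  by apply: contD; [exact: (contM c1 c1)|exact: (contM c2 c2)].
have i00 : @I01 R 0 by rewrite /I01 /= lexx ler01.
have i11 : @I01 R 1 by rewrite /I01 /= lexx ler01.
have [m m0 hm] : exists2 m, 0 < m & forall s t, I01 s -> I01 t -> m <= f (s, t).
  have Sn : S !=set0 by exists (0, 0).
  have cfS : {within S, continuous f}.
    by apply: continuous_in_subspaceT => z; rewrite inE; exact: cf.
  have [z zS hz] := @compact_EVT_min _ R f S Sn cS cfS.
  move: zS; rewrite inE => -[/= Is It]; exists (f z); first by case: z hz Is It => ? ? _; exact: pos.
  by move=> s t Is' It'; apply: hz; rewrite inE.
pose D (z : R * R) (w : R * R) := p z.1 z.2 * p w.1 w.2 + q z.1 z.2 * q w.1 w.2.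
have m4 : 0 < m / 4 by rewrite divr_gt0.
have [M M0 hM] : exists2 M, 0 < M & forall s t, I01 s -> I01 t -> `|p s t| <= M /\ `|q s t| <= M.
  have Sn : S !=set0 by exists (0, 0).
  have cfS : {within S, continuous f}.
    by apply: continuous_in_subspaceT => z; rewrite inE; exact: cf.
  have [z zS hz] := @compact_EVT_max _ R f S Sn cS cfS.
  have fz : 0 < f z by move: zS; rewrite inE => -[]; case: z {hz} => ? ? /= *; exact: pos.
  exists (f z + 1); first by rewrite addr_gt0.
  move=> s t Is It; have := hz (s, t); rewrite inE => /(_ (conj Is It)) h.
  rewrite /f /= in h fz.
  have aux (x y A : R) : 0 < A -> x ^+ 2 + y ^+ 2 <= A -> `|x| <= A + 1.
    move=> A0 xyA; have := sqr_ge0 y; have := sqr_ge0 (`|x| - 1).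
    rewrite sqrrB expr1n mulr1 real_normK ?num_real//; lra.
  by split; [apply: (aux _ (q s t))|apply: (aux _ (p s t)); rewrite // addrC].
(* As |p| and |q| are at most M, an oscillation below e keeps the inner product of two slices at
   least m - m/4 - m/4. *)
pose e := m / (4 * M).
have e0 : 0 < e by rewrite divr_gt0// mulr_gt0.
have [d1 d10 h1] := compact_unif cS (fun z Sz => (cpq z.1 z.2 Sz.1 Sz.2).1 :
   {for z, continuous (fun z : R * R => p z.1 z.2)}) e0.
have [d2 d20 h2] := compact_unif cS (fun z Sz => (cpq z.1 z.2 Sz.1 Sz.2).2 :
   {for z, continuous (fun z : R * R => q z.1 z.2)}) e0.
have close s s' t : I01 s -> I01 s' -> I01 t -> `|s - s'| < Num.min d1 d2 ->
    0 < p s t * p s' t + q s t * q s' t.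
  move=> Is Is' It; rewrite lt_min => /andP[sd1 sd2].
  have b d : `|s - s'| < d -> ball ((s, t) : R * R) d (s', t).
    by move=> sd; split=> /=; [rewrite -ball_normE|apply: ballxx; exact: le_lt_trans sd].
  have a1 := h1 (s, t) (s', t) (conj Is It) (b _ sd1).
  have a2 := h2 (s, t) (s', t) (conj Is It) (b _ sd2).
  have [b1 b2] := hM s t Is It; have := hm s t Is It; rewrite /f /= in a1 a2 * => hms.
  have k1 : p s t * (p s t - p s' t) <= m / 4.
    apply: le_trans (ler_norm _) _; rewrite normrM.
    apply: (@le_trans _ _ (M * e)); first by rewrite ler_pM// ltW.
    by rewrite /e le_eqVlt; apply/orP; left; apply/eqP; field; rewrite gt_eqF.
  have k2 : q s t * (q s t - q s' t) <= m / 4.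
    apply: le_trans (ler_norm _) _; rewrite normrM.
    apply: (@le_trans _ _ (M * e)); first by rewrite ler_pM// ltW.
    by rewrite /e le_eqVlt; apply/orP; left; apply/eqP; field; rewrite gt_eqF.
  rewrite !mulrBr -!expr2 in k1 k2; lra.
have dm0 : 0 < Num.min d1 d2 by rewrite lt_min d10.
have [k hk] : exists k : nat, k.+1%:R^-1 < Num.min d1 d2.
  have [k _ /(_ k (leqnn k)) h] := near_infty_natSinv_lt (PosNum dm0); by exists k.
have ik j : (j <= k.+1)%N -> I01 (j%:R / k.+1%:R : R).
  move=> jk; rewrite /I01 /= divr_ge0// ler_pdivrMr// mul1r ler_nat//.
have ct s t : I01 s -> I01 t -> {for t, continuous (p s)} /\ {for t, continuous (q s)}.
  move=> Is It; have [c1 c2] := cpq s t Is It.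
  split.
    exact: (continuous_comp (@cont_pairl _ _ s t) c1).
  exact: (continuous_comp (@cont_pairl _ _ s t) c2).
have step j : (j <= k.+1)%N -> exists2 a', arglift (p (j%:R / k.+1%:R)) (q (j%:R / k.+1%:R)) a' &
    forall t, I01 t -> (forall s, I01 s -> p s t = p 0 t /\ q s t = q 0 t) -> a' t = a t.
  elim: j => [_|j IH jk]; first by exists a => //; rewrite mul0r.
  have [a' la' ha'] := IH (ltnW jk).
  have [|t It|a'' la'' ha''] := arglift_step la' _ _ (u' := p (j.+1%:R / k.+1%:R))
     (v' := q (j.+1%:R / k.+1%:R)).
  - move=> t It; have [c1 c2] := ct _ _ (ik _ (ltnW jk)) It; have [c3 c4] := ct _ _ (ik _ jk) It.
    by split.
  - apply: close => //; [exact/ik/ltnW|exact: ik|].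
    rewrite -mulrBl -[j.+1%:R]natr1 opprD addrA subrr sub0r mulN1r normrN.
    by rewrite ger0_norm// invr_ge0.
  exists a'' => // t It hs; have [e1 e2] := hs _ (ik _ (ltnW jk)).
  have [e3 e4] := hs _ (ik _ jk); rewrite ha'' ?ha'//; [by rewrite e1 e3|by rewrite e2 e4].
by have := step k.+1 (leqnn _); rewrite divff.
Qed.

Lemma is_derive_comp1 (f g : R -> R) (t a b : R) :
  is_derive (g t) 1 f a -> is_derive t 1 g b -> is_derive t 1 (fun s => f (g s)) (a * b).
Proof.
move=> df dg; have [df1 df2] := df.
have dif : differentiable f (g t) by apply/derivable1_diffP.
apply: (is_derive_eq (chain_curve dif dg)).
rewrite deriveE// -[b in LHS]mulr1 -[b * 1]/(b *: (1 : R)) linearZ /= -deriveE// df2.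
by rewrite mulrC.
Qed.

Lemma is_derive_div (f g : R -> R) (t a b : R) : g t != 0 ->
  is_derive t 1 f a -> is_derive t 1 g b ->
  is_derive t 1 (fun s => f s / g s) (a / g t - f t * b / g t ^+ 2).
Proof.
move=> g0 df dg; have [dg1 dg2] := dg.
have di : is_derive t 1 (fun s => (g s)^-1) (- b / g t ^+ 2).
  split; first exact: (derivableV g0 dg1).
  have := deriveV g0 dg1; rewrite dg2 => ->.
  by rewrite -[LHS]/(- (g t) ^- 2 * b) mulNr mulrC mulNr.
apply: (is_derive_eq (is_derive_mul df di)).
by field.
Qed.

(** Near t the argument is exactly a t + atan (Y s / X s), where X + iY is w(s) times the conjugate
    of w(t) for w = u + iv; continuity of a excludes other branches. The quotient is differentiated
    at t, where Y vanishes. *)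
Lemma arglift_derive (u v : R -> R) a (t du dv : R) : 0 < t < 1 -> arglift u v a ->
  0 < u t ^+ 2 + v t ^+ 2 ->
  is_derive t 1 u du -> is_derive t 1 v dv ->
  is_derive t 1 a ((u t * dv - v t * du) / (u t ^+ 2 + v t ^+ 2)).
Proof.
move=> /andP[t0 t1] la pos du' dv'.
have It : I01 t by rewrite /I01 /= !ltW.
have [ca e1 e2] := la t It.
pose X s := u t * u s + v t * v s; pose Y s := u t * v s - v t * u s.
have Xt : X t = u t ^+ 2 + v t ^+ 2 by rewrite /X !expr2.
have Yt : Y t = 0 by rewrite /Y mulrC subrr.
have dX : is_derive t 1 X (u t * du + v t * dv).
  apply: (is_derive_eq (is_derive_add (is_derive_mul (is_derive_cst (u t) t 1) du')
     (is_derive_mul (is_derive_cst (v t) t 1) dv'))).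
  by rewrite !mulr0 !addr0.
have dY : is_derive t 1 Y (u t * dv - v t * du).
  apply: (is_derive_eq (is_derive_sub (is_derive_mul (is_derive_cst (u t) t 1) dv')
     (is_derive_mul (is_derive_cst (v t) t 1) du'))).
  by rewrite !mulr0 !addr0.
have Xt0 : X t != 0 by rewrite Xt gt_eqF.
have dq := is_derive_div Xt0 dY dX; rewrite Yt !mul0r subr0 Xt in dq.
have dat : is_derive (Y t / X t) 1 (@atan R) 1.
  apply: (is_derive_eq (is_derive1_atan (Y t / X t))).
  by rewrite Yt mul0r expr0n addr0 invr1.
have := is_derive_add (is_derive_cst (a t) t 1) (@is_derive_comp1 (@atan R) (fun s => Y s / X s) t _ _ dat dq).
rewrite add0r mul1r; apply: near_eq_is_derive.
have pi0 : 0 < pi / 2 :> R by rewrite divr_gt0// pi_gt0.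
have n1 : \forall s \near t, `|a t - a s| < pi / 2 by move/cvgrPdist_lt: ca; exact.
have n2 : \forall s \near t, I01 s.
  have : \forall s \near t, s \in `]0, 1[.
    by apply: near_in_itvoo; rewrite in_itv/= t0.
  by apply: filterS => s; rewrite in_itv/= /I01 /= => /andP[/ltW-> /ltW->].
have n3 : \forall s \near t, 0 < u s ^+ 2 + v s ^+ 2.
  have cu : {for t, continuous u} by apply/differentiable_continuous/derivable1_diffP; have [] := du'.
  have cv : {for t, continuous v} by apply/differentiable_continuous/derivable1_diffP; have [] := dv'.
  have cw : {for t, continuous (fun s => u s * u s + v s * v s)} by apply: contD; apply: contM.
  rewrite !expr2 in pos.
  exact: (cvgr_gt _ cw _ pos).
near=> s.
have ats : `|a t - a s| < pi / 2 by near: s; exact: n1.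
have Is : I01 s by near: s; exact: n2.
have [_ f1 f2] := la s Is.
set r := Num.sqrt (u t ^+ 2 + v t ^+ 2) in e1 e2.
set r' := Num.sqrt (u s ^+ 2 + v s ^+ 2) in f1 f2.
have inI : a s - a t \in `](- (pi / 2)), (pi / 2)[%R.
  by rewrite in_itv/= -ltr_norml distrC.
have XE : X s = r * r' * cos (a s - a t).
  by rewrite /X e1 e2 f1 f2 cosB; ring.
have YE : Y s = r * r' * sin (a s - a t).
  by rewrite /Y e1 e2 f1 f2 sinB; ring.
have c0 : 0 < cos (a s - a t) by apply: cos_gt0_pihalf; move: inI; rewrite in_itv.
have rr : r * r' != 0.
  rewrite mulf_neq0 ?gt_eqF ?sqrtr_gt0//; near: s; exact: n3.
have -> : Y s / X s = tan (a s - a t).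
  by rewrite XE YE /tan invfM mulrACA divff// mul1r.
by rewrite tanK// addrC subrK.
Unshelve. all: by end_near.
Qed.

End ArgumentLift.

(** * Positive paths avoid the eigenvalue -1 *)

Section ComplexContinuity.
Variables (R : realType) (T : topologicalType).
Local Notation C := R[i].
Local Notation Re := complex.Re.
Local Notation Im := complex.Im.
Implicit Types (f g : T -> C) (x : T).

Definition ccont f x :=
  {for x, continuous (fun y => Re (f y))} /\ {for x, continuous (fun y => Im (f y))}.

Lemma ccont_cst (c : C) x : ccont (fun=> c) x.
Proof. by split; exact: cont_cst. Qed.

Lemma ccontD f g x : ccont f x -> ccont g x -> ccont (fun y => f y + g y) x.
Proof.
move=> [f1 f2] [g1 g2]; split.
  rewrite (_ : (fun y => _) = (fun y => Re (f y) + Re (g y))); first exact: contD.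
  by apply/funext => y; rewrite cReD.
rewrite (_ : (fun y => _) = (fun y => Im (f y) + Im (g y))); first exact: contD.
by apply/funext => y; rewrite cImD.
Qed.

Lemma contN (f : T -> R) x : {for x, continuous f} -> {for x, continuous (fun y => - f y)}.
Proof. by move=> cf; exact: (cvgN cf). Qed.

Lemma ccontM f g x : ccont f x -> ccont g x -> ccont (fun y => f y * g y) x.
Proof.
move=> [f1 f2] [g1 g2]; split.
  rewrite (_ : (fun y => _) = (fun y => Re (f y) * Re (g y) + - (Im (f y) * Im (g y)))).
    by apply: contD; [exact: contM|apply: contN; exact: contM].
  by apply/funext => y; rewrite cReM.
rewrite (_ : (fun y => _) = (fun y => Re (f y) * Im (g y) + Im (f y) * Re (g y))).
  by apply: contD; exact: contM.
by apply/funext => y; rewrite cImM.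
Qed.

Lemma ccont_sum (I : Type) (r : seq I) (f : I -> T -> C) x :
  (forall i, ccont (f i) x) -> ccont (fun y => \sum_(i <- r) f i y) x.
Proof.
move=> cf; elim: r => [|i r IH].
  by under eq_fun do rewrite big_nil; exact: ccont_cst.
by under eq_fun do rewrite big_cons; exact: ccontD.
Qed.

Lemma ccont_prod (I : Type) (r : seq I) (f : I -> T -> C) x :
  (forall i, ccont (f i) x) -> ccont (fun y => \prod_(i <- r) f i y) x.
Proof.
move=> cf; elim: r => [|i r IH].
  by under eq_fun do rewrite big_nil; exact: ccont_cst.
by under eq_fun do rewrite big_cons; exact: ccontM.
Qed.

Lemma ccont_det n (M : T -> 'M[C]_n) x : (forall i j, ccont (fun y => M y i j) x) ->
  ccont (fun y => \det (M y)) x.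
Proof.
move=> cM; rewrite /determinant; apply: ccont_sum => s.
by apply: ccontM; [exact: ccont_cst|apply: ccont_prod].
Qed.

Lemma cont_det n (M : T -> 'M[R]_n) x : (forall i j, {for x, continuous (fun y => M y i j)}) ->
  {for x, continuous (fun y => \det (M y))}.
Proof.
move=> cM; rewrite /determinant; apply: cont_sum => s _.
by apply: contM; [exact: cont_cst|apply: cont_prod].
Qed.

End ComplexContinuity.

(** * Traces and determinants in a unitary eigenbasis *)

Section HermitianTrace.
Variable R : realType.
Local Notation C := R[i].
Local Notation Re := complex.Re.
Local Notation Im := complex.Im.
Local Open Scope complex_scope.
Local Open Scope sesquilinear_scope.
Local Notation rc := (map_mx (real_complex R)).
Variable N : nat.
Implicit Types (V : 'M[C]_N) (x : 'rV[R]_N) (E S B : 'M[R]_N).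

Definition udiag B V x := [/\ V *m V^t* = 1%:M, V^t* *m V = 1%:M
  & V *m cmx B = diag_mx (rc x) *m V].

Lemma udiag_exists B : B^T = B -> exists V x, udiag B V x.
Proof.
move=> Bs; have Bh : (cmx B)^t* = cmx B by rewrite cmx_trC Bs.
have [V [x [_ V1 V2 VB xR]]] := hermitian_diagonalize Bh.
exists V, (map_mx (@Re R) x); split => //; rewrite VB; congr (diag_mx _ *m _).
by apply/rowP => k; rewrite !mxE; have := xR k; move=> /RRe_real <-.
Qed.

Lemma udiagE B V x : udiag B V x -> cmx B = V^t* *m diag_mx (rc x) *m V.
Proof. by move=> [V1 V2 VB]; rewrite -mulmxA -VB mulmxA V2 mul1mx. Qed.

Lemma udiag_val B V x k : udiag B V x -> x 0 k = Re ((V *m cmx B *m V^t*) k k).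
Proof. by move=> [V1 V2 VB]; rewrite VB -mulmxA V1 mulmx1 !mxE eqxx mulr1n. Qed.

Lemma tr_cmx E : \tr (cmx E) = (\tr E)%:C.
Proof.
rewrite /mxtrace -[RHS]/(real_complex R _) rmorph_sum; apply: eq_bigr => k _.
by rewrite /cmx mxE.
Qed.

Lemma sum_udiag E V : V *m V^t* = 1%:M -> V^t* *m V = 1%:M ->
  \sum_k Re ((V *m cmx E *m V^t*) k k) = \tr E.
Proof.
move=> V1 V2; rewrite -cRe_sum -[\sum_k _]/(\tr (V *m cmx E *m V^t*)).
by rewrite mxtrace_mulC mulmxA V2 mul1mx tr_cmx.
Qed.

Lemma udiag_gt0 E V k : V *m V^t* = 1%:M -> E^T = E -> posdef E ->
  0 < Re ((V *m cmx E *m V^t*) k k).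
Proof.
move=> V1 Es Ep; have Ec := posdef_cmx Es Ep.
have Vu : V \in unitmx by case: (mulmx1_unit V1).
have := posdefC_diag k (posdefC_conj Vu Ec).
by rewrite ltcE => /andP[].
Qed.

Lemma det_udiag S V x : udiag S V x -> \det S = \prod_k x 0 k.
Proof.
move=> h; have [V1 V2 VB] := h.
have e : (\det S)%:C = \prod_k (x 0 k)%:C.
  rewrite -det_cmx (udiagE h) !det_mulmx mulrAC -det_mulmx V2 det1 mul1r det_diag.
  by apply: eq_bigr => k _; rewrite mxE.
by move: e; rewrite -[RHS](rmorph_prod (real_complex R)) => -[].
Qed.

Lemma tr_mul_inv E S V x : udiag S V x -> (forall k, x 0 k != 0) ->
  S \in unitmx /\ \tr (E *m invmx S) = \sum_k Re ((V *m cmx E *m V^t*) k k) / x 0 k.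
Proof.
move=> h x0; have [V1 V2 VB] := h.
have Su : S \in unitmx.
  by rewrite unitmxE (det_udiag h) unitfE; apply/prodf_neq0 => k _.
split=> //.
pose y : 'rV[R]_N := \row_k (x 0 k)^-1.
have e : cmx (invmx S) = V^t* *m diag_mx (rc y) *m V.
  have SS : cmx S *m cmx (invmx S) = 1%:M by rewrite -cmxM mulmxV// cmx1.
  have Sc : cmx S \in unitmx by case: (mulmx1_unit SS).
  have s1 : diag_mx (rc x) *m diag_mx (rc y) = 1%:M.
    rewrite mulmx_diag (_ : \row_j _ = const_mx 1) ?diag_const_mx//.
    by apply/rowP => k; rewrite !mxE -[LHS](rmorphM (real_complex R)) mulfV// rmorph1.
  apply: (can_inj (mulKmx Sc)); rewrite SS (udiagE h) -!mulmxA.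
  rewrite (mulmxA V (V^t*)) V1 mul1mx (mulmxA (diag_mx (rc x)) (diag_mx (rc y))) s1.
  by rewrite mul1mx V2.
have : (\tr (E *m invmx S))%:C = \sum_k (V *m cmx E *m V^t*) k k * ((x 0 k)^-1)%:C.
  rewrite -tr_cmx cmxM e !mulmxA mxtrace_mulC !mulmxA /mxtrace.
  by apply: eq_bigr => k _; rewrite mul_mx_diag !mxE.
move=> /(congr1 (@Re R)) /= ->; rewrite cRe_sum; apply: eq_bigr => k _.
by rewrite mulrC cReMr mulrC.
Qed.

Lemma tr_mul_inv_ge0 E S : E^T = E -> posdef E -> S^T = S -> posdef S ->
  0 <= \tr (E *m invmx S).
Proof.
move=> Es Ep Ss Sp; have [V [x h]] := udiag_exists Ss; have [V1 V2 _] := h.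
have xp k : 0 < x 0 k by rewrite (udiag_val _ h) udiag_gt0.
have [_ ->] := tr_mul_inv E h (fun k => lt0r_neq0 (xp k)).
by apply: sumr_ge0 => k _; rewrite divr_ge0 ?ltW// udiag_gt0.
Qed.

Lemma udiag_bounds B V x k : B^T = B -> posdef B -> udiag B V x -> 0 < x 0 k <= \tr B.
Proof.
move=> Bs Bp h; have [V1 V2 _] := h; have xp j : 0 < x 0 j by rewrite (udiag_val _ h) udiag_gt0.
rewrite xp -(sum_udiag B V1 V2) (bigD1 k)//= -(udiag_val _ h) lerDl sumr_ge0// => j _.
by rewrite -(udiag_val _ h) ltW.
Qed.

Lemma udiag_sqr (c : R) B V x : udiag B V x ->
  udiag (c ^+ 2 *: 1%:M + B *m B) V (\row_k (c ^+ 2 + x 0 k ^+ 2)).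
Proof.
move=> [V1 V2 VB]; split=> //.
have cZ : cmx (c ^+ 2 *: 1%:M : 'M[R]_N) = (c ^+ 2)%:C *: 1%:M.
  rewrite -cmx1 /cmx; apply/matrixP => i j; rewrite !mxE -[LHS]/(real_complex R _).
  by rewrite rmorphM.
rewrite cmxD cmxM cZ mulmxDr -scalemxAr mulmx1 mulmxA VB -mulmxA VB mulmxA mulmx_diag.
rewrite !mul_diag_mx; apply/matrixP => i j; rewrite !mxE -mulrDl; congr (_ * _).
by rewrite -!rmorphM -rmorphD -expr2.
Qed.

(** In an eigenbasis of B the trace is the sum of E_kk / (c^2 + x_k^2), with E_kk > 0 and 0 < x_k <=
    tr B. *)
Lemma tr_resolvent_bounds (c : R) B E : 0 < c -> B^T = B -> posdef B -> E^T = E -> posdef E ->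
  let t := \tr (E *m invmx (c ^+ 2 *: 1%:M + B *m B)) in
  \tr E / (c ^+ 2 + (\tr B) ^+ 2) <= t <= \tr E / c ^+ 2.
Proof.
move=> c0 Bs Bp Es Ep /=; have [V [x h]] := udiag_exists Bs; have [V1 V2 _] := h.
have c2 : 0 < c ^+ 2 by rewrite exprn_gt0.
have p k : 0 < c ^+ 2 + x 0 k ^+ 2 by rewrite ltr_wpDr// sqr_ge0.
have [|_ ->] := tr_mul_inv E (udiag_sqr c h).
  by move=> k; rewrite mxE gt_eqF.
rewrite -(sum_udiag E V1 V2) !mulr_suml.
apply/andP; split; apply: ler_sum => k _; have e0 := udiag_gt0 k V1 Es Ep;
  rewrite (ler_pM2l e0); have /andP[x0 xB] := udiag_bounds k Bs Bp h; rewrite mxE.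
  have xB2 : x 0 k ^+ 2 <= (\tr B) ^+ 2.
    by rewrite ler_sqr// nnegrE; [exact: ltW|exact: le_trans (ltW x0) xB].
  by rewrite lef_pV2 ?posrE// ?lerD2l// (lt_le_trans (p k))// lerD2l.
by rewrite lef_pV2 ?posrE// lerDl sqr_ge0.
Qed.

Lemma det_resolvent_le (c : R) B : B^T = B -> posdef B ->
  0 <= \det (c ^+ 2 *: 1%:M + B *m B) <= (c ^+ 2 + (\tr B) ^+ 2) ^+ N.
Proof.
move=> Bs Bp; have [V [x h]] := udiag_exists Bs.
rewrite (det_udiag (udiag_sqr c h)).
have p k : 0 <= c ^+ 2 + x 0 k ^+ 2 by rewrite addr_ge0 ?sqr_ge0.
rewrite prodr_ge0 /=; last by move=> k _; rewrite mxE.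
have -> : (c ^+ 2 + (\tr B) ^+ 2) ^+ N = \prod_(k < N) (c ^+ 2 + (\tr B) ^+ 2).
  by rewrite prodr_const card_ord.
apply: ler_prod => k _; rewrite mxE p /=.
have /andP[x0 xB] := udiag_bounds k Bs Bp h.
by rewrite lerD2l ler_sqr// nnegrE; [exact: ltW|exact: le_trans (ltW x0) xB].
Qed.

End HermitianTrace.

(** * A determinant that never vanishes on the symplectic group *)

Section CrossingForm.
Variable R : realType.
Local Notation C := R[i].
Local Notation Re := complex.Re.
Local Notation Im := complex.Im.
Local Open Scope complex_scope.
Local Open Scope sesquilinear_scope.
Variables (n : nat) (c : R).
Local Notation J := (Jmx n : 'M[R]_(n + n)).
Implicit Types W A : 'M[R]_(n + n).

(* Nonsingular at every symplectic [W] when [0 < c], including those with eigenvalue [-1];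
   the argument of its determinant increases along positive paths. *)
Definition Mc W : 'M[C]_(n + n) :=
  c%:C *: cmx (W + 1%:M) - 'i%C *: cmx ((W - 1%:M) *m J).

(** For symplectic W this real matrix is Mc Mc^H ([Mc_mul_trC]), so its determinant is |det
    Mc|^2. *)
Definition Sc W : 'M[R]_(n + n) :=
  c ^+ 2 *: ((W + 1%:M) *m (W + 1%:M)^T) + (W - 1%:M) *m (W - 1%:M)^T.

Lemma trmxCDZ m (a b : C) (X Y : 'M[C]_m) :
  (a *: X - b *: Y)^t* = Num.conj a *: X^t* - Num.conj b *: Y^t*.
Proof. by apply/matrixP => i j; rewrite !mxE rmorphB !rmorphM. Qed.

Lemma trmxC_Mc W : (Mc W)^t* = c%:C *: cmx (W + 1%:M)^T + 'i%C *: cmx ((W - 1%:M) *m J)^T.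
Proof.
rewrite trmxCDZ !cmx_trC !conjCcE.
have -> : conjc c%:C = c%:C by rewrite /= oppr0.
have -> : conjc 'i%C = - 'i%C :> C by apply/eqP; rewrite eq_complex /= oppr0 !eqxx.
by rewrite scaleNr opprK.
Qed.

Lemma mulCii : 'i%C * 'i%C = -1 :> C.
Proof. by apply/eqP; rewrite eq_complex /= !(mul0r, mulr0, mulr1, sub0r, addr0, oppr0) !eqxx. Qed.

Lemma cmxZ m (a : R) (X : 'M[R]_m) : cmx (a *: X) = a%:C *: cmx X.
Proof. by apply/matrixP => i j; rewrite !mxE -[LHS]/(real_complex R _) rmorphM. Qed.

(** The imaginary part cancels because (W + 1) ((W - 1) J)^T is symmetric for symplectic W. *)
Lemma Mc_mul_trC W : W *m J *m W^T = J -> Mc W *m (Mc W)^t* = cmx (Sc W).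
Proof.
move=> sW; rewrite trmxC_Mc /Mc.
have e : (W + 1%:M) *m ((W - 1%:M) *m J)^T = ((W - 1%:M) *m J) *m (W + 1%:M)^T.
  have t1 : (W - 1%:M)^T = W^T - 1%:M by rewrite linearB /= trmx1.
  have t2 : (W + 1%:M)^T = W^T + 1%:M by rewrite linearD /= trmx1.
  rewrite trmx_mul t1 t2 Jmx_tr !(mulmxDl, mulmxDr, mulmxN, mulNmx, mul1mx, mulmx1) ?mulmxA sW.
  move: (W *m J) (J *m W^T) J => a b j.
  by apply/matrixP => x y; rewrite !mxE; ring.
have f : ((W - 1%:M) *m J) *m ((W - 1%:M) *m J)^T = (W - 1%:M) *m (W - 1%:M)^T.
  by rewrite trmx_mul mulmxA -[_ *m J *m J^T]mulmxA Jmx_tr mulmxN Jmx_sqr opprK mulmx1.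
rewrite mulmxBl !mulmxDr -!scalemxAl -!scalemxAr !scalerA -!cmxM e f.
rewrite ['i%C * c%:C]mulrC mulCii scaleN1r opprB addrA addrAC.
set X := cmx _; set Y := cmx _; set Z := cmx _.
rewrite addrK.
by rewrite /Sc cmxD cmxZ expr2 -[(c * c)%:C]/(real_complex R _) rmorphM.
Qed.

Lemma mulmx_tr_ge0 m (v : 'rV[R]_m) : 0 <= (v *m v^T) 0 0.
Proof. by rewrite mxE sumr_ge0// => k _; rewrite mxE -expr2 sqr_ge0. Qed.

Lemma mulmx_tr_eq0 m (v : 'rV[R]_m) : (v *m v^T) 0 0 = 0 -> v = 0.
Proof.
move=> h; apply/rowP => k; rewrite mxE; apply/eqP; rewrite -sqrf_eq0 eq_le sqr_ge0 andbT.
rewrite -h mxE (bigD1 k)//= mxE -expr2 lerDl sumr_ge0// => j _; by rewrite mxE -expr2 sqr_ge0.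
Qed.

Lemma Sc_tr W : (Sc W)^T = Sc W.
Proof.
have h (X Y : 'M[R]_(n + n)) (a : R) : (a *: X + Y)^T = a *: X^T + Y^T.
  by apply/matrixP => i j; rewrite !mxE.
by rewrite /Sc h !trmx_mul !trmxK.
Qed.

(** A vector annihilated by both squares satisfies v (W + 1) = v (W - 1) = 0, hence 2 v = 0; the
    eigenvalue -1 is no exception. *)
Lemma Sc_posdef W : 0 < c -> posdef (Sc W).
Proof.
move=> c0 v v0.
set p := v *m (W + 1%:M); set q := v *m (W - 1%:M).
have -> : (v *m Sc W *m v^T) 0 0 = c ^+ 2 * (p *m p^T) 0 0 + (q *m q^T) 0 0.
  rewrite /Sc mulmxDr mulmxDl -scalemxAr -scalemxAl mxE [X in X + _]mxE.
  by rewrite /p /q !trmx_mul !mulmxA.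
have a1 : 0 <= c ^+ 2 * (p *m p^T) 0 0 by rewrite mulr_ge0 ?sqr_ge0 ?mulmx_tr_ge0.
have a2 := mulmx_tr_ge0 q.
rewrite lt_def (addr_ge0 a1 a2) andbT.
apply: contra v0 => /eqP h.
have h1 : c ^+ 2 * (p *m p^T) 0 0 = 0 by apply/eqP; rewrite eq_le a1 andbT; lra.
have h2 : (q *m q^T) 0 0 = 0 by apply/eqP; rewrite eq_le a2 andbT; lra.
have p0 : p = 0.
  apply: mulmx_tr_eq0; apply/eqP; move/eqP: h1; rewrite mulf_eq0 expf_eq0 /= gt_eqF//.
have q0 := mulmx_tr_eq0 h2.
have : p - q = 0 by rewrite p0 q0 subrr.
rewrite /p /q -mulmxBr opprB addrC addrA addrNK -mulr2n -scaler_nat -scalemxAr mulmx1.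
by move/eqP; rewrite scaler_eq0 pnatr_eq0.
Qed.

Lemma Mc_sqr_det W : W *m J *m W^T = J ->
  Re (\det (Mc W)) ^+ 2 + Im (\det (Mc W)) ^+ 2 = \det (Sc W).
Proof.
move=> sW; have := congr1 determinant (Mc_mul_trC sW).
rewrite det_mulmx det_cmx det_map_mx det_tr mulC_conj sqr_cabs.
by move=> [].
Qed.

Lemma cmx_expand m (X Y P Q : 'M[R]_m) :
  (c%:C *: cmx X - 'i%C *: cmx (- Y)) *m (c%:C *: cmx P + 'i%C *: cmx Q) =
  cmx (c ^+ 2 *: (X *m P) - Y *m Q) + 'i%C *: cmx (c *: (X *m Q + Y *m P)).
Proof.
have -> : cmx (- Y) = - cmx Y by apply/matrixP => i j; rewrite !mxE -[LHS]/(real_complex R _) rmorphN.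
rewrite cmxB !cmxZ cmxD !cmxM scalerN opprK mulmxDl !mulmxDr -!scalemxAl -!scalemxAr !scalerA mulCii.
have -> : (c ^+ 2)%:C = c%:C * c%:C by rewrite expr2 -[LHS]/(real_complex R _) rmorphM.
move: (cmx X *m cmx P) (cmx X *m cmx Q) (cmx Y *m cmx P) (cmx Y *m cmx Q) => a b d f.
by apply/matrixP => i j; rewrite !mxE; ring.
Qed.

Lemma cmxM_expand m (X Y S : 'M[R]_m) :
  (cmx X + 'i%C *: cmx Y) *m cmx S = cmx (X *m S) + 'i%C *: cmx (Y *m S).
Proof. by rewrite mulmxDl -scalemxAl !cmxM. Qed.

(** Im tr (M' M^-1) is the derivative of the argument of det M. Since M^-1 = M^H S^-1, it comes from
    the imaginary part of M' M^H, which is 2 c W A W^T. *)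
Lemma Mc_im_trace W A : 0 < c -> W *m J *m W^T = J ->
  let W' := W *m A *m J in
  Im (\tr ((c%:C *: cmx W' - 'i%C *: cmx (W' *m J)) *m invmx (Mc W))) =
  2 * c * \tr (W *m A *m W^T *m invmx (Sc W)).
Proof.
move=> c0 sW W'; have Su := posdef_unit (Sc_posdef W c0).
have e : Mc W *m ((Mc W)^t* *m cmx (invmx (Sc W))) = 1%:M.
  by rewrite mulmxA Mc_mul_trC// -cmxM mulmxV// cmx1.
have Mu : Mc W \in unitmx by case: (mulmx1_unit e).
have -> : invmx (Mc W) = (Mc W)^t* *m cmx (invmx (Sc W)).
  by apply: (can_inj (mulKmx Mu)); rewrite e mulmxV.
have -> : W' *m J = - (W *m A) by rewrite /W' -mulmxA Jmx_sqr mulmxN mulmx1.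
rewrite trmxC_Mc.
set Q := (W - 1%:M) *m J; set P := W + 1%:M.
rewrite mulmxA cmx_expand cmxM_expand.
rewrite mxtraceD mxtraceZ !tr_cmx cImD cImM /= !(mul0r, mul1r, add0r, mulr0, addr0).
have -> : W' *m Q^T + W *m A *m P^T = 2 *: (W *m A *m W^T).
  rewrite /W' /Q /P trmx_mul Jmx_tr mulmxA mulmxN -[_ *m J *m J]mulmxA Jmx_sqr mulmxN mulmx1 opprK.
  have t1 : (W - 1%:M)^T = W^T - 1%:M by rewrite linearB /= trmx1.
  have t2 : (W + 1%:M)^T = W^T + 1%:M by rewrite linearD /= trmx1.
  rewrite t1 t2 !(mulmxDr, mulmxN, mulmx1) addrACA addNr addr0.
  by rewrite -mulr2n scaler_nat.
by rewrite scalerA -scalemxAl mxtraceZ ?addr0 mulrC [c * 2]mulrC mulrC.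
Qed.

(** Follows from (W + 1) B = -(W - 1) J and its transpose. The blow-up of B at the eigenvalue -1 is
    thus balanced by det (W + 1). *)
Lemma Sc_chart W : W *m J *m W^T = J -> W + 1%:M \in unitmx ->
  Sc W = (W + 1%:M) *m (c ^+ 2 *: 1%:M + cay W *m cay W) *m (W + 1%:M)^T.
Proof.
move=> sW uW; set P := W + 1%:M.
have bb : P *m (cay W *m cay W) *m P^T = (W - 1%:M) *m (W - 1%:M)^T.
  have e : P *m cay W = - ((W - 1%:M) *m J).
    rewrite /cay mulmxN !mulmxA; congr (- (_ *m _)).
    have -> : P *m (W - 1%:M) = (W - 1%:M) *m P.
      by rewrite /P !(mulmxDl, mulmxDr, mulmxN, mulNmx, mul1mx, mulmx1);
        move: (W *m W) (1%:M) => a b; apply/matrixP => i j; rewrite !mxE; ring.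
    by rewrite mulmxK.
  have e2 : cay W *m P^T = J *m (W - 1%:M)^T.
    have := congr1 trmx e; rewrite trmx_mul (cay_tr sW uW) => ->.
    by rewrite linearN /= trmx_mul Jmx_tr mulNmx opprK.
  rewrite mulmxA e -mulmxA e2 mulNmx mulmxA -[_ *m J *m J]mulmxA Jmx_sqr.
  by rewrite mulmxN mulmx1 mulNmx opprK.
by rewrite mulmxDr mulmxDl bb -scalemxAr mulmx1 -scalemxAl.
Qed.

(** In the Cayley chart the rate of the argument is c tr (B' (c^2 + B^2)^-1), where B' = 2 C A C^T
    is the velocity of B. *)
Lemma tr_chart W A : 0 < c -> W *m J *m W^T = J -> W + 1%:M \in unitmx ->
  2 * c * \tr (W *m A *m W^T *m invmx (Sc W)) =
  c * \tr (2 *: (cayC W *m A *m (cayC W)^T) *m invmx (c ^+ 2 *: 1%:M + cay W *m cay W)).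
Proof.
move=> c0 sW uW; set P := W + 1%:M; set S' := c ^+ 2 *: _ + _.
have uS := posdef_unit (Sc_posdef W c0).
have eS : Sc W = P *m S' *m P^T := Sc_chart sW uW.
have uP' : P^T \in unitmx by rewrite unitmx_tr.
have uS' : S' \in unitmx.
  by move: uS; rewrite eS !unitmx_mul => /andP[/andP[_]].
have -> : invmx (Sc W) = invmx P^T *m invmx S' *m invmx P.
  apply: (can_inj (mulKmx uS)); rewrite (mulmxV uS) eS !mulmxA.
  rewrite -[_ *m P^T *m invmx P^T]mulmxA (mulmxV uP') mulmx1.
  by rewrite -[_ *m S' *m invmx S']mulmxA (mulmxV uS') mulmx1 (mulmxV uW).
rewrite -scalemxAl mxtraceZ mulrA; congr (_ * _); first by rewrite mulrC.
rewrite !mulmxA mxtrace_mulC !mulmxA /cayC -/P trmx_mul trmx_inv.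
by rewrite !mulmxA.
Qed.

End CrossingForm.

(** * Argument estimates along positive curves *)

Section AvoidMinusOne.
Variable R : realType.
Local Notation C := R[i].
Local Notation Re := complex.Re.
Local Notation Im := complex.Im.
Local Open Scope complex_scope.
Implicit Types t : R.

Lemma mvt_pos (f : R -> R) (x y : R) : x < y ->
  (forall t, x <= t <= y -> {for t, continuous f}) ->
  (forall t, x < t < y -> derivable f t 1) ->
  exists2 t, x < t < y & f y - f x = 'D_1 f t * (y - x).
Proof.
move=> xy cf df.
have [| |t] := @MVT R f (fun t => 'D_1 f t) x y xy.
- by move=> t; rewrite in_itv /= => xty; apply: derivableP; exact: df.
- by apply: continuous_in_subspaceT => r; rewrite inE /= in_itv /=; exact: cf.
- by rewrite in_itv /= => xty e; exists t.
Qed.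

Lemma derive_ge0_le (f : R -> R) (x y : R) : x <= y ->
  (forall t, x <= t <= y -> {for t, continuous f}) ->
  (forall t, x < t < y -> exists2 d, 0 <= d & is_derive t 1 f d) -> f x <= f y.
Proof.
rewrite le_eqVlt => /predU1P[->//|xy] cf df.
have hd t : x < t < y -> derivable f t 1 by move=> /df[d _ []].
have [t xty e] := mvt_pos xy cf hd.
have [d d0 [_ dd]] := df t xty.
by rewrite -subr_ge0 e dd mulr_ge0// subr_ge0 ltW.
Qed.

Lemma is_derive_continuous (f : R -> R) t d : is_derive t 1 f d -> {for t, continuous f}.
Proof. by move=> [df _]; apply/differentiable_continuous/derivable1_diffP. Qed.

Lemma cont_neq0 (T : topologicalType) (f : T -> R) (x : T) : {for x, continuous f} ->
  f x != 0 -> \forall y \near x, f y != 0.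
Proof.
move=> cf fx; have h : `|f x| > 0 by rewrite normr_gt0.
have /cvgrPdist_lt/(_ _ h) := cf; apply: filterS => y; apply: contraTneq => ->.
by rewrite subr0 ltxx.
Qed.

Lemma trmx_conj N (P X : 'M[R]_N) : X^T = X -> (P *m X *m P^T)^T = P *m X *m P^T.
Proof. by move=> Xs; rewrite trmx_mul trmxK trmx_mul Xs mulmxA. Qed.

Lemma mxder_quad N (B : R -> 'M[R]_N) t B' (v : 'rV[R]_N) : mxder B t B' ->
  is_derive t 1 (fun s => (v *m B s *m v^T) 0 0) ((v *m B' *m v^T) 0 0).
Proof.
move=> dB; rewrite mxE; under eq_fun do rewrite mxE.
apply: is_derive_bigsum => j _; rewrite [X in _ (X * _)]mxE.
have d1 : is_derive t 1 (fun s => (v *m B s) 0 j) (\sum_i v 0 i * B' i j).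
  under eq_fun do rewrite mxE.
  apply: is_derive_bigsum => i _.
  apply: (is_derive_eq (is_derive_mul (is_derive_cst (v 0 i) t 1) (dB i j))).
  by rewrite mulr0 addr0.
apply: (is_derive_eq (is_derive_mul d1 (is_derive_cst (v^T j 0) t 1))).
by rewrite mulr0 add0r mulrC.
Qed.

Lemma mxder_tr N (B : R -> 'M[R]_N) t B' : mxder B t B' ->
  is_derive t 1 (fun s => \tr (B s)) (\tr B').
Proof. by move=> dB; apply: is_derive_bigsum => i _; exact: dB. Qed.

Variable n : nat.
Local Notation J := (Jmx n : 'M[R]_(n + n)).
Implicit Types W A : R -> 'M[R]_(n + n).

Definition pos_curve W A := [/\ W 0 = 1%:M,
  forall t, I01 t -> mxder W t (W t *m A t *m J),
  forall t, I01 t -> W t *m J *m (W t)^T = J,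
  forall t, I01 t -> (A t)^T = A t &
  forall t, I01 t -> posdef (A t)].

Lemma mxder_cont N (M : R -> 'M[R]_N) t M' i j : mxder M t M' ->
  {for t, continuous (fun s => M s i j)}.
Proof. by move=> dM; exact: is_derive_continuous (dM i j). Qed.

Lemma mxder_det_cont W A t : pos_curve W A -> I01 t ->
  {for t, continuous (fun s => \det (W s + 1%:M))}.
Proof.
move=> [_ dW _ _ _] It; apply: cont_det => i j.
have := mxderD (dW t It) (mxder_cst 1%:M t); exact: mxder_cont.
Qed.

Lemma cay_mxder W A t : pos_curve W A -> I01 t -> W t + 1%:M \in unitmx ->
  mxder (fun s => cay (W s)) t (2 *: (cayC (W t) *m A t *m (cayC (W t))^T)).
Proof.
move=> pW It uW; have [_ dW sW _ _] := pW.
have nu : \forall s \near t, W s + 1%:M \in unitmx.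
  have d0 : \det (W t + 1%:M) != 0 by rewrite -unitfE -unitmxE.
  apply: filterS (cont_neq0 (mxder_det_cont pW It) d0) => s.
  by rewrite unitmxE unitfE.
have dP := mxderD (dW t It) (mxder_cst 1%:M t).
have dI := mxder_inv dP nu.
(* The Cayley transform is differentiated in the form (W + 1)^-1 (2 J) - J, where W enters once. *)
have h := mxderD (mxderM dI (mxder_cst (2 *: J) t)) (mxder_cst (- J) t).
rewrite -(cay_velocity (sW t It) uW).
have -> : - (2 *: (invmx (W t + 1%:M) *m (W t *m A t *m J) *m invmx (W t + 1%:M) *m J)) =
  - (invmx (W t + 1%:M) *m (W t *m A t *m J + 0) *m invmx (W t + 1%:M)) *m (2 *: J) +
     invmx (W t + 1%:M) *m 0 + 0.
  by rewrite addr0 mulmx0 !addr0 -scalemxAr mulNmx scalerN.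
move=> i j; apply: (near_eq_is_derive _ (h i j)); apply: filterS nu => s us.
rewrite /cay; congr (fun_of_matrix _ i j).
have -> : W s - 1%:M = W s + 1%:M - 2 *: 1%:M.
  by rewrite scaler_nat mulr2n opprD addrA addrK.
rewrite mulmxBl (mulmxV us) -scalemxAl mul1mx mulmxBl mul1mx opprB -scalemxAl scalemxAr.
by [].
Qed.

Lemma cay1 : cay (1%:M : 'M[R]_(n + n)) = 0.
Proof. by rewrite /cay subrr !mul0mx oppr0. Qed.

(** The quadratic form v B v^T starts at 0 and has positive derivative by [posdef_velocity]. *)
Lemma cay_posdef W A t : pos_curve W A -> 0 < t -> t <= 1 ->
  (forall s, 0 <= s <= t -> W s + 1%:M \in unitmx) -> posdef (cay (W t)).
Proof.
move=> pW t0 t1 uW v v0; have [W0 _ sW _ posA] := pW.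
have I s : 0 <= s <= t -> I01 s by move=> /andP[s0 st]; rewrite /I01 /= s0 (le_trans st).
have d s : 0 <= s <= t -> is_derive s 1 (fun s => (v *m cay (W s) *m v^T) 0 0)
    ((v *m (2 *: (cayC (W s) *m A s *m (cayC (W s))^T)) *m v^T) 0 0).
  move=> hs; apply: mxder_quad; apply: cay_mxder => //; [exact: I|exact: uW].
have [s|s /andP[s0 st]|s /andP[s0 st] e] := mvt_pos t0 (f := fun s => (v *m cay (W s) *m v^T) 0 0).
- by move=> hs; exact: is_derive_continuous (d s hs).
- by have [] := d s; rewrite ?(ltW s0) ?(ltW st).
have hs : 0 <= s <= t by rewrite !ltW.
have z : (v *m cay (W 0) *m v^T) 0 0 = 0 by rewrite W0 cay1 mulmx0 mul0mx mxE.
rewrite z !subr0 in e; rewrite e; have [_ ->] := d s hs; rewrite mulr_gt0//.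
by apply: posdef_velocity => //; [exact: sW (I s hs)|exact: uW|exact: posA (I s hs)].
Qed.

Definition Dre c W (t : R) := Re (\det (Mc c (W t))).
Definition Dim c W (t : R) := Im (\det (Mc c (W t))).

Lemma Mc_ccont (T : topologicalType) (c : R) (F : T -> 'M[R]_(n + n)) x :
  (forall i j, {for x, continuous (fun y => F y i j)}) ->
  ccont (fun y => \det (Mc c (F y))) x.
Proof.
move=> cF; apply: ccont_det => i j.
have -> : (fun y => Mc c (F y) i j) = (fun y => c%:C * ((F y + 1%:M) i j)%:C +
    - 'i%C * (((F y - 1%:M) *m J) i j)%:C).
  by apply/funext => y; rewrite /Mc /cmx !mxE mulNr.
have creal (f : T -> R) : {for x, continuous f} -> ccont (fun y => (f y)%:C) x.
  by move=> cf; split=> //=; exact: cont_cst.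
apply: ccontD; apply: ccontM; try exact: ccont_cst; apply: creal.
  rewrite (_ : (fun y => _) = (fun y => F y i j + (1%:M : 'M[R]_(n + n)) i j)).
    by apply: contD => //; exact: cont_cst.
  by apply/funext => y; rewrite mxE.
rewrite (_ : (fun y => _) = (fun y => \sum_k (F y i k + (- 1%:M : 'M[R]_(n + n)) i k) * J k j)).
  apply: cont_sum => k _; apply: contM; last exact: cont_cst.
  by apply: contD => //; exact: cont_cst.
by apply/funext => y; rewrite mxE; apply: eq_bigr => k _; rewrite [in LHS]mxE.
Qed.

Lemma cder_Mc c W A t : pos_curve W A -> I01 t ->
  let W' := W t *m A t *m J in
  cder (fun s => \det (Mc c (W s))) t
    (\tr ((c%:C *: cmx W' - 'i%C *: cmx (W' *m J)) *m \adj (Mc c (W t)))).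
Proof.
move=> [_ dW _ _ _] It W'; apply: cder_det => i j.
have creal (f : R -> R) d : is_derive t 1 f d -> cder (fun s => (f s)%:C) t d%:C.
  by move=> df; split=> //=; exact: is_derive_cst.
have dP := mxderD (dW t It) (mxder_cst 1%:M t).
have dQ := mxderM (mxderD (dW t It) (mxder_cst (- 1%:M) t)) (mxder_cst J t).
have h := cderD (cderM (cder_cst c%:C t) (creal _ _ (dP i j)))
  (cderM (cder_cst (- 'i%C) t) (creal _ _ (dQ i j))).
have -> : (fun s => Mc c (W s) i j) = (fun s => c%:C * ((W s + 1%:M) i j)%:C +
    - 'i%C * (((W s - 1%:M) *m J) i j)%:C).
  by apply/funext => y; rewrite /Mc /cmx !mxE mulNr.
have -> // : (c%:C *: cmx W' - 'i%C *: cmx (W' *m J)) i j =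
   c%:C * ((W' + 0) i j)%:C + 0 * ((W t + 1%:M) i j)%:C +
   (- 'i%C * (((W' + 0) *m J + (W t - 1%:M) *m 0) i j)%:C + 0 * (((W t - 1%:M) *m J) i j)%:C).
by rewrite !mul0r mulmx0 !addr0; clearbody W'; rewrite /cmx !mxE mulNr.
Qed.

(** The rate is Im (D' / D) for D = det Mc; Jacobi's formula gives D' = D tr (M' M^-1), and
    [Mc_im_trace] evaluates the trace. *)
Lemma arglift_crossing c W A a t : 0 < c -> pos_curve W A -> 0 < t < 1 ->
  arglift (Dre c W) (Dim c W) a ->
  is_derive t 1 a (2 * c * \tr (W t *m A t *m (W t)^T *m invmx (Sc c (W t)))).
Proof.
move=> c0 pW t01 la; have [_ _ sW _ _] := pW.
have It : I01 t by case/andP: t01 => *; rewrite /I01 /= !ltW.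
have sWt := sW t It.
have Sp := posdef_det_gt0 (Sc_tr c (W t)) (Sc_posdef (W t) c0).
have e := Mc_sqr_det c sWt.
have pos : 0 < Dre c W t ^+ 2 + Dim c W t ^+ 2 by rewrite /Dre /Dim e.
have [d1 d2] := cder_Mc c pW It.
apply: (is_derive_eq (arglift_derive t01 la pos d1 d2)).
rewrite -(Mc_im_trace (A t) c0 sWt).
set M' := c%:C *: cmx _ - _; set M := Mc c (W t).
have uM : M \in unitmx.
  rewrite unitmxE unitfE; apply: contraTneq pos => h.
  by rewrite /Dre /Dim -/M h /= expr0n addr0 ltxx.
have -> : \adj M = \det M *: invmx M.
  by rewrite /invmx uM scalerA divff ?scale1r// -unitfE -unitmxE.
rewrite -scalemxAr mxtraceZ cReM cImM -/(Dre c W t) -/(Dim c W t).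
move: pos; set u := Dre c W t; set v := Dim c W t; set z := \tr _ => pos.
by field; rewrite gt_eqF.
Qed.

(** The rate is a positive multiple of the trace of a product of two positive definite matrices, W A
    W^T and the inverse of Sc. The estimate also holds where W leaves the Cayley chart. *)
Lemma arglift_mono c W A a x y : 0 < c -> pos_curve W A ->
  arglift (Dre c W) (Dim c W) a -> 0 <= x -> x <= y -> y <= 1 -> a x <= a y.
Proof.
move=> c0 pW la x0 xy y1; apply: derive_ge0_le => // t /andP[xt ty].
  by have [] := la t; rewrite // /I01 /= (le_trans x0)// (le_trans ty).
have t01 : 0 < t < 1 by rewrite (le_lt_trans x0)// (lt_le_trans ty).
have It : I01 t by case/andP: t01 => *; rewrite /I01 /= !ltW.
have [_ _ sW sA pA] := pW.
eexists; last exact: (arglift_crossing c0 pW t01 la).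
have uW := symp_unit (sW t It).
rewrite !mulr_ge0 ?(ltW c0)//; apply: tr_mul_inv_ge0.
- by rewrite !trmx_mul trmxK sA// mulmxA.
- move=> v v0; have -> : v *m (W t *m A t *m (W t)^T) *m v^T = (v *m W t) *m A t *m (v *m W t)^T.
    by rewrite trmx_mul !mulmxA.
  apply: (pA t It); apply: contra v0 => /eqP h; apply/eqP.
  by rewrite -[v](mulmxK uW) h mul0mx.
- exact: Sc_tr.
- exact: Sc_posdef.
Qed.

(** With tau = tr B / c, the bounds of [tr_resolvent_bounds] say tau' / (1 + tau^2) <= a' <= tau',
    and the outer terms are the derivatives of atan tau and tau, which vanish at time 0. The upper
    bound serves on the given path; the lower one turns a small increase of the argument into a
    bound on B. *)
Lemma arglift_chart c W A a t : 0 < c -> pos_curve W A ->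
  arglift (Dre c W) (Dim c W) a -> 0 < t <= 1 ->
  (forall s, 0 <= s <= t -> W s + 1%:M \in unitmx) ->
  atan (\tr (cay (W t)) / c) <= a t - a 0 <= \tr (cay (W t)) / c.
Proof.
move=> c0 pW la /andP[t0 t1] uW; have [W0 _ sW sA pA] := pW.
have I s : 0 <= s <= t -> I01 s by move=> /andP[s0 st]; rewrite /I01 /= s0 (le_trans st).
pose tau s := \tr (cay (W s)) / c.
pose B' s := 2 *: (cayC (W s) *m A s *m (cayC (W s))^T).
have dtau s : 0 <= s <= t -> is_derive s 1 tau (\tr (B' s) / c).
  move=> hs; have h := mxder_tr (cay_mxder pW (I s hs) (uW s hs)).
  apply: (is_derive_eq (is_derive_mul h (is_derive_cst c^-1 s 1))).
  by rewrite mulr0 add0r mulrC.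
have datan s : 0 <= s <= t -> is_derive s 1 (fun s => atan (tau s))
    ((1 + tau s ^+ 2)^-1 * (\tr (B' s) / c)).
  by move=> hs; exact: (@is_derive_comp1 _ (@atan R) tau s _ _ (is_derive1_atan _) (dtau s hs)).
have ca s : 0 <= s <= t -> {for s, continuous a} by move=> hs; have [] := la s (I s hs).
have tau0 : tau 0 = 0 by rewrite /tau W0 cay1 mxtrace0 mul0r.
have bnd s : 0 < s < t -> exists2 d, is_derive s 1 a d &
    (1 + tau s ^+ 2)^-1 * (\tr (B' s) / c) <= d <= \tr (B' s) / c.
  move=> /andP[s0 st].
  have hs : 0 <= s <= t by rewrite !ltW.
  have s01 : 0 < s < 1 by rewrite s0 (lt_le_trans st).
  eexists; first exact: (arglift_crossing c0 pW s01 la).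
  rewrite (tr_chart (A s) c0 (sW s (I s hs)) (uW s hs)) -/(B' s).
  have Bp : posdef (cay (W s)).
    apply: (cay_posdef pW s0) => [|r /andP[r0 rs]]; first by rewrite (le_trans (ltW st)).
    by apply: uW; rewrite r0 (le_trans rs)// ltW.
  have Bs := cay_tr (sW s (I s hs)) (uW s hs).
  have E's : (B' s)^T = B' s.
    by rewrite /B' linearZ /= trmx_conj// (sA s (I s hs)).
  have E'p := posdef_velocity (sW s (I s hs)) (uW s hs) (pA s (I s hs)).
  have /andP[l u] := tr_resolvent_bounds c0 Bs Bp E's E'p.
  have c2 : 0 < c ^+ 2 by rewrite exprn_gt0.
  have cT : 0 < c ^+ 2 + \tr (cay (W s)) ^+ 2 by rewrite ltr_wpDr// sqr_ge0.
  apply/andP; split.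
    have -> : (1 + tau s ^+ 2)^-1 * (\tr (B' s) / c) =
       c * (\tr (B' s) / (c ^+ 2 + (\tr (cay (W s))) ^+ 2)).
      have p1 : 1 + tau s ^+ 2 != 0 by rewrite gt_eqF// ltr_wpDr ?sqr_ge0.
      move: p1; rewrite /tau; move: (\tr (cay (W s))) cT => w cT p1.
      by field; rewrite ?p1 (gt_eqF c0) (gt_eqF cT).
    by rewrite ler_pM2l.
  have -> : \tr (B' s) / c = c * (\tr (B' s) / c ^+ 2).
    by field; rewrite (gt_eqF c0).
  by rewrite ler_pM2l.
have ge0lt s : 0 < s < t -> 0 <= s <= t by move=> /andP[*]; rewrite !ltW.
apply/andP; split.
  suff : a 0 - atan (tau 0) <= a t - atan (tau t) by rewrite tau0 atan0 subr0 -/(tau t); lra.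
  apply: (@derive_ge0_le (fun s => a s - atan (tau s))) => [|s hs|s hs]; first exact: ltW.
    by apply: contD; [exact: ca|apply: contN; exact: is_derive_continuous (datan s hs)].
  have [d da /andP[l u]] := bnd s hs; eexists.
    2: exact: (is_derive_sub da (datan s (ge0lt s hs))).
  by rewrite subr_ge0.
suff : tau 0 - a 0 <= tau t - a t by rewrite tau0 -/(tau t); lra.
apply: (@derive_ge0_le (fun s => tau s - a s)) => [|s hs|s hs]; first exact: ltW.
  by apply: contD; [exact: is_derive_continuous (dtau s hs)|apply: contN; exact: ca].
have [d da /andP[l u]] := bnd s hs; eexists.
  2: exact: (is_derive_sub (dtau s (ge0lt s hs)) da).
by rewrite subr_ge0.
Qed.

Lemma Mc1 c : Mc c (1%:M : 'M[R]_(n + n)) = cmx ((2 * c) *: 1%:M).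
Proof.
have s0 : (1%:M : 'M[R]_(n + n)) - 1%:M = 0 := subrr _.
rewrite /Mc s0 mul0mx.
have -> : cmx (0 : 'M[R]_(n + n)) = 0 by apply/matrixP => i j; rewrite !mxE.
by rewrite scaler0 subr0 -cmxZ; congr cmx; rewrite -mulr2n -scaler_nat scalerA mulrC.
Qed.

(** The curve is contracted to its starting point by (r, t) |-> W (r t). At r = 0 the determinant is
    the constant (2 c)^(2n) > 0, whose argument is 0. *)
Lemma arglift_exists c W A : 0 < c -> pos_curve W A ->
  exists a, arglift (Dre c W) (Dim c W) a.
Proof.
move=> c0 pW; have [W0 dW sW _ _] := pW.
pose p (r t : R) := Dre c W (r * t); pose q (r t : R) := Dim c W (r * t).
have II (r t : R) : I01 r -> I01 t -> I01 (r * t).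
  by move=> /andP[r0 r1] /andP[t0 t1]; rewrite /I01 /= mulr_ge0//= mulr_ile1.
have [|r t Ir It||a la _] := @arglift_homotopy R p q (fun=> 0).
- move=> r t Ir It; apply: Mc_ccont => i j.
  have c1 : {for (r, t), continuous (fun z : R * R => z.1 * z.2)}.
    by apply: contM; [exact: cvg_fst|exact: cvg_snd].
  have c2 : {for r * t, continuous (fun s => W s i j)} by exact: mxder_cont (dW _ (II r t Ir It)).
  exact: (@continuous_comp _ _ _ (fun z : R * R => z.1 * z.2) (fun s => W s i j) (r, t) c1 c2).
- rewrite /p /q /Dre /Dim Mc_sqr_det; last exact/sW/II.
  by apply: posdef_det_gt0; [exact: Sc_tr|exact: Sc_posdef].
- move=> t It; split; first exact: cont_cst.
    rewrite /p /q /Dre /Dim mul0r W0 Mc1 det_cmx /= expr0n addr0 cos0 mulr1 sqrtr_sqr.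
    by rewrite ger0_norm// detZ det1 mulr1 exprn_ge0// mulr_ge0// ltW.
  by rewrite /p /q /Dre /Dim mul0r W0 Mc1 det_cmx /= sin0 mulr0.
exists a => t It; have [h1 h2 h3] := la t It; move: h2 h3; rewrite /p /q mul1r => h2 h3.
by split.
Qed.

(** By contradiction at the first time t0 where det (W1 + 1) = 0. Before t0, the lower bound of
    [arglift_chart], monotonicity of the argument and the total increase shared with W0 bound tr B
    along W1; hence det Sc <= K det (W1 + 1)^2 with a fixed K. As s tends to t0 this contradicts det
    Sc > 0. *)
Theorem avoid_minus1 W0 A0 W1 A1 (F : R -> R -> 'M[R]_(n + n)) :
  pos_curve W0 A0 -> pos_curve W1 A1 ->
  (forall s t, I01 s -> I01 t -> forall i j,
     {for (s, t), continuous (fun z : R * R => F z.1 z.2 i j)}) ->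
  (forall s t, I01 s -> I01 t -> F s t *m J *m (F s t)^T = J) ->
  (forall t, I01 t -> F 0 t = W0 t /\ F 1 t = W1 t) ->
  (forall s, I01 s -> F s 0 = W0 0 /\ F s 1 = W0 1) ->
  (forall t, I01 t -> W0 t + 1%:M \in unitmx) ->
  forall t, I01 t -> W1 t + 1%:M \in unitmx.
Proof.
move=> p0 p1 cF sF F01 Fe u0 t1 It1.
have i0 : @I01 R 0 by rewrite /I01 /= lexx ler01.
have i1 : @I01 R 1 by rewrite /I01 /= lexx ler01.
apply/contraT => nu.
pose tau0 := \tr (cay (W0 1)).
have tau0_ge0 : 0 <= tau0.
  have Bp : posdef (cay (W0 1)) by apply: (cay_posdef p0) => // s hs; exact: u0.
  have [_ _ sW _ _] := p0.
  have Bs := cay_tr (sW 1 i1) (u0 1 i1).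
  have [V [x h]] := udiag_exists Bs; have [V1 V2 _] := h.
  by rewrite /tau0 -(sum_udiag _ V1 V2) sumr_ge0// => k _; rewrite ltW// udiag_gt0.
(* With this c the total increase along W0 is at most tau0 / c < 1 <= pi / 2. *)
pose c := tau0 + 1; have c0 : 0 < c by rewrite ltr_wpDl.
have [a0 la0] := arglift_exists c0 p0.
have up : a0 1 - a0 0 <= tau0 / c.
  have := arglift_chart c0 p0 la0 (t := 1); rewrite ltr01 lexx => /(_ isT).
  by case/(_ (fun s hs => u0 s hs))/andP.
pose p s t := Dre c (F s) t; pose q s t := Dim c (F s) t.
have [|s t Is It||a1 la1 ha1] := @arglift_homotopy R p q a0.
- by move=> s t Is It; apply: Mc_ccont => i j; exact: cF.
- rewrite /p /q /Dre /Dim Mc_sqr_det; last exact: sF.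
  by apply: posdef_det_gt0; [exact: Sc_tr|exact: Sc_posdef].
- move=> t It; have [h1 h2 h3] := la0 t It; have [e1 _] := F01 t It.
  by rewrite /p /q /Dre /Dim e1.
have e0 : a1 0 = a0 0.
  apply: (ha1 0 i0) => s Is; have [h _] := Fe s Is; have [h' _] := Fe 0 i0.
  by rewrite /p /q /Dre /Dim h h'.
have e1 : a1 1 = a0 1.
  apply: (ha1 1 i1) => s Is; have [_ h] := Fe s Is; have [_ h'] := Fe 0 i0.
  by rewrite /p /q /Dre /Dim h h'.
have {}la1 : arglift (Dre c W1) (Dim c W1) a1.
  move=> t It; have [h1 h2 h3] := la1 t It; have [_ e] := F01 t It.
  by move: h2 h3; rewrite /p /q /Dre /Dim e => h2 h3; split.
have [W10 _ sW1 _ _] := p1.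
pose f t := \det (W1 t + 1%:M).
pose Z : set R := [set t | I01 t /\ f t = 0].
have Zt1 : Z t1 by split=> //; apply/eqP; move: nu; rewrite unitmxE unitfE negbK.
have lbZ : lbound Z 0 by move=> t [/andP[]].
have hiZ : has_inf Z by split; [exists t1|exists 0].
pose t0 := inf Z.
have t00 : 0 <= t0 by apply: lb_le_inf => //; exists t1.
have t0t1 : t0 <= t1 by apply: ge_inf => //; exists 0.
have It0 : I01 t0 by case/andP: It1 => _ t11; rewrite /I01 /= t00 (le_trans t0t1).
have below s : 0 <= s -> s < t0 -> f s != 0.
  move=> s0 st; apply/eqP => fs.
  suff : t0 <= s by rewrite leNgt st.
  apply: ge_inf; first by exists 0.
  by split=> //; case/andP: It0 => _ ?; rewrite /I01 /= s0 ltW// (lt_le_trans st).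
have cf : {for t0, continuous f} := mxder_det_cont p1 It0.
have f0 : f t0 = 0.
  apply/eqP/contraT => fn.
  have /nbhs_ballP[e /= e0' he] := cont_neq0 cf fn.
  have [x [Ix fx] xe] := inf_adherent e0' hiZ.
  have xt0 : t0 <= x by apply: ge_inf; [exists 0|].
  have : f x != 0.
    by apply: he; rewrite -ball_normE /= distrC ger0_norm ?subr_ge0// ltrBlDl.
  by rewrite fx eqxx.
have t0p : 0 < t0.
  rewrite lt_def t00 andbT; apply: contra_eq_neq f0 => ->.
  rewrite /f W10 -mulr2n -scaler_nat detZ det1 mulr1 expf_neq0// pnatr_eq0//.
pose x := tau0 / c.
have x1 : x < 1 by rewrite /x ltr_pdivrMr// mul1r ltrDl.
have x0 : 0 <= x by rewrite divr_ge0// ltW.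
have xpi : x \in `](- (pi / 2)), (pi / 2)[%R.
  by rewrite in_itv /= (lt_le_trans x1 (pihalf_ge1 R)) andbT (lt_le_trans _ x0)// oppr_lt0 divr_gt0 ?pi_gt0.
(* Before t0 one has tr B <= c tan x, so K bounds det (c^2 + B^2) there. *)
pose K := (c ^+ 2 + (c * tan x) ^+ 2) ^+ (n + n).
have bound s : 0 < s -> s < t0 -> \det (Sc c (W1 s)) <= f s ^+ 2 * K.
  move=> s0 st; have s1 : s <= 1 by case/andP: It0 => _ ?; rewrite ltW// (lt_le_trans st).
  have us r : 0 <= r <= s -> W1 r + 1%:M \in unitmx.
    by move=> /andP[r0 rs]; rewrite unitmxE unitfE below// (le_lt_trans rs).
  have Is : I01 s by rewrite /I01 /= s1 ltW.
  have uss : W1 s + 1%:M \in unitmx by apply: us; rewrite lexx ltW.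
  have s01 : 0 < s <= 1 by rewrite s0.
  have /andP[lo _] := arglift_chart c0 p1 la1 s01 us.
  have Bp : posdef (cay (W1 s)) := cay_posdef p1 s0 s1 us.
  have Bs := cay_tr (sW1 s Is) uss.
  have am := arglift_mono c0 p1 la1 (ltW s0) s1 (lexx 1).
  set w := \tr (cay (W1 s)) in lo.
  have w0 : 0 <= w.
    have [V [y h]] := udiag_exists Bs; have [V1 V2 _] := h.
    by rewrite /w -(sum_udiag _ V1 V2) sumr_ge0// => k _; rewrite ltW// udiag_gt0.
  have wx : w <= c * tan x.
    rewrite -ler_pdivrMl// mulrC leNgt; apply/negP => /lt_atan; rewrite tanK// => h.
    by move: h; rewrite ltNge => /negP; apply; rewrite (le_trans lo)//; rewrite e0 e1 in am up *; rewrite /x; lra.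
  rewrite (Sc_chart c (sW1 s Is) uss) !det_mulmx det_tr -/(f s) mulrAC -expr2 ler_wpM2l ?sqr_ge0//.
  have /andP[_ h] := det_resolvent_le c Bs Bp; rewrite (le_trans h)// /K -/w.
  apply: lerXn2r; rewrite ?nnegrE ?addr_ge0 ?sqr_ge0//.
  by rewrite lerD2l ler_sqr ?nnegrE// (le_trans w0).
have cS : {for t0, continuous (fun s => Dre c W1 s ^+ 2 + Dim c W1 s ^+ 2)}.
  have [_ dW1 _ _ _] := p1.
  have [k1 k2] := @Mc_ccont R c W1 t0 (fun i j => @mxder_cont _ W1 t0 _ i j (dW1 t0 It0)).
  by apply: contD; [exact: (contM k1 k1)|exact: (contM k2 k2)].
have cG : {for t0, continuous (fun s => f s ^+ 2 * K + - (Dre c W1 s ^+ 2 + Dim c W1 s ^+ 2))}.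
  apply: contD; last exact: contN.
  by apply: contM; [exact: (contM cf cf)|exact: cont_cst].
have G0 : f t0 ^+ 2 * K + - (Dre c W1 t0 ^+ 2 + Dim c W1 t0 ^+ 2) < 0.
  rewrite f0 expr0n mul0r add0r oppr_lt0 /Dre /Dim Mc_sqr_det; last exact: sW1.
  by apply: posdef_det_gt0; [exact: Sc_tr|exact: Sc_posdef].
have nG : nbhs t0 [set s | f s ^+ 2 * K + - (Dre c W1 s ^+ 2 + Dim c W1 s ^+ 2) < 0].
  exact: (cvgr_lt _ cG _ G0).
have /nbhs_ballP[e /= e0' he] := nG.
pose s := t0 - Num.min e t0 / 2.
have m0 : 0 < Num.min e t0 by rewrite lt_min e0'.
have me : Num.min e t0 <= e by rewrite ge_min lexx.
have mt : Num.min e t0 <= t0 by rewrite ge_min lexx orbT.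
have s0 : 0 < s by rewrite /s; lra.
have st : s < t0 by rewrite /s; lra.
have : f s ^+ 2 * K + - (Dre c W1 s ^+ 2 + Dim c W1 s ^+ 2) < 0.
  apply: he; rewrite -ball_normE /= /s opprB addrC subrK ger0_norm; lra.
rewrite /Dre /Dim Mc_sqr_det; last first.
  by apply: sW1; case/andP: It0 => _ ?; rewrite /I01 /= (ltW s0) ltW// (lt_le_trans st).
by have := bound s s0 st; lra.
Qed.

End AvoidMinusOne.

(** * Transport of integrals by the flow *)

Section Cutoff.
Variable R : realType.
Implicit Types y : R.

Lemma is_derive_quad (f : R -> R) (x d c : R) :
  (forall h, `|f (x + h) - f x - h * d| <= c * h ^+ 2) -> is_derive x 1 f d.
Proof.
move=> hf; have c0 : 0 <= c.
  by have := le_trans (normr_ge0 _) (hf 1); rewrite expr1n mulr1.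
have cv : h^-1 *: (f (h *: 1 + x) - f x) @[h --> 0^'] --> d.
  apply/cvgrPdist_lt => e e0.
  have ec : 0 < e / (c + 1) by rewrite divr_gt0// ltr_wpDl.
  have n1 : \forall h \near (0 : R)^', `|h| < e / (c + 1).
    by apply: dnbhs0_lt.
  have n2 : \forall h \near (0 : R)^', h != 0 by exact: nbhs_dnbhs_neq.
  near=> h.
  have h0 : h != 0 by near: h; exact: n2.
  have he : `|h| < e / (c + 1) by near: h; exact: n1.
  have -> : d - h^-1 *: (f (h *: 1 + x) - f x) = - (h^-1 * (f (x + h) - f x - h * d)).
    by rewrite -[h *: 1]/(h * 1) mulr1 [h + x]addrC -[h^-1 *: _]/(h^-1 * _); field.
  rewrite normrN normrM normfV ltr_pdivrMl ?normr_gt0//.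
  have hh : h ^+ 2 = `|h| ^+ 2 by rewrite real_normK ?num_real.
  apply: le_lt_trans (hf h) _; rewrite hh.
  have a0 : 0 < `|h| by rewrite normr_gt0.
  rewrite expr2 mulrA mulrC ltr_pM2l//.
  apply: (@le_lt_trans _ _ ((c + 1) * `|h|)); first by rewrite ler_wpM2r// lerDl.
  by rewrite mulrC -ltr_pdivlMr// ltr_wpDl.
by apply: DeriveDef; [apply/cvg_ex; exists d|apply: cvg_lim].
Unshelve. all: by end_near.
Qed.

Lemma pospart_sqr_derive (x : R) :
  is_derive x 1 (fun y => Num.max y 0 ^+ 2) (2 * Num.max x 0).
Proof.
apply: (@is_derive_quad _ _ _ 1) => h; rewrite mul1r.
have h2 := sqr_ge0 h.
case: (leP x 0) => x0; case: (leP (x + h) 0) => xh; rewrite ler_norml; apply/andP; split; nra.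
Qed.

(** A C^1 substitute for the indicator of x < 0: it vanishes for k x >= -1 and tends to 1 at each x
    < 0 as k grows. The squared positive part is C^1, which is the regularity that the transport
    argument asks for. *)
Definition cutoff (k x : R) : R :=
  let m := Num.max (- (k * x) - 1) 0 ^+ 2 in m / (1 + m).

Lemma cutoff01 k x : 0 <= cutoff k x <= 1.
Proof.
rewrite /cutoff; set m := _ ^+ 2; have m0 : 0 <= m by exact: sqr_ge0.
by rewrite divr_ge0 ?addr_ge0//= ler_pdivrMr ?mul1r ?lerDr ?ltr_pwDl.
Qed.

Lemma cutoff0 k x : -1 <= k * x -> cutoff k x = 0.
Proof.
move=> h; rewrite /cutoff; have -> : Num.max (- (k * x) - 1) 0 = 0.
  by apply/max_idPr; lra.
by rewrite expr0n mul0r.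
Qed.

Lemma cutoff_derive (k x : R) : exists2 d : R -> R, forall y : R, is_derive y 1 (cutoff k) (d y) &
  {for x, continuous d}.
Proof.
pose w y := - (k * y) - 1; pose m y : R := Num.max (w y) 0 ^+ 2.
pose dm y : R := 2 * Num.max (w y) 0 * - k.
have m1 y : 0 < 1 + m y by rewrite ltr_pwDl// sqr_ge0.
have dw y : is_derive y 1 w (- k).
  have d1 := is_derive_mul (is_derive_cst k y 1) (is_derive_id y 1).
  have d2 := is_derive_sub (is_deriveN d1) (is_derive_cst (1 : R) y 1).
  by apply: (is_derive_eq d2); rewrite /= mulr0 addr0 subr0 mulr1.
have dm' y : is_derive y 1 m (dm y).
  exact: (@is_derive_comp1 _ (fun y => Num.max y 0 ^+ 2) w y _ _ (pospart_sqr_derive _) (dw y)).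
have cw y : {for y, continuous w} := is_derive_continuous (dw y).
have cm y : {for y, continuous m} := is_derive_continuous (dm' y).
exists (fun y => dm y / (1 + m y) - m y * dm y / (1 + m y) ^+ 2).
  move=> y; have d1 := is_derive_add (is_derive_cst (1 : R) y 1) (dm' y).
  apply: (is_derive_eq (@is_derive_div R m (fun s => 1 + m s) y _ _ (lt0r_neq0 (m1 y)) (dm' y) d1)).
  by rewrite add0r.
have cmax : {for x, continuous (fun y => Num.max (w y) 0)}.
  have -> : (fun y => Num.max (w y) 0) = w \max cst 0 by [].
  by apply: continuous_max; [exact: cw|exact: cst_continuous].
have cdm : {for x, continuous dm}.
  by apply: contM; [apply: contM => //; exact: cont_cst|exact: cont_cst].
have c1m : {for x, continuous (fun y => 1 + m y)} by apply: contD => //; exact: cont_cst.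
have civ : {for x, continuous (fun y => (1 + m y)^-1)}.
  by apply: cvgV => //; rewrite gt_eqF.
apply: contD; first exact: contM.
apply: contN; apply: contM; first exact: contM.
have -> : (fun y => ((1 + m y) ^+ 2)^-1) = (fun y => (1 + m y)^-1 * (1 + m y)^-1).
  by apply/funext => y; rewrite expr2 invfM.
exact: contM.
Qed.

Lemma cutoff_cvg (x : R) : x < 0 -> cutoff k.+1%:R x @[k --> \oo] --> (1 : R).
Proof.
move=> x0; apply/cvgrPdist_lt => e e0.
near=> k.
have kx : (e^-1 + 2) / - x <= k.+1%:R.
  have : (e^-1 + 2) / - x <= k%:R by near: k; exact: nbhs_infty_ger.
  by move=> /le_trans; apply; rewrite ler_nat.
rewrite /cutoff; set y := - _ - 1.
have nx : 0 < - x by rewrite oppr_gt0.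
have ye : e^-1 + 1 <= y by move: kx; rewrite ler_pdivrMr// mulrN /y; lra.
have ei : 0 < e^-1 by rewrite invr_gt0.
have -> : Num.max y 0 = y by apply/max_idPl; lra.
have y2 : 0 < 1 + y ^+ 2 by rewrite ltr_pwDl// sqr_ge0.
have -> : 1 - y ^+ 2 / (1 + y ^+ 2) = (1 + y ^+ 2)^-1 by field; rewrite gt_eqF.
rewrite gtr0_norm ?invr_gt0// -[e in _ < e]invrK ltf_pV2 ?posrE//.
nra.
Unshelve. all: by end_near.
Qed.

End Cutoff.

(** * The domain, its defining function and cutoffs *)

Section Domain.
Variables (R : realType) (N : nat) (O : set 'rV[R]_N) (rho : 'rV[R]_N -> R).
Hypotheses (oO : open O) (bO : bounded_set O) (srho : smooth_on setT rho)
  (Oe : O = [set z | rho z < 0]).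
Implicit Types (z : 'rV[R]_N) (f : 'rV[R]_N -> R) (C : R).

Lemma rho_cont z : {for z, continuous rho}.
Proof. by have [] := srho [::] (I : setT z). Qed.

Lemma closure_le (T : topologicalType) (A : set T) (a : T -> R) (c : R) (z : T) : closure A z ->
  {for z, continuous a} -> (forall y, A y -> a y <= c) -> a z <= c.
Proof.
move=> Az ca h; rewrite leNgt; apply/negP => cz.
have [y [Ay]] := Az _ (cvgr_gt _ ca _ cz).
by rewrite /= ltNge h.
Qed.

Lemma closure_rho z : closure O z -> rho z <= 0.
Proof.
move=> Oz; have h y : O y -> rho y <= 0 by rewrite Oe => /ltW.
exact: (closure_le Oz (@rho_cont z) h).
Qed.

Lemma bdry_rho z : closure O z -> ~ O z -> rho z = 0.
Proof.
move=> Oz nO; apply/eqP; rewrite eq_le closure_rho//= leNgt; apply/negP => h.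
by apply: nO; rewrite Oe.
Qed.

Lemma coord_cont i (z : 'rV[R]_N) : {for z, continuous (fun y : 'rV[R]_N => y 0 i)}.
Proof. exact: coord_continuous. Qed.

Lemma domain_box : exists2 M, 0 <= M & forall z i, closure O z -> `|z 0 i| <= M.
Proof.
have [M [_ hM]] := bO; pose M1 := Num.max M 0 + 1.
have MM : M < M1 by rewrite /M1 (@le_lt_trans _ _ (Num.max M 0)) ?le_max ?lexx// ltrDl.
have M0 : 0 <= M1 by rewrite /M1 addr_ge0// le_max lexx orbT.
exists M1 => // z i Oz.
have c : {for z, continuous (fun y : 'rV[R]_N => `|y 0 i|)}.
  exact: (continuous_comp (@coord_cont i z) (@norm_continuous _ _ _)).
apply: (@closure_le _ O (fun y => `|y 0 i|) M1 z Oz c).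
by move=> y Oy; apply: le_trans (rV_coord_le y i) _; exact: hM.
Qed.

Lemma closure_compact : compact (closure O).
Proof.
have [M M0 hM] := domain_box.
apply: (subclosed_compact (@closed_closure _ O) (@box_compact R N M)).
by move=> z Oz i; exact: hM.
Qed.

(** Off O one has rho >= 0 > -1 / (k + 1), so the cutoff vanishes in a neighbourhood and no
    continuity of f is asked there. *)
Lemma indic_cutoff_cont k (f : 'rV[R]_N -> R) z : (O z -> {for z, continuous f}) ->
  {for z, continuous (fun z => \1_O z * (cutoff k.+1%:R (rho z) * f z))}.
Proof.
move=> cf; have [Oz|nOz] := pselect (O z).
  apply: (@cont_near_eq _ _ _ (fun z => cutoff k.+1%:R (rho z) * f z)).
    by apply: (near_open oO Oz) => y Oy; rewrite indicE mem_set// mul1r.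
  apply: contM; last exact: cf.
  have [d dd _] := cutoff_derive k.+1%:R (rho z).
  exact: (@continuous_comp _ _ _ rho (cutoff k.+1%:R) z (@rho_cont z) (is_derive_continuous (dd (rho z)))).
apply: (@cont_near_eq _ _ _ (fun=> 0)); last exact: cont_cst.
have rz : - k.+1%:R^-1 < rho z.
  rewrite (@lt_le_trans _ _ 0) ?oppr_lt0 ?invr_gt0// leNgt; apply/negP => h.
  by apply: nOz; rewrite Oe.
have nn : \forall y \near z, - k.+1%:R^-1 < rho y by exact: (cvgr_gt _ (@rho_cont z) _ rz).
apply: filterS nn => y ry.
rewrite cutoff0 ?mul0r ?mulr0//.
by move: ry; rewrite ltrNl -[_^-1]div1r ltr_pdivlMr// => /ltW; lra.
Qed.

Lemma indic_notin (f : 'rV[R]_N -> R) z : ~ O z -> \1_O z * f z = 0.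
Proof. by move=> nO; rewrite indicE memNset// mul0r. Qed.

Lemma indic_bound (f : 'rV[R]_N -> R) C z : 0 <= C -> (O z -> `|f z| <= C) ->
  `|\1_O z * f z| <= C.
Proof.
move=> C0 h; have [Oz|nOz] := pselect (O z); last by rewrite indic_notin// normr0.
by rewrite indicE mem_set// mul1r h.
Qed.

Section Tame.
Variable M : R.
Hypotheses (M0 : 0 <= M) (hM : forall z i, closure O z -> `|z 0 i| <= M).

Lemma tame_indic_cutoff k C f : 0 <= C -> (forall z, O z -> {for z, continuous f}) ->
  (forall z, O z -> `|f z| <= C) ->
  tame M C (fun z => \1_O z * (cutoff k.+1%:R (rho z) * f z)).
Proof.
move=> C0 cf bf; apply: tame_Cc => //.
- by move=> z; apply: indic_cutoff_cont => Oz; exact: cf.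
- move=> z; apply: (@indic_bound (fun z => cutoff k.+1%:R (rho z) * f z)) => // Oz; rewrite normrM.
  have /andP[c0 c1] := cutoff01 k.+1%:R (rho z).
  by rewrite ger0_norm// -[C]mul1r ler_pM// bf.
- move=> z i Mz; apply: (@indic_notin (fun z => cutoff k.+1%:R (rho z) * f z)) => Oz.
  by move: Mz; rewrite ltNge hM//; exact: subset_closure.
Qed.

Lemma indic_cutoff_cvg (f : 'rV[R]_N -> R) z :
  \1_O z * (cutoff k.+1%:R (rho z) * f z) @[k --> \oo] --> \1_O z * f z.
Proof.
have [Oz|nOz] := pselect (O z).
  have c : cutoff k.+1%:R (rho z) @[k --> \oo] --> (1 : R).
    by apply: cutoff_cvg; move: Oz; rewrite Oe.
  have h : \1_O z * (cutoff k.+1%:R (rho z) * f z) @[k --> \oo] --> \1_O z * (1 * f z).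
    by apply: cvgM; [exact: cvg_cst|apply: cvgM => //; exact: cvg_cst].
  by rewrite mul1r in h.
have -> : (fun k => \1_O z * (cutoff k.+1%:R (rho z) * f z)) = (fun=> 0 : R).
  by apply/funext => k; rewrite indicE memNset// mul0r.
by rewrite indic_notin//; exact: cvg_cst.
Qed.

(** The indicator makes the function discontinuous, but it is the pointwise limit of its cutoffs,
    which are continuous with compact support. *)
Lemma tame_indic C f : 0 <= C -> (forall z, O z -> {for z, continuous f}) ->
  (forall z, O z -> `|f z| <= C) -> tame M C (fun z => \1_O z * f z).
Proof.
move=> C0 cf bf; apply: (@tame_cvg R N M C
  (fun k z => \1_O z * (cutoff k.+1%:R (rho z) * f z))) => //.
  by move=> k; exact: tame_indic_cutoff.
by move=> z; exact: indic_cutoff_cvg.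
Qed.

End Tame.

Lemma compact_norm_bound (T : topologicalType) (A : set T) (f : T -> R) : compact A ->
  (forall x, A x -> {for x, continuous f}) -> exists2 C, 0 <= C & forall x, A x -> `|f x| <= C.
Proof.
move=> cA cf; have [An|A0] := pselect (A !=set0); last first.
  by exists 0 => // x Ax; exfalso; apply: A0; exists x.
have cfS : {within A, continuous (fun x => `|f x|)}.
  apply: continuous_in_subspaceT => z; rewrite inE => Az.
  exact: (continuous_comp (cf z Az) (@norm_continuous _ _ _)).
have [z zS hz] := @compact_EVT_max _ R (fun x => `|f x|) A An cA cfS.
by exists `|f z| => // x Ax; apply: hz; rewrite inE.
Qed.

(** If w = f z were interior, rho o g would have a local maximum at w, with value rho z = 0, so the
    derivative of g at w would send every vector into the kernel of d rho at z. But f o g = id near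
    w makes this derivative invertible, contradicting grad rho z <> 0. *)
Lemma boundary_stable (f g : 'rV[R]_N -> 'rV[R]_N) z :
  (forall z, rho z = 0 -> grad rho z != 0) ->
  smooth_near (closure O) f -> smooth_near (closure O) g ->
  (forall z, closure O z -> closure O (f z) /\ closure O (g z)) ->
  (forall z, closure O z -> g (f z) = z /\ f (g z) = z) ->
  closure O z -> ~ O z -> ~ O (f z).
Proof.
move=> gr [Uf [oUf sUf sf]] [Ug [oUg sUg sg]] stab inv Cz nOz Ofz.
set w := f z; have gw : g w = z by have [] := inv z Cz.
have Cw : closure O w by exact: subset_closure.
have Ugw : Ug w by exact: sUg.
have Ufz : Uf z by exact: sUf.
have rz : rho z = 0 by exact: bdry_rho.
have dg v : derivable g w v by have [_] := sg [::] w Ugw; exact.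
have [difr Dr] := smooth_differentiable [::] openT srho (I : setT z).
have dfc j : differentiable (fun y => f y 0 j) z.
  by have [] := smooth_differentiable [::] oUf (smooth_coord j oUf sf).1 Ufz.
have cg : {for w, continuous g} by have [] := sg [::] w Ugw.
have crit v : 'D_('D_v g w) rho z = 0.
  have difr' : differentiable rho (g w) by rewrite gw.
  have h : is_derive w v (rho \o g) ('D_('D_v g w) rho z).
    by rewrite -[X in 'D_ _ rho X]gw; exact: chain_dir.
  have [e e0 he] : exists2 e : R, 0 < e & forall r, `|r| < e -> O (w + r *: v).
    have c : {for (0 : R), continuous (fun r : R => w + r *: v)}.
      by apply: cvgD; [exact: cvg_cst|apply: cvgZr_tmp; exact: cvg_id].
    have nO : nbhs (0 : R) [set r | O (w + r *: v)].
      by apply: c; rewrite /= scale0r addr0; exact: open_nbhs_nbhs.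
    have /nbhs_ballP[e /= e0 he] := nO; exists e => // r re.
    by apply: he; rewrite -ball_normE /= sub0r normrN.
  have hl (r : R) : `|r| < e -> derivable (fun r : R => (rho \o g) (w + r *: v)) r 1.
    move=> re; have Ur : Ug (w + r *: v) by apply/sUg/subset_closure/he.
    have difg : differentiable rho (g (w + r *: v)).
      by have [] := smooth_differentiable [::] openT srho (I : setT (g (w + r *: v))).
    have dgr : derivable g (w + r *: v) v by have [_] := sg [::] _ Ur; exact.
    have [d1 _] := chain_dir difg dgr.
    by have [] := is_derive_line d1.
  have [||||_ e2] := @derive1_at_max R (fun r : R => (rho \o g) (w + r *: v)) (- e) e 0.
  - by rewrite ge0_cp// ltW.
  - by move=> t; rewrite in_itv /= -ltr_norml; exact: hl.
  - by rewrite in_itv /= oppr_lt0 e0.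
  - move=> t; rewrite in_itv /= -ltr_norml => te; rewrite /= scale0r addr0 gw rz.
    by apply: closure_rho; have [] := stab (w + t *: v) (subset_closure (he t te)).
  have [h1 h2] := h.
  have := @is_derive_line R _ _ (rho \o g) w v 0; rewrite scale0r addr0 => /(_ h1)[_].
  by rewrite e2 h2.
have gf0 : dmx g w *m (grad rho z)^T = 0.
  apply/matrixP => i k; rewrite mxE [RHS]mxE -[RHS](crit (evec i)) [RHS]Dr; apply: eq_bigr => j _.
  by rewrite !mxE.
have gf1 : dmx g w *m dmx f z = 1%:M.
  apply/matrixP => i j; rewrite !mxE.
  have [difj Dj] := smooth_differentiable [::] oUf (smooth_coord j oUf sf).1 Ufz.
  have difj' : differentiable (fun y => f y 0 j) (g w) by rewrite gw.
  have [h1 h2] : is_derive w (evec i) ((fun y => f y 0 j) \o g)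
      ('D_('D_(evec i) g w) (fun y => f y 0 j) z).
    by rewrite -[X in 'D_ _ _ X]gw; exact: chain_dir.
  have h3 : is_derive w (evec i) ((fun y => f y 0 j) \o g) ((i == j)%:R).
    apply: (@near_eq_is_derive _ _ _ (fun y : 'rV[R]_N => y 0 j)).
      by apply: (near_open oO Ofz) => y Oy /=; have [_ ->] := inv y (subset_closure Oy).
    have did : derivable (@id 'rV[R]_N) w (evec i) by exact: derivable_id.
    split; first exact: (derivable_mxP _ _ _).1 did 0 j.
    have := derive_mx did; rewrite derive_id => /matrixP/(_ 0 j); rewrite !mxE /=.
    by rewrite eq_sym => ->.
  have [_ h4] := h3; rewrite -h4 h2 Dj; apply: eq_bigr => l _; rewrite !mxE /=; congr (_ * _).
  by have := (smooth_coord j oUf sf).2 [:: evec l] z Ufz.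
have [ug _] := mulmx1_unit gf1.
have /eqP := gr z rz; apply; apply: trmx_inj; rewrite trmx0.
by rewrite -[LHS](mulKmx ug) gf0 mulmx0.
Qed.

End Domain.

(** * Vanishing integrals of derivatives *)

Section ZeroMean.
Variables (R : realType) (N : nat).
Implicit Types (z : 'rV[R]_N) (f q : 'rV[R]_N -> R) (M : R).

Lemma Cc_bounded M f : continuous f -> (forall z i, M < `|z 0 i| -> f z = 0) ->
  exists2 C, 0 <= C & forall z, `|f z| <= C.
Proof.
move=> cf sf; have [C C0 hC] := @compact_norm_bound R _ _ f (@box_compact R N M) (fun z _ => @cf z).
exists C => // z; have [h|h] := pselect (forall i, `|z 0 i| <= M); first exact: hC.
have [i /negP] := (existsNP _).2 h; rewrite -ltNge => hi.
by rewrite (sf z i hi) normr0.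
Qed.

Lemma tame_Cc' M f : 0 <= M -> continuous f -> (forall z i, M < `|z 0 i| -> f z = 0) ->
  exists2 C, 0 <= C & tame M C f.
Proof.
move=> M0 cf sf; have [C C0 hC] := Cc_bounded cf sf; exists C => //; exact: tame_Cc.
Qed.

Lemma translate_cont (V : normedModType R) (a z : V) : {for z, continuous (fun y : V => y + a)}.
Proof. by apply: cvgD; [exact: cvg_id|exact: cvg_cst]. Qed.

Lemma Itot_lin (I : Type) (r : seq I) M (C c : I -> R) (f : I -> 'rV[R]_N -> R) : 0 <= M ->
  (forall i, tame M (C i) (f i)) ->
  exists2 C', tame M C' (fun z => \sum_(i <- r) c i * f i z) &
    Itot (fun z => \sum_(i <- r) c i * f i z) = \sum_(i <- r) c i * Itot (f i).
Proof.
move=> M0 tf; elim: r => [|i r [C' t' e]].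
  have t0 : tame M 0 (fun _ : 'rV[R]_N => 0 : R).
    by apply: tame_Cc => //; [move=> z; exact: cst_continuous|move=> z; rewrite normr0].
  exists 0; first by under eq_fun do rewrite big_nil.
  under eq_fun do rewrite big_nil.
  rewrite big_nil; apply/eqP; rewrite -normr_le0.
  by have := Itot_bound M0 t0; rewrite mul0r.
exists (`|c i| * C i + C').
  under eq_fun do rewrite big_cons; apply: tameD => //; exact: tameZ.
under eq_fun do rewrite big_cons.
rewrite big_cons -e /Itot.
rewrite (iintD _ M0 (tameZ (c i) M0 (tf i)) t' (enum_uniq _)).
by rewrite (iintZ _ _ M0 (tf i) (enum_uniq _)).
Qed.

(* Difference quotients have zero integral by translation invariance. *)
Lemma Itot_div0 M q (qd : 'rV[R]_N -> R) i : 0 <= M ->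
  (forall z, is_derive z (evec i) q (qd z)) -> continuous q -> continuous qd ->
  (forall z j, M < `|z 0 j| -> q z = 0) -> Itot qd = 0.
Proof.
move=> M0 dq cq cqd sq.
have sqd z j : M < `|z 0 j| -> qd z = 0.
  move=> Mz.
  have c : {for z, continuous (fun y : 'rV[R]_N => `|y 0 j|)}.
    exact: (continuous_comp (@coord_cont R N j z) (@norm_continuous _ _ _)).
  have nn : \forall y \near z, 0 = q y.
    have n1 : \forall y \near z, M < `|(y : 'rV[R]_N) 0 j| by exact: (cvgr_gt _ c _ Mz).
    by apply: filterS n1 => y /sq ->.
  have [_ <-] := dq z.
  by have [_ ->] := near_eq_is_derive nn (is_derive_cst (0 : R) z (evec i)).
have [C C0 hC] := Cc_bounded cqd sqd.
(* The steps h k are at most 1, so all difference quotients are supported in the box of size M +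
   1. *)
have M1 : 0 <= M + 1 by rewrite addr_ge0.
pose h k : R := k.+1%:R^-1.
have h0 k : 0 < h k by rewrite invr_gt0.
have h1 k : h k <= 1 by rewrite invf_le1// ler1n.
pose f_ k z := (h k)^-1 * (q (z + h k *: evec i) - q z).
have mv k z : exists2 c, `|c| <= h k & f_ k z = qd (z + c *: evec i).
  have [|c ch e] := @MVT_dir R _ q z (evec i) (h k).
    by move=> s _; have [] := dq (z + s *: evec i).
  exists c; first by rewrite (gtr0_norm (h0 k)) in ch.
  by have [_ <-] := dq (z + c *: evec i); rewrite /f_ e mulrA mulVf ?mul1r// gt_eqF.
have csh k : continuous (fun z => q (z + h k *: evec i)).
  move=> z; have c1 : {for z, continuous (fun y : 'rV[R]_N => y + h k *: evec i)}.
    exact: (@translate_cont _ (h k *: evec i) z).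
  exact: (@continuous_comp _ _ _ (fun y : 'rV[R]_N => y + h k *: evec i) q z c1 (@cq _)).
have ssh k z j : M + 1 < `|z 0 j| -> q (z + h k *: evec i) = 0.
  move=> Mz; apply: (sq _ j); rewrite !mxE.
  have e1 : `|h k * (@evec R N i) 0 j| <= 1.
    rewrite mxE eqxx /= normrM gtr0_norm//.
    by case: (j == i); rewrite ?normr1 ?normr0 ?mulr1 ?mulr0// ?ler01.
  have := lerB_normD (z 0 j) (h k * (@evec R N i) 0 j); rewrite !mxE /= in e1 *; lra.
have sq1 z j : M + 1 < `|z 0 j| -> q z = 0.
  by move=> Mz; apply: (sq z j); rewrite (lt_trans _ Mz)// ltrDl.
have cf k : continuous (f_ k).
  move=> z.
  have a1 : {for z, continuous (fun z : 'rV[R]_N => q (z + h k *: evec i))} := csh k z.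
  have a2 : {for z, continuous (fun z : 'rV[R]_N => - q z)} by apply: contN; exact: cq.
  exact: (contM (@cont_cst R _ (h k)^-1 z) (contD a1 a2)).
have tf k : tame (M + 1) C (f_ k).
  apply: tame_Cc => //.
    by move=> z; have [c _ ->] := mv k z; exact: hC.
  by move=> z j Mz; rewrite /f_ (ssh k z j Mz) (sq1 z j Mz) subrr mulr0.
have If k : Itot (f_ k) = 0.
  have [C1 _ t1] := tame_Cc' M1 (@cq) sq1.
  have [C2 _ t2] := tame_Cc' M1 (csh k) (ssh k).
  have t3 := tameZ (-1) M1 t1.
  have e : f_ k = (fun z => (h k)^-1 * (q (z + h k *: evec i) + -1 * q z)).
    by apply/funext => z; rewrite /f_ mulN1r.
  have tD := tameD M1 t2 t3.
  rewrite e /Itot (iintZ _ _ M1 tD (enum_uniq _)) (iintD _ M1 t2 t3 (enum_uniq _)).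
  rewrite (iintZ _ _ M1 t1 (enum_uniq _)) -/(Itot _) -/(Itot q) (Itot_trans _ _ M1 t1).
  by rewrite mulN1r subrr mulr0.
have pw z : f_ k z @[k --> \oo] --> qd z.
  apply/cvgrPdist_lt => e e0.
  have /cvgrPdist_lt/(_ e e0)/nbhs_ballP[d /= d0 hd] := cqd z.
  have nk : \forall k \near \oo, h k < d by exact: (near_infty_natSinv_lt (PosNum d0)).
  near=> k; have [c ch ->] := mv k z; apply: hd.
  have hk : h k < d by near: k; exact: nk.
  rewrite -ball_normE /= opprD addrA subrr sub0r normrN.
  apply: le_lt_trans hk; apply: le_trans ch; apply: rV_norm_le => // j; rewrite !mxE /=.
  by rewrite normrM; case: (_ == _); rewrite ?normr1 ?normr0 ?mulr1 ?mulr0.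
have cv : Itot (f_ k) @[k --> \oo] --> Itot qd by exact: (iint_cvg M1 tf pw (enum_uniq _)).
have e0 : (fun k => Itot (f_ k)) = (fun=> 0 : R) by apply/funext => k; exact: If.
rewrite e0 in cv; apply: esym.
by have := cvg_unique _ (cvg_cst (0 : R) : _ @ \oo --> _) cv; apply.
Unshelve. all: by end_near.
Qed.

Lemma dirM (z v : 'rV[R]_N) f q (a b : R) : is_derive z v f a -> is_derive z v q b ->
  is_derive z v (fun y => f y * q y) (f z * b + q z * a).
Proof. by move=> df dg; exact: (is_deriveM df dg). Qed.

Lemma dir_sum (z v : 'rV[R]_N) (I : Type) (r : seq I) (f : I -> 'rV[R]_N -> R) (d : I -> R) :
  (forall i, is_derive z v (f i) (d i)) ->
  is_derive z v (fun y => \sum_(i <- r) f i y) (\sum_(i <- r) d i).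
Proof.
move=> fd; elim: r => [|i r IH].
  by rewrite big_nil; under eq_fun do rewrite big_nil; exact: is_derive_cst.
by rewrite big_cons; under eq_fun do rewrite big_cons; exact: (is_deriveD (fd i) IH).
Qed.

(** Vanishing is required on O near every point outside O, boundary points included, so locally the
    extension by 0 is either F or 0. *)
Lemma zero_ext (O : set 'rV[R]_N) (F Fd : 'rV[R]_N -> R) v : open O ->
  (forall z, O z -> [/\ is_derive z v F (Fd z), {for z, continuous F} & {for z, continuous Fd}]) ->
  (forall z, ~ O z -> \forall y \near z, O y -> F y = 0 /\ Fd y = 0) ->
  [/\ forall z, is_derive z v (fun z => \1_O z * F z) (\1_O z * Fd z),
      continuous (fun z => \1_O z * F z) & continuous (fun z => \1_O z * Fd z)].
Proof.
move=> oO h1 h2.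
have inO z (E : 'rV[R]_N -> R) : O z -> \forall y \near z, E y = \1_O y * E y.
  by move=> Oz; apply: (near_open oO Oz) => y Oy; rewrite indicE mem_set// mul1r.
have nO z : ~ O z -> \forall y \near z, 0 = \1_O y * F y /\ 0 = \1_O y * Fd y.
  move=> /h2; apply: filterS => y hy; have [Oy|nOy] := pselect (O y).
    by have [-> ->] := hy Oy; rewrite mulr0.
  by rewrite !indic_notin.
split=> z; have [Oz|nOz] := pselect (O z).
- have [d _ _] := h1 z Oz; rewrite indicE mem_set// mul1r.
  exact: (near_eq_is_derive (inO z F Oz)).
- rewrite indicE memNset// mul0r.
  have nn : \forall y \near z, 0 = \1_O y * F y by apply: filterS (nO z nOz) => y [].
  exact: (near_eq_is_derive nn (is_derive_cst (0 : R) z v)).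
- have [_ c _] := h1 z Oz; exact: (cont_near_eq (inO z F Oz) c).
- apply: (@cont_near_eq _ _ _ (fun=> 0)); last exact: cont_cst.
  by apply: filterS (nO z nOz) => y [].
- have [_ _ c] := h1 z Oz; exact: (cont_near_eq (inO z Fd Oz) c).
- apply: (@cont_near_eq _ _ _ (fun=> 0)); last exact: cont_cst.
  by apply: filterS (nO z nOz) => y [].
Qed.

Lemma bilin_sum (x y : 'rV[R]_N) (A : 'M[R]_N) :
  (x *m A *m y^T) 0 0 = \sum_i \sum_j A i j * (x 0 i * y 0 j).
Proof.
rewrite mxE exchange_big /=; apply: eq_bigr => j _; rewrite mxE mulr_suml.
by apply: eq_bigr => i _; rewrite [y^T _ _]mxE; ring.
Qed.

Lemma antisym_sum (A S : 'M[R]_N) : A^T = - A -> S^T = S -> \sum_i \sum_j A i j * S i j = 0.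
Proof.
move=> Aa Ss; set x := LHS; have : x = - x.
  rewrite {1}/x exchange_big -sumrN; apply: eq_bigr => i _; rewrite -sumrN; apply: eq_bigr => j _.
  have -> : A j i = - A i j by move/matrixP/(_ i j): Aa; rewrite !mxE.
  have -> : S j i = S i j by move/matrixP/(_ i j): Ss; rewrite !mxE.
  by rewrite mulNr.
by lra.
Qed.

(** The matrix has the shape of a Hessian of K o G expanded by the chain rule: the terms g_l D_ijl
    are symmetric by the symmetry of D, and the others add up to W H W^T. *)
Lemma sym_hess_mx (g : 'I_N -> R) (W H : 'M[R]_N) (D : 'I_N -> 'I_N -> 'I_N -> R) : H^T = H ->
  (forall i j l, D i j l = D j i l) ->
  let S : 'M[R]_N := \matrix_(i, j) \sum_l (g l * D i j l + W j l * (W *m H) i l) in S^T = S.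
Proof.
move=> Hs Ds S; have Q : (W *m H *m W^T)^T = W *m H *m W^T := trmx_conj W Hs.
apply/matrixP => i j; rewrite !mxE !big_split /=; congr (_ + _).
  by apply: eq_bigr => l _; rewrite Ds.
have e c d : \sum_l W c l * (W *m H) d l = (W *m H *m W^T) d c.
  by rewrite [RHS]mxE; apply: eq_bigr => l _; rewrite mulrC [W^T _ _]mxE.
by rewrite !e; move/matrixP/(_ i j): Q; rewrite [LHS]mxE.
Qed.

End ZeroMean.

(** * Invariance of integrals under the flow *)

Section Transport.
Variables (R : realType) (n : nat) (O : set 'rV[R]_(n + n)).
Variables (K : R -> 'rV[R]_(n + n) -> R) (G : R -> 'rV[R]_(n + n) -> 'rV[R]_(n + n)).
Local Notation N := (n + n)%N.
Local Notation J := (Jmx n : 'M[R]_(n + n)).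
Local Notation Gp := (fun p : R * 'rV[R]_(n + n) => G p.1 p.2).
Local Notation Kp := (fun p : R * 'rV[R]_(n + n) => K p.1 p.2).
Local Notation Gj j := (fun p : R * 'rV[R]_(n + n) => G p.1 p.2 0 j).
Variables (UG UK : set (R * 'rV[R]_(n + n))).
Hypotheses (oO : open O) (oUG : open UG) (oUK : open UK).
Hypotheses (subG : I01 `*` closure O `<=` UG) (subK : I01 `*` closure O `<=` UK).
Hypotheses (sG : smooth_on UG Gp) (sK : smooth_on UK Kp).
Hypothesis GO : forall t z, I01 t -> closure O z -> closure O (G t z).
Hypothesis ode : forall t z, I01 t -> closure O z ->
  deriv01 (fun s => G s z) t (grad (K t) (G t z) *m J).
Local Notation d1 := ((1, 0) : R * 'rV[R]_(n + n)).
Local Notation dz v := ((0, v) : R * 'rV[R]_(n + n)).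
Implicit Types (z y : 'rV[R]_(n + n)) (s t : R) (p : R * 'rV[R]_(n + n)).

Lemma gradK_flow_cont l p : UG p -> UK (p.1, G p.1 p.2) ->
  {for p, continuous (fun p => 'D_(evec l) (K p.1) (G p.1 p.2))}.
Proof.
move=> Up Kp'.
have -> : (fun p => 'D_(evec l) (K p.1) (G p.1 p.2)) =
  (fun q => 'D_(dz (evec l)) Kp q) \o (fun p => (p.1, G p.1 p.2)).
  by apply/funext => q /=; have [_] := pair_slice_z Kp q.1 (G q.1 q.2) (evec l).
have c1 := @flow_pair_cont R n G UG sG p Up.
have c2 : {for (p.1, G p.1 p.2), continuous (fun q => 'D_(dz (evec l)) Kp q)}.
  by have [] := sK [:: dz (evec l)] Kp'.
exact: (@continuous_comp _ _ _ (fun p => (p.1, G p.1 p.2)) _ p c1 c2).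
Qed.

Lemma slice_near s z : UG (s, z) -> \forall y \near z, UG (s, y).
Proof.
move=> U; have c := @cont_pairl 'rV[R]_(n + n) R s z.
by apply: c; apply: open_nbhs_nbhs.
Qed.

Definition D2 s (i j l : 'I_N) z : R :=
  'D_(dz (evec i)) (fun p => 'D_(dz (evec j)) (Gj l) p) (s, z).

Lemma D2_sym s i j l z : UG (s, z) -> D2 s i j l z = D2 s j i l z.
Proof. by move=> U; exact: (smooth_schwarz _ _ oUG (smooth_coord l oUG sG).1 U). Qed.

Lemma dmx_dir_derive s i j l z : UG (s, z) ->
  is_derive z (evec i) (fun y => dmx (G s) y j l) (D2 s i j l z).
Proof.
move=> U; have sl := (smooth_coord l oUG sG).1.
have [dd eD] := pair_slice_z (fun p => 'D_(dz (evec j)) (Gj l) p) s z (evec i).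
have d : is_derive z (evec i) (fun y => 'D_(dz (evec j)) (Gj l) (s, y)) (D2 s i j l z).
  apply: DeriveDef; last exact: eD.
  by apply/dd; have [_] := sl [:: dz (evec j)] (s, z) U; exact.
apply: (near_eq_is_derive _ d); apply: filterS (slice_near U) => y Uy.
by rewrite (flow_dmx oUG sG).
Qed.

Lemma cont_fix (S : topologicalType) (F : R * 'rV[R]_(n + n) -> S) s z :
  {for (s, z), continuous F} -> {for z, continuous (fun y => F (s, y))}.
Proof.
move=> c; exact: (@continuous_comp _ _ _ (fun y => (s, y)) F z (@cont_pairl _ _ s z) c).
Qed.

Variables (rho : 'rV[R]_(n + n) -> R) (M : R).
Hypotheses (srho : smooth_on setT rho) (Oe : O = [set z | rho z < 0]).
Hypotheses (M0 : 0 <= M) (hM : forall z i, closure O z -> `|z 0 i| <= M).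
Hypothesis cO : compact (closure O).
Hypothesis GB : forall t z, I01 t -> closure O z -> ~ O z -> ~ O (G t z).
Hypothesis G0 : forall z, closure O z -> G 0 z = z.
Hypothesis symp : forall t z, I01 t -> closure O z ->
  dmx (G t) z *m J *m (dmx (G t) z)^T = J.
Variables (U : set 'rV[R]_(n + n)) (f : 'rV[R]_(n + n) -> R) (fd : 'I_N -> 'rV[R]_(n + n) -> R).
Variable delta : R.
Hypotheses (oU : open U) (subU : closure O `<=` U) (delta0 : 0 < delta).
Hypothesis C1f : forall z, U z -> {for z, continuous f} /\ forall i,
  is_derive z (evec i) f (fd i z) /\ {for z, continuous (fd i)}.
Hypothesis fz : forall z, U z -> - delta <= rho z -> f z = 0.

Lemma cutf_near z : U z -> - delta < rho z -> \forall y \near z, f y = 0 /\ forall i, fd i y = 0.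
Proof.
move=> Uz dz.
have n1 : \forall y \near z, - delta < rho y by exact: (cvgr_gt _ (@rho_cont _ _ _ srho z) _ dz).
have o : open [set y | U y /\ - delta < rho y].
  rewrite openE => y [Uy dy]; rewrite /interior.
  have n2 : \forall x \near y, - delta < rho x by exact: (cvgr_gt _ (@rho_cont _ _ _ srho y) _ dy).
  have n3 : \forall x \near y, U x by exact: open_nbhs_nbhs.
  by apply: filterS2 n3 n2.
apply: (near_open o (conj Uz dz)) => y [Uy dy]; split; first by apply: fz => //; exact: ltW.
move=> i; have [_ /(_ i) [[_ <-] _]] := C1f Uy.
have nn : \forall x \near y, 0 = f x.
  by apply: (near_open o (conj Uy dy)) => x [Ux dx]; rewrite fz// ltW.
by have [_ ->] := near_eq_is_derive nn (is_derive_cst (0 : R) y (evec i)).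
Qed.

Lemma f_diff z : U z -> differentiable f z /\ forall v, 'D_v f z = \sum_i v 0 i * fd i z.
Proof.
move=> Uz; have [_ h] := C1f Uz.
have [||df Df] := @C1_differentiable R N f z.
- by apply: (near_open oU Uz) => y Uy i; have [_ /(_ i) [[]]] := C1f Uy.
- move=> i; have [_ c] := h i; apply: (cont_near_eq _ c).
  by apply: (near_open oU Uz) => y Uy; have [_ /(_ i) [[_ ->]]] := C1f Uy.
split=> // v; rewrite Df; apply: eq_bigr => i _; by have [[_ ->]] := h i.
Qed.

(** Outside the closure there are no points of O nearby. At a boundary point, G s z is again on the
    boundary, where rho = 0 > -delta, and f vanishes in a neighbourhood of it. *)
Lemma near_bdry s z : I01 s -> ~ O z ->
  \forall y \near z, O y -> f (G s y) = 0 /\ forall i, fd i (G s y) = 0.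
Proof.
move=> Is nOz; have [Cz|nCz] := pselect (closure O z); last first.
  have [B nB hB] : exists2 B : set 'rV[R]_(n + n), nbhs z B & ~ ((O `&` B) !=set0).
    by apply: contra_notP nCz => h B nB; apply: contra_notP h => hB; exists B.
  by apply: filterS nB => y By Oy; exfalso; apply: hB; exists y.
have CG := GO Is Cz; have nG := GB Is Cz nOz.
have rG : rho (G s z) = 0 by exact: (bdry_rho srho Oe).
have UGz : UG (s, z) by exact: subG.
have c : {for z, continuous (G s)} by exact: (cont_fix (@flow_cont R n G UG sG _ UGz)).
have h : - delta < rho (G s z) by rewrite rG oppr_lt0.
have nn : \forall y \near z, f (G s y) = 0 /\ forall i, fd i (G s y) = 0.
  exact: (c _ (cutf_near (subU CG) h)).
by apply: filterS nn => y hy _.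
Qed.

(** The time derivative of f (G s z), see [Pt_derive]: a Poisson bracket of K and f evaluated at G s
    z. *)
Definition Pt p : R := (grad (K p.1) (G p.1 p.2) *m J *m (\row_l fd l (G p.1 p.2))^T) 0 0.

Lemma Pt_cont p : I01 p.1 -> closure O p.2 -> {for p, continuous Pt}.
Proof.
case: p => s z /= Is Cz; have Up : UG (s, z) by exact: subG.
have CG := GO Is Cz; have Kp' : UK (s, G s z) by exact: subK.
have -> : Pt = (fun p => \sum_i \sum_j J i j * ('D_(evec i) (K p.1) (G p.1 p.2) * fd j (G p.1 p.2))).
  apply/funext => p; rewrite /Pt bilin_sum; apply: eq_bigr => i _; apply: eq_bigr => j _.
  by rewrite !mxE.
apply: cont_sum => i _; apply: cont_sum => j _; apply: contM; first exact: cont_cst.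
apply: contM; first exact: gradK_flow_cont.
have [_ /(_ j) [_ c]] := C1f (subU CG).
exact: (@continuous_comp _ _ _ Gp (fd j) (s, z) (@flow_cont R n G UG sG _ Up) c).
Qed.

Lemma Pt_derive s z : I01 s -> closure O z -> is_derive s 1 (fun r => f (G r z)) (Pt (s, z)).
Proof.
move=> Is Cz; have Up : UG (s, z) by exact: subG.
have CG := GO Is Cz; have [df Df] := f_diff (subU CG).
have dG : derivable Gp (s, z) d1 by have [_] := sG [::] Up; exact.
have h := pair_slice_t dG.
apply: (is_derive_eq (chain_curve df h)); rewrite Df /Pt mxE; apply: eq_bigr => j _.
have -> : (\row_l fd l (G s z))^T j 0 = fd j (G s z) by rewrite !mxE.
congr (_ * _).
rewrite -(flow_velocity oUG subG sG ode j Is Cz).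
by have := (smooth_coord j oUG sG).2 [:: d1] (s, z) Up.
Qed.

(** [hd] is the z-gradient of f o G s, [kap] that of K s o G s, and [kapd] the Hessian of the
    latter, expanded by the chain rule. *)
Definition hd s i z : R := (\row_l fd l (G s z) *m (dmx (G s) z)^T) 0 i.
Definition kap s j z : R := (grad (K s) (G s z) *m (dmx (G s) z)^T) 0 j.
Definition kapd s i j z : R := \sum_l ('D_(evec l) (K s) (G s z) * D2 s i j l z +
  dmx (G s) z j l * (dmx (G s) z *m hess (K s) (G s z)) i l).

Lemma flow_dir_derive s i z : I01 s -> closure O z ->
  is_derive z (evec i) (fun y => f (G s y)) (hd s i z).
Proof.
move=> Is Cz; have Up : UG (s, z) by exact: subG.
have CG := GO Is Cz; have [df Df] := f_diff (subU CG).
have dG : derivable (G s) z (evec i) by exact: (@flow_dmx_derivable R n G UG sG s z i Up).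
apply: (is_derive_eq (chain_dir df dG)); rewrite Df /hd mxE; apply: eq_bigr => j _.
by rewrite !mxE mulrC.
Qed.

Lemma kap_derive s i j z : I01 s -> closure O z ->
  is_derive z (evec i) (kap s j) (kapd s i j z).
Proof.
move=> Is Cz; have Up : UG (s, z) by exact: subG.
have -> : kap s j = (fun y => \sum_l 'D_(evec l) (K s) (G s y) * dmx (G s) y j l).
  by apply/funext => y; rewrite /kap mxE; apply: eq_bigr => l _; rewrite !mxE.
apply: dir_sum => l; apply: dirM; last exact: dmx_dir_derive.
by apply: (@grad_flow_derive R n O K G UG UK) => //.
Qed.

Lemma kap_cont s j z : I01 s -> closure O z -> {for z, continuous (kap s j)}.
Proof.
move=> Is Cz; have Up : UG (s, z) by exact: subG.
have Kp' : UK (s, G s z) by apply: subK; split=> //; exact: GO.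
have -> : kap s j = (fun y => \sum_l 'D_(evec l) (K s) (G s y) * dmx (G s) y j l).
  by apply/funext => y; rewrite /kap mxE; apply: eq_bigr => l _; rewrite !mxE.
apply: cont_sum => l _; apply: contM.
  exact: (cont_fix (@gradK_flow_cont l (s, z) Up Kp')).
exact: (cont_fix (@flow_dmx_cont R n G UG oUG sG j l (s, z) Up)).
Qed.

Lemma kapd_cont s i j z : I01 s -> closure O z -> {for z, continuous (kapd s i j)}.
Proof.
move=> Is Cz; have Up : UG (s, z) by exact: subG.
have Kp' : UK (s, G s z) by apply: subK; split=> //; exact: GO.
have cW a b := cont_fix (@flow_dmx_cont R n G UG oUG sG a b (s, z) Up).
apply: cont_sum => l _; apply: contD; apply: contM.
- exact: (cont_fix (@gradK_flow_cont l (s, z) Up Kp')).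
- apply: (cont_fix (F := fun p => 'D_(dz (evec i)) (fun p => 'D_(dz (evec j)) (Gj l) p) p)).
  by have [] := (smooth_coord l oUG sG).1 [:: dz (evec i); dz (evec j)] (s, z) Up.
- exact: cW.
have -> : (fun y => (dmx (G s) y *m hess (K s) (G s y)) i l) =
   (fun y => \sum_k dmx (G s) y i k * hess (K s) (G s y) k l).
  by apply/funext => y; rewrite mxE.
apply: cont_sum => k _; apply: contM; first exact: cW.
exact: (cont_fix (@flow_hess_cont R n K G UG UK oUK sG sK k l (s, z) Up Kp')).
Qed.

Lemma hd_cont s i z : I01 s -> closure O z -> {for z, continuous (hd s i)}.
Proof.
move=> Is Cz; have Up : UG (s, z) by exact: subG.
have -> : hd s i = (fun y => \sum_l fd l (G s y) * dmx (G s) y i l).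
  by apply/funext => y; rewrite /hd mxE; apply: eq_bigr => l _; rewrite !mxE.
apply: cont_sum => l _; apply: contM; last first.
  exact: (cont_fix (@flow_dmx_cont R n G UG oUG sG i l (s, z) Up)).
have [_ /(_ l) [_ c]] := C1f (subU (GO Is Cz)).
have cG := cont_fix (@flow_cont R n G UG sG _ Up).
exact: (@continuous_comp _ _ _ (G s) (fd l) z cG c).
Qed.

Lemma fG_cont s z : I01 s -> closure O z -> {for z, continuous (fun y => f (G s y))}.
Proof.
move=> Is Cz; have Up : UG (s, z) by exact: subG.
have [c _] := C1f (subU (GO Is Cz)).
have cG := cont_fix (@flow_cont R n G UG sG _ Up).
exact: (@continuous_comp _ _ _ (G s) f z cG c).
Qed.

(* Liouville's theorem, in divergence form. *)
Lemma Pt_div s z : I01 s -> closure O z ->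
  Pt (s, z) = - \sum_i \sum_j J i j * (hd s i z * kap s j z + f (G s z) * kapd s i j z).
Proof.
move=> Is Cz; have Up : UG (s, z) by exact: subG.
have Kp' : UK (s, G s z) by apply: subK; split=> //; exact: GO.
set W := dmx (G s) z; set H := hess (K s) (G s z).
set a : 'rV[R]_N := \row_l fd l (G s z); set b := grad (K s) (G s z).
(* J is antisymmetric and [kapd] is symmetric, so the second-order terms drop out. *)
have sk : \sum_i \sum_j J i j * kapd s i j z = 0.
  pose S := \matrix_(i, j) kapd s i j z.
  have -> : \sum_i \sum_j J i j * kapd s i j z = \sum_i \sum_j J i j * S i j.
    by apply: eq_bigr => i _; apply: eq_bigr => j _; rewrite [S _ _]mxE.
  apply: antisym_sum; first exact: Jmx_tr.
  exact: (sym_hess_mx (fun l => 'D_(evec l) (K s) (G s z)) W (hess_sym oUK sK Kp')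
    (fun i j l => D2_sym i j l Up)).
have -> : \sum_i \sum_j J i j * (hd s i z * kap s j z + f (G s z) * kapd s i j z) =
   \sum_i \sum_j J i j * (hd s i z * kap s j z) + f (G s z) * \sum_i \sum_j J i j * kapd s i j z.
  rewrite mulr_sumr -big_split /=; apply: eq_bigr => i _; rewrite mulr_sumr -big_split /=.
  by apply: eq_bigr => j _; rewrite mulrDr; congr (_ + _); rewrite mulrCA.
rewrite sk mulr0 addr0 -(bilin_sum (a *m W^T) (b *m W^T)) trmx_mul trmxK !mulmxA.
(* The identity W^T J W = J removes the Jacobians from the bracket of the pulled-back functions. *)
have -> : a *m W^T *m J *m W *m b^T = a *m (W^T *m J *m W) *m b^T by rewrite !mulmxA.
rewrite (symp_tr (symp Is Cz)) /Pt -/a -/b.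
have -> : (b *m J *m a^T) 0 0 = ((b *m J *m a^T)^T) 0 0 by rewrite [RHS]mxE.
by rewrite !trmx_mul trmxK Jmx_tr mulNmx mulmxN mulmxA mxE.
Qed.

(** [Pt_div] writes the integrand as a constant combination of partial derivatives of (f o G) kap_j;
    these products extend by 0 outside O to C^1 functions of compact support, so [Itot_div0] applies
    to each. *)
Lemma Itot_Pt s : I01 s ->
  (exists C, tame M C (fun z => \1_O z * Pt (s, z))) /\ Itot (fun z => \1_O z * Pt (s, z)) = 0.
Proof.
move=> Is; have sub := @subset_closure _ O.
pose q j z := f (G s z) * kap s j z.
pose qd i j z := hd s i z * kap s j z + f (G s z) * kapd s i j z.
have ext i j : [/\ forall z, is_derive z (evec i) (fun z => \1_O z * q j z) (\1_O z * qd i j z),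
      continuous (fun z => \1_O z * q j z) & continuous (fun z => \1_O z * qd i j z)].
  apply: zero_ext => //.
    move=> z /sub Cz; split.
    - apply: (is_derive_eq (dirM (flow_dir_derive i Is Cz) (kap_derive i j Is Cz))).
      by rewrite /qd addrC [kap s j z * _]mulrC.
    - by apply: contM; [exact: fG_cont|exact: kap_cont].
    - by apply: contD; apply: contM; [exact: hd_cont|exact: kap_cont|exact: fG_cont|exact: kapd_cont].
  move=> z nOz; apply: filterS (near_bdry Is nOz) => y h Oy; have [h1 h2] := h Oy.
  rewrite /q /qd h1 !mul0r /hd (_ : \row_l _ = 0) ?mul0mx ?mxE ?mul0r ?addr0//.
  by apply/rowP => l; rewrite !mxE h2.
have sq (F : 'rV[R]_N -> R) z i : M < `|z 0 i| -> \1_O z * F z = 0.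
  by move=> Mz; apply: indic_notin => /sub Cz; move: Mz; rewrite ltNge hM.
have tq i j : exists2 C, 0 <= C & tame M C (fun z => \1_O z * qd i j z).
  by have [_ _ c] := ext i j; exact: (tame_Cc' M0 c (sq (qd i j))).
have Iq i j : Itot (fun z => \1_O z * qd i j z) = 0.
  by have [e1 e2 e3] := ext i j; exact: (Itot_div0 M0 e1 e2 e3 (sq (q j))).
(* One bound is selected for every pair of indices at once, as [Itot_lin] takes a family of
   bounds. *)
pose C ij := xget 0 [set C : R | tame M C (fun z => \1_O z * qd ij.1 ij.2 z)].
have tC (ij : 'I_N * 'I_N) : tame M (C ij) (fun z => \1_O z * qd ij.1 ij.2 z).
  have [c _ tc] := tq ij.1 ij.2; rewrite /C; case: xgetP => [c' _ //|h].
  by exfalso; exact: (h c).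
have [C' tC' e] := @Itot_lin R N _ (index_enum ('I_N * 'I_N)%type) M C
  (fun ij => - J ij.1 ij.2) _ M0 tC.
have eP : (fun z => \1_O z * Pt (s, z)) = (fun z => \sum_ij - J ij.1 ij.2 * (\1_O z * qd ij.1 ij.2 z)).
  apply/funext => z; have [Oz|nOz] := pselect (O z); last first.
    rewrite (@indic_notin _ _ _ (fun z => Pt (s, z)))// big1// => ij _.
    by rewrite (@indic_notin _ _ _ (qd ij.1 ij.2))// mulr0.
  rewrite (Pt_div Is (sub _ Oz)) indicE mem_set// mul1r -sumrN.
  rewrite -(pair_bigA _ (fun i j => - J i j * (1 * qd i j z))) /=; apply: eq_bigr => i _.
  by rewrite -sumrN; apply: eq_bigr => j _; rewrite mul1r mulNr.
rewrite eP; split; first by exists C'.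
by rewrite e big1// => ij _; rewrite Iq mulr0.
Qed.

(** Summing the increments over a subdivision of [0, t] with mesh below d gives |u t - u 0| <= e,
    for every e. *)
Lemma small_increments_const (u : R -> R) :
  (forall e, 0 < e -> exists2 d, 0 < d & forall s s', I01 s -> I01 s' -> `|s' - s| < d ->
     `|u s' - u s| <= e * `|s' - s|) -> forall t, I01 t -> u t = u 0.
Proof.
move=> hu t It; apply/eqP; rewrite -subr_eq0 -normr_le0; apply/ler_addgt0Pr => e e0.
rewrite add0r; have [d d0 hd] := hu e e0.
have /andP[t0 t1] := It.
have [k hk] : exists k : nat, k.+1%:R^-1 < d.
  by have [k _ /(_ k (leqnn k)) h] := near_infty_natSinv_lt (PosNum d0); exists k.
have ki : 0 < k.+1%:R^-1 :> R by rewrite invr_gt0.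
pose x (j : nat) := t * (j%:R / k.+1%:R).
have Ix j : (j <= k.+1)%N -> I01 (x j).
  move=> jk; have j1 : j%:R / k.+1%:R <= 1 :> R by rewrite ler_pdivrMr// mul1r ler_nat.
  by rewrite /I01 /= mulr_ge0 ?divr_ge0//= mulr_ile1// divr_ge0.
have step j : (j <= k.+1)%N -> `|u (x j) - u 0| <= e * (j%:R / k.+1%:R).
  elim: j => [_|j IH jk]; first by rewrite /x mul0r mulr0 subrr normr0 mulr0.
  have dx : x j.+1 - x j = t / k.+1%:R.
    by rewrite /x -mulrBr -mulrBl -[j.+1%:R]natr1 addrAC subrr add0r mul1r.
  have tk : t / k.+1%:R <= k.+1%:R^-1 by rewrite ler_piMl// ltW.
  have nd : `|x j.+1 - x j| = t / k.+1%:R by rewrite dx ger0_norm// divr_ge0.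
  have h1 := hd _ _ (Ix j (ltnW jk)) (Ix j.+1 jk).
  rewrite nd in h1; have {}h1 := h1 (le_lt_trans tk hk).
  have h2 := IH (ltnW jk).
  apply: (le_trans (ler_distD (u (x j)) _ _)).
  have -> : e * (j.+1%:R / k.+1%:R) = e * k.+1%:R^-1 + e * (j%:R / k.+1%:R).
    by rewrite -[j.+1%:R]natr1 mulrDl mul1r mulrDr addrC.
  by apply: lerD => //; apply: le_trans h1 _; rewrite ler_pM2l.
have := step k.+1 (leqnn _); rewrite divff// mulr1 /x divff// mulr1.
by [].
Qed.

(** Since the integral of Pt vanishes, the increment of the integral from s to s' is the integral of
    F = f (G s') - f (G s) - (s' - s) Pt. By the mean value theorem and uniform continuity of Pt on
    a compact set, F is uniformly o(|s' - s|). *)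
Lemma transport t : I01 t ->
  Itot (fun z => \1_O z * f (G t z)) = Itot (fun z => \1_O z * f z).
Proof.
move=> It; have sub := @subset_closure _ O.
have i00 : @I01 R 0 by rewrite /I01 /= lexx ler01.
have -> : (fun z => \1_O z * f z) = (fun z => \1_O z * f (G 0 z)).
  apply/funext => z; have [Oz|nOz] := pselect (O z); first by rewrite G0//; exact: sub.
  by rewrite (@indic_notin _ _ _ f)// (@indic_notin _ _ _ (fun z => f (G 0 z))).
apply: (@small_increments_const (fun t => Itot (fun z => \1_O z * f (G t z)))) => // e e0.
pose V := (2 * M) ^+ N; have V0 : 0 <= V by rewrite exprn_ge0// mulr_ge0.
pose e' := e / (V + 1).
have e'0 : 0 < e' by rewrite divr_gt0// ltr_wpDl.
have cS : compact (I01 `*` closure O : set (R * 'rV[R]_N)) by apply: compact_setX => //; exact: I01_compact.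
have [d d0 hd'] := compact_unif cS (fun p (h : (I01 `*` closure O) p) => @Pt_cont p h.1 h.2) e'0.
have tfG s : I01 s -> exists2 C, 0 <= C & tame M C (fun z => \1_O z * f (G s z)).
  move=> Is; have [C C0 hC] := compact_norm_bound cO (fun z => @fG_cont s z Is).
  exists C => //; apply: (tame_indic oO srho Oe M0 hM) => // z /sub Cz; [exact: fG_cont|exact: hC].
exists d => // s s' Is Is' sd.
have [[C tP] IP] := Itot_Pt Is.
have [C1 _ t1] := tfG s Is; have [C2 _ t2] := tfG s' Is'.
pose F z := \1_O z * f (G s' z) + (-1 * (\1_O z * f (G s z)) + - (s' - s) * (\1_O z * Pt (s, z))).
have ta := tameZ (-1) M0 t1; have tb := tameZ (- (s' - s)) M0 tP.
have tc := tameD M0 ta tb; have tF := tameD M0 t2 tc.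
have IF : Itot F = Itot (fun z => \1_O z * f (G s' z)) - Itot (fun z => \1_O z * f (G s z)).
  have un := enum_uniq 'I_N.
  rewrite /Itot /F (iintD _ M0 t2 tc un) (iintD _ M0 ta tb un) (iintZ _ _ M0 t1 un).
  by rewrite (iintZ _ _ M0 tP un) -/(Itot (fun z => \1_O z * Pt (s, z))) IP mulr0 addr0 mulN1r.
have bF z : `|F z| <= e' * `|s' - s|.
  have [Oz|nOz] := pselect (O z); last first.
    rewrite /F (@indic_notin _ _ _ (fun z => f (G s' z)))// (@indic_notin _ _ _ (fun z => f (G s z)))//.
    by rewrite (@indic_notin _ _ _ (fun z => Pt (s, z)))// !mulr0 !addr0 normr0 mulr_ge0// ltW.
  have Cz := sub _ Oz; rewrite /F indicE mem_set// !mul1r mulN1r.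
  have [->|ss] := eqVneq s' s; first by rewrite !subrr oppr0 mul0r addr0 subrr normr0 mulr0.
  have [c Ic [cs e1]] : exists2 c, I01 c & `|c - s| <= `|s' - s| /\
      f (G s' z) - f (G s z) = (s' - s) * Pt (c, z).
    have mv a b : I01 a -> I01 b -> a < b -> exists2 c, a < c < b &
        f (G b z) - f (G a z) = Pt (c, z) * (b - a).
      move=> /andP[a0 a1] /andP[b0 b1] ab.
      have I r : a <= r <= b -> I01 r.
        by move=> /andP[ar rb]; rewrite /I01 /= (le_trans a0)// (le_trans rb).
      have [r hr|r /andP[h1 h2]|r /andP[h1 h2] er] := mvt_pos ab (f := fun r => f (G r z)).
      - exact: (is_derive_continuous (Pt_derive (I r hr) Cz)).
      - have Ir : I01 r by apply: I; rewrite !ltW.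
        by have [] := Pt_derive Ir Cz.
      exists r; first by rewrite h1.
      have Ir : I01 r by apply: I; rewrite !ltW.
      by rewrite er; have [_ ->] := Pt_derive Ir Cz.
    have /andP[s0 s1] := Is; have /andP[s'0 s'1] := Is'.
    case: (ltgtP s' s) ss => // ss _.
      have [c /andP[c1 c2] ec] := mv s' s Is' Is ss; exists c.
        by rewrite /I01 /= ltW ?(le_lt_trans s'0)// ltW// (lt_le_trans c2).
      by split; [rewrite !ltr0_norm ?subr_lt0//; lra|rewrite -opprB ec; ring].
    have [c /andP[c1 c2] ec] := mv s s' Is Is' ss; exists c.
      by rewrite /I01 /= ltW ?(le_lt_trans s0)// ltW// (lt_le_trans c2).
    by split; [rewrite !gtr0_norm ?subr_gt0//; lra|rewrite ec; ring].
  have -> : f (G s' z) + (- f (G s z) + - (s' - s) * Pt (s, z)) =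
     (s' - s) * (Pt (c, z) - Pt (s, z)).
    by rewrite mulrBr -e1; ring.
  rewrite normrM mulrC ler_wpM2r// distrC ltW//; apply: hd' => //.
  split=> /=; last exact: ballxx.
  by rewrite -ball_normE /= distrC (le_lt_trans cs).
have tF' : tame M (e' * `|s' - s|) F by have [a b c] := tF; split.
have := Itot_bound M0 tF'; rewrite IF -/V => h; apply: (le_trans h).
rewrite mulrAC ler_wpM2r// /e' mulrAC ler_pdivrMr ?ltr_wpDl//.
by rewrite ler_pM2l// lerDl.
Qed.

End Transport.

(** * The Maslov angle along positive paths *)

Section ThetaCurve.
Variables (R : realType) (n : nat).
Local Notation C := R[i].
Local Notation Re := complex.Re.
Local Notation Im := complex.Im.
Local Notation N := (n + n)%N.
Local Notation J := (Jmx n : 'M[R]_(n + n)).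
Local Open Scope complex_scope.
Local Open Scope sesquilinear_scope.
Implicit Types (B : 'M[R]_(n + n)) (t : R).

(** Exhibits [dTheta] as a real linear form in the entries, which can be bounded and differentiated
    along curves term by term. *)
Lemma dTheta_form (Q : 'M[C]_N) (x : 'rV[R]_N) : exists w : 'M[R]_N,
  forall M, dTheta Q x M = \sum_a \sum_b w a b * M a b.
Proof.
exists (\matrix_(a, b) \sum_k `|x 0 k| / (1 + x 0 k ^+ 2) * Re (Q k a * Num.conj (Q k b))) => M.
rewrite /dTheta.
under [RHS]eq_bigr do under eq_bigr do rewrite mxE mulr_suml.
under [RHS]eq_bigr do rewrite exchange_big /=.
rewrite [RHS]exchange_big /=; apply: eq_bigr => k _.
have -> : Re ((Q *m cmx M *m Q^t*) k k) = \sum_a \sum_b Re (Q k a * Num.conj (Q k b)) * M a b.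
  rewrite mxE cRe_sum exchange_big /=; apply: eq_bigr => b _.
  rewrite mxE mulr_suml cRe_sum; apply: eq_bigr => a _.
  rewrite !mxE mulrAC mulrC [RHS]mulrC -cReMr; congr (Re _); rewrite /cmx ?mxE //.
by rewrite mulr_sumr; apply: eq_bigr => a _; rewrite mulr_sumr; apply: eq_bigr => b _; rewrite mulrA.
Qed.

Lemma Theta_ge0 B : 0 <= Theta B.
Proof. by apply: sumr_ge0 => k _. Qed.

Lemma Theta_le B : Theta B <= N%:R * (pi / 2).
Proof.
rewrite /Theta (@le_trans _ _ (\sum_(k < N) (pi / 2)))//.
  apply: ler_sum => k _; rewrite ler_norml; apply/andP; split; apply/ltW.
    exact: atan_gtNpi2.
  exact: atan_ltpi2.
by rewrite sumr_const card_ord mulr_natl.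
Qed.

Lemma Theta_lip B0 : B0^T = B0 -> posdef B0 -> forall e, 0 < e -> exists2 d, 0 < d &
  forall B, B^T = B -> posdef B -> (forall i j, `|B i j - B0 i j| <= d) ->
  `|Theta B - Theta B0| < e.
Proof.
move=> Bs Bp e e0; have [Q [x sd]] := sdiag_exists Bs Bp.
have [c [d [c0 d0 h]]] := Theta_expansion sd.
have [w hw] := dTheta_form Q x.
pose L := \sum_a \sum_b `|w a b|.
have L0 : 0 <= L by apply: sumr_ge0 => a _; apply: sumr_ge0 => b _.
pose m := Num.min d (Num.min 1 (e / (L + c + 1))).
have Lc : 0 < L + c + 1 by rewrite ltr_wpDl// addr_ge0.
have m0 : 0 < m by rewrite !lt_min d0 ltr01 divr_gt0.
have md : m <= d by rewrite ge_min lexx.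
have m1 : m <= 1 by rewrite !ge_min lexx orbT.
have me : m * (L + c + 1) <= e by rewrite -ler_pdivlMr// !ge_min lexx !orbT.
exists m => // B Bs' Bp' hB.
have h0 : 0 <= m <= d by rewrite ltW.
have h1 := h B m Bs' Bp' h0 hB.
have h2 : `|dTheta Q x (B - B0)| <= L * m.
  rewrite hw; apply: (le_trans (ler_norm_sum _ _ _)); rewrite /L mulr_suml; apply: ler_sum => a _.
  apply: (le_trans (ler_norm_sum _ _ _)); rewrite mulr_suml; apply: ler_sum => b _.
  by rewrite normrM ler_wpM2l// !mxE.
have h3 : c * m ^+ 2 <= c * m by rewrite ler_wpM2l// expr2 ger_pMl.
have -> : Theta B - Theta B0 = (Theta B - Theta B0 - dTheta Q x (B - B0)) + dTheta Q x (B - B0).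
  by rewrite subrK.
apply: (le_lt_trans (ler_normD _ _)).
have : m * (L + c + 1) = L * m + c * m + m by ring.
lra.
Qed.

Lemma Jmx_le1 i j : `|J i j| <= 1.
Proof.
have e : (J *m J^T) i i = 1 by rewrite Jmx_tr mulmxN Jmx_sqr opprK mxE eqxx.
have : J i j ^+ 2 <= 1.
  rewrite -[X in _ <= X]e [X in _ <= X]mxE (bigD1 j)//= [J^T _ _]mxE -expr2 lerDl sumr_ge0// => k _.
  by rewrite [J^T _ _]mxE -expr2 sqr_ge0.
by rewrite -[1 in X in X -> _](expr1n _ 2) -[J i j ^+ 2]real_normK ?num_real// ler_sqr ?nnegrE.
Qed.

(** The trace of (B K)^2 computed in the eigenbasis; K = -i J produces the sign. *)
Lemma sdiag_sum_sqr B Q x : sdiag B Q x ->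
  \sum_k x 0 k ^+ 2 = - \tr (B *m J *m (B *m J)).
Proof.
move=> [Qu _ QT]; set T := cmx B *m Kmx R n; set D := diag_mx _ in QT.
have QT' : Q *m T = D *m Q by rewrite mulmxA.
have e : \tr (D *m D) = \tr (T *m T).
  have -> : D *m D = Q *m (T *m T) *m invmx Q.
    by rewrite mulmxA QT' -[D *m Q *m T]mulmxA QT' mulmxA -[_ *m Q *m invmx Q]mulmxA (mulmxV Qu) mulmx1.
  by rewrite mxtrace_mulC (mulKmx Qu).
have eT : T *m T = - cmx (B *m J *m (B *m J)).
  rewrite /T /Kmx -!scalemxAr -scalemxAl scalerA mulrNN mulCii scaleN1r.
  by rewrite !cmxM.
move: e; rewrite eT raddfN /= tr_cmx => /(congr1 (@Re R)).
rewrite cReN /= => <-; rewrite /D mulmx_diag mxtrace_diag cRe_sum; apply: eq_bigr => k _.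
by rewrite !mxE cReMr expr2.
Qed.

(** The expansion of [Theta] concerns positive definite matrices and says nothing at B = 0, where
    the path starts. There the bound comes from sum x_k^2 = -tr ((B J)^2), quadratic in the entries
    of B, and from |atan x| <= |x| + x^2. *)
Lemma Theta_small B (m : R) : 0 <= m -> B^T = B -> posdef B -> (forall i j, `|B i j| <= m) ->
  Theta B <= N%:R * (N%:R ^+ 2 * m + (N%:R ^+ 2 * m) ^+ 2).
Proof.
move=> m0 Bs Bp hB; set y := _ * m; have [Q [x sd]] := sdiag_exists Bs Bp.
have y0 : 0 <= y by rewrite mulr_ge0// exprn_ge0.
have bX i j : `|(B *m J) i j| <= N%:R * m.
  rewrite mxE; apply: (le_trans (ler_norm_sum _ _ _)).
  apply: (@le_trans _ _ (\sum_(k < N) m)); last by rewrite sumr_const card_ord mulr_natl.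
  by apply: ler_sum => k _; rewrite normrM -[m]mulr1 ler_pM// Jmx_le1.
have eS (a : R) : \sum_(i < N) \sum_(k < N) a = N%:R * (N%:R * a).
  by rewrite !mulr_natl !sumr_const !card_ord.
have s2 : \sum_k x 0 k ^+ 2 <= y ^+ 2.
  rewrite (sdiag_sum_sqr sd); apply: le_trans (ler_norm _) _; rewrite normrN.
  apply: (le_trans (ler_norm_sum _ _ _)).
  apply: (@le_trans _ _ (\sum_(i < N) \sum_(k < N) (N%:R * m) ^+ 2)).
    apply: ler_sum => i _; rewrite mxE; apply: (le_trans (ler_norm_sum _ _ _)).
    by apply: ler_sum => k _; rewrite normrM expr2 ler_pM.
  rewrite eS /y.
  by rewrite le_eqVlt; apply/orP; left; apply/eqP; ring.
have xk k : `|x 0 k| <= y.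
  rewrite -ler_sqr ?nnegrE// real_normK ?num_real//; apply: le_trans s2.
  by rewrite (bigD1 k)//= lerDl sumr_ge0// => j _; rewrite sqr_ge0.
rewrite (Theta_sdiag sd) (@le_trans _ _ (\sum_(k < N) (y + y ^+ 2)))//; last first.
  by rewrite sumr_const card_ord mulr_natl.
apply: ler_sum => k _; have := atan_taylor 0 (x 0 k).
rewrite atan0 !subr0 expr0n addr0 divr1 => h.
have -> : atan (x 0 k) = (atan (x 0 k) - x 0 k) + x 0 k by rewrite subrK.
apply: (le_trans (ler_normD _ _)); rewrite addrC lerD// (le_trans h)//.
by rewrite -[x 0 k ^+ 2]real_normK ?num_real// ler_sqr ?nnegrE.
Qed.

Lemma is_derive_quad_near (f : R -> R) (x d c : R) : 0 <= c ->
  (\forall s \near x, `|f s - f x - (s - x) * d| <= c * (s - x) ^+ 2) -> is_derive x 1 f d.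
Proof.
move=> c0 hf.
pose P s := `|f s - f x - (s - x) * d| <= c * (s - x) ^+ 2.
(* Where the estimate fails, f is replaced by its tangent, so that the global version
   [is_derive_quad] applies. *)
pose f' s := if P s then f s else f x + (s - x) * d.
have e : \forall s \near x, f' s = f s by apply: filterS hf => s; rewrite /f' /P => ->.
apply: (near_eq_is_derive e); apply: (@is_derive_quad _ _ _ _ c) => h.
have -> : f' x = f x by rewrite /f'; case: ifP => // _; rewrite subrr mul0r addr0.
rewrite /f' /P; case: ifPn => [|_]; first by rewrite [x + h - x]addrAC subrr add0r.
have -> : f x + (x + h - x) * d - f x - h * d = 0 by ring.
rewrite normr0.
by rewrite mulr_ge0// sqr_ge0.
Qed.

Lemma is_derive_lip (f : R -> R) (t d : R) : is_derive t 1 f d ->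
  \forall s \near t, `|f s - f t| <= (`|d| + 1) * `|s - t|.
Proof.
move=> df; have dif : differentiable f t by apply/derivable1_diffP; have [] := df.
have [df1 df2] := df.
have cv : h^-1 *: (f (h *: 1 + t) - f t) @[h --> 0^'] --> d.
  by rewrite -df2; exact: df1.
have h1 : \forall h \near (0 : R)^', `|d - h^-1 *: (f (h *: 1 + t) - f t)| < 1.
  by move/cvgrPdist_lt: cv; apply.
have h2 : \forall h \near (0 : R), h != 0 -> `|d - h^-1 *: (f (h *: 1 + t) - f t)| < 1.
  exact: h1.
have [e /= e0 he] := (nbhs_ballP _ _).1 h2.
apply/nbhs_ballP; exists e => //= s; rewrite -ball_normE /= => ts.
have [->|st] := eqVneq s t; first by rewrite !subrr normr0 mulr0.
have st0 : s - t != 0 by rewrite subr_eq0.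
have ts' : `|s - t| < e by rewrite distrC.
have := he (s - t); rewrite -ball_normE /= sub0r normrN => /(_ ts' st0).
rewrite -[(s - t) *: 1]/((s - t) * 1) mulr1 subrK -[_ *: _]/((s - t)^-1 * (f s - f t)) => h.
have : `|(s - t)^-1 * (f s - f t)| <= `|d| + 1.
  have -> : (s - t)^-1 * (f s - f t) = d - (d - (s - t)^-1 * (f s - f t)) by rewrite subKr.
  by apply: (le_trans (ler_normB _ _)); rewrite lerD2l ltW.
by rewrite normrM normfV mulrC ler_pdivrMr ?normr_gt0.
Qed.

Section Curve.
Variables (W A : R -> 'M[R]_N).
Hypotheses (pW : pos_curve W A) (uW : forall t, I01 t -> W t + 1%:M \in unitmx).

Let sW t : I01 t -> W t *m J *m (W t)^T = J.
Proof. by have [_ _ h _ _] := pW; exact: h. Qed.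

Lemma curve_cay_sym t : I01 t -> (cay (W t))^T = cay (W t).
Proof. by move=> It; apply: cay_tr; [exact: sW|exact: uW]. Qed.

Lemma curve_cay_posdef t : I01 t -> 0 < t -> posdef (cay (W t)).
Proof.
move=> /andP[_ t1] t0; apply: (cay_posdef pW t0 t1) => s /andP[s0 st].
by apply: uW; rewrite /I01 /= s0 (le_trans st).
Qed.

(** At t = 0 the Cayley matrix is 0, outside the positive definite matrices on which [Theta] is
    controlled; the value 0 is the limit there, by [Theta_small]. *)
Definition Thc t : R := if t == 0 then 0 else Theta (cay (W t)).

Lemma Thc_le t : 0 <= Thc t <= N%:R * (pi / 2).
Proof.
rewrite /Thc; case: ifP => _; last by rewrite Theta_ge0 Theta_le.
by rewrite lexx mulr_ge0// divr_ge0// pi_ge0.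
Qed.

Lemma curve_cay_cont t i j : I01 t -> {for t, continuous (fun s => cay (W s) i j)}.
Proof. by move=> It; exact: (mxder_cont (cay_mxder pW It (uW It))). Qed.

Lemma near_all (T : topologicalType) (x : T) (I : finType) (P : I -> T -> Prop) :
  (forall i, \forall y \near x, P i y) -> \forall y \near x, forall i, P i y.
Proof. by move=> h; apply: filter_forall. Qed.

Lemma curve_cay_near t e : I01 t -> 0 < e ->
  \forall s \near t, forall i j, `|cay (W s) i j - cay (W t) i j| <= e.
Proof.
move=> It e0; apply: near_all => i; apply: near_all => j.
have /cvgrPdist_lt/(_ e e0) := @curve_cay_cont t i j It.
by apply: filterS => s; rewrite distrC => /ltW.
Qed.

(** [Theta_small] handles t = 0 and [Theta_lip] later times. Continuity is asked within [0, 1],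
    because positivity of [cay (W s)] is known for 0 < s <= 1 only. *)
Lemma Thc_cont t e : I01 t -> 0 < e -> exists2 d, 0 < d &
  forall s, I01 s -> `|s - t| < d -> `|Thc s - Thc t| < e.
Proof.
move=> It e0.
have [->|t0] := eqVneq t 0.
  have i0 : @I01 R 0 by rewrite /I01 /= lexx ler01.
  pose c := N%:R * (N%:R ^+ 2 + N%:R ^+ 4) : R.
  have c0 : 0 <= c by rewrite mulr_ge0// addr_ge0// exprn_ge0.
  pose m := Num.min 1 (e / (c + 1)).
  have c1 : 0 < c + 1 by rewrite ltr_wpDl.
  have m0 : 0 < m by rewrite lt_min ltr01 divr_gt0.
  have m1 : m <= 1 by rewrite ge_min lexx.
  have me : m * (c + 1) <= e by rewrite -ler_pdivlMr// ge_min lexx orbT.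
  have [d /= d0 hd] := (nbhs_ballP _ _).1 (curve_cay_near i0 m0).
  exists d => // s Is sd; rewrite {2}/Thc eqxx subr0.
  rewrite /Thc; case: eqVneq => [_|s0]; first by rewrite normr0.
  have sp : 0 < s by rewrite lt_def s0; case/andP: Is.
  rewrite ger0_norm ?Theta_ge0//.
  have hB i j : `|cay (W s) i j| <= m.
    have W00 : cay (W 0) = 0 by have [-> _ _ _ _] := pW; exact: cay1.
    have := hd s; rewrite -ball_normE /= distrC => /(_ sd i j).
    by rewrite W00 [(0 : 'M[R]_N) i j]mxE subr0.
  have := Theta_small (ltW m0) (curve_cay_sym Is) (curve_cay_posdef Is sp) hB => h.
  apply: (le_lt_trans h).
  have mm : m ^+ 2 <= m by rewrite expr2 ger_pMl.
  have : N%:R * (N%:R ^+ 2 * m + (N%:R ^+ 2 * m) ^+ 2) <= c * m.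
    have -> : c * m = N%:R * (N%:R ^+ 2 * m + N%:R ^+ 4 * m) by rewrite /c; ring.
    rewrite ler_wpM2l// lerD2l exprMn -exprM ler_wpM2l// exprn_ge0//.
  have : m * (c + 1) = c * m + m by ring.
  lra.
have tp : 0 < t by rewrite lt_def t0; case/andP: It.
have [d d0 hd] := Theta_lip (curve_cay_sym It) (curve_cay_posdef It tp) e0.
have [d' /= d'0 hd'] := (nbhs_ballP _ _).1 (curve_cay_near It d0).
exists (Num.min d' t); first by rewrite lt_min d'0.
move=> s Is; rewrite lt_min => /andP[sd' st].
have sp : 0 < s by move: st; rewrite ltr_norml => /andP[]; lra.
rewrite /Thc (gt_eqF sp) (gt_eqF tp); apply: hd => //; [exact: curve_cay_sym|exact: curve_cay_posdef|].
by apply: hd'; rewrite -ball_normE /= distrC.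
Qed.

(** The error of [Theta_expansion] is quadratic in the increment of B, and B is Lipschitz at t, so
    [Thc] inherits the derivative of [dTheta] along B; [dTheta_lower] bounds it below. *)
Lemma Thc_derive t : (0 < n)%N -> 0 < t < 1 -> exists2 d, is_derive t 1 Thc d &
  n%:R * powR (\det (A t)) (N%:R^-1) <= d.
Proof.
move=> n0 /andP[t0 t1]; have It : I01 t by rewrite /I01 /= !ltW.
have [_ _ _ sA pA] := pW.
have Bs := curve_cay_sym It; have Bp := curve_cay_posdef It t0.
have [Q [x sd]] := sdiag_exists Bs Bp.
exists (dTheta Q x (2 *: (cayC (W t) *m A t *m (cayC (W t))^T))); last first.
  by apply: (dTheta_lower (sW It) (uW It)) => //; [exact: sA|exact: pA].
have [c [d [c0 d0 h]]] := Theta_expansion sd.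
have [w hw] := dTheta_form Q x.
have dB := cay_mxder pW It (uW It).
set B' := 2 *: _ in dB *.
have n1 : \forall s \near t, 0 < s < 1.
  have := @near_in_itvoo R 0 1 t; rewrite in_itv /= t0 t1 => /(_ isT).
  by apply: filterS => s; rewrite in_itv.
have e1 : \forall s \near t, Theta (cay (W s)) = Thc s.
  by apply: filterS n1 => s /andP[s0 _]; rewrite /Thc gt_eqF.
apply: (near_eq_is_derive e1).
pose g s := dTheta Q x (cay (W s)).
have dg : is_derive t 1 g (dTheta Q x B').
  have -> : g = (fun s => \sum_a \sum_b w a b * cay (W s) a b) by apply/funext => s; exact: hw.
  rewrite hw; apply: is_derive_bigsum => a _; apply: is_derive_bigsum => b _.
  apply: (is_derive_eq (is_derive_mul (is_derive_cst (w a b) t 1) (dB a b))).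
  by rewrite mulr0 addr0.
have -> : (fun s => Theta (cay (W s))) = (fun s => (Theta (cay (W s)) - g s) + g s).
  by apply/funext => s; rewrite subrK.
rewrite -[X in is_derive _ _ _ X]add0r; apply: is_derive_add => //.
pose L := \sum_a \sum_b (`|B' a b| + 1).
have L0 : 0 <= L by apply: sumr_ge0 => a _; apply: sumr_ge0 => b _; rewrite addr_ge0.
apply: (@is_derive_quad_near _ _ _ (c * L ^+ 2)); first by rewrite mulr_ge0// sqr_ge0.
have n2 : \forall s \near t, forall a b, `|cay (W s) a b - cay (W t) a b| <= (`|B' a b| + 1) * `|s - t|.
  by apply: near_all => a; apply: near_all => b; exact: (is_derive_lip (dB a b)).
have n3 : \forall s \near t, L * `|s - t| <= d.
  have dl : 0 < d / (L + 1) by rewrite divr_gt0// ltr_wpDl.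
  apply/nbhs_ballP; exists (d / (L + 1)) => //= s; rewrite -ball_normE /= distrC => /ltW h1.
  apply: (@le_trans _ _ ((L + 1) * `|s - t|)); first by rewrite ler_wpM2r// lerDl.
  by rewrite mulrC -ler_pdivlMr// ltr_wpDl.
near=> s.
have s01 : 0 < s < 1 by near: s; exact: n1.
have h2 : forall a b, `|cay (W s) a b - cay (W t) a b| <= (`|B' a b| + 1) * `|s - t|.
  by near: s; exact: n2.
have h3 : L * `|s - t| <= d by near: s; exact: n3.
have Is : I01 s by case/andP: s01 => *; rewrite /I01 /= !ltW.
have s0 : 0 < s by case/andP: s01.
have hL a b : `|cay (W s) a b - cay (W t) a b| <= L * `|s - t|.
  apply: le_trans (h2 a b) _; rewrite ler_wpM2r// /L (bigD1 a)//= (bigD1 b)//= -addrA lerDl.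
  apply: addr_ge0; apply: sumr_ge0 => k _; first by rewrite addr_ge0.
  by apply: sumr_ge0 => l _; rewrite addr_ge0.
have hm : 0 <= L * `|s - t| <= d by rewrite h3 mulr_ge0.
have := h _ _ (curve_cay_sym Is) (curve_cay_posdef Is s0) hm hL.
have mxB (X Y : 'M[R]_N) a b : (X - Y) a b = X a b - Y a b by rewrite !mxE.
have -> : dTheta Q x (cay (W s) - cay (W t)) = g s - g t.
  rewrite /g !hw -sumrB; apply: eq_bigr => a _; rewrite -sumrB; apply: eq_bigr => b _.
  by rewrite mxB mulrBr.
rewrite mulr0 subr0 exprMn real_normK ?num_real// mulrA.
have e2 (a b k l : R) : a - b - (k - l) = a - k - (b - l) by ring.
by rewrite e2.
Unshelve. all: by end_near.
Qed.

Lemma within_I01 (f : R -> R) :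
  (forall t e, I01 t -> 0 < e -> exists2 d, 0 < d &
    forall s, I01 s -> `|s - t| < d -> `|f s - f t| < e) -> {within I01, continuous f}.
Proof.
move=> h; apply/subspace_continuousP => t It; apply/cvgrPdist_lt => e e0.
have [d d0 hd] := h t e It e0.
have nn : \forall s \near t, I01 s -> `|f t - f s| < e.
  apply/nbhs_ballP; exists d => //= s; rewrite -ball_normE /= => ts Is.
  by rewrite distrC; apply: hd => //; rewrite distrC.
exact: nn.
Qed.

Lemma expi_eq (x y : R) : expi x = expi y -> cos (2 * pi * (x - y)) = 1.
Proof.
move=> [e1 e2]; rewrite mulrBr cosB e1 e2 -!expr2.
by rewrite cos2Dsin2.
Qed.

(** If d = f - g were positive at 1, the intermediate value theorem would give it a value m in (0,
    1/2]; but cos (2 pi m) = 1 has no solution there. Exchanging f and g yields equality. *)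
Lemma lift_unique (f g : R -> R) : {within I01, continuous f} -> {within I01, continuous g} ->
  f 0 = g 0 -> (forall t, I01 t -> expi (f t) = expi (g t)) -> f 1 <= g 1.
Proof.
move=> cf cg e0 he; rewrite leNgt; apply/negP => gf.
have II : @I01 R = `[0, 1]%classic by apply/seteqP; split => t /=; rewrite in_itv.
pose d t := f t - g t.
have cd : {within `[0, 1], continuous d}.
  move/subspace_continuousP: cf => cf; move/subspace_continuousP: cg => cg.
  by rewrite -II; apply/subspace_continuousP => t It; apply: cvgB; [exact: cf|exact: cg].
pose m := Num.min (d 1) (2^-1).
have d1 : 0 < d 1 by rewrite subr_gt0.
have m0 : 0 < m by rewrite lt_min d1 invr_gt0 ltr0n.
have md : m <= d 1 by rewrite ge_min lexx.
have m2 : m <= 2^-1 by rewrite ge_min lexx orbT.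
have d0 : d 0 = 0 by rewrite /d e0 subrr.
have [|c] := @IVT R d 0 1 m ler01 cd.
  rewrite d0 (_ : Num.min 0 (d 1) = 0); last by apply/min_idPl; exact: ltW.
  by rewrite (_ : Num.max 0 (d 1) = d 1) ?(ltW m0) ?md//; apply/max_idPr; exact: ltW.
rewrite in_itv /= => Ic dc.
have Ic' : I01 c by [].
have hc := expi_eq (he c Ic'); rewrite -/(d c) dc in hc.
have /cos_inj h : cos (2 * pi * m) = cos 0 by rewrite cos0.
have pm : 0 < 2 * pi * m by rewrite !mulr_gt0// pi_gt0.
have pm1 : 2 * pi * m <= pi.
  have := pi_gt0 R; move: m2; move: (pi : R) => p m2 p0; nra.
have : 2 * pi * m = 0 by apply: h; rewrite in_itv /= ?lexx ?pi_ge0 ?pm1 ?(ltW pm).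
by move/eqP; rewrite (gt_eqF pm).
Qed.

(** By [upsilon_cay], [Thc] divided by 2 pi is a continuous lift of [upsilon] along the curve, and
    [lift_unique] identifies its end value with that of whichever lift [mu_path] selects. *)
Lemma mu_pathE (gam : R -> 'M[R]_N) : (forall t, I01 t -> gam t = W t) ->
  mu_path gam = Theta (cay (W 1)) / (2 * pi).
Proof.
move=> gW; have i0 : @I01 R 0 by rewrite /I01 /= lexx ler01.
have i1 : @I01 R 1 by rewrite /I01 /= lexx ler01.
have W00 : W 0 = 1%:M by have [] := pW.
have p0 := pi_gt0 R; have p2 : 0 < 2 * pi :> R by rewrite mulr_gt0.
pose th t := Thc t / (2 * pi).
have th0 : th 0 = 0 by rewrite /th /Thc eqxx mul0r.
have th1 : th 1 = Theta (cay (W 1)) / (2 * pi) by rewrite /th /Thc oner_eq0.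
have cth : {within I01, continuous th}.
  apply: within_I01 => t e It e0.
  have e'0 : 0 < e * (2 * pi) by rewrite mulr_gt0.
  have [d d0 hd] := Thc_cont It e'0; exists d => // s Is sd.
  by rewrite /th -mulrBl normrM normfV (gtr0_norm p2) ltr_pdivrMr// hd.
have uth t : I01 t -> expi (th t) = upsilon (gam t).
  move=> It; rewrite gW//; have [->|t0] := eqVneq t 0; first by rewrite W00 upsilon1 th0.
  have tp : 0 < t by rewrite lt_def t0; case/andP: It.
  rewrite (upsilon_cay (sW It) (uW It) (curve_cay_posdef It tp)) /th /Thc.
  by rewrite (negbTE t0).
rewrite /mu_path; case: xgetP => [r _ [f [f0 cf uf <-]]|h]; last first.
  by exfalso; apply: (h (th 1)); exists th.
have e t : I01 t -> expi (f t) = expi (th t) by move=> It; rewrite uf// uth.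
rewrite -th1; apply/eqP; rewrite eq_le; apply/andP; split.
  by apply: lift_unique => //; rewrite f0 th0.
by apply: lift_unique => //; [rewrite f0 th0|move=> t It; rewrite e].
Qed.

End Curve.

End ThetaCurve.

(** * Integrals bounded by increments *)

Section IncrementIntegral.
Variable R : realType.
Local Notation mu := (@lebesgue_measure R).
Implicit Types t : R.

Lemma pospart_lip (s t : R) : `|Num.max 0 s - Num.max 0 t| <= `|s - t|.
Proof.
have n1 : s - t <= `|s - t| := ler_norm _.
have n2 : t - s <= `|s - t| by rewrite distrC ler_norm.
have n3 : 0 <= `|s - t| := normr_ge0 _.
move: (`|s - t|) n1 n2 n3 => r n1 n2 n3.
by case: (leP 0 s) => s0; case: (leP 0 t) => t0; rewrite ler_norml; apply/andP; split; lra.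
Qed.

Lemma clamp_lip (s t : R) :
  `|Num.max 0 (Num.min s 1) - Num.max 0 (Num.min t 1)| <= `|s - t|.
Proof.
apply: (le_trans (pospart_lip _ _)).
have n1 : s - t <= `|s - t| := ler_norm _.
have n2 : t - s <= `|s - t| by rewrite distrC ler_norm.
have n3 : 0 <= `|s - t| := normr_ge0 _.
move: (`|s - t|) n1 n2 n3 => r n1 n2 n3.
by case: (leP s 1) => s1; case: (leP t 1) => t1; rewrite ler_norml; apply/andP; split; lra.
Qed.

(** No differentiability of v is assumed: lower bounds for its increments on short intervals are
    summed over a subdivision and compared with a primitive of g. *)
Lemma int_le_increments (g v : R -> R) :
  (forall e, 0 < e -> exists2 d, 0 < d & forall s s', I01 s -> I01 s' -> `|s - s'| < d ->
    `|g s - g s'| <= e) ->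
  (forall e, 0 < e -> exists2 d, 0 < d & forall a b, I01 a -> I01 b -> a <= b -> b - a < d ->
    (b - a) * (g a - e) <= v b - v a) ->
  Rintegral mu I01 g <= v 1 - v 0.
Proof.
move=> hg hv.
have II : @I01 R = `[0, 1]%classic by apply/seteqP; split => t /=; rewrite in_itv.
(* Composing with the clamp to [0, 1] extends g continuously to the whole line. *)
pose cl t : R := Num.max 0 (Num.min t 1).
have Icl t : I01 (cl t) by rewrite /I01 /= /cl le_max lexx /= ge_max ler01 ge_min lexx orbT.
have clI t : I01 t -> cl t = t.
  by move=> /andP[t0 t1]; rewrite /cl (min_idPl t1); apply/max_idPr.
have cld s t : `|cl s - cl t| <= `|s - t|.
  exact: clamp_lip.
pose h t := g (cl t).
have ch t : {for t, continuous h}.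
  apply/cvgrPdist_lt => e e0; have e2 : 0 < e / 2 by rewrite divr_gt0.
  have [d d0 hd] := hg _ e2.
  apply/nbhs_ballP; exists d => // s ts; have {}ts : `|t - s| < d := ts.
  have := hd _ _ (Icl t) (Icl s) (le_lt_trans (cld t s) ts); rewrite /h; lra.
have hI a b : mu.-integrable `[a, b] (EFin \o h).
  apply: continuous_compact_integrable; first exact: segment_compact.
  by apply: continuous_in_subspaceT => s _; exact: ch.
(* Starting the primitive at -1 makes 0 an interior point, so P has two-sided derivatives at both
   ends of [0, 1]. *)
pose P x := Rintegral mu `[(-1), x] h.
have dP t : -1 < t < 2 -> is_derive t 1 P (h t).
  move=> /andP[t1 t2]; have [d e] := @continuous_FTC1_closed R h (-1) t 2 t2 (hI _ _) t1 (@ch t).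
  by apply: DeriveDef; [exact: d|rewrite -derive1E e].
have I2 t : 0 <= t <= 1 -> -1 < t < 2 by move=> /andP[? ?]; apply/andP; split; lra.
have eP : Rintegral mu I01 g = P 1 - P 0.
  have -> : Rintegral mu I01 g = Rintegral mu `[0, 1] h.
    by rewrite II; apply: eq_Rintegral => t; rewrite inE /= in_itv /= => It; rewrite /h clI.
  rewrite /Rintegral.
  have cP t : 0 <= t <= 1 -> {for t, continuous P}.
    by move=> /I2 /dP dPt; exact: is_derive_continuous dPt.
  have c1 : {within `[0, 1], continuous h}.
    by apply: continuous_in_subspaceT => s _; exact: ch.
  have c2 : derivable_oo_LRcontinuous P 0 1.
    split.
    - move=> t; rewrite in_itv /= => /andP[t0 t1]; have t01 : 0 <= t <= 1 by rewrite !ltW.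
      by have [] := dP t (I2 t t01).
    - by apply: cvg_at_right_filter; apply: cP; rewrite lexx ler01.
    - by apply: cvg_at_left_filter; apply: cP; rewrite lexx ler01.
  have c3 : {in `]0, 1[, derive1 P =1 h}.
    move=> t; rewrite in_itv /= => /andP[t0 t1]; have t01 : 0 <= t <= 1 by rewrite !ltW.
    by rewrite derive1E; have [_ ->] := dP t (I2 t t01).
  by rewrite (continuous_FTC2 ltr01 c1 c2 c3).
rewrite eP; apply/ler_addgt0Pr => e e0.
have e2 : 0 < e / 2 by rewrite divr_gt0.
have [d1 d10 h1] := hg _ e2; have [d2 d20 h2] := hv _ e2.
have dm0 : 0 < Num.min d1 d2 by rewrite lt_min d10.
have [k hk] : exists k : nat, k.+1%:R^-1 < Num.min d1 d2.
  by have [k _ /(_ k (leqnn k)) hh] := near_infty_natSinv_lt (PosNum dm0); exists k.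
move: hk; rewrite lt_min => /andP[hk1 hk2].
have ki : 0 < k.+1%:R^-1 :> R by rewrite invr_gt0.
pose x (j : nat) : R := j%:R / k.+1%:R.
have Ix j : (j <= k.+1)%N -> I01 (x j).
  by move=> jk; rewrite /I01 /= divr_ge0//= ler_pdivrMr// mul1r ler_nat.
have step j : (j <= k.+1)%N -> P (x j) - P 0 <= v (x j) - v 0 + e * x j.
  elim: j => [_|j IH jk]; first by rewrite /x mul0r !subrr mulr0 addr0.
  have {}IH := IH (ltnW jk); have I1 := Ix j (ltnW jk); have I3 := Ix j.+1 jk.
  have dx : x j.+1 = x j + k.+1%:R^-1 by rewrite /x -[j.+1%:R]natr1 mulrDl mul1r.
  have lt : x j < x j.+1 by rewrite dx ltrDl.
  have /andP[a0 a1] := I1; have /andP[b0 b1] := I3.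
  have [r /andP[hr1 hr2]|r /andP[hr1 hr2]|r /andP[r1 r2] er] := mvt_pos lt (f := P).
  - by apply: (is_derive_continuous (dP r _)); apply: I2; rewrite (le_trans a0)// (le_trans hr2).
  - have rI : 0 <= r <= 1 by rewrite (le_trans a0 (ltW hr1)) (le_trans (ltW hr2)).
    by have [] := dP r (I2 r rI).
  have rI : 0 <= r <= 1 by rewrite (le_trans a0 (ltW r1)) (le_trans (ltW r2)).
  have [_ eD] := dP r (I2 r rI); rewrite eD /h (clI r rI) dx [x j + _]addrC addrK in er.
  have rx : `|r - x j| < d1 by rewrite gtr0_norm ?subr_gt0// (lt_trans _ hk1)// ltrBlDl -dx.
  have g1 := h1 _ _ rI I1 rx.
  have v1 := h2 _ _ I1 I3 (ltW lt); rewrite dx [x j + _]addrC addrK in v1.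
  have {}v1 := v1 hk2.
  have g2 : g r <= g (x j) + e / 2 by move: g1; rewrite ler_norml => /andP[_]; lra.
  rewrite dx [x j + _]addrC.
  have m1 : g r / k.+1%:R <= (g (x j) + e / 2) / k.+1%:R by rewrite ler_pM2r.
  move: er v1 m1 IH; move: (k.+1%:R^-1) => y er v1 m1 IH; nra.
have := step k.+1 (leqnn _); rewrite /x divff// mulr1; lra.
Qed.

End IncrementIntegral.

(** * Closure properties of C^1 functions *)

Section C1Class.
Variables (R : realType) (N : nat) (U : set 'rV[R]_N).
Implicit Types (z : 'rV[R]_N) (f g : 'rV[R]_N -> R).

Definition C1with f (fd : 'I_N -> 'rV[R]_N -> R) := forall z, U z ->
  {for z, continuous f} /\ forall i, is_derive z (evec i) f (fd i z) /\ {for z, continuous (fd i)}.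

Definition C1fun f := exists fd, C1with f fd.

Lemma C1fun_cst (c : R) : C1fun (fun=> c).
Proof.
exists (fun _ _ => 0) => z _; split; first exact: cont_cst.
by move=> i; split; [exact: is_derive_cst|exact: cont_cst].
Qed.

Lemma C1fun_add f g : C1fun f -> C1fun g -> C1fun (fun z => f z + g z).
Proof.
move=> [fd hf] [gd hg]; exists (fun i z => fd i z + gd i z) => z Uz.
have [cf df] := hf z Uz; have [cg dg] := hg z Uz; split; first exact: contD.
move=> i; have [a1 a2] := df i; have [b1 b2] := dg i.
by split; [exact: (is_deriveD a1 b1)|exact: contD].
Qed.

Lemma C1fun_mul f g : C1fun f -> C1fun g -> C1fun (fun z => f z * g z).
Proof.
move=> [fd hf] [gd hg]; exists (fun i z => f z * gd i z + g z * fd i z) => z Uz.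
have [cf df] := hf z Uz; have [cg dg] := hg z Uz; split; first exact: contM.
move=> i; have [a1 a2] := df i; have [b1 b2] := dg i.
by split; [exact: dirM|apply: contD; exact: contM].
Qed.

Lemma C1fun_sum (I : Type) (r : seq I) (f : I -> 'rV[R]_N -> R) :
  (forall i, C1fun (f i)) -> C1fun (fun z => \sum_(i <- r) f i z).
Proof.
move=> hf; elim: r => [|i r IH]; first by under eq_fun do rewrite big_nil; exact: C1fun_cst.
by under eq_fun do rewrite big_cons; exact: C1fun_add.
Qed.

Lemma C1fun_prod (I : Type) (r : seq I) (f : I -> 'rV[R]_N -> R) :
  (forall i, C1fun (f i)) -> C1fun (fun z => \prod_(i <- r) f i z).
Proof.
move=> hf; elim: r => [|i r IH]; first by under eq_fun do rewrite big_nil; exact: C1fun_cst.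
by under eq_fun do rewrite big_cons; exact: C1fun_mul.
Qed.

Lemma C1fun_det m (M : 'rV[R]_N -> 'M[R]_m) : (forall i j, C1fun (fun z => M z i j)) ->
  C1fun (fun z => \det (M z)).
Proof.
move=> hM; rewrite /determinant; apply: C1fun_sum => s.
by apply: C1fun_mul; [exact: C1fun_cst|apply: C1fun_prod].
Qed.

Lemma C1fun_comp f (g dg : R -> R) : C1fun f ->
  (forall z, U z -> is_derive (f z) 1 g (dg (f z)) /\ {for f z, continuous dg}) ->
  C1fun (fun z => g (f z)).
Proof.
move=> [fd hf] hg; exists (fun i z => dg (f z) * fd i z) => z Uz.
have [cf df] := hf z Uz; have [dgz cdg] := hg z Uz.
have cg : {for f z, continuous g} := is_derive_continuous dgz.
split; first exact: (@continuous_comp _ _ _ f g z cf cg).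
move=> i; have [a1 a2] := df i; split.
  have dif : differentiable g (f z) by apply/derivable1_diffP; have [] := dgz.
  have [d1 d2] := a1.
  apply: (is_derive_eq (chain_dir dif d1)); rewrite d2.
  rewrite deriveE// -[X in 'd g _ X]mulr1 -[fd i z * 1]/(fd i z *: (1 : R)) linearZ /= -deriveE//.
  by have [_ ->] := dgz; rewrite mulrC.
by apply: contM => //; exact: (@continuous_comp _ _ _ f dg z cf cdg).
Qed.

Lemma C1fun_smooth f vs : smooth_on U f -> C1fun (iterD vs f).
Proof.
move=> sf; exists (fun i => iterD (evec i :: vs) f) => z Uz.
have [cf df] := sf vs z Uz; split=> // i; split; first exact: derivableP.
by have [] := sf (evec i :: vs) z Uz.
Qed.

End C1Class.

Section PowerDerivative.
Variable R : realType.

Lemma powR_derive (p x : R) : 0 < x ->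
  is_derive x 1 (fun y => powR y p) (expR (p * ln x) * (p / x)) /\
  {for x, continuous (fun x => expR (p * ln x) * (p / x))}.
Proof.
move=> x0.
have dl := is_derive_mul (is_derive_cst p x 1) (is_derive1_ln x0).
have cl : {for x, continuous (fun y => p * ln y)}.
  by apply: contM; [exact: cont_cst|exact: continuous_ln].
split.
  have e : \forall y \near x, expR (p * ln y) = powR y p.
    have n : \forall y \near x, 0 < y by exact: lt_nbhsr.
    by apply: filterS n => y y0; rewrite /powR gt_eqF.
  apply: (near_eq_is_derive e).
  apply: (is_derive_eq (@is_derive_comp1 R expR (fun y => p * ln y) x _ _ (is_derive_expR _) dl)).
  by rewrite mulr0 addr0.
apply: contM; first exact: (@continuous_comp _ _ _ (fun y => p * ln y) expR x cl (@continuous_expR R _)).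
apply: contM; first exact: cont_cst.
by apply: cvgV; [rewrite gt_eqF|exact: cvg_id].
Qed.

Lemma lim_le (u : nat -> R) (a b : R) : u k @[k --> \oo] --> a -> (forall k, u k <= b) -> a <= b.
Proof.
move=> cu h; rewrite leNgt; apply/negP => ba.
have ab : 0 < a - b by rewrite subr_gt0.
have /cvgrPdist_lt/(_ _ ab) [k _ hk] := cu.
have := hk k (leqnn k); have := h k => /= h1 h2.
have := ler_norm (a - u k); lra.
Qed.

End PowerDerivative.

(** * Transport of the length density *)

Section DensityTransport.
Variables (R : realType) (n : nat) (O : set 'rV[R]_(n + n)).
Variables (K : R -> 'rV[R]_(n + n) -> R) (G : R -> 'rV[R]_(n + n) -> 'rV[R]_(n + n)).
Local Notation N := (n + n)%N.
Local Notation J := (Jmx n : 'M[R]_(n + n)).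
Variables (UG UK : set (R * 'rV[R]_(n + n))).
Hypotheses (oO : open O) (oUG : open UG) (oUK : open UK).
Hypotheses (subG : I01 `*` closure O `<=` UG) (subK : I01 `*` closure O `<=` UK).
Hypotheses (sG : smooth_on UG (fun p => G p.1 p.2)) (sK : smooth_on UK (fun p => K p.1 p.2)).
Hypothesis GO : forall t z, I01 t -> closure O z -> closure O (G t z).
Hypothesis ode : forall t z, I01 t -> closure O z ->
  deriv01 (fun s => G s z) t (grad (K t) (G t z) *m J).
Variables (rho : 'rV[R]_(n + n) -> R) (M : R).
Hypotheses (srho : smooth_on setT rho) (Oe : O = [set z | rho z < 0]).
Hypotheses (M0 : 0 <= M) (hM : forall z i, closure O z -> `|z 0 i| <= M).
Hypothesis cO : compact (closure O).
Hypothesis GB : forall t z, I01 t -> closure O z -> ~ O z -> ~ O (G t z).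
Hypothesis G0 : forall z, closure O z -> G 0 z = z.
Hypothesis symp : forall t z, I01 t -> closure O z ->
  dmx (G t) z *m J *m (dmx (G t) z)^T = J.
Hypothesis posK : forall t z, I01 t -> closure O z -> posdef (hess (K t) z).
Implicit Types (z y : 'rV[R]_(n + n)) (s t : R) (p : R * 'rV[R]_(n + n)).

Definition Gam t y : R := powR (\det (hess (K t) y)) (N%:R^-1).

Lemma det_hess_gt0 t y : I01 t -> closure O y -> 0 < \det (hess (K t) y).
Proof.
move=> It Cy; apply: posdef_det_gt0; last exact: posK.
by apply: (hess_sym oUK sK); exact: subK.
Qed.

Lemma Gam_cont p : I01 p.1 -> closure O p.2 -> {for p, continuous (fun p => Gam p.1 p.2)}.
Proof.
move=> It Cz; have Up : UK p by case: p It Cz => *; exact: subK.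
have cd : {for p, continuous (fun p => \det (hess (K p.1) p.2))}.
  by apply: cont_det => i j; exact: (@hess_cont R n K UK oUK sK i j p Up).
have [d _] := powR_derive (N%:R^-1) (det_hess_gt0 It Cz).
exact: (@continuous_comp _ _ _ (fun p => \det (hess (K p.1) p.2)) (fun x => powR x (N%:R^-1)) p cd
  (is_derive_continuous d)).
Qed.

Lemma GamG_cont p : I01 p.1 -> closure O p.2 ->
  {for p, continuous (fun p => Gam p.1 (G p.1 p.2))}.
Proof.
move=> It Cz; have Up : UG p by case: p It Cz => *; exact: subG.
have c1 := @flow_pair_cont R n G UG sG p Up.
have c2 := @Gam_cont (p.1, G p.1 p.2) It (GO It Cz).
exact: (@continuous_comp _ _ _ (fun p => (p.1, G p.1 p.2)) (fun p => Gam p.1 p.2) p c1 c2).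
Qed.

Lemma fix_cont (F : R * 'rV[R]_N -> R) t z :
  {for (t, z), continuous F} -> {for z, continuous (fun y => F (t, y))}.
Proof.
move=> c; exact: (@continuous_comp _ _ _ (fun y => (t, y)) F z (@cont_pairl _ _ t z) c).
Qed.

Lemma tame_closure (f : 'rV[R]_N -> R) : (forall z, closure O z -> {for z, continuous f}) ->
  exists2 C, 0 <= C & tame M C (fun z => \1_O z * f z).
Proof.
move=> cf; have [C C0 hC] := compact_norm_bound cO cf; exists C => //.
have sub := @subset_closure _ O.
by apply: (tame_indic oO srho Oe M0 hM) => // z /sub Cz; [exact: cf|exact: hC].
Qed.

Lemma Itot_le (C C' : R) (f g : 'rV[R]_N -> R) : tame M C f -> tame M C' g ->
  (forall z, f z <= g z) -> Itot f <= Itot g.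
Proof. by move=> tf tg h; exact: (iint_le _ M0 tf tg (enum_uniq _) h). Qed.

Lemma indic_le (f g : 'rV[R]_N -> R) z : (O z -> f z <= g z) -> \1_O z * f z <= \1_O z * g z.
Proof.
move=> h; have [Oz|nOz] := pselect (O z); last by rewrite !indic_notin.
by rewrite indicE mem_set// !mul1r h.
Qed.

(** [transport] concerns functions vanishing near the boundary. For the cutoffs f_k of [Gam], the
    integral of f_k equals that of f_k o G, which is at most that of Gam o G; on the left, f_k
    converges to [Gam]. *)
Lemma density_transport_le t : I01 t ->
  Itot (fun z => \1_O z * Gam t z) <= Itot (fun z => \1_O z * Gam t (G t z)).
Proof.
move=> It; have sub := @subset_closure _ O.
have [sKt oKt] := smooth_Kt oUK sK t; set Ut := [set y | UK (t, y)] in sKt oKt.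
have cdet y : Ut y -> {for y, continuous (fun y => \det (hess (K t) y))}.
  move=> Uy; apply: cont_det => i j.
  exact: (fix_cont (@hess_cont R n K UK oUK sK i j (t, y) Uy)).
(* On U the determinant stays positive, so its fractional power is C^1 there. *)
pose U := [set y | Ut y /\ 0 < \det (hess (K t) y)].
have oU : open U.
  rewrite openE => y [Uy dy]; rewrite /interior.
  have n2 : \forall x \near y, 0 < \det (hess (K t) x) by exact: (cvgr_gt _ (@cdet y Uy) _ dy).
  have n3 : \forall x \near y, Ut x by exact: open_nbhs_nbhs.
  by apply: filterS2 n3 n2.
have subU : closure O `<=` U.
  by move=> z Cz; split; [exact: subK|exact: det_hess_gt0].
have sKU : smooth_on U (K t) by move=> vs x [Ux _]; exact: sKt.
have srU : smooth_on U rho by move=> vs x _; exact: srho.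
have C1G : C1fun U (Gam t).
  apply: (@C1fun_comp R N U (fun y => \det (hess (K t) y)) (fun x => powR x (N%:R^-1))
    (fun x => expR (N%:R^-1 * ln x) * (N%:R^-1 / x))).
    apply: C1fun_det => i j.
    have -> : (fun z => hess (K t) z i j) = iterD [:: evec i; evec j] (K t).
      by apply/funext => z; rewrite mxE.
    exact: C1fun_smooth.
  by move=> z [_ d0]; exact: powR_derive.
pose f k z := cutoff k.+1%:R (rho z) * Gam t z.
have C1f k : C1fun U (f k).
  apply: C1fun_mul => //.
  have [d dd _] := cutoff_derive k.+1%:R (0 : R).
  apply: (@C1fun_comp R N U rho (cutoff k.+1%:R) d); first exact: (C1fun_smooth [::] srU).
  move=> z _; split; first exact: dd.
  have [d' dd' c'] := cutoff_derive k.+1%:R (rho z).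
  (* Each use of [cutoff_derive] gives continuity of the derivative at one point; uniqueness of
     derivatives identifies the functions it returns. *)
  have -> : d = d' by apply/funext => y; have [_ <-] := dd y; have [_ <-] := dd' y.
  exact: c'.
have Gc z : closure O z -> {for z, continuous (Gam t)}.
  by move=> Cz; exact: (fix_cont (@Gam_cont (t, z) It Cz)).
have GGc z : closure O z -> {for z, continuous (fun z => Gam t (G t z))}.
  by move=> Cz; exact: (fix_cont (@GamG_cont (t, z) It Cz)).
have [CG CG0 tG] := tame_closure GGc.
have [C C0 hC] := compact_norm_bound cO Gc.
have tk k : tame M C (fun z => \1_O z * f k z).
  apply: (tame_indic_cutoff oO srho Oe M0 hM) => // z /sub Cz; [exact: Gc|exact: hC].
have cv : Itot (fun z => \1_O z * f k z) @[k --> \oo] --> Itot (fun z => \1_O z * Gam t z).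
  apply: (iint_cvg M0 tk _ (enum_uniq _)) => z; exact: (indic_cutoff_cvg Oe).
apply: (lim_le cv) => k.
have [fd hfd] := C1f k.
have d0 : 0 < k.+1%:R^-1 :> R by rewrite invr_gt0.
have fz z : U z -> - k.+1%:R^-1 <= rho z -> f k z = 0.
  move=> _ h; rewrite /f cutoff0 ?mul0r// mulrC -ler_pdivrMr// mulN1r//.
rewrite -(@transport R n O K G UG UK oO oUG oUK subG subK sG sK GO ode rho M srho Oe M0 hM cO
  GB G0 symp U (f k) fd k.+1%:R^-1 oU subU d0 hfd fz t It).
have fGc z : closure O z -> {for z, continuous (fun z => f k (G t z))}.
  move=> Cz; have Up : UG (t, z) by exact: subG.
  have [c _] := hfd _ (subU _ (GO It Cz)).
  have cG := fix_cont (F := fun p => f k (G p.1 p.2)) (t := t) (z := z).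
  apply: cG; exact: (@continuous_comp _ _ _ (fun p => G p.1 p.2) (f k) (t, z) (@flow_cont R n G UG sG _ Up) c).
have [Cf _ tf] := tame_closure fGc.
apply: (Itot_le tf tG) => z.
apply: (@indic_le (fun z => f k (G t z)) (fun z => Gam t (G t z))) => Oz; rewrite /f ger_pMl ?powR_gt0 ?det_hess_gt0//.
  by case/andP: (cutoff01 k.+1%:R (rho (G t z))).
by apply: GO => //; exact: sub.
Qed.

End DensityTransport.

(** * Homotopies and positive paths *)

Section SmoothMaps.
Variables (R : realType) (N : nat) (O : set 'rV[R]_N).
Hypothesis oO : open O.
Implicit Types (z : 'rV[R]_N) (f g : 'rV[R]_N -> 'rV[R]_N).

Lemma coord_comp_cont (T : topologicalType) (F : T -> 'rV[R]_N) (x : T) j :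
  {for x, continuous F} -> {for x, continuous (fun y => F y 0 j)}.
Proof.
move=> cF; exact: (@continuous_comp _ _ _ F (fun v : 'rV[R]_N => v 0 j) x cF (@coord_cont R N j _)).
Qed.

Lemma dmx_smooth_cont f z i j : smooth_near (closure O) f -> closure O z ->
  {for z, continuous (fun y => dmx f y i j)}.
Proof.
move=> [U [oU sU sf]] Cz.
have -> : (fun y => dmx f y i j) = (fun y => iterD [:: evec i] f y 0 j).
  by apply/funext => y; rewrite mxE.
by apply: coord_comp_cont; have [] := sf [:: evec i] z (sU z Cz).
Qed.

(** [dmx] uses ambient derivatives, and the two maps may differ off the closure of O. On the open
    set O they agree locally, and on the closure both Jacobians are continuous. *)
Lemma dmx_eq f g z : smooth_near (closure O) f -> smooth_near (closure O) g ->
  (forall y, O y -> f y = g y) -> closure O z -> dmx f z = dmx g z.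
Proof.
move=> sf sg e Cz; apply/matrixP => i j.
apply: (@closure_eq R _ O (fun y => dmx f y i j) (fun y => dmx g y i j) z Cz).
- exact: dmx_smooth_cont.
- exact: dmx_smooth_cont.
move=> y Oy; rewrite !mxE.
have [U [oU sU sg']] := sg.
have dg : derivable g y (evec i) by have [_] := sg' [::] y (sU y (subset_closure Oy)); exact.
have nn : \forall x \near y, g x = f x by apply: (near_open oO Oy) => x Ox; rewrite e.
by have [_ ->] := near_eq_is_derive nn (derivableP dg).
Qed.

Lemma smooth_near_id : smooth_near (closure O) (@id 'rV[R]_N).
Proof.
exists setT; split=> //; first exact: openT.
have h (vs : seq 'rV[R]_N) : exists c : 'rV[R]_N, iterD vs id = id \/ iterD vs id = cst c.
  elim: vs => [|v vs [c [IH|IH]]]; first by exists 0; left.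
    by exists v; right; apply/funext => x /=; rewrite IH derive_id.
  by exists 0; right; apply/funext => x /=; rewrite IH derive_cst.
move=> vs x _; have [c [->|->]] := h vs.
  by split; [exact: cvg_id|move=> v; exact: derivable_id].
by split; [exact: cst_continuous|move=> v; exact: derivable_cst].
Qed.

Lemma dmx_id z : dmx (@id 'rV[R]_N) z = 1%:M.
Proof. by apply/matrixP => i j; rewrite !mxE derive_id mxE eqxx /= eq_sym. Qed.

Lemma inv_cont (T : topologicalType) m (P : T -> 'M[R]_m) (x : T) :
  (forall i j, {for x, continuous (fun y => P y i j)}) -> P x \in unitmx ->
  forall i j, {for x, continuous (fun y => invmx (P y) i j)}.
Proof.
move=> cP ux i j.
have cd := @cont_det R T m P x cP.
have d0 : \det (P x) != 0 by rewrite -unitfE -unitmxE.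
apply: (@cont_near_eq _ _ _ (fun y => (\det (P y))^-1 * cofactor (P y) j i)).
  apply: filterS (cont_neq0 cd d0) => y dy.
  by rewrite /invmx unitmxE unitfE dy !mxE.
apply: contM; first by apply: cvgV.
rewrite /cofactor; apply: contM; first exact: cont_cst.
apply: cont_det => a b.
have -> : (fun y => row' j (col' i (P y)) a b) = (fun y => P y (lift j a) (lift i b)).
  by apply/funext => y; rewrite !mxE.
exact: cP.
Qed.

End SmoothMaps.

Section CayleyContinuity.
Variables (R : realType) (n : nat).

Lemma cay_cont (T : topologicalType) (W : T -> 'M[R]_(n + n)) (x : T) :
  (forall i j, {for x, continuous (fun y => W y i j)}) -> W x + 1%:M \in unitmx ->
  forall i j, {for x, continuous (fun y => cay (W y) i j)}.
Proof.
move=> cW ux i j.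
have cP a b : {for x, continuous (fun y => (W y + 1%:M) a b)}.
  rewrite (_ : (fun y => _) = (fun y => W y a b + (1%:M : 'M[R]_(n + n)) a b)).
    by apply: contD => //; exact: cont_cst.
  by apply/funext => y; rewrite mxE.
have cI := @inv_cont R T _ (fun y => W y + 1%:M) x cP ux.
have -> : (fun y => cay (W y) i j) = (fun y => - \sum_l (\sum_k
    (W y i k + (- 1%:M : 'M[R]_(n + n)) i k) * invmx (W y + 1%:M) k l) * Jmx n l j).
  apply/funext => y; rewrite /cay mxE; congr (- _); rewrite mxE; apply: eq_bigr => l _.
  by congr (_ * _); rewrite mxE; apply: eq_bigr => k _; congr (_ * _); rewrite mxE.
apply: contN; apply: cont_sum => l _; apply: contM; last exact: cont_cst.
apply: cont_sum => k _; apply: contM; last exact: cI.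
by apply: contD => //; exact: cont_cst.
Qed.

Lemma unit_eigenvalue (W : 'M[R]_n) : (W + 1%:M \in unitmx) = ~~ eigenvalue W (-1).
Proof.
have -> : W + 1%:M = W - (-1)%:M by rewrite raddfN opprK.
by rewrite /eigenvalue /eigenspace kermx_eq0 negbK row_free_unit.
Qed.

Lemma cont_eps (T : topologicalType) (f : T -> R) (x : T) :
  (forall e, 0 < e -> \forall y \near x, `|f y - f x| < e) -> {for x, continuous f}.
Proof.
move=> h; apply/cvgrPdist_lt => e e0; apply: filterS (h e e0) => y.
by rewrite distrC.
Qed.

Lemma cont_near_le (T : topologicalType) (f : T -> R) (x : T) e : {for x, continuous f} ->
  0 < e -> \forall y \near x, `|f y - f x| <= e.
Proof.
move=> /cvgrPdist_lt h e0; apply: filterS (h e e0) => y; rewrite distrC; exact: ltW.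
Qed.

Lemma lt_norm_sub_le (x y q : R) : `|x - y| < q -> x - q <= y.
Proof. by rewrite ltr_norml => /andP[_]; lra. Qed.

(** The factors 1 are values of the indicator at a point of O; [step0_le] is the same inequality off
    O. *)
Lemma step_le (x y w l q : R) : l * (w - q) <= y - x ->
  1 * x + (l * (1 * w) + - (l * q) * (1 * 1)) <= 1 * y.
Proof. by rewrite mulrBr; lra. Qed.

Lemma step0_le (x y w l q : R) : 0 * x + (l * (0 * w) + - q * (0 * 1)) <= 0 * y.
Proof. by rewrite !mul0r !mulr0 !addr0. Qed.

(** Arithmetic of one time step: m is n, ba is b - a, A and C are the integrals of the angle at
    times a and b, B and D those of the transported and the original density, and w is the
    volume. *)
Lemma divided_step_le (m ba A B C D w e e' : R) : 0 < m -> 0 <= ba -> D <= B -> e' * w <= e ->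
  A + (m * ba * B + - (m * ba * e') * w) <= C -> ba * (D - e) <= m^-1 * C - m^-1 * A.
Proof.
move=> m0 ba0 DB we h; rewrite -mulrBr ler_pdivlMl//.
have mb : 0 <= m * ba by rewrite mulr_ge0// ltW.
have := ler_wpM2l mb DB; have := ler_wpM2l mb we; lra.
Qed.

Lemma deriv01_eq (V : normedModType R) (c c' : R -> V) t v : I01 t ->
  (forall s, I01 s -> c s = c' s) -> deriv01 c t v -> deriv01 c' t v.
Proof.
move=> It e h B nB; have := h B nB; rewrite /nbhs /= /within /=.
by apply: filterS => r hr [r0 Ir]; have := hr (conj r0 Ir); rewrite /= !e.
Qed.

End CayleyContinuity.

(** * Slices of the homotopy *)

Section HomotopySlice.
Variables (R : realType) (n : nat) (O : set 'rV[R]_(n + n)).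
Variables (F : R -> R -> 'rV[R]_(n + n) -> 'rV[R]_(n + n)).
Local Notation N := (n + n)%N.
Local Notation FF := (fun p : R * R * 'rV[R]_(n + n) => F p.1.1 p.1.2 p.2).
Variable UF : set (R * R * 'rV[R]_(n + n)).
Hypotheses (oUF : open UF) (subF : I01 `*` I01 `*` closure O `<=` UF) (sF : smooth_on UF FF).

Definition Uslice s := [set p : R * 'rV[R]_(n + n) | UF ((s, p.1), p.2)].

(** Provides joint smoothness in (t, z); [positive_path] states smoothness of each map
    separately. *)
Lemma slice_flow s : I01 s -> [/\ open (Uslice s), I01 `*` closure O `<=` Uslice s &
  smooth_on (Uslice s) (fun p : R * 'rV[R]_(n + n) => F s p.1 p.2)].
Proof.
move=> Is.
pose a : R * R * 'rV[R]_(n + n) := ((s, 0), 0).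
pose L (p : R * 'rV[R]_(n + n)) : R * R * 'rV[R]_(n + n) := ((0, p.1), p.2).
have cL : continuous L.
  move=> p; apply: cont_pair; last exact: cvg_snd.
  by apply: cont_pair; [exact: cst_continuous|exact: cvg_fst].
have lL (h : R) v z : L (h *: v + z) = h *: L v + L z.
  by rewrite /L; congr ((_, _), _); rewrite /= scaler0 addr0.
have aL p : a + L p = ((s, p.1), p.2).
  by rewrite /a /L; congr ((_, _), _); rewrite /= ?addr0 ?add0r.
have eU : Uslice s = [set p | UF (a + L p)] by apply/funext => p; rewrite /Uslice /= aL.
have eF : (fun p : R * 'rV[R]_(n + n) => F s p.1 p.2) = (fun p => FF (a + L p)).
  by apply/funext => p; rewrite aL.
split.
- by rewrite eU; exact: (@open_slice R _ _ a L UF cL oUF).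
- by move=> [t z] [/= It Cz]; apply: subF.
- by rewrite eU eF; exact: (@smooth_slice R _ _ _ FF a L UF lL cL sF).
Qed.

Lemma homotopy_dmx_cont s t z i j : I01 s -> I01 t -> closure O z ->
  {for (s, t), continuous (fun p : R * R => dmx (F p.1 p.2) z i j)}.
Proof.
move=> Is It Cz; have Up : UF ((s, t), z) by apply: subF.
pose L (v : 'rV[R]_(n + n)) : R * R * 'rV[R]_(n + n) := (0, v).
have lL (h : R) u v : L (h *: u + v) = h *: L u + L v.
  by rewrite /L; congr (_, _); rewrite /= scaler0 addr0.
have -> : (fun p : R * R => dmx (F p.1 p.2) z i j) = (fun p => iterD [:: L (evec i)] FF (p, z) 0 j).
  apply/funext => p; rewrite mxE /=.
  pose a : R * R * 'rV[R]_(n + n) := (p, 0).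
  have aL y : a + L y = (p, y) by rewrite /a /L; congr (_, _); rewrite /= ?addr0 ?add0r.
  have [_ e] := @derive_slice R _ _ _ FF a L lL z (evec i).
  have eF : (fun y => FF (a + L y)) = F p.1 p.2 by apply/funext => y; rewrite aL.
  by rewrite eF aL in e; rewrite e.
apply: coord_comp_cont.
have c : {for ((s, t), z), continuous (iterD [:: L (evec i)] FF)} by have [] := sF [:: L (evec i)] Up.
exact: (@continuous_comp _ _ _ (fun p : R * R => (p, z)) _ (s, t) (@cont_pairr _ _ z (s, t)) c).
Qed.

End HomotopySlice.

(** * The length estimate for one path *)

Section OnePath.
Variables (R : realType) (n : nat) (O : set 'rV[R]_(n + n)).
Variables (K : R -> 'rV[R]_(n + n) -> R) (psi G : R -> 'rV[R]_(n + n) -> 'rV[R]_(n + n)).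
Local Notation N := (n + n)%N.
Local Notation J := (Jmx n : 'M[R]_(n + n)).
Variables (UG UK : set (R * 'rV[R]_(n + n))).
Hypotheses (oO : open O) (oUG : open UG) (oUK : open UK).
Hypotheses (subG : I01 `*` closure O `<=` UG) (subK : I01 `*` closure O `<=` UK).
Hypotheses (sG : smooth_on UG (fun p => G p.1 p.2)) (sK : smooth_on UK (fun p => K p.1 p.2)).
Hypothesis pp : positive_path O K psi.
Hypothesis Ge : forall t z, I01 t -> closure O z -> G t z = psi t z.
Hypothesis sympG : forall t, I01 t -> symplecto O (G t).
Implicit Types (z y : 'rV[R]_(n + n)) (s t : R).

Let i0 : @I01 R 0. Proof. by rewrite /I01 /= lexx ler01. Qed.
Let i1 : @I01 R 1. Proof. by rewrite /I01 /= lexx ler01. Qed.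

Lemma path_stable t z : I01 t -> closure O z -> closure O (G t z).
Proof. by move=> /sympG [_ [g [_ h _ _]]] Cz; have [] := h z Cz. Qed.

Lemma path_ode t z : I01 t -> closure O z ->
  deriv01 (fun s => G s z) t (grad (K t) (G t z) *m J).
Proof.
move=> It Cz; have [_ _ _ h _] := pp; have [_ /(_ t It) d] := h z Cz.
rewrite (Ge It Cz); apply: (@deriv01_eq R _ (fun s => psi s z) _ t _ It _ d) => s Is.
by rewrite Ge.
Qed.

Lemma path_start z : closure O z -> G 0 z = z.
Proof. by move=> Cz; rewrite Ge//; have [_ _ _ h _] := pp; have [] := h z Cz. Qed.

Lemma path_symp t z : I01 t -> closure O z -> dmx (G t) z *m J *m (dmx (G t) z)^T = J.
Proof. by move=> /sympG [_ [g [_ _ _ h]]] Cz; exact: h. Qed.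

Lemma path_smooth t : I01 t -> smooth_near (closure O) (G t).
Proof. by move=> /sympG []. Qed.

Lemma path_posK t z : I01 t -> closure O z -> posdef (hess (K t) z).
Proof. by move=> It Cz; have [_ _ h _ _] := pp; exact: h. Qed.

Lemma path_curve z : closure O z ->
  pos_curve (fun t => dmx (G t) z) (fun t => hess (K t) (G t z)).
Proof.
move=> Cz; split.
- rewrite -[RHS](dmx_id z); apply: (dmx_eq oO) => //; first exact: path_smooth.
    exact: smooth_near_id.
  by move=> y Oy; rewrite path_start//; exact: subset_closure.
- move=> t It i j.
  exact: (@flow_dmx_is_derive R n O K G UG UK oO oUG oUK subG subK sG sK path_stable path_ode t z i j It Cz).
- by move=> t It; exact: path_symp.
- by move=> t It; apply: (hess_sym oUK sK); apply: subK; split=> //; exact: path_stable.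
- by move=> t It; apply: path_posK => //; exact: path_stable.
Qed.

Hypothesis n0 : (0 < n)%N.
Hypothesis uG : forall t z, I01 t -> closure O z -> dmx (G t) z + 1%:M \in unitmx.

Local Notation Th z := (Thc (fun t => dmx (G t) z)).

(** Mean value theorem with the lower bound of [Thc_derive]; m is a lower bound of the density along
    the trajectory of z. *)
Lemma Thc_increment z (a b m : R) : closure O z -> I01 a -> I01 b -> a <= b ->
  (forall c, a < c < b -> m <= Gam K c (G c z)) ->
  n%:R * (b - a) * m <= Th z b - Th z a.
Proof.
move=> Cz Ia Ib ab hm; have pc := path_curve Cz; have u t := @uG t z^~ Cz.
move: ab; rewrite le_eqVlt => /predU1P[->|ab]; first by rewrite !subrr mulr0 mul0r.
have /andP[a0 a1] := Ia; have /andP[b0 b1] := Ib.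
have t01 t : a < t < b -> 0 < t < 1.
  by move=> /andP[t1 t2]; rewrite (le_lt_trans a0)// (lt_le_trans t2).
have uu t : I01 t -> dmx (G t) z + 1%:M \in unitmx by move=> It; exact: uG.
have cT : {within `[a, b], continuous (Th z)}.
  apply: (@continuous_subspaceW _ _ _ I01).
    by move=> t /=; rewrite in_itv /= => /andP[t1 t2]; rewrite /I01 /= (le_trans a0)// (le_trans t2).
  by apply: within_I01 => t e It e0; exact: (Thc_cont pc uu It e0).
have [t|t] := @MVT R (Th z) (fun t => 'D_1 (Th z) t) a b ab _ cT.
  rewrite in_itv /= => /t01 h; have [d [dd _] _] := Thc_derive pc uu n0 h.
  exact: derivableP.
rewrite in_itv /= => tab ->; have [d [_ ->] dl] := Thc_derive pc uu n0 (t01 t tab).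
rewrite mulrAC ler_pM2r ?subr_gt0//; apply: le_trans dl.
by rewrite ler_pM2l ?ltr0n//; exact: hm.
Qed.

Lemma Thc_space_cont t z : I01 t -> O z -> {for z, continuous (fun y => Th y t)}.
Proof.
move=> It Oz; have sub := @subset_closure _ O.
have [->|t0] := eqVneq t 0.
  have -> : (fun y => Th y 0) = (fun=> 0) by apply/funext => y; rewrite /Thc eqxx.
  exact: cont_cst.
have tp : 0 < t by rewrite lt_def t0; case/andP: It.
have -> : (fun y => Th y t) = (fun y => Theta (cay (dmx (G t) y))).
  by apply/funext => y; rewrite /Thc (negbTE t0).
have uu y s : closure O y -> I01 s -> dmx (G s) y + 1%:M \in unitmx by move=> Cy Is; exact: uG.
have Bs y : closure O y -> (cay (dmx (G t) y))^T = cay (dmx (G t) y).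
  by move=> Cy; exact: (curve_cay_sym (path_curve Cy) (fun s => uu y s Cy) It).
have Bp y : closure O y -> posdef (cay (dmx (G t) y)).
  by move=> Cy; exact: (curve_cay_posdef (path_curve Cy) (fun s => uu y s Cy) It tp).
have Cz := sub _ Oz.
apply: cont_eps => e e0; have [d d0 hd] := Theta_lip (Bs z Cz) (Bp z Cz) e0.
have nc : \forall y \near z, forall i j, `|cay (dmx (G t) y) i j - cay (dmx (G t) z) i j| <= d.
  apply: near_all => i; apply: near_all => j.
  have c := @cay_cont R n _ (dmx (G t)) z (fun i j => @dmx_smooth_cont R N O (G t) z i j (path_smooth It) Cz) (uG It Cz) i j.
  exact: (cont_near_le c d0).
have nO : \forall y \near z, O y by exact: open_nbhs_nbhs.
apply: filterS2 nc nO => y hy /sub Cy.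
exact: (hd _ (Bs y Cy) (Bp y Cy) hy).
Qed.

Variables (rho : 'rV[R]_(n + n) -> R).
Hypotheses (bO : bounded_set O) (srho : smooth_on setT rho) (Oe : O = [set z | rho z < 0]).
Hypothesis gr : forall z, rho z = 0 -> grad rho z != 0.

Lemma path_bdry t z : I01 t -> closure O z -> ~ O z -> ~ O (G t z).
Proof.
move=> It Cz nO; have [sf [g [sg h1 h2 _]]] := sympG It.
exact: (boundary_stable oO srho Oe gr sf sg h1 h2 Cz nO).
Qed.

(** The function v is the z-integral of the angle divided by n. On a short interval [a, b] the
    density along trajectories stays close to its value at time a; integrating [Thc_increment] over
    z and applying [density_transport_le] at time a gives the increment bound that
    [int_le_increments] asks for. *)
Theorem length_le : Rintegral (@lebesgue_measure R) I01 (fun t => integral_over O (Gam K t)) <=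
  n%:R^-1 * integral_over O (fun z => Theta (cay (dmx (G 1) z))).
Proof.
have sub := @subset_closure _ O.
have [M M0 hM] := domain_box bO.
have cO := closure_compact bO.
have nR : 0 < n%:R :> R by rewrite ltr0n.
have cS : compact (I01 `*` closure O : set (R * 'rV[R]_N)) by apply: compact_setX => //; exact: I01_compact.
have cG p : (I01 `*` closure O) p -> {for p, continuous (fun p => Gam K p.1 p.2)}.
  by move=> [It Cz]; exact: (Gam_cont oUK subK sK path_posK).
have cGG p : (I01 `*` closure O) p -> {for p, continuous (fun p => Gam K p.1 (G p.1 p.2))}.
  by move=> [It Cz]; exact: (GamG_cont oUK subG subK sG sK path_stable path_posK).
have tG t : I01 t -> exists2 C, 0 <= C & tame M C (fun z => \1_O z * Gam K t z).
  move=> It; apply: (tame_closure oO srho Oe M0 hM cO) => z Cz.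
  exact: (fix_cont (cG (t, z) (conj It Cz))).
have tGG t : I01 t -> exists2 C, 0 <= C & tame M C (fun z => \1_O z * Gam K t (G t z)).
  move=> It; apply: (tame_closure oO srho Oe M0 hM cO) => z Cz.
  exact: (fix_cont (cGG (t, z) (conj It Cz))).
have tT t : I01 t -> tame M (N%:R * (pi / 2)) (fun z => \1_O z * Th z t).
  move=> It; apply: (tame_indic oO srho Oe M0 hM).
  - by rewrite mulr_ge0// divr_ge0// pi_ge0.
  - by move=> z Oz; exact: Thc_space_cont.
  - by move=> z Oz; have /andP[h1 h2] := Thc_le (fun t => dmx (G t) z) t; rewrite ger0_norm.
have t1 : tame M 1 (fun z => \1_O z * 1).
  apply: (tame_indic oO srho Oe M0 hM) => // z Oz; first exact: cont_cst.
  by rewrite normr1.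
pose V := (2 * M) ^+ N; have V0 : 0 <= V by rewrite exprn_ge0// mulr_ge0.
have un := enum_uniq 'I_N.
pose v t := n%:R^-1 * Itot (fun z => \1_O z * Th z t).
have v0 : v 0 = 0.
  rewrite /v; have -> : (fun z => \1_O z * Th z 0) = (fun z => 0 * (\1_O z * 1)).
    by apply/funext => z; rewrite /Thc eqxx mulr0 mul0r.
  by rewrite /Itot (iintZ _ _ M0 t1 un) mul0r mulr0.
have v1 : v 1 = n%:R^-1 * integral_over O (fun z => Theta (cay (dmx (G 1) z))).
  rewrite /v /integral_over /Itot; congr (_ * iint _ _ _); apply/funext => z.
  by rewrite /Thc oner_eq0.
rewrite -v1 -[v 1]subr0 -v0; apply: int_le_increments => e e0.
  pose e' := e / (V + 1); have e'0 : 0 < e' by rewrite divr_gt0// ltr_wpDl.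
  have [d d0 hd] := compact_unif cS cG e'0; exists d => // s s' Is Is' ss.
  have [C1 _ h1] := tG s Is; have [C2 _ h2] := tG s' Is'.
  have h3 := tameZ (-1) M0 h2; have h4 := tameD M0 h1 h3.
  have h5 : tame M e' (fun z => \1_O z * Gam K s z + -1 * (\1_O z * Gam K s' z)).
    have [_ a b] := h4; split=> // z; rewrite mulN1r -mulrBr.
    apply: (@indic_bound R N O (fun z => Gam K s z - Gam K s' z)); first exact: ltW.
    move=> /sub Cz; apply/ltW; apply: (hd (s, z) (s', z)) => //.
    by split=> /=; [rewrite -ball_normE|exact: ballxx].
  have := Itot_bound M0 h5; rewrite /Itot (iintD _ M0 h1 h3 un) (iintZ _ _ M0 h2 un) mulN1r => h.
  apply: (le_trans h); rewrite -/V /e' mulrAC ler_pdivrMr ?ltr_wpDl//.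
  by rewrite ler_pM2l// lerDl.
pose vo := Itot (fun z => \1_O z * 1) : R.
have vo0 : 0 <= vo.
  have z1 := tameZ 0 M0 t1.
  have : Itot (fun z => 0 * (\1_O z * 1)) <= vo.
    apply: (Itot_le M0 z1 t1) => z; rewrite mul0r mulr1 indicE.
    by case: (_ \in _).
  by rewrite /Itot (iintZ _ _ M0 t1 un) mul0r.
(* An error e' at each point costs e' vo <= e after integration over O. *)
pose e' := e / (vo + 1); have e'0 : 0 < e' by rewrite divr_gt0// ltr_wpDl.
have ee : e' * vo <= e by rewrite /e' mulrAC ler_pdivrMr ?ltr_wpDl// ler_pM2l// lerDl.
have [d d0 hd] := compact_unif cS cGG e'0; exists d => // a b Ia Ib ab bad.
have [C1 _ h1] := tGG a Ia; have [C2 _ h2] := tG a Ia.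
have cov : Itot (fun z => \1_O z * Gam K a z) <= Itot (fun z => \1_O z * Gam K a (G a z)).
  exact: (density_transport_le oO oUG oUK subG subK sG sK path_stable path_ode srho Oe M0 hM cO
    path_bdry path_start path_symp path_posK Ia).
have ta := tT a Ia; have tb := tT b Ib.
pose k := n%:R * (b - a).
have k0 : 0 <= k by rewrite mulr_ge0// subr_ge0.
have p1 := tameZ k M0 h1; have p2 := tameZ (- (k * e')) M0 t1.
have p3 := tameD M0 p1 p2; have p4 := tameD M0 ta p3.
have low : Itot (fun z => \1_O z * Th z a + (k * (\1_O z * Gam K a (G a z)) + - (k * e') * (\1_O z * 1)))
    <= Itot (fun z => \1_O z * Th z b).
  apply: (Itot_le M0 p4 tb) => z; have [Oz|nOz] := pselect (O z); last first.
    have ind0 : \1_O z = 0 :> R by rewrite indicE memNset.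
    by rewrite ind0; exact: step0_le.
  have Cz := sub _ Oz; rewrite indicE mem_set//.
  apply: step_le; apply: (@Thc_increment z a b (Gam K a (G a z) - e') Cz Ia Ib ab) => c /andP[ac cb].
  apply: lt_norm_sub_le; apply: (hd (a, z) (c, z) (conj Ia Cz)); split=> /=; last exact: ballxx.
  rewrite -ball_normE /= distrC gtr0_norm ?subr_gt0//.
  by apply: lt_trans bad; rewrite ltrD2r.
move: low; rewrite /Itot (iintD _ M0 ta p3 un) (iintD _ M0 p1 p2 un) (iintZ _ _ M0 h1 un) (iintZ _ _ M0 t1 un).
move=> low; apply: (divided_step_le nR _ cov ee low); by rewrite subr_ge0.
Qed.

End OnePath.

(** * Comparison of the two paths through the homotopy *)

Unset Implicit Arguments.

Theorem theorem8 (R : realType) (n : nat) (Omega : set 'rV[R]_(n + n))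
    (H : R -> 'rV[R]_(n + n) -> R)
    (phi : R -> 'rV[R]_(n + n) -> 'rV[R]_(n + n)) :
  (0 < n)%N ->
  unif_convex_smooth Omega ->
  positive_path Omega H phi ->
  (forall t z, I01 t -> closure Omega z -> ~~ eigenvalue (dmx (phi t) z) (-1)) ->
  forall (K : R -> 'rV[R]_(n + n) -> R)
         (psi : R -> 'rV[R]_(n + n) -> 'rV[R]_(n + n)),
    positive_path Omega K psi ->
    homotopic_rel_ends Omega phi psi ->
    (forall t z, I01 t -> closure Omega z -> ~~ eigenvalue (dmx (psi t) z) (-1)) /\
    lengthG Omega K <= 2 * pi / n%:R * maslov_mean Omega phi.
Proof.
move=> n0 [_ oO bO _ [rho [srho Oe gr _]]] pphi ephi K psi ppsi [F [[UF [oUF subF sF]] sympF Fe F01]].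
have i0 : @I01 R 0 by rewrite /I01 /= lexx ler01.
have i1 : @I01 R 1 by rewrite /I01 /= lexx ler01.
have sub := @subset_closure _ Omega.
have sm s t : I01 s -> I01 t -> smooth_near (closure Omega) (F s t).
  by move=> Is It; have [] := sympF s t Is It.
have [[UH [oUH subH sH]] _ _ _ sphi] := pphi.
have [[UK [oUK subK sK]] _ _ _ spsi] := ppsi.
have sy1 t : I01 t -> symplecto Omega (F 1 t) by move=> It; exact: sympF.
(* [F 0] and [F 1] become jointly smooth representatives of phi and psi, with the same Jacobians on
   the closure of Omega. *)
have [] := slice_flow oUF subF sF i0; move=> op0 sub0 s0.
have [] := slice_flow oUF subF sF i1; move=> op1 sub1 s1.
have e0 t z : I01 t -> closure Omega z -> F 0 t z = phi t z by move=> It Cz; have [] := F01 t z It Cz.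
have e1 t z : I01 t -> closure Omega z -> F 1 t z = psi t z by move=> It Cz; have [] := F01 t z It Cz.
have d0 t z : I01 t -> closure Omega z -> dmx (F 0 t) z = dmx (phi t) z.
  move=> It; apply: (dmx_eq oO); [exact: sm|by have [] := sphi t It|].
  by move=> y Oy; rewrite e0//; exact: sub.
have d1 t z : I01 t -> closure Omega z -> dmx (F 1 t) z = dmx (psi t) z.
  move=> It; apply: (dmx_eq oO); [exact: sm|by have [] := spsi t It|].
  by move=> y Oy; rewrite e1//; exact: sub.
have c0 z Cz := @path_curve R n Omega H phi (F 0) _ UH oO op0 oUH sub0 subH s0 sH pphi e0
  (fun t It => sympF 0 t i0 It) z Cz.
have c1 z Cz := @path_curve R n Omega K psi (F 1) _ UK oO op1 oUK sub1 subK s1 sK ppsi e1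
  (fun t It => sympF 1 t i1 It) z Cz.
have u0 t z : I01 t -> closure Omega z -> dmx (F 0 t) z + 1%:M \in unitmx.
  by move=> It Cz; rewrite unit_eigenvalue d0// ephi.
have Fend z s : I01 s -> closure Omega z ->
    dmx (F s 0) z = dmx (F 0 0) z /\ dmx (F s 1) z = dmx (F 0 1) z.
  move=> Is Cz; split; apply: (dmx_eq oO) => //; try exact: sm; move=> y /sub Cy.
    by have [-> _] := Fe s y Is Cy; have [-> _] := Fe 0 y i0 Cy.
  by have [_ ->] := Fe s y Is Cy; have [_ ->] := Fe 0 y i0 Cy.
have u1 t z : I01 t -> closure Omega z -> dmx (F 1 t) z + 1%:M \in unitmx.
  move=> It Cz.
  have h1 s r : I01 s -> I01 r -> forall i j,
      {for (s, r), continuous (fun p : R * R => dmx (F p.1 p.2) z i j)}.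
    by move=> Is Ir i j; exact: (homotopy_dmx_cont subF sF).
  have h2 s r : I01 s -> I01 r -> dmx (F s r) z *m Jmx n *m (dmx (F s r) z)^T = Jmx n.
    by move=> Is Ir; have [_ [g [_ _ _ h]]] := sympF s r Is Ir; exact: h.
  exact: (@avoid_minus1 R n _ _ _ _ (fun s t => dmx (F s t) z) (c0 z Cz) (c1 z Cz) h1 h2
    (fun r _ => conj erefl erefl) (fun s Is => Fend z s Is Cz) (fun r Ir => u0 r z Ir Cz) t It).
split; first by move=> t z It Cz; rewrite -d1// -unit_eigenvalue u1.
have main := @length_le R n Omega K psi (F 1) _ UK oO op1 oUK sub1 subK s1 sK ppsi e1
  sy1 n0 u1 rho bO srho Oe gr.
have vol0 : 0 <= vol Omega.
  have [M M0 hM] := domain_box bO.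
  have t1 : tame M 1 (fun z => \1_Omega z * 1).
    apply: (tame_indic oO srho Oe M0 hM) => // z Oz; first exact: cont_cst.
    by rewrite normr1.
  have z1 := tameZ 0 M0 t1; have un := enum_uniq 'I_(n + n).
  have : Itot (fun z => 0 * (\1_Omega z * 1)) <= vol Omega.
    apply: (Itot_le M0 z1 t1) => z; rewrite mul0r mulr1 indicE.
    by case: (_ \in _).
  by rewrite /Itot (iintZ _ _ M0 t1 un) mul0r.
have p0 := pi_gt0 R; have nR : 0 < n%:R :> R by rewrite ltr0n.
(* The Maslov index is computed along phi, but the angle depends only on the matrix at time 1, which
   [F 0] and [F 1] share; this moves the integral to psi. *)
have -> : maslov_mean Omega phi = (vol Omega)^-1 * ((2 * pi)^-1 *
    integral_over Omega (fun z => Theta (cay (dmx (F 1 1) z)))).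
  rewrite /maslov_mean; congr (_ * _).
  have [M M0 hM] := domain_box bO.
  have tT : tame M ((n + n)%:R * (pi / 2)) (fun z => \1_Omega z * Theta (cay (dmx (F 1 1) z))).
    apply: (tame_indic oO srho Oe M0 hM).
    - by rewrite mulr_ge0// divr_ge0// pi_ge0.
    - move=> z Oz.
      have <- : (fun y => Thc (fun t => dmx (F 1 t) y) 1) = (fun y => Theta (cay (dmx (F 1 1) y))).
        by apply/funext => y; rewrite /Thc oner_eq0.
      by apply: (@Thc_space_cont R n Omega K psi (F 1) (Uslice UF 1) UK).
    - by move=> z Oz; rewrite ger0_norm ?Theta_ge0// Theta_le.
  rewrite /integral_over -(iintZ _ _ M0 tT (enum_uniq _)); congr (iint _ _ _).
  apply/funext => z; have [Oz|nOz] := pselect (Omega z); last first.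
    rewrite (@indic_notin _ _ _ (fun z => mu_path (fun t => dmx (phi t) z)))//.
    by rewrite (@indic_notin _ _ _ (fun z => Theta (cay (dmx (F 1 1) z))))// mulr0.
  have Cz := sub _ Oz; rewrite indicE mem_set// !mul1r.
  rewrite (mu_pathE (c0 z Cz) (fun t It => u0 t z It Cz) (gam := fun t => dmx (phi t) z)).
    by have [_ ->] := Fend z 1 i1 Cz; rewrite mulrC.
  by move=> t It; rewrite d0.
rewrite /lengthG [X in _ <= X]mulrCA ler_wpM2l ?invr_ge0//; apply: (le_trans main).
(* The factor 2 pi / n against 1 / (2 pi) leaves the 1 / n of [length_le]. *)
rewrite mulrA le_eqVlt; apply/orP; left; apply/eqP; congr (_ * _).
by rewrite mulrAC mulfV ?mul1r// gt_eqF// mulr_gt0.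
Qed.
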